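(* Let $q>1$, let $a,b,c:q^{\mathbb{Z}}\to\mathbb{C}$ with $a(t)\ne0$ for all $t$, and consider (A) $\bigl(a(t)u^\Delta(t)\bigr)^{\Delta\rho}+\bigl(b(t)+2\lambda c(t)+\lambda^2\bigr)u(t)=0$, $t\in q^{\mathbb{Z}}$, (B) $\widehat a_n\widehat u_{n+1}+\widehat a_{n-1}\widehat u_{n-1}+\{\widehat b_n+2\widehat\lambda\,\widehat c_n+\widehat\lambda^2\}\widehat u_n=0$, $n\in\mathbb{Z}$, where $\widehat u_n=\widehat u(q^n)$, $\widehat u(t)=\sqrt t\,u(t)$, $\widehat\lambda=q^{-1/4}\lambda$, and $\widehat a_n=\widehat a(q^n)$, $\widehat b_n=\widehat b(q^n)$, $\widehat c_n=\widehat c(q^n)$ with $$\widehat a(t)=\frac{a(t)}{(q-1)^2t^2},\qquad \widehat b(t)=\frac{b(t)}{\sqrt q}-\sqrt q\,\widehat a(t)-\frac{\widehat a(t/q)}{\sqrt q},\qquad \widehat c(t)=q^{-1/4}c(t).$$ Let $L^q_\lambda$ be the operator in $\ell^2(q^{\mathbb{Z}})$ given by the left-hand side of (A). Then: (i) $u\in\ell^2(q^{\mathbb{Z}})$ and $u$ solves (A) if and only if $\widehat u\in\ell^2(\mathbb{Z})$ and $\widehat u$ solves (B). (ii) $\lambda$ is an eigenvalue of (A) if and only if $\widehat\lambda=q^{-1/4}\lambda$ is an eigenvalue of (B). For (iii)–(v) assume $$\sum_{t\in q^{\mathbb{Z}}}\Bigl|\frac{\ln t}{\ln q}\Bigr|\bigl(|1-\widehat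 a(t)|+|2+\widehat b(t)|+|\widehat c(t)|\bigr)<\infty .$$ (iii) For $\operatorname{Im}z>0$ and $\lambda=2q^{1/4}\cos(z/2)$, $$J^+(t,z)=\alpha^+(t)\exp\Bigl(i\tfrac{\ln t}{\ln q}z\Bigr)\Bigl\{1+\int_{r\in q^{\mathbb{N}}}A^+(t,r)\exp\Bigl(i\tfrac{\ln r}{2\ln q}z\Bigr)\Delta_qr\Bigr\},$$ $$J^-(t,z)=\alpha^-(t)\exp\Bigl(-i\tfrac{\ln t}{\ln q}z\Bigr)\Bigl\{1+\int_{r\in q^{-\mathbb{N}}}A^-(t,r)\exp\Bigl(-i\tfrac{\ln r}{2\ln q}z\Bigr)\Delta_qr\Bigr\}$$ are (Jost) solutions of (A), where $\alpha^\pm(t)$ and $A^\pm(t,r)$ are uniquely expressed in terms of the sequences $(\widehat a_n)$, $(\widehat b_n)$, $(\widehat c_n)$. (iv) With $Q(z)=W[J^-(\cdot,z),J^+(\cdot,z)]$, $$\sigma_d(L^q_\lambda)=\{\lambda=2q^{1/4}\cos\tfrac z2: z\in P^+,\ Q(z)=0\},\qquad \sigma_{ss}(L^q_\lambda)=\{\lambda=2q^{1/4}\cos\tfrac z2: z\in P_0,\ Q(z)=0\}.$$ (v) $\sigma_c(L^q_\lambda)=[-2q^{1/4},2q^{1/4}]$. (vi) If, for some $\varepsilon>0$ and some $\delta$ with $\frac12\le\delta\le1$, $$\sup_{t\in q^{\mathbb{Z}}}\Bigl\{\exp\Bigl(\varepsilon\Bigl|\frac{\ln t}{\ln q}\Bigr|^\delta\Bigr)\bigl(|1-\widehat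 a(t)|+|2+\widehat b(t)|+|\widehat c(t)|\bigr)\Bigr\}<\infty,$$ then $L^q_\lambda$ has a finite number of eigenvalues and spectral singularities, with finite multiplicity.
   Context: Notation: $q^{\mathbb{Z}}=\{q^n:n\in\mathbb{Z}\}$, $q^{\mathbb{N}}=\{q^n:n=1,2,\dots\}$, $q^{-\mathbb{N}}=\{q^{-n}:n=1,2,\dots\}$. The $q$-derivative is $y^\Delta(t)=\frac{y(qt)-y(t)}{(q-1)t}$, $u^\rho(t)=u(t/q)$, and $(au^\Delta)^{\Delta\rho}(t)=((au^\Delta)^\Delta)(t/q)$. The $q$-integral over a set $S\subset q^{\mathbb{Z}}$ is $\int_Sf(t)\Delta_qt=(q-1)\sum_{t\in S}tf(t)$. $\ell^2(q^{\mathbb{Z}})$ is the Hilbert space of functions on $q^{\mathbb{Z}}$ with $\|f\|_q^2=\int_{q^{\mathbb{Z}}}|f(t)|^2\Delta_qt<\infty$. $P^+=\{\eta+i\varphi:\eta\in[-\pi,3\pi],\varphi>0\}$, $P_0=(-\pi,3\pi)\setminus\{0,\pi,2\pi\}$. The coefficients of the Jost solutions are $\alpha^\pm(q^n)=q^{-n/2}\alpha^\pm_n$ and $A^\pm(q^n,q^m)=K^\pm_{n,m}/((q-1)q^m)$, where, with $a_n=\widehat a_n$, $p_n=\widehat c_n$, $h_n=2+\widehat b_n$, $\alpha_n^+=(-1)^n(\prod_{r\ge n}a_r)^{-1}$, $K_{n,1}^+=2\sum_{r\ge n+1}p_r$, $K_{n,2}^+=\sum_{r\ge n+1}(h_r+2p_rK_{r,1}^+)$,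 $K_{n,3}^+=\sum_{r\ge n+1}(h_rK_{r,1}^++2p_r(K_{r,2}^++1))$, $K_{n,4}^+=\sum_{r\ge n+1}((1-a_r^2)+h_rK_{r,2}^++2p_r(K_{r,3}^++K_{r,1}^+))$, $K_{n,m+4}^+=K_{n+1,m}^++\sum_{r\ge n+1}((1-a_r^2)K_{r+1,m}^++h_rK_{r,m+2}^++2p_r(K_{r,m+1}^++K_{r,m+3}^+))$ for $m\ge1$; and $\alpha_n^-=(-1)^n(\prod_{r\le n-1}a_r)^{-1}$, $K_{n,-1}^-=2\sum_{r\le n-1}p_r$, $K_{n,-2}^-=\sum_{r\le n-1}(h_r+2p_rK_{r,-1}^-)$, $K_{n,-3}^-=\sum_{r\le n-1}(h_rK_{r,-1}^-+2p_r(K_{r,-2}^-+1))$, $K_{n,-4}^-=\sum_{r\le n-1}((1-a_{r-1}^2)+h_rK_{r,-2}^-+2p_r(K_{r,-3}^-+K_{r,-1}^-))$, $K_{n,m-4}^-=K_{n-1,m}^-+\sum_{r\le n-1}((1-a_{r-1}^2)K_{r-1,m}^-+h_rK_{r,m-2}^-+2p_r(K_{r,m-1}^-+K_{r,m-3}^-))$ for $m\le-1$. The formulas for $J^\pm$ extend continuously to real $z$. The Wronskian of two solutions of (A) is $W[u,v]=a(t)(u(t)v^\Delta(t)-u^\Delta(t)v(t))$ (independent of $t$). Spectral notions for $L_\lambda^q$ are those of the pencil: $\lambda$ is an eigenvalue of (A) (element of $\sigma_d$) if (A) has a nonzero solution in $\ell^2(q^{\mathbb{Z}})$, and $\widehat\lambda$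 is an eigenvalue of (B) if (B) has a nonzero solution in $\ell^2(\mathbb{Z})$; $\lambda\in\sigma_c(L^q_\lambda)$ (continuous spectrum) if $L_\lambda^q$ is injective with dense range but its inverse is unbounded. Spectral singularities are poles of the resolvent kernel embedded in the continuous spectrum; concretely, $\lambda\in\sigma_{ss}(L^q_\lambda)$ iff $\widehat\lambda=q^{-1/4}\lambda$ is a spectral singularity of (B), i.e. $\widehat\lambda=2\cos\frac z2$ for some $z\in P_0$ with $\Phi(z)=0$, where $\Phi(z)=\widehat a_n(f_n^-f_{n+1}^+-f_{n+1}^-f_n^+)$, $f_n^\pm(z)=q^{n/2}J^\pm(q^n,z)$. The multiplicity of an eigenvalue or spectral singularity is the multiplicity of the corresponding zero of $\Phi$ in $P^+\cup P_0$ (at a real zero, the order of vanishing in terms of the derivatives of $\Phi$, which extend continuously to the real axis under the hypothesis of (vi)). *)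

(* Defs.v *)
From Stdlib Require Export Reals ZArith List ClassicalDescription.
From Coquelicot Require Export Coquelicot.
Open Scope R_scope.

(* The limit and sum operators below are total (componentwise [Lim_seq] and
   [Series]); convergence is always asserted separately. *)

Definition CLim (u : nat -> C) : C :=
  (real (Lim_seq (fun k => Re (u k))), real (Lim_seq (fun k => Im (u k)))).

Definition CSeries (u : nat -> C) : C :=
  (Series (fun k => Re (u k)), Series (fun k => Im (u k))).

Fixpoint Cprod (f : nat -> C) (N : nat) : C :=
  match N with
  | O => RtoC 1
  | S N' => (Cprod f N' * f N')%C
  end.

Definition Cexp (z : C) : C :=
  (exp (Re z) * cos (Im z), exp (Re z) * sin (Im z)).

Definition Ccos (z : C) : C := ((Cexp (Ci * z) + Cexp (- (Ci * z))) / RtoC 2)%C.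

Definition Zsum (f : Z -> C) : C :=
  (CSeries (fun k => f (Z.of_nat k)) + CSeries (fun k => f (- Z.of_nat k - 1)%Z))%C.

Definition Zsummable (f : Z -> C) : Prop :=
  ex_series (fun k => Cmod (f (Z.of_nat k))) /\
  ex_series (fun k => Cmod (f (- Z.of_nat k - 1)%Z)).

Definition sum_ge (n : Z) (f : Z -> C) : C :=
  CSeries (fun k => f (n + Z.of_nat k)%Z).

Definition sum_le (n : Z) (f : Z -> C) : C :=
  CSeries (fun k => f (n - Z.of_nat k)%Z).

Definition is_sum_ge (n : Z) (f : Z -> C) (s : C) : Prop :=
  @is_series C_AbsRing C_NormedModule (fun k => f (n + Z.of_nat k)%Z) s.

Definition is_sum_le (n : Z) (f : Z -> C) (s : C) : Prop :=
  @is_series C_AbsRing C_NormedModule (fun k => f (n - Z.of_nat k)%Z) s.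

Definition prod_ge (n : Z) (f : Z -> C) : C :=
  CLim (Cprod (fun k => f (n + Z.of_nat k)%Z)).

Definition prod_le (n : Z) (f : Z -> C) : C :=
  CLim (Cprod (fun k => f (n - Z.of_nat k)%Z)).

(* Convergence of an infinite product includes that its value is nonzero. *)
Definition is_prod_ge (n : Z) (f : Z -> C) (P : C) : Prop :=
  filterlim (Cprod (fun k => f (n + Z.of_nat k)%Z)) eventually (locally P)
  /\ P <> RtoC 0.

Definition is_prod_le (n : Z) (f : Z -> C) (P : C) : Prop :=
  filterlim (Cprod (fun k => f (n - Z.of_nat k)%Z)) eventually (locally P)
  /\ P <> RtoC 0.

(* A function on q^Z is represented by a function on R of which
   only the values at the points of q^Z matter; all equations, equalities and
   norms below are taken on q^Z. *)

Definition qZ (q t : R) : Prop := exists n : Z, t = powerRZ q n.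
Definition qN (q t : R) : Prop := exists n : Z, (1 <= n)%Z /\ t = powerRZ q n.
Definition qNinv (q t : R) : Prop := exists n : Z, (1 <= n)%Z /\ t = powerRZ q (- n).

Definition qlog (q t : R) : R := ln t / ln q.

(* For t = q^n, [qlog q t] is the integer n itself, so the rounding is exact. *)
Definition qidx (q t : R) : Z := Int_part (qlog q t).

Definition qderiv (q : R) (y : R -> C) (t : R) : C :=
  ((y (q * t)%R - y t) / RtoC ((q - 1) * t))%C.

Definition qint (q : R) (S : R -> Prop) (f : R -> C) : C :=
  (RtoC (q - 1) *
   Zsum (fun n => if excluded_middle_informative (S (powerRZ q n))
                  then RtoC (powerRZ q n) * f (powerRZ q n) else RtoC 0))%C.

Definition qintegrable (q : R) (S : R -> Prop) (f : R -> C) : Prop :=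
  Zsummable (fun n => if excluded_middle_informative (S (powerRZ q n))
                      then (RtoC (powerRZ q n) * f (powerRZ q n))%C else RtoC 0).

Definition in_l2q (q : R) (f : R -> C) : Prop :=
  qintegrable q (qZ q) (fun t => RtoC (Cmod (f t) ^ 2)).

Definition norm_q (q : R) (f : R -> C) : R :=
  sqrt (Re (qint q (qZ q) (fun t => RtoC (Cmod (f t) ^ 2)))).

Definition in_l2Z (v : Z -> C) : Prop :=
  Zsummable (fun n => RtoC (Cmod (v n) ^ 2)).

Definition L_op (q : R) (a b c : R -> C) (lam : C) (u : R -> C) (t : R) : C :=
  (qderiv q (fun s => a s * qderiv q u s) (t / q)
   + (b t + RtoC 2 * lam * c t + lam * lam) * u t)%C.

Definition solves_A (q : R) (a b c : R -> C) (lam : C) (u : R -> C) : Prop :=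
  forall t, qZ q t -> L_op q a b c lam u t = RtoC 0.

Definition solves_B (ah bh ch : Z -> C) (lamh : C) (v : Z -> C) : Prop :=
  forall n : Z,
    (ah n * v (n + 1)%Z + ah (n - 1)%Z * v (n - 1)%Z
     + (bh n + RtoC 2 * lamh * ch n + lamh * lamh) * v n)%C = RtoC 0.

Definition hat_a (q : R) (a : R -> C) (t : R) : C :=
  (a t / RtoC ((q - 1) ^ 2 * t ^ 2))%C.

Definition hat_b (q : R) (a b : R -> C) (t : R) : C :=
  (b t / RtoC (sqrt q) - RtoC (sqrt q) * hat_a q a t
   - hat_a q a (t / q)%R / RtoC (sqrt q))%C.

Definition hat_c (q : R) (c : R -> C) (t : R) : C :=
  (RtoC (Rpower q (- (1 / 4))) * c t)%C.

Definition hat_u (u : R -> C) (t : R) : C := (RtoC (sqrt t) * u t)%C.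

Definition hat_lam (q : R) (lam : C) : C := (RtoC (Rpower q (- (1 / 4))) * lam)%C.

Definition qseq (q : R) (f : R -> C) (n : Z) : C := f (powerRZ q n).

Definition eigenvalue_A (q : R) (a b c : R -> C) (lam : C) : Prop :=
  exists u, in_l2q q u /\ solves_A q a b c lam u /\
            exists t, qZ q t /\ u t <> RtoC 0.

Definition eigenvalue_B (ah bh ch : Z -> C) (lamh : C) : Prop :=
  exists v, in_l2Z v /\ solves_B ah bh ch lamh v /\ exists n, v n <> RtoC 0.

(* In the coefficients of the Jost solutions, a, h, p are sequences on Z; the
   second index of K^+_{n,m} (resp. K^-_{n,-m}) is the natural number m >= 1,
   written first.  The value at m = 0 is never used. *)

Definition alpha_plus_seq (a : Z -> C) (n : Z) : C :=
  (RtoC (powerRZ (-1) n) * / prod_ge n a)%C.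

Definition alpha_minus_seq (a : Z -> C) (n : Z) : C :=
  (RtoC (powerRZ (-1) n) * / prod_le (n - 1) a)%C.

Fixpoint K_plus (a h p : Z -> C) (m : nat) (n : Z) {struct m} : C :=
  match m with
  | O => RtoC 0
  | 1%nat => (RtoC 2 * sum_ge (n + 1) (fun r => p r))%C
  | S (S O as k1) => sum_ge (n + 1) (fun r => h r + RtoC 2 * p r * K_plus a h p k1 r)%C
  | S (S (S O as k1) as k2) => sum_ge (n + 1) (fun r =>
        h r * K_plus a h p k1 r
        + RtoC 2 * p r * (K_plus a h p k2 r + RtoC 1))%C
  | S (S (S (S O as k1) as k2) as k3) => sum_ge (n + 1) (fun r =>
        (RtoC 1 - a r * a r) + h r * K_plus a h p k2 r
        + RtoC 2 * p r * (K_plus a h p k3 r + K_plus a h p k1 r))%C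
  | S (S (S (S (S _ as k) as k1) as k2) as k3) =>
      (K_plus a h p k (n + 1) + sum_ge (n + 1) (fun r =>
        (RtoC 1 - a r * a r) * K_plus a h p k (r + 1) + h r * K_plus a h p k2 r
        + RtoC 2 * p r * (K_plus a h p k1 r + K_plus a h p k3 r)))%C
  end.

Fixpoint K_minus (a h p : Z -> C) (m : nat) (n : Z) {struct m} : C :=
  match m with
  | O => RtoC 0
  | 1%nat => (RtoC 2 * sum_le (n - 1) (fun r => p r))%C
  | S (S O as k1) => sum_le (n - 1) (fun r => h r + RtoC 2 * p r * K_minus a h p k1 r)%C
  | S (S (S O as k1) as k2) => sum_le (n - 1) (fun r =>
        h r * K_minus a h p k1 r
        + RtoC 2 * p r * (K_minus a h p k2 r + RtoC 1))%C
  | S (S (S (S O as k1) as k2) as k3) => sum_le (n - 1) (fun r =>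
        (RtoC 1 - a (r - 1)%Z * a (r - 1)%Z) + h r * K_minus a h p k2 r
        + RtoC 2 * p r * (K_minus a h p k3 r + K_minus a h p k1 r))%C
  | S (S (S (S (S _ as k) as k1) as k2) as k3) =>
      (K_minus a h p k (n - 1) + sum_le (n - 1) (fun r =>
        (RtoC 1 - a (r - 1)%Z * a (r - 1)%Z) * K_minus a h p k (r - 1)
        + h r * K_minus a h p k2 r
        + RtoC 2 * p r * (K_minus a h p k1 r + K_minus a h p k3 r)))%C
  end.

(* The same formulas, now including the convergence of all the infinite
   products and series in them. *)
Definition coef_formulas_plus (a h p alpha : Z -> C) (K : nat -> Z -> C) : Prop :=
  forall n : Z,
  (exists P, is_prod_ge n a P /\ alpha n = (RtoC (powerRZ (-1) n) * / P)%C) /\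
  (exists s, is_sum_ge (n + 1) (fun r => p r) s /\ K 1%nat n = (RtoC 2 * s)%C) /\
  is_sum_ge (n + 1) (fun r => h r + RtoC 2 * p r * K 1%nat r)%C (K 2%nat n) /\
  is_sum_ge (n + 1) (fun r =>
      h r * K 1%nat r + RtoC 2 * p r * (K 2%nat r + RtoC 1))%C (K 3%nat n) /\
  is_sum_ge (n + 1) (fun r =>
      (RtoC 1 - a r * a r) + h r * K 2%nat r
      + RtoC 2 * p r * (K 3%nat r + K 1%nat r))%C (K 4%nat n) /\
  (forall m, (1 <= m)%nat -> exists s,
     is_sum_ge (n + 1) (fun r =>
       (RtoC 1 - a r * a r) * K m (r + 1)%Z + h r * K (m + 2)%nat r
       + RtoC 2 * p r * (K (m + 1)%nat r + K (m + 3)%nat r))%C s /\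
     K (m + 4)%nat n = (K m (n + 1)%Z + s)%C).

Definition coef_formulas_minus (a h p alpha : Z -> C) (K : nat -> Z -> C) : Prop :=
  forall n : Z,
  (exists P, is_prod_le (n - 1) a P /\ alpha n = (RtoC (powerRZ (-1) n) * / P)%C) /\
  (exists s, is_sum_le (n - 1) (fun r => p r) s /\ K 1%nat n = (RtoC 2 * s)%C) /\
  is_sum_le (n - 1) (fun r => h r + RtoC 2 * p r * K 1%nat r)%C (K 2%nat n) /\
  is_sum_le (n - 1) (fun r =>
      h r * K 1%nat r + RtoC 2 * p r * (K 2%nat r + RtoC 1))%C (K 3%nat n) /\
  is_sum_le (n - 1) (fun r =>
      (RtoC 1 - a (r - 1)%Z * a (r - 1)%Z) + h r * K 2%nat r
      + RtoC 2 * p r * (K 3%nat r + K 1%nat r))%C (K 4%nat n) /\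
  (forall m, (1 <= m)%nat -> exists s,
     is_sum_le (n - 1) (fun r =>
       (RtoC 1 - a (r - 1)%Z * a (r - 1)%Z) * K m (r - 1)%Z + h r * K (m + 2)%nat r
       + RtoC 2 * p r * (K (m + 1)%nat r + K (m + 3)%nat r))%C s /\
     K (m + 4)%nat n = (K m (n - 1)%Z + s)%C).

Definition seq_a (q : R) (a : R -> C) : Z -> C := qseq q (hat_a q a).
Definition seq_b (q : R) (a b : R -> C) : Z -> C := qseq q (hat_b q a b).
Definition seq_p (q : R) (c : R -> C) : Z -> C := qseq q (hat_c q c).
Definition seq_h (q : R) (a b : R -> C) (n : Z) : C := (RtoC 2 + seq_b q a b n)%C.

Definition alpha_plus (q : R) (a : R -> C) (t : R) : C :=
  (RtoC (Rpower q (- (IZR (qidx q t) / 2))) * alpha_plus_seq (seq_a q a) (qidx q t))%C.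

Definition alpha_minus (q : R) (a : R -> C) (t : R) : C :=
  (RtoC (Rpower q (- (IZR (qidx q t) / 2))) * alpha_minus_seq (seq_a q a) (qidx q t))%C.

Definition A_plus (q : R) (a b c : R -> C) (t r : R) : C :=
  (K_plus (seq_a q a) (seq_h q a b) (seq_p q c) (Z.to_nat (qidx q r)) (qidx q t)
   / RtoC ((q - 1) * r))%C.

Definition A_minus (q : R) (a b c : R -> C) (t r : R) : C :=
  (K_minus (seq_a q a) (seq_h q a b) (seq_p q c) (Z.to_nat (- qidx q r)) (qidx q t)
   / RtoC ((q - 1) * r))%C.

Definition jost_integrand_plus (q : R) (A : R -> R -> C) (t : R) (z : C) (r : R) : C :=
  (A t r * Cexp (Ci * RtoC (ln r / (2 * ln q)) * z))%C.

Definition jost_integrand_minus (q : R) (A : R -> R -> C) (t : R) (z : C) (r : R) : C :=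
  (A t r * Cexp (- (Ci * RtoC (ln r / (2 * ln q)) * z)))%C.

Definition jost_form_plus (q : R) (alpha : R -> C) (A : R -> R -> C) (t : R) (z : C) : C :=
  (alpha t * Cexp (Ci * RtoC (ln t / ln q) * z) *
   (RtoC 1 + qint q (qN q) (jost_integrand_plus q A t z)))%C.

Definition jost_form_minus (q : R) (alpha : R -> C) (A : R -> R -> C) (t : R) (z : C) : C :=
  (alpha t * Cexp (- (Ci * RtoC (ln t / ln q) * z)) *
   (RtoC 1 + qint q (qNinv q) (jost_integrand_minus q A t z)))%C.

Definition lam_of (q : R) (z : C) : C :=
  (RtoC (2 * Rpower q (1 / 4)) * Ccos (z / RtoC 2))%C.

(* The Jost solutions at z solve the equation for lam_of z and satisfy
     u(q^n) ~ (-1)^n q^(-n/2) exp(i n z)    as n -> +oo,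
     u(q^n) ~ (-1)^n q^(-n/2) exp(- i n z)  as n -> -oo. *)
Definition is_jost_plus (q : R) (a b c : R -> C) (z : C) (u : R -> C) : Prop :=
  solves_A q a b c (lam_of q z) u /\
  filterlim (fun n : nat =>
      RtoC ((-1) ^ n * Rpower q (INR n / 2)) * Cexp (- (Ci * RtoC (INR n) * z))
      * u (powerRZ q (Z.of_nat n)))%C
    eventually (locally (RtoC 1)).

Definition is_jost_minus (q : R) (a b c : R -> C) (z : C) (u : R -> C) : Prop :=
  solves_A q a b c (lam_of q z) u /\
  filterlim (fun n : nat =>
      RtoC ((-1) ^ n * Rpower q (- (INR n / 2))) * Cexp (- (Ci * RtoC (INR n) * z))
      * u (powerRZ q (- Z.of_nat n)))%C
    eventually (locally (RtoC 1)).

Definition represents_jost_plus (q : R) (a b c : R -> C)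
    (alpha : R -> C) (A : R -> R -> C) : Prop :=
  forall z : C, 0 < Im z ->
    (forall t, qZ q t -> qintegrable q (qN q) (jost_integrand_plus q A t z)) /\
    is_jost_plus q a b c z (fun t => jost_form_plus q alpha A t z).

Definition represents_jost_minus (q : R) (a b c : R -> C)
    (alpha : R -> C) (A : R -> R -> C) : Prop :=
  forall z : C, 0 < Im z ->
    (forall t, qZ q t -> qintegrable q (qNinv q) (jost_integrand_minus q A t z)) /\
    is_jost_minus q a b c z (fun t => jost_form_minus q alpha A t z).

Definition J_plus (q : R) (a b c : R -> C) (t : R) (z : C) : C :=
  jost_form_plus q (alpha_plus q a) (A_plus q a b c) t z.

Definition J_minus (q : R) (a b c : R -> C) (t : R) (z : C) : C :=
  jost_form_minus q (alpha_minus q a) (A_minus q a b c) t z.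

Definition wronskian (q : R) (a : R -> C) (u v : R -> C) (t : R) : C :=
  (a t * (u t * qderiv q v t - qderiv q u t * v t))%C.

(* The Wronskian of the two Jost solutions, and Phi below, do not depend on the
   point where they are evaluated; the values at t = 1, i.e. n = 0, are used. *)
Definition Q_fun (q : R) (a b c : R -> C) (z : C) : C :=
  wronskian q a (fun t => J_minus q a b c t z) (fun t => J_plus q a b c t z) 1.

Definition f_plus (q : R) (a b c : R -> C) (n : Z) (z : C) : C :=
  (RtoC (Rpower q (IZR n / 2)) * J_plus q a b c (powerRZ q n) z)%C.

Definition f_minus (q : R) (a b c : R -> C) (n : Z) (z : C) : C :=
  (RtoC (Rpower q (IZR n / 2)) * J_minus q a b c (powerRZ q n) z)%C.

Definition Phi_at (q : R) (a b c : R -> C) (n : Z) (z : C) : C :=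
  (seq_a q a n *
   (f_minus q a b c n z * f_plus q a b c (n + 1) z
    - f_minus q a b c (n + 1) z * f_plus q a b c n z))%C.

Definition Phi (q : R) (a b c : R -> C) (z : C) : C := Phi_at q a b c 0 z.

Definition P_plus (z : C) : Prop := - PI <= Re z <= 3 * PI /\ 0 < Im z.

Definition P_zero (z : C) : Prop :=
  Im z = 0 /\ - PI < Re z < 3 * PI /\ Re z <> 0 /\ Re z <> PI /\ Re z <> 2 * PI.

Definition sigma_d (q : R) (a b c : R -> C) (lam : C) : Prop :=
  eigenvalue_A q a b c lam.

Definition sigma_ss (q : R) (a b c : R -> C) (lam : C) : Prop :=
  exists z, P_zero z /\ Phi q a b c z = RtoC 0 /\
            hat_lam q lam = (RtoC 2 * Ccos (z / RtoC 2))%C.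

Definition L_dom (q : R) (a b c : R -> C) (lam : C) (u : R -> C) : Prop :=
  in_l2q q u /\ in_l2q q (L_op q a b c lam u).

Definition sigma_c (q : R) (a b c : R -> C) (lam : C) : Prop :=
  (forall u, L_dom q a b c lam u ->
     (forall t, qZ q t -> L_op q a b c lam u t = RtoC 0) ->
     forall t, qZ q t -> u t = RtoC 0) /\
  (forall (g : R -> C) (eps : R), in_l2q q g -> 0 < eps ->
     exists u, L_dom q a b c lam u /\
       norm_q q (fun t => L_op q a b c lam u t - g t)%C < eps) /\
  ~ (exists M, forall u, L_dom q a b c lam u ->
       norm_q q u <= M * norm_q q (L_op q a b c lam u)).

Definition perturbation (q : R) (a b c : R -> C) (t : R) : R :=
  Cmod (RtoC 1 - hat_a q a t) + Cmod (RtoC 2 + hat_b q a b t) + Cmod (hat_c q c t).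

Definition first_moment (q : R) (a b c : R -> C) : Prop :=
  Zsummable (qseq q (fun t => RtoC (Rabs (ln t / ln q) * perturbation q a b c t))).

(* [Rpower 0 d] is not 0 in the standard library. *)
Definition pow_nonneg (x d : R) : R := if Req_EM_T x 0 then 0 else Rpower x d.

Definition exp_decay (q : R) (a b c : R -> C) (eps delta : R) : Prop :=
  exists M, forall t, qZ q t ->
    exp (eps * pow_nonneg (Rabs (ln t / ln q)) delta) * perturbation q a b c t <= M.

Definition continuous_closed_uhp (F : C -> C) : Prop :=
  forall z, 0 <= Im z ->
    filterlim F (within (fun w => 0 <= Im w) (locally z)) (locally (F z)).

(* [D k] is the k-th complex derivative of F on the open upper half-plane,
   extended continuously to the real axis; this gives the order of a zero both
   inside the half-plane and on its boundary. *)
Definition zero_of_order (F : C -> C) (z0 : C) (m : nat) : Prop :=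
  exists D : nat -> C -> C,
    (forall z, 0 <= Im z -> D O z = F z) /\
    (forall k z, 0 < Im z ->
       @is_derive C_AbsRing C_NormedModule (D k) z (D (S k) z)) /\
    (forall k, continuous_closed_uhp (D k)) /\
    (forall k, (k < m)%nat -> D k z0 = RtoC 0) /\
    D m z0 <> RtoC 0.

Definition zero_over (q : R) (a b c : R -> C) (lam z : C) : Prop :=
  (P_plus z \/ P_zero z) /\ lam = lam_of q z /\ Phi q a b c z = RtoC 0.

Definition finite_multiplicity (q : R) (a b c : R -> C) (lam : C) : Prop :=
  (exists z, zero_over q a b c lam z) /\
  (forall z, zero_over q a b c lam z ->
     exists m, (1 <= m)%nat /\ zero_of_order (Phi q a b c) z m).

(* Main.v *)
Require Import Defs.
From Stdlib Require Import ssreflect ssrbool Lia Lra Psatz FunctionalExtensionality.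
From Stdlib Require ClassicalEpsilon Wf_nat.
Set Implicit Arguments.
Unset Strict Implicit.
Unset Printing Implicit Defensive.

(** The substitution [sqrt t u(t)] turns the q-difference equation into a three-term recurrence.
    With [w = exp (i z / 2)], so that the spectral parameter is [w + 1 / w], its Jost solution at
    plus infinity is [alpha_n w^(2 n) F_n(w)], where [F_n(w) = 1 + sum_m K_(n,m) w^m]; comparing
    powers of [w] in the recurrence gives the formulas for [K], and an induction on the number of
    terms bounds the sum of the [|K_(n,m)|] (with a weight [exp (eta sqrt m)] in part (vi)) by the
    first moment of the perturbation.  The Jost solution at minus infinity comes from reflection.

    Since the Wronskian is constant, a solution that is square-summable at one end is a multiple of
    the decaying Jost solution there, so eigenvalues are the zeros of the Wronskian of the two Jost
    solutions.  Away from the zeros and off the segment the operator is bounded below: far from the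
    origin it is close to the free operator, which is a product of two first-order operators with
    contractive coefficient, and finitely many coordinates are controlled by the two Jost
    solutions.  On the segment, truncating a bounded Jost solution by long tents shows that the
    operator is not bounded below; the images of these truncations also approximate combinations
    of two neighbouring unit vectors, and chaining them shows that the range is dense.

    In part (vi), [G(w) = w^2 Phi] is a power series with [sum_m |g_m| exp (eta sqrt m)] finite and
    [G(0) <> 0].  If all Taylor coefficients of [G] vanish at a point [w0] of the unit circle, then
    [|G(w)| <= C exp (- c / |w - w0|)].  The product of the rotations of [G] by the [N]-th roots of
    unity is then at most [(C exp (- c' (1 + 1/2 + ... + 1/N)))^N] on the circle, hence also at the
    origin, which for large [N] contradicts [G(0) <> 0].  So zeros of [G] in the closed disk are of
    finite order and isolated, and by compactness there are finitely many. *)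

(** The square root in the weight is what [delta >= 1/2] provides, and it is borderline. A weight
    [exp (eta sqrt m)] bounds the [k]-th Taylor coefficient of [G] on the closed disk by a multiple
    of [(2k)! / (k! eta^(2k))]: [G] is smooth up to the circle but need not extend across it, so
    zeros might a priori accumulate there. Optimizing the order of the Taylor expansion at a flat
    point gives the decay [exp (- c / |w - w0|)]; since [1 / |t|] is not integrable at 0, this
    contradicts Jensen's inequality for [log |G|]. The harmonic sum is a discrete substitute for
    that integral. Working with [w] in the closed disk instead of [z] in the half-plane makes the
    domain compact: [w = 0] stands for [Im z = infinity], and [G(0) <> 0] keeps zeros away from it.
    The estimates of the [K_(n,m)] are shaped by the recursion, in which one step in [n] shifts the
    power of [w] by four, so that decay of the perturbation at site [n] is traded for weight at
    index [4 n]. *)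

Lemma Cmod_triang_sub (x y : C) : Cmod (x - y) <= Cmod x + Cmod y.
Proof. unfold Cminus. apply: Rle_trans (Cmod_triangle _ _) _. rewrite Cmod_opp; lra. Qed.

Lemma Cmod_sub_sym (x y : C) : Cmod (x - y) = Cmod (y - x).
Proof. rewrite -Cmod_opp. f_equal; ring. Qed.

Lemma im_le_Cmod (c : C) : Rabs (Im c) <= Cmod c.
Proof. exact: Rle_trans (Rmax_r _ _) (Rmax_Cmod c). Qed.

Lemma Cmod_le_ReIm (c : C) : Cmod c <= Rabs (Re c) + Rabs (Im c).
Proof.
  have E : c = (RtoC (Re c) + Ci * RtoC (Im c))%C by case: c => x y; apply: injective_projections => /=; ring.
  rewrite {1}E. apply: Rle_trans (Cmod_triangle _ _) _. rewrite Cmod_mult Cmod_Ci !Cmod_R. lra.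
Qed.

Lemma Re_plus (x y : C) : Re (x + y) = Re x + Re y. Proof. by []. Qed.
Lemma Im_plus (x y : C) : Im (x + y) = Im x + Im y. Proof. by []. Qed.
Lemma Re_mult (x y : C) : Re (x * y) = Re x * Re y - Im x * Im y. Proof. by []. Qed.
Lemma C_ext (x y : C) : Re x = Re y -> Im x = Im y -> x = y.
Proof. exact: injective_projections. Qed.

Lemma Cmult_eq0_r (c x : C) : c <> RtoC 0 -> (c * x = 0)%C -> x = RtoC 0.
Proof. move=> Hc H. have -> : x = (/ c * (c * x))%C by field. by rewrite H Cmult_0_r. Qed.

(** * Series of complex numbers *)

Definition summable (u : nat -> C) : Prop := ex_series (fun k => Cmod (u k)).

Lemma ex_series_Rle (u v : nat -> R) :
  (forall k, 0 <= u k <= v k) -> ex_series v -> ex_series u.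
Proof.
  move=> H; apply: ex_series_le => k. case: (H k) => H1 H2.
  rewrite /norm /= /abs /= Rabs_pos_eq //.
Qed.

Lemma summable_le (u : nat -> C) (v : nat -> R) :
  (forall k, Cmod (u k) <= v k) -> ex_series v -> summable u.
Proof. move=> H; apply: ex_series_Rle => k; split; [exact: Cmod_ge_0 | exact: H]. Qed.

Lemma ex_series_plusR (u v : nat -> R) :
  ex_series u -> ex_series v -> ex_series (fun k => u k + v k).
Proof. exact: ex_series_plus. Qed.

Lemma ex_series_scalR (c : R) (u : nat -> R) :
  ex_series u -> ex_series (fun k => c * u k).
Proof. exact: (ex_series_scal c). Qed.

Lemma ex_series_abs (u : nat -> R) :
  (forall k, 0 <= u k) -> ex_series u -> ex_series (fun k => Rabs (u k)).
Proof. move=> H; apply: ex_series_ext => k; rewrite Rabs_pos_eq //. Qed.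

Section Summable.
Variables u v : nat -> C.
Hypothesis su : summable u.

Lemma summable_Re_abs : ex_series (fun k => Rabs (Re (u k))).
Proof. apply: ex_series_Rle su => k; split; [exact: Rabs_pos | exact: re_le_Cmod]. Qed.

Lemma summable_Im_abs : ex_series (fun k => Rabs (Im (u k))).
Proof. apply: ex_series_Rle su => k; split; [exact: Rabs_pos | exact: im_le_Cmod]. Qed.

Lemma summable_Re : ex_series (fun k => Re (u k)).
Proof. exact: ex_series_Rabs summable_Re_abs. Qed.

Lemma summable_Im : ex_series (fun k => Im (u k)).
Proof. exact: ex_series_Rabs summable_Im_abs. Qed.

Lemma summable_scal (c : C) : summable (fun k => c * u k)%C.
Proof.
  apply: (ex_series_ext (fun k => Cmod c * Cmod (u k))); first by move=> k; rewrite Cmod_mult.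
  exact: ex_series_scalR.
Qed.

Lemma CSeries_scal (c : C) : CSeries (fun k => c * u k)%C = (c * CSeries u)%C.
Proof.
  have H1 := summable_Re; have H2 := summable_Im.
  apply: C_ext; rewrite /CSeries /=.
  - rewrite Series_minus; [| exact: ex_series_scalR H1 | exact: ex_series_scalR H2].
    by rewrite !Series_scal_l.
  - rewrite Series_plus; [| exact: ex_series_scalR H2 | exact: ex_series_scalR H1].
    by rewrite !Series_scal_l.
Qed.

(** [CSeries] sums real and imaginary parts separately, so estimating the parts would lose a
    constant. Multiplying by the conjugate of the sum [s] turns [|s|^2] into the sum of the reals
    [Re (Cconj s * u k)], each at most [|s| |u k|]; then [|s|] is cancelled. *)
Lemma CSeries_le : Cmod (CSeries u) <= Series (fun k => Cmod (u k)).
Proof.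
  set s := CSeries u.
  have Hs : 0 <= Series (fun k => Cmod (u k)).
    rewrite -(Rmult_0_l (Series (fun k => 0))) -Series_scal_l.
    apply: Series_le => // k; split; [lra | rewrite Rmult_0_l; exact: Cmod_ge_0].
  case: (Req_dec (Cmod s) 0) => [-> //| Hne].
  have H0 : 0 < Cmod s by case: (Cmod_ge_0 s) => // H; rewrite -H in Hne.
  have E : Cmod s ^ 2 = Series (fun k => Re (Cconj s * u k)).
    have -> : Series (fun k => Re (Cconj s * u k)) = Re (CSeries (fun k => Cconj s * u k)%C) by [].
    rewrite CSeries_scal -/s Cmod2_alt Re_mult /=; ring.
  have : Cmod s ^ 2 <= Cmod s * Series (fun k => Cmod (u k)).
    rewrite E -Series_scal_l.
    apply: Rle_trans (Rle_abs _) _.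
    apply: Rle_trans (Series_Rabs _ _) _.
    - apply: (@ex_series_Rle _ (fun k => Cmod s * Cmod (u k))); last exact: ex_series_scalR.
      move=> k; split; first exact: Rabs_pos.
      rewrite -(Cmod_conj s) -Cmod_mult; exact: re_le_Cmod.
    - apply: Series_le; last exact: ex_series_scalR.
      move=> k; split; first exact: Rabs_pos.
      rewrite -(Cmod_conj s) -Cmod_mult; exact: re_le_Cmod.
  move=> H; apply: (Rmult_le_reg_l (Cmod s)) => //; lra.
Qed.

Lemma summable_incr (M : nat) : summable (fun k => u (M + k)%nat).
Proof. exact: (proj1 (ex_series_incr_n (fun k => Cmod (u k)) M)). Qed.

Lemma CSeries_incr_1 : CSeries u = (u 0%nat + CSeries (fun k => u (S k)))%C.
Proof.
  apply: C_ext; rewrite /CSeries /=; apply: Series_incr_1; [exact: summable_Re | exact: summable_Im].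
Qed.

Hypothesis sv : summable v.

Lemma summable_plus : summable (fun k => u k + v k)%C.
Proof.
  apply: (@summable_le _ (fun k => Cmod (u k) + Cmod (v k))); last exact: ex_series_plusR.
  move=> k; exact: Cmod_triangle.
Qed.

End Summable.

Lemma CSeries_plus (u v : nat -> C) : summable u -> summable v ->
  CSeries (fun k => u k + v k)%C = (CSeries u + CSeries v)%C.
Proof.
  move=> su sv; apply: C_ext; rewrite /CSeries /=; apply: Series_plus;
    by [apply: summable_Re | apply: summable_Im].
Qed.

Lemma CSeries_ext (u v : nat -> C) : (forall k, u k = v k) -> CSeries u = CSeries v.
Proof. by move=> H; congr CSeries; apply: functional_extensionality. Qed.

Lemma summable_ext (u v : nat -> C) : (forall k, u k = v k) -> summable u -> summable v.
Proof. by move=> H; apply: ex_series_ext => k; rewrite H. Qed.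

Lemma summable_opp (u : nat -> C) : summable u -> summable (fun k => - u k)%C.
Proof. by apply: ex_series_ext => k; rewrite Cmod_opp. Qed.

Lemma summable_minus (u v : nat -> C) : summable u -> summable v -> summable (fun k => u k - v k)%C.
Proof. by move=> su sv; apply: summable_plus => //; apply: summable_opp. Qed.

Lemma CSeries_minus (u v : nat -> C) : summable u -> summable v ->
  CSeries (fun k => u k - v k)%C = (CSeries u - CSeries v)%C.
Proof.
  move=> su sv; apply: C_ext; rewrite /CSeries /=; apply: Series_minus;
    by [apply: summable_Re | apply: summable_Im].
Qed.

Lemma summable_S (u : nat -> C) : summable (fun k => u (S k)) <-> summable u.
Proof. rewrite /summable; symmetry; exact: (ex_series_incr_1 (fun k => Cmod (u k))). Qed.

Lemma CSeries_0 : CSeries (fun _ => RtoC 0) = RtoC 0.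
Proof.
  have H : Series (fun _ => 0) = 0.
    rewrite -[RHS](Rmult_0_l (Series (fun _ => 0))) -Series_scal_l.
    apply: Series_ext => _; ring.
  by apply: C_ext; rewrite /CSeries /=.
Qed.

Fixpoint Csum (u : nat -> C) (M : nat) : C :=
  match M with O => RtoC 0 | S m => (Csum u m + u m)%C end.

Fixpoint Rsum (u : nat -> R) (M : nat) : R :=
  match M with O => 0 | S m => Rsum u m + u m end.

Lemma CSeries_split (u : nat -> C) (M : nat) : summable u ->
  CSeries u = (Csum u M + CSeries (fun k => u (M + k)%nat))%C.
Proof.
  move=> su; elim: M => [|M IH] /=; first by rewrite Cplus_0_l.
  rewrite IH (CSeries_incr_1 (summable_incr su M)) Nat.add_0_r -Cplus_assoc.
  congr (_ + (_ + _))%C; apply: CSeries_ext => k; congr u; lia.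
Qed.

Lemma Cmod_Csum (u : nat -> C) M : Cmod (Csum u M) <= Rsum (fun k => Cmod (u k)) M.
Proof.
  elim: M => [|M IH] /=; first by rewrite Cmod_0; lra.
  apply: Rle_trans (Cmod_triangle _ _) _; lra.
Qed.

Lemma Rsum_le (u v : nat -> R) M : (forall k, (k < M)%nat -> u k <= v k) -> Rsum u M <= Rsum v M.
Proof.
  elim: M => [|M IH] H /=; first lra.
  apply: Rplus_le_compat; [apply: IH => k Hk; apply: H; lia | apply: H; lia].
Qed.

Lemma Rsum_pos (u : nat -> R) M : (forall k, 0 <= u k) -> 0 <= Rsum u M.
Proof. move=> H; elim: M => [|M IH] /=; [lra | have := H M; lra]. Qed.

Lemma Rsum_plus (u v : nat -> R) M : Rsum (fun k => u k + v k) M = Rsum u M + Rsum v M.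
Proof. elim: M => [|M IH] /=; [ring | rewrite IH; ring]. Qed.

Lemma Rsum_scal (c : R) (u : nat -> R) M : Rsum (fun k => c * u k) M = c * Rsum u M.
Proof. elim: M => [|M IH] /=; [ring | rewrite IH; ring]. Qed.

Lemma Rsum_const (c : R) M : Rsum (fun _ => c) M = INR M * c.
Proof. elim: M => [|M IH]; [simpl; ring | rewrite S_INR /= IH; ring]. Qed.

Lemma Rsum_ext (u v : nat -> R) M : (forall k, (k < M)%nat -> u k = v k) -> Rsum u M = Rsum v M.
Proof. elim: M => [|M IH] H //=; rewrite IH ?H //; move=> k Hk; apply: H; lia. Qed.

Lemma Csum_ext (u v : nat -> C) M : (forall k, (k < M)%nat -> u k = v k) -> Csum u M = Csum v M.
Proof. elim: M => [|M IH] H //=; rewrite IH ?H //; move=> k Hk; apply: H; lia. Qed.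

Lemma Csum_plus (u v : nat -> C) M : Csum (fun k => u k + v k)%C M = (Csum u M + Csum v M)%C.
Proof. elim: M => [|M IH] /=; [ring | rewrite IH; ring]. Qed.

Lemma Csum_scal (c : C) (u : nat -> C) M : Csum (fun k => c * u k)%C M = (c * Csum u M)%C.
Proof. elim: M => [|M IH] /=; [ring | rewrite IH; ring]. Qed.

Lemma Rsum_S (u : nat -> R) M : Rsum u (S M) = u 0%nat + Rsum (fun k => u (S k)) M.
Proof. elim: M => [|M IH]; [simpl; ring | rewrite [Rsum u (S (S M))]/= -/(Rsum u (S M)) IH /=; ring]. Qed.

Lemma sum_n_Rsum (u : nat -> R) n : sum_n u n = Rsum u (S n).
Proof.
  elim: n => [|n IH]; first by rewrite sum_O /= Rplus_0_l.
  by rewrite sum_Sn IH.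
Qed.

Lemma sum_n_Csum (u : nat -> C) n :
  @sum_n (NormedModule.AbelianMonoid C_AbsRing C_NormedModule) u n = Csum u (S n).
Proof.
  elim: n => [|n IH]; first by rewrite sum_O /= Cplus_0_l.
  by rewrite sum_Sn IH.
Qed.

Lemma Rsum_le_Series (u : nat -> R) M : (forall k, 0 <= u k) -> ex_series u -> Rsum u M <= Series u.
Proof.
  move=> H eu.
  have HS : forall m v, (forall k, 0 <= v k) -> ex_series v -> 
      Series v = Rsum v m + Series (fun k => v (m + k)%nat).
    elim=> [|m IH] v Hv ev /=; first by rewrite Rplus_0_l.
    rewrite (IH _ Hv ev) (Series_incr_1 (fun k => v (m + k)%nat)).
      rewrite Nat.add_0_r Rplus_assoc; congr (_ + (_ + _)); apply: Series_ext => k; congr v; lia.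
    exact/(ex_series_incr_n v m).
  rewrite (HS M) //.
  have : 0 <= Series (fun k => u (M + k)%nat); last lra.
  rewrite -(Rmult_0_l (Series (fun k => 0))) -Series_scal_l.
  apply: Series_le; last exact/(ex_series_incr_n u M).
  move=> k; split; [lra | rewrite Rmult_0_l; exact: H].
Qed.

Lemma Series_ge0 (u : nat -> R) : (forall k, 0 <= u k) -> ex_series u -> 0 <= Series u.
Proof. by move=> H eu; apply: (@Rsum_le_Series u 0). Qed.

Lemma ex_series_bounded (u : nat -> R) (B : R) :
  (forall k, 0 <= u k) -> (forall M, Rsum u M <= B) -> ex_series u.
Proof.
  move=> H HB.
  have E : ex_finite_lim_seq (sum_n u).
    apply: (ex_finite_lim_seq_incr _ B).
    - move=> n; rewrite !sum_n_Rsum /=; have := H (S n); lra.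
    - move=> n; rewrite sum_n_Rsum; exact: HB.
  case: E => l Hl; exists l; exact: Hl.
Qed.

Lemma Series_le_bound (u : nat -> R) (B : R) :
  (forall k, 0 <= u k) -> (forall M, Rsum u M <= B) -> Series u <= B.
Proof.
  move=> H HB. have eu := ex_series_bounded H HB.
  have := Series_correct _ eu => Hl.
  apply: (is_lim_seq_le (sum_n u) (fun _ => B) (Series u) B _ Hl (is_lim_seq_const B)).
  move=> n; rewrite sum_n_Rsum; exact: HB.
Qed.

Lemma series_tail_small (B : nat -> R) (eps : R) : (forall k, 0 <= B k) -> ex_series B -> 0 < eps ->
  exists M, forall m, (M <= m)%nat -> 0 <= Series (fun k => B (m + k)%nat) < eps.
Proof.
  move=> HB eB He.
  have := Series_correct _ eB; rewrite /is_series => Hl.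
  have Hl' : is_lim_seq (sum_n B) (Series B) by exact: Hl.
  move/is_lim_seq_spec: Hl' => /(_ (mkposreal eps He)) [M HM]; exists (S M) => m Hm.
  split. apply: Series_ge0 => [k|]; [exact: HB | exact/(ex_series_incr_n B m)].
  have Em : S (Nat.pred m) = m by lia.
  have := HM (Nat.pred m) ltac:(lia); rewrite sum_n_Rsum Em /=.
  have -> : Series B = Rsum B m + Series (fun k => B (m + k)%nat).
    rewrite (Series_incr_n B m) //; last lia.
    rewrite -sum_n_Reals sum_n_Rsum. by rewrite Em.
  move=> H; have := Rle_abs (- (Rsum B m - (Rsum B m + Series (fun k => B (m + k)%nat)))).
  rewrite Rabs_Ropp; lra.
Qed.

(** Dominated convergence for series along a filter: beyond [M] both tails are below [eps / 4] by
    the common bound [B], and the finite part converges termwise. It is applied to neighbourhoods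
    within the closed half-plane, for continuity up to the real axis. *)
Lemma CSeries_dominated {T : Type} (F : (T -> Prop) -> Prop) {FF : Filter F}
    (u : T -> nat -> C) (l : nat -> C) (B : nat -> R) :
  ex_series B -> F (fun t => forall m, Cmod (u t m) <= B m) ->
  (forall m, Cmod (l m) <= B m) ->
  (forall m eps, 0 < eps -> F (fun t => Cmod (u t m - l m) < eps)) ->
  forall eps, 0 < eps -> F (fun t => Cmod (CSeries (u t) - CSeries l) < eps).
Proof.
  move=> eB Hu Hl Hc eps He.
  have HB : forall k, 0 <= B k by move=> k; exact: Rle_trans (Cmod_ge_0 _) (Hl k).
  have [M HM] := series_tail_small HB eB (ltac:(lra) : 0 < eps / 4).
  have {}HM := HM M (le_n M).
  have Hfin : forall m e, 0 < e -> F (fun t => Cmod (Csum (u t) m - Csum l m) < e).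
    elim=> [|m IH] e Hee /=.
      by apply: filter_forall => t; rewrite /Cminus Cplus_opp_r Cmod_0.
    have H1 := IH (e / 2) ltac:(lra); have H2 := Hc m (e / 2) ltac:(lra).
    apply: filter_imp (filter_and _ _ H1 H2) => t [H3 H4].
    have -> : (Csum (u t) m + u t m - (Csum l m + l m) = (Csum (u t) m - Csum l m) + (u t m - l m))%C by ring.
    apply: Rle_lt_trans (Cmod_triangle _ _) _; lra.
  have Hf := Hfin M (eps / 4) ltac:(lra).
  apply: filter_imp (filter_and _ _ Hu Hf) => t [H1 H2].
  have tl : forall v : nat -> C, (forall m, Cmod (v m) <= B m) -> Cmod (CSeries (fun k => v (M + k)%nat)) <= eps / 4.
    move=> v Hv. have eBM := proj1 (ex_series_incr_n B M) eB.
    apply: Rle_trans (CSeries_le _) _; first by apply: summable_le eBM => k; exact: Hv.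
    apply: Rle_trans (Rlt_le _ _ (proj2 HM)).
    apply: Series_le => // k; split; [exact: Cmod_ge_0 | exact: Hv].
  rewrite (CSeries_split M (summable_le H1 eB)) (CSeries_split M (summable_le Hl eB)).
  have -> : (Csum (u t) M + CSeries (fun k => u t (M + k)%nat) - (Csum l M + CSeries (fun k => l (M + k)%nat))
     = (Csum (u t) M - Csum l M) + (CSeries (fun k => u t (M + k)%nat) - CSeries (fun k => l (M + k)%nat)))%C by ring.
  apply: Rle_lt_trans (Cmod_triangle _ _) _.
  have := Cmod_triang_sub (CSeries (fun k => u t (M + k)%nat)) (CSeries (fun k => l (M + k)%nat)).
  have := tl _ H1; have := tl _ Hl. lra.
Qed.

(** * Limits of complex functions *)

Lemma filterlim_Cmod {T : Type} (F : (T -> Prop) -> Prop) {FF : Filter F} (f : T -> C) (l : C) :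
  filterlim f F (@locally C_UniformSpace l) <-> forall eps, 0 < eps -> F (fun t => Cmod (f t - l) < eps).
Proof.
  split.
  - move=> H eps He.
    have He2 : 0 < eps / 2 by lra.
    apply: filter_imp (proj1 (filterlim_locally f l) H (mkposreal _ He2)) => t [H1 H2].
    apply: Rle_lt_trans (Cmod_le_ReIm _) _.
    move: H1 H2; rewrite /ball /= /AbsRing_ball /= /abs /minus /plus /opp /= => H1 H2.
    rewrite /Re /Im /=; lra.
  - move=> H; apply/filterlim_locally => eps.
    apply: filter_imp (H eps (cond_pos eps)) => t Ht; split;
      rewrite /ball /= /AbsRing_ball /= /abs /minus /plus /opp /=.
    + exact: Rle_lt_trans (re_le_Cmod (f t - l)) Ht.
    + exact: Rle_lt_trans (im_le_Cmod (f t - l)) Ht.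
Qed.

Lemma is_series_CSeries (u : nat -> C) : summable u ->
  @is_series C_AbsRing C_NormedModule u (CSeries u).
Proof.
  move=> su.
  suff H : filterlim (fun n => Csum u (S n)) eventually (@locally C_UniformSpace (CSeries u)).
    apply: filterlim_ext H => n; by rewrite -sum_n_Csum.
  apply/filterlim_Cmod => eps He.
  have [M HM] := series_tail_small (fun k => Cmod_ge_0 (u k)) su He.
  exists M => n Hn.
  rewrite (CSeries_split (S n) su).
  have -> : (Csum u (S n) - (Csum u (S n) + CSeries (fun k => u (S n + k)%nat)) = - CSeries (fun k => u (S n + k)%nat))%C by ring.
  rewrite Cmod_opp. apply: Rle_lt_trans (CSeries_le (summable_incr su (S n))) _.
  by apply HM; lia.
Qed.

(** The uniform structure behind [locally] on [C] is that of a product of two lines; this is the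
    equivalent form with the Euclidean modulus, by [filterlim_Cmod]. *)
Definition Ctends {T : Type} (F : (T -> Prop) -> Prop) (f : T -> C) (l : C) : Prop :=
  forall eps, 0 < eps -> F (fun t => Cmod (f t - l) < eps).

Section Ctends.
Context {T : Type} {F : (T -> Prop) -> Prop} {FF : Filter F}.

Lemma Ctends_ext (f g : T -> C) l : (forall t, f t = g t) -> Ctends F f l -> Ctends F g l.
Proof. by move=> H Hf e He; apply: filter_imp (Hf e He) => t; rewrite H. Qed.

Lemma Ctends_ext_loc (f g : T -> C) l : F (fun t => f t = g t) -> Ctends F f l -> Ctends F g l.
Proof. by move=> H Hf e He; apply: filter_imp (filter_and _ _ H (Hf e He)) => t [<-]. Qed.

Lemma Ctends_const (l : C) : Ctends F (fun _ => l) l.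
Proof. by move=> e He; apply: filter_forall => _; rewrite /Cminus Cplus_opp_r Cmod_0. Qed.

Lemma Ctends_plus (f g : T -> C) l m : Ctends F f l -> Ctends F g m ->
  Ctends F (fun t => f t + g t)%C (l + m)%C.
Proof.
  move=> Hf Hg e He.
  have H1 := Hf (e / 2) ltac:(lra); have H2 := Hg (e / 2) ltac:(lra).
  apply: filter_imp (filter_and _ _ H1 H2) => t [H3 H4].
  have -> : (f t + g t - (l + m) = (f t - l) + (g t - m))%C by ring.
  apply: Rle_lt_trans (Cmod_triangle _ _) _; lra.
Qed.

Lemma Ctends_bounded (f : T -> C) l : Ctends F f l -> F (fun t => Cmod (f t) <= Cmod l + 1).
Proof.
  move=> Hf; apply: filter_imp (Hf 1 Rlt_0_1) => t H.
  have -> : f t = ((f t - l) + l)%C by ring.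
  apply: Rle_trans (Cmod_triangle _ _) _; lra.
Qed.

Lemma Ctends_bmult (f g : T -> C) B : F (fun t => Cmod (f t) <= B) -> Ctends F g (RtoC 0) ->
  Ctends F (fun t => f t * g t)%C (RtoC 0).
Proof.
  move=> Hb Hg e He.
  have HB : 0 < Rabs B + 1 by have := Rabs_pos B; lra.
  have H2 := Hg (e / (Rabs B + 1)) (Rdiv_lt_0_compat _ _ He HB).
  apply: filter_imp (filter_and _ _ Hb H2) => t [H3].
  have -> : (g t - 0 = g t)%C by ring.
  have -> : (f t * g t - 0 = f t * g t)%C by ring.
  move=> H4; rewrite Cmod_mult.
  have H5 : Cmod (f t) <= Rabs B + 1 by have := Rle_abs B; lra.
  apply: Rle_lt_trans (Rmult_le_compat_r _ _ _ (Cmod_ge_0 _) H5) _.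
  have := Rmult_lt_compat_l _ _ _ HB H4.
  by have -> : (Rabs B + 1) * (e / (Rabs B + 1)) = e by field; lra.
Qed.

Lemma Ctends_minus0 (f : T -> C) l : Ctends F f l -> Ctends F (fun t => f t - l)%C (RtoC 0).
Proof. move=> H e He; apply: filter_imp (H e He) => t. by have -> : (f t - l - 0 = f t - l)%C by ring. Qed.

Lemma Ctends_mult (f g : T -> C) l m : Ctends F f l -> Ctends F g m ->
  Ctends F (fun t => f t * g t)%C (l * m)%C.
Proof.
  move=> Hf Hg.
  have H1 := Ctends_bmult (Ctends_bounded Hf) (Ctends_minus0 Hg).
  have H2 := Ctends_bmult (f := fun _ => m) (B := Cmod m)
    (filter_forall (F := F) _ (fun _ => Rle_refl (Cmod m))) (Ctends_minus0 Hf).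
  have {}H2 := H2 FF.
  have H3 := Ctends_plus (Ctends_plus H1 H2) (Ctends_const (l * m)%C).
  rewrite !Cplus_0_l in H3.
  apply: Ctends_ext H3 => t; ring.
Qed.

Lemma Ctends_scal (c : C) (g : T -> C) m : Ctends F g m -> Ctends F (fun t => c * g t)%C (c * m)%C.
Proof. exact: Ctends_mult (Ctends_const c). Qed.

Lemma Ctends_opp (g : T -> C) m : Ctends F g m -> Ctends F (fun t => - g t)%C (- m)%C.
Proof.
  move=> H e He; apply: filter_imp (H e He) => t.
  have -> : (- g t - - m = - (g t - m))%C by ring.
  by rewrite Cmod_opp.
Qed.

Lemma Ctends_minus (f g : T -> C) l m : Ctends F f l -> Ctends F g m ->
  Ctends F (fun t => f t - g t)%C (l - m)%C.
Proof. move=> Hf Hg; exact: Ctends_plus Hf (Ctends_opp Hg). Qed.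

Lemma Ctends_inv (f : T -> C) l : l <> RtoC 0 -> Ctends F f l -> Ctends F (fun t => / f t)%C (/ l)%C.
Proof.
  move=> Hl Hf.
  have Hl0 := proj1 (Cmod_gt_0 l) Hl.
  have Hlow : F (fun t => Cmod l / 2 < Cmod (f t)).
    have H0 := Hf (Cmod l / 2) ltac:(lra).
    apply: filter_imp H0 => t H.
    have : Cmod l <= Cmod (f t) + Cmod (f t - l); last lra.
    have {1}-> : l = (f t - (f t - l))%C by ring.
    exact: Cmod_triang_sub.
  have Hb : F (fun t => Cmod (- / (f t * l)) <= 2 / (Cmod l * Cmod l)).
    apply: filter_imp Hlow => t H.
    have Hft : f t <> RtoC 0 by apply/Cmod_gt_0; lra.
    rewrite Cmod_opp Cmod_inv ?Cmod_mult; last exact: Cmult_neq_0.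
    have -> : 2 / (Cmod l * Cmod l) = / (Cmod l / 2 * Cmod l) by field; lra.
    apply: Rinv_le_contravar; first by apply: Rmult_lt_0_compat; lra.
    apply: Rmult_le_compat_r; lra.
  have H := Ctends_plus (Ctends_bmult Hb (Ctends_minus0 Hf)) (Ctends_const (/ l)%C).
  rewrite Cplus_0_l in H.
  apply: Ctends_ext_loc H.
  apply: filter_imp Hlow => t H.
  have Hft : f t <> RtoC 0 by apply/Cmod_gt_0; lra.
  by field.
Qed.

Lemma Ctends_pow (f : T -> C) l n : Ctends F f l -> Ctends F (fun t => f t ^ n)%C (l ^ n)%C.
Proof. by move=> H; elim: n => [|n IH] /=; [exact: Ctends_const | exact: Ctends_mult]. Qed.

End Ctends.

Lemma Ctends_unique {T : Type} {F : (T -> Prop) -> Prop} {FF : ProperFilter F} (f : T -> C) l m :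
  Ctends F f l -> Ctends F f m -> l = m.
Proof.
  move=> Hl Hm.
  have H : Cmod (l - m) = 0.
    apply: Rle_antisym; last exact: Cmod_ge_0.
    apply: le_epsilon => e He.
    have H1 := Hl (e / 2) ltac:(lra); have H2 := Hm (e / 2) ltac:(lra).
    case: (filter_ex _ (filter_and _ _ H1 H2)) => t [H3 H4].
    have -> : (l - m = (f t - m) - (f t - l))%C by ring.
    apply: Rle_trans (Cmod_triang_sub _ _) _; lra.
  have -> : (l = (l - m) + m)%C by ring.
  by rewrite (Cmod_eq_0 _ H) Cplus_0_l.
Qed.

(** * Two-sided sequences near plus infinity *)

(** The filter of neighbourhoods of plus infinity. Behaviour at minus infinity is expressed by
    composing with [n |-> - n], so that one set of lemmas serves both ends. *)
Definition Zinf (P : Z -> Prop) : Prop := exists N, forall n, (N <= n)%Z -> P n.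

Global Instance Zinf_filter : ProperFilter Zinf.
Proof.
  constructor; first by move=> P [N H]; exists N; apply: H; lia.
  constructor.
  - by exists 0%Z.
  - move=> P Q [N H1] [M H2]; exists (Z.max N M) => n Hn; split; [apply: H1 | apply: H2]; lia.
  - move=> P Q H [N HP]; exists N => n Hn; apply: H; exact: HP.
Qed.

Lemma Zinf_shift (P : Z -> Prop) (m : Z) : Zinf P -> Zinf (fun n => P (n + m)%Z).
Proof. by move=> [N H]; exists (N - m)%Z => n Hn; apply: H; lia. Qed.

Lemma Zinf_nat (P : Z -> Prop) : Zinf P -> eventually (fun n => P (Z.of_nat n)).
Proof. move=> [N H]; exists (Z.to_nat N) => n Hn; apply: H; lia. Qed.

Lemma nat_Zinf (P : Z -> Prop) : eventually (fun n => P (Z.of_nat n)) -> Zinf P.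
Proof.
  move=> [N H]; exists (Z.of_nat N) => n Hn.
  have -> : n = Z.of_nat (Z.to_nat n) by lia. apply: H; lia.
Qed.

Lemma ex_series_Zshift (f : Z -> R) (n m : Z) :
  ex_series (fun k => f (n + Z.of_nat k)%Z) -> ex_series (fun k => f (m + Z.of_nat k)%Z).
Proof.
  case: (Z.le_ge_cases n m) => Hnm.
  - move/(ex_series_incr_n _ (Z.to_nat (m - n))).
    apply: ex_series_ext => k; congr f; lia.
  - move=> H; apply/(ex_series_incr_n _ (Z.to_nat (n - m))).
    apply: ex_series_ext H => k; congr f; lia.
Qed.

Lemma summable_Zshift (f : Z -> C) (n m : Z) :
  summable (fun k => f (n + Z.of_nat k)%Z) -> summable (fun k => f (m + Z.of_nat k)%Z).
Proof. exact: (ex_series_Zshift (f := fun n => Cmod (f n))). Qed.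

Lemma sum_ge_step (f : Z -> C) (n : Z) : summable (fun k => f (n + Z.of_nat k)%Z) ->
  sum_ge n f = (f n + sum_ge (n + 1) f)%C.
Proof.
  move=> H; rewrite /sum_ge (CSeries_incr_1 H) Z.add_0_r; congr (_ + _)%C.
  apply: CSeries_ext => k; congr f; lia.
Qed.

Lemma sum_ge_tends (f : Z -> C) : summable (fun k => f (0 + Z.of_nat k)%Z) ->
  Ctends Zinf (fun n => sum_ge n f) (RtoC 0).
Proof.
  move=> H e He; apply: nat_Zinf.
  have [M HM] := series_tail_small (fun k => Cmod_ge_0 (f (0 + Z.of_nat k)%Z)) H He.
  exists M => m Hm.
  have -> : (sum_ge (Z.of_nat m) f - 0 = sum_ge (Z.of_nat m) f)%C by ring.
  have H' := summable_Zshift (Z.of_nat m) H.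
  apply: Rle_lt_trans (CSeries_le H') _.
  have [_] := HM m Hm.
  by rewrite (Series_ext _ (fun k => Cmod (f (Z.of_nat m + Z.of_nat k)%Z))) // => k; do 2 f_equal; lia.
Qed.

(** * Coefficients of the Jost solution at plus infinity *)

Arguments K_plus : simpl never.

Lemma exp_mono x y : x <= y -> exp x <= exp y.
Proof. case=> [H | ->]; [left; exact: exp_increasing | exact: Rle_refl]. Qed.

Definition pert (a h p : Z -> C) (n : Z) : R := Cmod (1 - a n) + Cmod (h n) + Cmod (p n).

(** [eta = 0] makes the weight 1, the case of the first moment hypothesis; [eta > 0] is for
    exponential decay. The square root is subadditive, so the weight is submultiplicative, which
    controls shifted and convolved sequences. *)
Definition wt (eta x : R) : R := exp (eta * sqrt x).

Lemma wt_ge1 eta x : 0 <= eta -> 1 <= wt eta x.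
Proof.
  move=> H; rewrite /wt -exp_0; apply: exp_mono.
  apply: Rmult_le_pos => //; exact: sqrt_pos.
Qed.

Lemma wt_mono eta x y : 0 <= eta -> x <= y -> wt eta x <= wt eta y.
Proof. move=> H Hxy; apply: exp_mono; apply: Rmult_le_compat_l => //; exact: sqrt_le_1_alt. Qed.

Lemma sqrt_subadd x y : 0 <= x -> 0 <= y -> sqrt (x + y) <= sqrt x + sqrt y.
Proof.
  move=> Hx Hy.
  have H1 := sqrt_pos x; have H2 := sqrt_pos y.
  have E : x + y <= (sqrt x + sqrt y) * (sqrt x + sqrt y).
    have := sqrt_sqrt x Hx; have := sqrt_sqrt y Hy; nra.
  apply: Rle_trans (sqrt_le_1_alt _ _ E) _.
  rewrite sqrt_square; lra.
Qed.

Lemma wt_subadd eta x y : 0 <= eta -> 0 <= x -> 0 <= y -> wt eta (x + y) <= wt eta x * wt eta y.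
Proof.
  move=> He Hx Hy; rewrite /wt -exp_plus -Rmult_plus_distr_l; apply: exp_mono.
  apply: Rmult_le_compat_l => //; exact: sqrt_subadd.
Qed.

Lemma Rsum_shift (u : nat -> R) r M : (forall j, (j < r)%nat -> u j = 0) ->
  Rsum u M = Rsum (fun j => u (j + r)%nat) (M - r).
Proof.
  move=> H; elim: M => [|M IH]; first by [].
  have E : Rsum u (S M) = Rsum u M + u M by [].
  case: (Nat.le_gt_cases r M) => Hr; rewrite E IH.
  - have -> : (S M - r = S (M - r))%nat by lia.
    rewrite /=. by have -> : (M - r + r = M)%nat by lia.
  - rewrite (H _ Hr) Rplus_0_r. have -> : (M - r = 0)%nat by lia.
    by have -> : (S M - r = 0)%nat by lia.
Qed.

Lemma Rsum_mono (u : nat -> R) M N : (forall k, 0 <= u k) -> (M <= N)%nat -> Rsum u M <= Rsum u N.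
Proof. move=> H; elim=> [|k _ IH] /=; [lra | have := H k; lra]. Qed.

(** The coefficients padded by four zeros and a one (the exponents of [w] being shifted by four),
    so that all of them satisfy one and the same recursion. *)
Definition kap (a h p : Z -> C) (j : nat) (n : Z) : C :=
  match j with
  | S (S (S (S m))) => match m with O => RtoC 1 | _ => K_plus a h p m n end
  | _ => RtoC 0
  end.

(** The part of the recursion in which every term carries a perturbation factor. *)
Definition kapE (a h p : Z -> C) (j : nat) (r : Z) : C :=
  (h r * kap a h p (j + 2) r + RtoC 2 * p r * (kap a h p (j + 1) r + kap a h p (j + 3) r)
   + (RtoC 1 - a r * a r) * kap a h p j (r + 1))%C.

Lemma kap_K a h p j n : (1 <= j)%nat -> kap a h p (j + 4) n = K_plus a h p j n.
Proof. by case: j => [|j] H; [lia | rewrite Nat.add_comm]. Qed.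

Lemma kap_lt4 a h p j n : (j < 4)%nat -> kap a h p j n = RtoC 0.
Proof. by case: j => [|[|[|[|j]]]] H //; lia. Qed.

Lemma CSeries_scalR (x : R) (u : nat -> C) :
  CSeries (fun k => RtoC x * u k)%C = (RtoC x * CSeries u)%C.
Proof.
  apply: C_ext; rewrite /CSeries /=.
  - rewrite Rmult_0_l Rminus_0_r -Series_scal_l; apply: Series_ext => k; rewrite /Re /Im /=; ring.
  - rewrite Rmult_0_l Rplus_0_r -Series_scal_l; apply: Series_ext => k; rewrite /Re /Im /=; ring.
Qed.

Lemma K_plus_1 a h p n : K_plus a h p 1 n = (RtoC 2 * sum_ge (n + 1) (fun r => p r))%C.
Proof. by []. Qed.

Lemma K_plus_2 a h p n :
  K_plus a h p 2 n = sum_ge (n + 1) (fun r => h r + RtoC 2 * p r * K_plus a h p 1 r)%C.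
Proof. by []. Qed.

Lemma K_plus_3 a h p n : K_plus a h p 3 n =
  sum_ge (n + 1) (fun r => h r * K_plus a h p 1 r + RtoC 2 * p r * (K_plus a h p 2 r + RtoC 1))%C.
Proof. by []. Qed.

Lemma K_plus_4 a h p n : K_plus a h p 4 n =
  sum_ge (n + 1) (fun r => (RtoC 1 - a r * a r) + h r * K_plus a h p 2 r
        + RtoC 2 * p r * (K_plus a h p 3 r + K_plus a h p 1 r))%C.
Proof. by []. Qed.

Lemma K_plus_5 a h p j n : K_plus a h p (S (S (S (S (S j))))) n =
  (K_plus a h p (S j) (n + 1) + sum_ge (n + 1) (fun r =>
        (RtoC 1 - a r * a r) * K_plus a h p (S j) (r + 1) + h r * K_plus a h p (S (S (S j))) r
        + RtoC 2 * p r * (K_plus a h p (S (S j)) r + K_plus a h p (S (S (S (S j)))) r)))%C.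
Proof. by []. Qed.

Global Opaque K_plus.

(** The five clauses of [K_plus] become one formula. At [j = 4] the padded entry 1 is right inside
    the sum, where it produces the bare term [1 - a r * a r], but it has no counterpart in front of
    the sum; hence the 1 subtracted there. *)
Lemma K_plus_kapE a h p j n : (1 <= j)%nat ->
  K_plus a h p j n = (kap a h p j (n + 1) - RtoC (if Nat.eqb j 4 then 1 else 0)
                      + sum_ge (n + 1) (kapE a h p j))%C.
Proof.
  case: j => [|[|[|[|[|j]]]]] Hj; first lia; rewrite /kapE.
  - rewrite K_plus_1 /sum_ge -CSeries_scalR /= /Cminus Copp_0 !Cplus_0_l.
    apply: CSeries_ext => k /=; ring.
  - rewrite K_plus_2 /= /sum_ge /Cminus Copp_0 !Cplus_0_l.
    apply: CSeries_ext => k; ring.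
  - rewrite K_plus_3 /= /sum_ge /Cminus Copp_0 !Cplus_0_l.
    apply: CSeries_ext => k; ring.
  - rewrite K_plus_4 /= /sum_ge.
    have -> : (1 - 1 = 0)%C by ring. rewrite Cplus_0_l.
    apply: CSeries_ext => k; ring.
  - rewrite K_plus_5 !Nat.add_succ_r Nat.add_0_r.
    have -> : RtoC (if Nat.eqb (S (S (S (S (S j))))) 4 then 1 else 0) = RtoC 0 by [].
    have -> : (kap a h p (S (S (S (S (S j))))) (n + 1) - 0)%C = K_plus a h p (S j) (n + 1) by rewrite /kap; ring.
    congr (_ + _)%C. rewrite /sum_ge. apply: CSeries_ext => k. rewrite /kap; ring.
Qed.

Lemma summable_Zbound (f : Z -> C) (g : Z -> R) (B : R) (n : Z) :
  Zinf (fun r => Cmod (f r) <= B * g r) -> ex_series (fun k => g (Z.of_nat k)) ->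
  summable (fun k => f (n + Z.of_nat k)%Z).
Proof.
  move=> [N HN] Hg; apply: (summable_Zshift (n := N)).
  apply: (@summable_le _ (fun k => B * g (N + Z.of_nat k)%Z)).
    by move=> k; apply: HN; lia.
  apply: ex_series_scalR; apply: (@ex_series_Zshift g 0).
  exact: Hg.
Qed.

Section KapLimits.
Variables a h p : Z -> C.
Hypothesis Hs : ex_series (fun k => pert a h p (Z.of_nat k)).
Local Notation eps := (pert a h p).
Local Notation kap := (kap a h p).
Local Notation kapE := (kapE a h p).

Lemma pert_bounds n :
  [/\ 0 <= eps n, Cmod (1 - a n) <= eps n, Cmod (h n) <= eps n & Cmod (p n) <= eps n].
Proof.
  rewrite /pert; have := Cmod_ge_0 (1 - a n); have := Cmod_ge_0 (h n); have := Cmod_ge_0 (p n).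
  split; lra.
Qed.

Lemma pert_le_sum (k : nat) : eps (Z.of_nat k) <= Series (fun k => eps (Z.of_nat k)).
Proof.
  have H0 : forall k, 0 <= eps (Z.of_nat k) by move=> j; case: (pert_bounds (Z.of_nat j)).
  apply: Rle_trans (Rsum_le_Series (S k) H0 Hs).
  rewrite /=; have := Rsum_pos k H0; lra.
Qed.

Definition abound : R := 2 + Series (fun k => eps (Z.of_nat k)).

Lemma one_plus_a_bound (n : Z) : (0 <= n)%Z -> Cmod (1 + a n) <= abound.
Proof.
  move=> Hn; have -> : n = Z.of_nat (Z.to_nat n) by lia.
  set k := Z.to_nat n. have := pert_le_sum k; case: (pert_bounds (Z.of_nat k)) => _ H _ _.
  have -> : (1 + a (Z.of_nat k) = 2 - (1 - a (Z.of_nat k)))%C by rewrite /RtoC; ring_simplify; apply: C_ext => /=; ring.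
  have := Cmod_triang_sub 2 (1 - a (Z.of_nat k)); rewrite Cmod_R Rabs_pos_eq /abound; lra.
Qed.

Lemma one_minus_a2_bound (n : Z) : (0 <= n)%Z -> Cmod (1 - a n * a n) <= abound * eps n.
Proof.
  move=> Hn; have -> : (1 - a n * a n = (1 + a n) * (1 - a n))%C by ring.
  rewrite Cmod_mult; case: (pert_bounds n) => H0 H1 _ _.
  apply: Rmult_le_compat => //; try exact: Cmod_ge_0; exact: one_plus_a_bound.
Qed.

Lemma kapE_bound j (n : Z) : (0 <= n)%Z -> Cmod (kapE j n) <=
  eps n * (Cmod (kap (j + 2) n) + 2 * Cmod (kap (j + 1) n) + 2 * Cmod (kap (j + 3) n)
           + abound * Cmod (kap j (n + 1))).
Proof.
  move=> Hn; rewrite /kapE.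
  case: (pert_bounds n) => H0 H1 H2 H3; have H4 := one_minus_a2_bound Hn.
  apply: Rle_trans (Cmod_triangle _ _) _.
  have T1 : Cmod (h n * kap (j + 2) n) <= eps n * Cmod (kap (j + 2) n).
    rewrite Cmod_mult; apply: Rmult_le_compat_r => //; exact: Cmod_ge_0.
  have T2 : Cmod (2 * p n * (kap (j + 1) n + kap (j + 3) n)) <= eps n * (2 * Cmod (kap (j + 1) n) + 2 * Cmod (kap (j + 3) n)).
    rewrite !Cmod_mult Cmod_R Rabs_pos_eq; last lra.
    have := Cmod_triangle (kap (j + 1) n) (kap (j + 3) n).
    have := Cmod_ge_0 (p n); have := Cmod_ge_0 (kap (j + 1) n + kap (j + 3) n); nra.
  have T3 : Cmod ((1 - a n * a n) * kap j (n + 1)) <= eps n * (abound * Cmod (kap j (n + 1))).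
    rewrite Cmod_mult. have := Cmod_ge_0 (kap j (n + 1)); nra.
  have := Cmod_triangle (h n * kap (j + 2) n) (2 * p n * (kap (j + 1) n + kap (j + 3) n)); lra.
Qed.

Lemma kapE_summable_aux j l0 l1 l2 l3 :
  Ctends Zinf (kap j) l0 -> Ctends Zinf (kap (j + 1)) l1 ->
  Ctends Zinf (kap (j + 2)) l2 -> Ctends Zinf (kap (j + 3)) l3 ->
  forall n, summable (fun k => kapE j (n + Z.of_nat k)%Z).
Proof.
  move=> H0 H1 H2 H3 n.
  set B := (Cmod l2 + 1) + 2 * (Cmod l1 + 1) + 2 * (Cmod l3 + 1) + abound * (Cmod l0 + 1).
  apply: (summable_Zbound (B := B) (g := eps)) => //.
  have [N0 B0] := Ctends_bounded H0; have [N1 B1] := Ctends_bounded H1.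
  have [N2 B2] := Ctends_bounded H2; have [N3 B3] := Ctends_bounded H3.
  exists (Z.max 0 (Z.max N0 (Z.max N1 (Z.max N2 N3)))) => r Hr.
  apply: Rle_trans (kapE_bound _ _) _; first lia.
  rewrite Rmult_comm; apply: Rmult_le_compat_r; first by case: (pert_bounds r).
  have := B0 (r + 1)%Z ltac:(lia); have := B1 r ltac:(lia); have := B2 r ltac:(lia); have := B3 r ltac:(lia).
  have Ha : 0 <= abound by have := one_plus_a_bound (Z.le_refl 0); have := Cmod_ge_0 (1 + a 0%Z); lra.
  move=> T3 T2 T1 T0. have := Rmult_le_compat_l _ _ _ Ha T0. rewrite /B; lra.
Qed.

(** Strong induction: if the four lower coefficients converge, they are bounded near infinity, so
    [kapE] is dominated by the summable perturbation and its tail sums tend to 0. This is not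
    uniform in [j]; it makes every defining series converge and fixes the values at infinity from
    which the uniform estimates start. *)
Lemma kap_tends j : Ctends Zinf (kap j) (RtoC (if Nat.eqb j 4 then 1 else 0)).
Proof.
  elim/(well_founded_induction lt_wf): j => j IH.
  case: (Nat.le_gt_cases j 4) => Hj.
    have Hc : forall c, (forall n, c = kap j n) -> Ctends Zinf (kap j) c.
      move=> c Hc; apply: Ctends_ext Hc _; exact: Ctends_const.
    case: j Hj IH Hc => [|[|[|[|[|j]]]]] Hj IH Hc; try exact: Hc. lia.
  have [i Ei] : exists i, j = (i + 4)%nat by exists (j - 4)%nat; lia.
  subst j. have -> : Nat.eqb (i + 4) 4 = false by apply/Nat.eqb_neq; lia.
  have H0 := IH i ltac:(lia).
  have HE := kapE_summable_aux H0 (IH (i + 1)%nat ltac:(lia)) (IH (i + 2)%nat ltac:(lia)) (IH (i + 3)%nat ltac:(lia)).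
  have L1 : Ctends Zinf (fun n => kap i (n + 1) - RtoC (if Nat.eqb i 4 then 1 else 0))%C (RtoC 0).
    move=> e He. apply: (@Zinf_shift (fun n => Cmod (kap i n - RtoC (if Nat.eqb i 4 then 1 else 0) - 0) < e)).
    exact: Ctends_minus0 H0 e He.
  have L2 : Ctends Zinf (fun n => sum_ge (n + 1) (kapE i)) (RtoC 0).
    move=> e He. apply: (@Zinf_shift (fun n => Cmod (sum_ge n (kapE i) - 0) < e)).
    exact: sum_ge_tends (HE 0%Z) e He.
  have := Ctends_plus L1 L2; rewrite Cplus_0_l.
  move=> L3; refine (Ctends_ext _ (L3 _)) => n; rewrite kap_K ?K_plus_kapE //; lia.
Qed.

Lemma kapE_summable j n : summable (fun k => kapE j (n + Z.of_nat k)%Z).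
Proof. exact: kapE_summable_aux (kap_tends _) (kap_tends _) (kap_tends _) (kap_tends _) n. Qed.

(** Differencing in [n] replaces the tail sum by a single term and removes the exceptional 1 at
    [j = 4]. The right side contains the same kind of increment one site further and four indices
    lower, so the formula can be iterated. *)
Lemma kap_step j n :
  (kap (j + 4) (n - 1) - kap (j + 4) n = kap j n - kap j (n + 1) + kapE j n)%C.
Proof.
  case: j => [|j].
    rewrite /kapE /=; ring.
  rewrite !kap_K; try lia. rewrite !K_plus_kapE; try lia.
  rewrite Z.sub_add (sum_ge_step (kapE_summable (S j) n)); ring.
Qed.

(** The coefficients at [n - 1] come from those at [n] and [n + 1] without an infinite sum. This
    carries weighted summability from large [n] to every [n], and multiplied by powers of [w] and
    summed it is the recurrence for [Fp]. *)
Lemma kap_back j n : kap (j + 4) (n - 1) =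
  (kap (j + 4) n + h n * kap (j + 2) n + 2 * p n * (kap (j + 1) n + kap (j + 3) n)
   + kap j n - a n * a n * kap j (n + 1))%C.
Proof.
  have -> : kap (j + 4) (n - 1) = ((kap (j + 4) (n - 1) - kap (j + 4) n) + kap (j + 4) n)%C by ring.
  rewrite kap_step /kapE; ring.
Qed.

End KapLimits.

Section KapBounds.
Variables a h p : Z -> C.
Variable eta : R.
Hypothesis eta0 : 0 <= eta.
Hypothesis Hs : ex_series (fun k => INR k * (wt eta (4 * INR k) * pert a h p (Z.of_nat k))).
Local Notation eps := (pert a h p).
Local Notation kap := (kap a h p).
Local Notation kapE := (kapE a h p).

Lemma pert_summable : ex_series (fun k => eps (Z.of_nat k)).
Proof.
  apply/(ex_series_incr_1 (fun k => eps (Z.of_nat k))).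
  move: (Hs) => /(ex_series_incr_1 (fun k => INR k * (wt eta (4 * INR k) * eps (Z.of_nat k)))).
  apply: ex_series_Rle => k; case: (pert_bounds a h p (Z.of_nat (S k))) => H _ _ _; split => //.
  have H1 := wt_ge1 (4 * INR (S k)) eta0.
  have H2 : 1 <= INR (S k) by rewrite S_INR; have := pos_INR k; lra.
  have : 1 * eps (Z.of_nat (S k)) <= wt eta (4 * INR (S k)) * eps (Z.of_nat (S k)) by apply: Rmult_le_compat_r.
  rewrite Rmult_1_l => H3.
  have : 1 * (wt eta (4 * INR (S k)) * eps (Z.of_nat (S k))) <= INR (S k) * (wt eta (4 * INR (S k)) * eps (Z.of_nat (S k))).
    apply: Rmult_le_compat_r => //; lra.
  lra.
Qed.

Local Notation Ps := pert_summable.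
Local Notation A := (abound a h p).
Local Notation W i j := (wt eta (INR (j + 4 * i))).

Lemma abound_ge2 : 2 <= A.
Proof.
  rewrite /abound; suff : 0 <= Series (fun k => eps (Z.of_nat k)) by lra.
  apply: Series_ge0 Ps => k; by case: (pert_bounds a h p (Z.of_nat k)).
Qed.

Definition wsum (M : nat) (n : Z) : R := Rsum (fun j => W 0 j * Cmod (kap (j + 4) n)) M.
(** The extra [4 i] in the weight counts how often [kap_step] has been unrolled: each unrolling
    lowers the index by four and has to keep the original weight. *)
Definition wdsum (i M : nat) (n : Z) : R :=
  Rsum (fun j => W i j * Cmod (kap (j + 4) (n - 1) - kap (j + 4) n)) M.

Lemma W_pos i j : 0 <= W i j.
Proof. have := wt_ge1 (INR (j + 4 * i)) eta0; lra. Qed.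

Lemma wterm_pos i j x : 0 <= W i j * Cmod x.
Proof. apply: Rmult_le_pos; [exact: W_pos | exact: Cmod_ge_0]. Qed.

Lemma W_shift i j d : (d <= 4)%nat -> W i (j + d) <= wt eta (4 * INR i) * (wt eta 4 * W 0 j).
Proof.
  move=> /le_INR Hd. have E4 : INR 4 = 4 by simpl; ring.
  have P1 : 0 <= INR j by exact: pos_INR. have P2 : 0 <= INR i by exact: pos_INR.
  rewrite Nat.mul_0_r Nat.add_0_r.
  apply: (Rle_trans _ (wt eta (4 * INR i + (4 + INR j)))).
    apply: wt_mono => //; rewrite (plus_INR (j + d)) (plus_INR j) (mult_INR 4) E4; lra.
  apply: Rle_trans (wt_subadd eta0 _ _) _; try lra.
  apply: Rmult_le_compat_l; first by have := wt_ge1 (4 * INR i) eta0; lra.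
  apply: wt_subadd => //; lra.
Qed.

(** A shift by [c <= 3] instead of 4 loses at least one of the [M] indices to the zero padding,
    hence [M - 1] on the right. This gain is what closes the induction on the number of terms. *)
Lemma wsum_shift c i M n : (c <= 3)%nat ->
  Rsum (fun j => W i j * Cmod (kap (j + c) n)) M <= wt eta (4 * INR i) * (wt eta 4 * wsum (M - 1) n).
Proof.
  move=> Hc.
  rewrite (@Rsum_shift _ (4 - c)); last first.
    by move=> j Hj; rewrite kap_lt4 ?Cmod_0 ?Rmult_0_r //; lia.
  apply: (Rle_trans _ (Rsum (fun j => (wt eta (4 * INR i) * wt eta 4) * (W 0 j * Cmod (kap (j + 4) n))) (M - (4 - c)))).
    apply: Rsum_le => j Hj.
    have -> : (j + (4 - c) + c = j + 4)%nat by lia.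
    rewrite -Rmult_assoc; apply: Rmult_le_compat_r; first exact: Cmod_ge_0.
    rewrite Rmult_assoc; apply: W_shift; lia.
  rewrite Rsum_scal Rmult_assoc; apply: Rmult_le_compat_l; first by have := wt_ge1 (4 * INR i) eta0; lra.
  apply: Rmult_le_compat_l; first by have := wt_ge1 4 eta0; lra.
  apply: Rsum_mono; last lia. move=> k; exact: wterm_pos.
Qed.

(** The 5 collects the factors 1, 2, 2 of the terms of [kapE] at [n], [A] bounds [|1 + a|] in
    [1 - a^2 = (1 + a) (1 - a)], and [wt eta 4] pays for the index shift. *)
Definition wpert_const : R := wt eta 4 * (5 + A).

Lemma wE_bound i M n : (0 <= n)%Z ->
  Rsum (fun j => W i j * Cmod (kapE j n)) M <=
  wt eta (4 * INR i) * (wpert_const * eps n * (wsum (M - 1) n + wsum (M - 1) (n + 1))).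
Proof.
  move=> Hn.
  have HA := abound_ge2.
  case: (pert_bounds a h p n) => He _ _ _.
  apply: (Rle_trans _ (eps n * (Rsum (fun j => W i j * Cmod (kap (j + 2) n)) M
    + 2 * Rsum (fun j => W i j * Cmod (kap (j + 1) n)) M + 2 * Rsum (fun j => W i j * Cmod (kap (j + 3) n)) M
    + A * Rsum (fun j => W i j * Cmod (kap (j + 0) (n + 1))) M))).
    rewrite -!Rsum_scal -!Rsum_plus -Rsum_scal.
    apply: Rsum_le => j _. rewrite Nat.add_0_r.
    have := Rmult_le_compat_l _ _ _ (W_pos i j) (kapE_bound Ps j Hn). lra.
  have B c m : (c <= 3)%nat -> Rsum (fun j => W i j * Cmod (kap (j + c) m)) M <= wt eta (4 * INR i) * (wt eta 4 * wsum (M - 1) m).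
    exact: wsum_shift.
  have B1 := B 1%nat n ltac:(lia); have B2 := B 2%nat n ltac:(lia); have B3 := B 3%nat n ltac:(lia).
  have B0 := B 0%nat (n + 1)%Z ltac:(lia).
  have HA' : 0 <= A by lra.
  have B0' := Rmult_le_compat_l _ _ _ HA' B0.
  set X := wt eta (4 * INR i) * wt eta 4.
  have HX : 0 <= X by apply: Rmult_le_pos; [have := wt_ge1 (4 * INR i) eta0 | have := wt_ge1 4 eta0]; lra.
  have S1 : 0 <= wsum (M - 1) n by apply: Rsum_pos => k; exact: wterm_pos.
  have S2 : 0 <= wsum (M - 1) (n + 1) by apply: Rsum_pos => k; exact: wterm_pos.
  apply: (Rle_trans _ (eps n * (5 * (X * wsum (M - 1) n) + A * (X * wsum (M - 1) (n + 1))))).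
    apply: Rmult_le_compat_l => //; rewrite /X; lra.
  have -> : wt eta (4 * INR i) * (wpert_const * eps n * (wsum (M - 1) n + wsum (M - 1) (n + 1)))
    = eps n * ((5 + A) * (X * wsum (M - 1) n) + (5 + A) * (X * wsum (M - 1) (n + 1))) by rewrite /wpert_const /X; ring.
  have Q1 := Rmult_le_pos _ _ HX S1; have Q2 := Rmult_le_pos _ _ HX S2.
  have Q3 := Rmult_le_pos _ _ HA' Q1.
  apply: Rmult_le_compat_l => //; lra.
Qed.

Lemma wdsum_step i M n : (0 <= n)%Z -> wdsum i M n <= wdsum (S i) (M - 4) (n + 1) +
  wt eta (4 * INR i) * (wpert_const * eps n * (wsum (M - 1) n + wsum (M - 1) (n + 1))).
Proof.
  move=> Hn.
  have E : wdsum (S i) (M - 4) (n + 1) = Rsum (fun j => W i j * Cmod (kap j n - kap j (n + 1))) M.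
    rewrite (@Rsum_shift _ 4); last first.
      move=> j Hj; rewrite !kap_lt4 //. rewrite /Cminus Cplus_opp_r Cmod_0; ring.
    apply: Rsum_ext => j _. rewrite Z.add_simpl_r. do 3 f_equal; lia.
  apply: Rle_trans (Rplus_le_compat_l _ _ _ (wE_bound i M Hn)).
  rewrite E -Rsum_plus; apply: Rsum_le => j _.
  rewrite (kap_step Ps) -Rmult_plus_distr_l; apply: Rmult_le_compat_l (Cmod_triangle _ _); exact: W_pos.
Qed.

Definition wpert (k : nat) : R := wpert_const * (wt eta (4 * INR k) * eps (Z.of_nat k)).
Definition wpert_tail (k : nat) : R := Series (fun r => wpert (k + r)).
(** The sum of [wpert_tail] over all later sites: [wpert (k + r)] occurs in [r] of them. This is
    where the first moment is spent. *)
Definition wpert_tail2 (k : nat) : R := Series (fun r => INR r * wpert (k + r)).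

Lemma wpert_const_pos : 0 <= wpert_const.
Proof. have := abound_ge2; have := wt_ge1 4 eta0 => H1 H2; apply: Rmult_le_pos; lra. Qed.

Lemma wpert_pos k : 0 <= wpert k.
Proof.
  apply: Rmult_le_pos; first exact: wpert_const_pos.
  apply: Rmult_le_pos; first by have := wt_ge1 (4 * INR k) eta0; lra.
  by case: (pert_bounds a h p (Z.of_nat k)).
Qed.

Lemma wpert_moment : ex_series (fun k => INR k * wpert k).
Proof.
  apply: ex_series_ext (ex_series_scalR wpert_const Hs) => k; rewrite /wpert; simpl; ring.
Qed.

Lemma wpert_ex k : ex_series (fun r => wpert (k + r)).
Proof.
  apply/(ex_series_incr_n wpert k)/(ex_series_incr_1 wpert).
  move/(ex_series_incr_1 (fun k => INR k * wpert k)): wpert_moment.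
  apply: ex_series_Rle => j; have H := wpert_pos (S j); split => //.
  rewrite S_INR; have := pos_INR j; nra.
Qed.

Lemma wpert_moment_ex k : ex_series (fun r => INR r * wpert (k + r)).
Proof.
  move/(ex_series_incr_n (fun k => INR k * wpert k) k): wpert_moment.
  apply: ex_series_Rle => j; have H := wpert_pos (k + j); have P1 := pos_INR j; have P2 := pos_INR k.
  rewrite plus_INR; nra.
Qed.

Lemma wpert_tail_step k : wpert_tail k = wpert k + wpert_tail (S k).
Proof.
  rewrite /wpert_tail (Series_incr_1 _ (wpert_ex k)) Nat.add_0_r; congr (_ + _).
  apply: Series_ext => r; congr wpert; lia.
Qed.

Lemma wpert_tail2_step k : wpert_tail2 k = wpert_tail2 (S k) + wpert_tail (S k).
Proof.
  rewrite /wpert_tail2 (Series_incr_1 _ (wpert_moment_ex k)) /wpert_tail -Series_plus; [|exact: wpert_moment_ex|exact: wpert_ex].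
  rewrite [INR 0]/= Rmult_0_l Rplus_0_l.
  apply: Series_ext => r; rewrite S_INR. have -> : (k + S r = S k + r)%nat by lia. ring.
Qed.

Lemma wpert_tail_pos k : 0 <= wpert_tail k.
Proof. apply: Series_ge0 (wpert_ex k) => r; exact: wpert_pos. Qed.

Lemma wpert_tail2_pos k : 0 <= wpert_tail2 k.
Proof. apply: Series_ge0 (wpert_moment_ex k) => r; apply: Rmult_le_pos; [exact: pos_INR | exact: wpert_pos]. Qed.

Lemma wpert_tail2_small e : 0 < e -> eventually (fun k => wpert_tail2 k < e).
Proof.
  move=> He.
  have H0 : forall k, 0 <= INR k * wpert k by move=> k; apply: Rmult_le_pos; [exact: pos_INR | exact: wpert_pos].
  have [M HM] := series_tail_small H0 wpert_moment He.
  exists M => k Hk; apply: Rle_lt_trans (proj2 (HM k Hk)).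
  apply: Series_le; last exact/(ex_series_incr_n (fun k => INR k * wpert k) k)/wpert_moment.
  move=> r; have H := wpert_pos (k + r); have P1 := pos_INR r; have P2 := pos_INR k.
  rewrite plus_INR; nra.
Qed.

(** Unrolling [wdsum_step] raises [i] and [n] together, so [i <= n] persists and [wt eta (4 i)] is
    covered by the weight [wt eta (4 n)] contained in [wpert n]. Each unrolling uses up four
    indices; the perturbation terms met on the way add up to a tail. The 4 is twice the assumed
    bound 2. *)
Lemma wdsum_bound N M : (forall n, (N <= n)%nat -> wsum (M - 1) (Z.of_nat n) <= 2) ->
  forall M' i n, (M' <= M)%nat -> (N <= n)%nat -> (i <= n)%nat -> wdsum i M' (Z.of_nat n) <= 4 * wpert_tail n.
Proof.
  move=> HM; elim/(well_founded_induction lt_wf) => M' IH i n HM' Hn Hi.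
  case: (Nat.eq_dec M' 0) => [-> | Hne].
    rewrite /wdsum /=; have := wpert_tail_pos n; lra.
  apply: Rle_trans (wdsum_step _ _ _) _; first lia.
  have E : (Z.of_nat n + 1 = Z.of_nat (S n))%Z by lia.
  rewrite E.
  have H1 := IH (M' - 4)%nat ltac:(lia) (S i) (S n) ltac:(lia) ltac:(lia) ltac:(lia).
  have H2 : wt eta (4 * INR i) * (wpert_const * eps (Z.of_nat n) * (wsum (M' - 1) (Z.of_nat n) + wsum (M' - 1) (Z.of_nat (S n)))) <= 4 * wpert n.
    have mono m : wsum (M' - 1) m <= wsum (M - 1) m.
      apply: Rsum_mono; last lia. move=> k; exact: wterm_pos.
    have S1 := HM n Hn; have S2 := HM (S n) ltac:(lia).
    have m1 := mono (Z.of_nat n); have m2 := mono (Z.of_nat (S n)).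
    have Q : 0 <= wpert_const * eps (Z.of_nat n).
      apply: Rmult_le_pos; [exact: wpert_const_pos | by case: (pert_bounds a h p (Z.of_nat n))].
    apply: (Rle_trans _ (wt eta (4 * INR n) * (wpert_const * eps (Z.of_nat n) * 4))); last by rewrite /wpert; lra.
    have S3 : 0 <= wsum (M' - 1) (Z.of_nat n) by apply: Rsum_pos => k; exact: wterm_pos.
    have S4 : 0 <= wsum (M' - 1) (Z.of_nat (S n)) by apply: Rsum_pos => k; exact: wterm_pos.
    apply: Rmult_le_compat.
    - have := wt_ge1 (4 * INR i) eta0; lra.
    - apply: Rmult_le_pos => //; lra.
    - apply: wt_mono => //; have := le_INR _ _ Hi; lra.
    - apply: Rmult_le_compat_l => //; lra.
  rewrite (wpert_tail_step n); lra.
Qed.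

Lemma wsum_diff M n : wsum M (n - 1) <= wsum M n + wdsum 0 M n.
Proof.
  rewrite /wsum /wdsum -Rsum_plus; apply: Rsum_le => j _.
  rewrite -Rmult_plus_distr_l; apply: Rmult_le_compat_l; first exact: W_pos.
  have {1}-> : kap (j + 4) (n - 1) = (kap (j + 4) n + (kap (j + 4) (n - 1) - kap (j + 4) n))%C by ring.
  exact: Cmod_triangle.
Qed.

Lemma wsum_lim M e : 0 < e -> eventually (fun k => wsum M (Z.of_nat k) < 1 + e).
Proof.
  elim: M e => [|M IH] e He; first by exists 0%nat => k _; rewrite /wsum /=; lra.
  case: M IH => [|M] IH.
    exists 0%nat => k _; rewrite /wsum /= Cmod_1 /wt sqrt_0 Rmult_0_r exp_0; lra.
  have He2 : 0 < e / 2 / W 0 (S M).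
    apply: Rdiv_lt_0_compat; first lra. have := wt_ge1 (INR (S M + 4 * 0)) eta0; lra.
  have [N1 H1] := IH (e / 2) ltac:(lra).
  have [N2 H2] := Zinf_nat (kap_tends Ps (S M + 4) He2).
  exists (N1 + N2)%nat => k Hk.
  have E : wsum (S (S M)) (Z.of_nat k) = wsum (S M) (Z.of_nat k) + W 0 (S M) * Cmod (kap (S M + 4) (Z.of_nat k)) by [].
  rewrite E; have := H1 k ltac:(lia).
  have := H2 k ltac:(lia). have -> : Nat.eqb (S M + 4) 4 = false by apply/Nat.eqb_neq; lia.
  have -> : (kap (S M + 4) (Z.of_nat k) - 0 = kap (S M + 4) (Z.of_nat k))%C by ring.
  move=> H3 H4.
  have P : 0 < W 0 (S M) by have := wt_ge1 (INR (S M + 4 * 0)) eta0; lra.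
  have := Rmult_lt_compat_l _ _ _ P H3.
  have -> : W 0 (S M) * (e / 2 / W 0 (S M)) = e / 2 by field; lra.
  lra.
Qed.

(** A bootstrap on [M]. Where the double tail is below 1/4 the claimed bound for [M] is at most 2,
    which is the hypothesis of [wdsum_bound] for [M + 1]; the resulting increments [4 wpert_tail]
    add up to [4 wpert_tail2] on the way in from infinity, where the weighted sum is at most 1. *)
Lemma wsum_bound : exists N, forall M n, (N <= n)%nat -> wsum M (Z.of_nat n) <= 1 + 4 * wpert_tail2 n.
Proof.
  have [N HN] := wpert_tail2_small (ltac:(lra) : 0 < 1 / 4).
  exists N; elim=> [|M IH] n Hn; first by rewrite /wsum /=; have := wpert_tail2_pos n; lra.
  have H2 : forall n, (N <= n)%nat -> wsum (S M - 1) (Z.of_nat n) <= 2.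
    move=> k Hk; rewrite Nat.sub_1_r /=; have := IH k Hk; have := HN k Hk; lra.
  have D := wdsum_bound H2.
  have step k : (N <= k)%nat -> wsum (S M) (Z.of_nat k) - 4 * wpert_tail2 k <= wsum (S M) (Z.of_nat (S k)) - 4 * wpert_tail2 (S k).
    move=> Hk. have := wsum_diff (S M) (Z.of_nat (S k)).
    have -> : (Z.of_nat (S k) - 1 = Z.of_nat k)%Z by lia.
    have := D (S M) 0%nat (S k) ltac:(lia) ltac:(lia) ltac:(lia).
    rewrite (wpert_tail2_step k); lra.
  (* By [step] this difference never decreases as the site moves out, so its value at [n] is bounded
     by its values near infinity. *)
  have far r : wsum (S M) (Z.of_nat n) - 4 * wpert_tail2 n <= wsum (S M) (Z.of_nat (n + r)) - 4 * wpert_tail2 (n + r).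
    elim: r => [|r IHr]; first by rewrite Nat.add_0_r; lra.
    apply: Rle_trans IHr _; rewrite Nat.add_succ_r; apply: step; lia.
  suff : wsum (S M) (Z.of_nat n) - 4 * wpert_tail2 n <= 1 by lra.
  apply: le_epsilon => e He.
  have [N1 H1] := wsum_lim (S M) He.
  have := far N1; have := H1 (n + N1)%nat ltac:(lia); have := wpert_tail2_pos (n + N1); lra.
Qed.

(** [wsum_bound] needs a small tail and covers large [n] only. From there [kap_back] moves a pair of
    adjacent sites to the left, at the price of constants that depend on the site. *)
Lemma kap_wsummable n : ex_series (fun j => W 0 j * Cmod (kap (j + 4) n)).
Proof.
  have [N HN] := wsum_bound.
  have far n' : (N <= n')%nat -> ex_series (fun j => W 0 j * Cmod (kap (j + 4) (Z.of_nat n'))).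
    move=> Hn; apply: ex_series_bounded; first by move=> k; exact: wterm_pos.
    by move=> M; exact: (HN M n' Hn).
  have back m : ex_series (fun j => W 0 j * Cmod (kap (j + 4) m)) ->
       ex_series (fun j => W 0 j * Cmod (kap (j + 4) (m + 1))) ->
       ex_series (fun j => W 0 j * Cmod (kap (j + 4) (m - 1))).
    move=> H1 H2.
    have sh c m' : (c <= 3)%nat -> ex_series (fun j => W 0 j * Cmod (kap (j + 4) m')) -> ex_series (fun j => W 0 j * Cmod (kap (j + c) m')).
      move=> Hc H; apply: (@ex_series_bounded _ (wt eta (4 * INR 0) * (wt eta 4 * Series (fun j => W 0 j * Cmod (kap (j + 4) m'))))).
        move=> k; exact: wterm_pos.
      move=> M; apply: Rle_trans (wsum_shift _ _ _ Hc) _.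
      apply: Rmult_le_compat_l; first by have := wt_ge1 (4 * INR 0) eta0; lra.
      apply: Rmult_le_compat_l; first by have := wt_ge1 4 eta0; lra.
      apply: Rsum_le_Series => // k; exact: wterm_pos.
    have B0 := sh 0%nat m ltac:(lia) H1. have B1 := sh 1%nat m ltac:(lia) H1.
    have B2 := sh 2%nat m ltac:(lia) H1. have B3 := sh 3%nat m ltac:(lia) H1.
    have B4 := sh 0%nat (m + 1)%Z ltac:(lia) H2.
    have BB := ex_series_plusR (ex_series_plusR (ex_series_plusR H1 (ex_series_scalR (Cmod (h m)) B2))
      (ex_series_scalR (2 * Cmod (p m)) (ex_series_plusR B1 B3)))
      (ex_series_plusR B0 (ex_series_scalR (Cmod (a m * a m)) B4)).
    apply: ex_series_Rle BB => j; split; first exact: wterm_pos.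
    rewrite (kap_back Ps).
    have P := W_pos 0 j.
    have E1 := Cmod_triang_sub (kap (j + 4) m + h m * kap (j + 2) m + 2 * p m * (kap (j + 1) m + kap (j + 3) m) + kap j m) (a m * a m * kap j (m + 1)).
    have E2 := Cmod_triangle (kap (j + 4) m + h m * kap (j + 2) m + 2 * p m * (kap (j + 1) m + kap (j + 3) m)) (kap j m).
    have E3 := Cmod_triangle (kap (j + 4) m + h m * kap (j + 2) m) (2 * p m * (kap (j + 1) m + kap (j + 3) m)).
    have E4 := Cmod_triangle (kap (j + 4) m) (h m * kap (j + 2) m).
    have E5 := Cmod_triangle (kap (j + 1) m) (kap (j + 3) m).
    have E6 : Cmod (2 * p m * (kap (j + 1) m + kap (j + 3) m)) <= 2 * Cmod (p m) * (Cmod (kap (j + 1) m) + Cmod (kap (j + 3) m)).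
      rewrite !Cmod_mult Cmod_R Rabs_pos_eq; last lra.
      apply: Rmult_le_compat_l => //. have := Cmod_ge_0 (p m); lra.
    have E7 : Cmod (a m * a m * kap j (m + 1)) = Cmod (a m * a m) * Cmod (kap j (m + 1)) by rewrite Cmod_mult.
    have E8 : Cmod (h m * kap (j + 2) m) = Cmod (h m) * Cmod (kap (j + 2) m) by rewrite Cmod_mult.
    have E : Cmod (kap (j + 4) m + h m * kap (j + 2) m + 2 * p m * (kap (j + 1) m + kap (j + 3) m) + kap j m - a m * a m * kap j (m + 1))
      <= Cmod (kap (j + 4) m) + Cmod (h m) * Cmod (kap (j + 2) m)
       + 2 * Cmod (p m) * (Cmod (kap (j + 1) m) + Cmod (kap (j + 3) m)) + Cmod (kap j m)
       + Cmod (a m * a m) * Cmod (kap j (m + 1)) by lra.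
    apply: Rle_trans (Rmult_le_compat_l _ _ _ P E) _.
    rewrite !Nat.mul_0_r !Nat.add_0_r; apply: Req_le; ring.
  have both r : ex_series (fun j => W 0 j * Cmod (kap (j + 4) (Z.of_nat N - Z.of_nat r))) /\
             ex_series (fun j => W 0 j * Cmod (kap (j + 4) (Z.of_nat N - Z.of_nat r + 1))).
    elim: r => [|r [I1 I2]].
      split. rewrite Z.sub_0_r; exact: far.
      have -> : (Z.of_nat N - Z.of_nat 0 + 1 = Z.of_nat (S N))%Z by lia. apply: far; lia.
    have E : (Z.of_nat N - Z.of_nat (S r) = Z.of_nat N - Z.of_nat r - 1)%Z by lia.
    rewrite E; split; first exact: back.
    by rewrite Z.sub_add.
  case: (Z.le_gt_cases (Z.of_nat N) n) => H.
    have -> : n = Z.of_nat (Z.to_nat n) by lia. apply: far; lia.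
  have -> : n = (Z.of_nat N - Z.of_nat (Z.to_nat (Z.of_nat N - n)))%Z by lia.
  exact: (proj1 (both _)).
Qed.

End KapBounds.

(** * The complex exponential *)

Lemma Cexp_plus (x y : C) : Cexp (x + y) = (Cexp x * Cexp y)%C.
Proof.
  apply: C_ext; rewrite /Cexp /= /Re /Im /= exp_plus ?cos_plus ?sin_plus; ring.
Qed.

Lemma Cexp_0 : Cexp 0 = RtoC 1.
Proof. apply: C_ext; rewrite /Cexp /= exp_0 ?cos_0 ?sin_0; ring. Qed.

Lemma Cmod_Cexp (x : C) : Cmod (Cexp x) = exp (Re x).
Proof.
  rewrite /Cmod /Cexp /=.
  have -> : exp (Re x) * cos (Im x) * (exp (Re x) * cos (Im x) * 1) + exp (Re x) * sin (Im x) * (exp (Re x) * sin (Im x) * 1)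
     = exp (Re x) * exp (Re x) * (Rsqr (sin (Im x)) + Rsqr (cos (Im x))) by rewrite /Rsqr; ring.
  rewrite sin2_cos2 Rmult_1_r; apply: sqrt_square; left; exact: exp_pos.
Qed.

Lemma Cexp_neq_0 (x : C) : Cexp x <> RtoC 0.
Proof. apply/Cmod_gt_0; rewrite Cmod_Cexp; exact: exp_pos. Qed.

Lemma Cexp_opp (x : C) : Cexp (- x) = (/ Cexp x)%C.
Proof.
  have H := @Cexp_neq_0 x.
  have E : (Cexp (- x) * Cexp x = 1)%C.
    rewrite -Cexp_plus -Cexp_0; congr Cexp; ring.
  have -> : (Cexp (- x) = Cexp (- x) * Cexp x * / Cexp x)%C by field.
  by rewrite E Cmult_1_l.
Qed.

Lemma Cexp_nat (x : C) n : Cexp (RtoC (INR n) * x) = (Cexp x ^ n)%C.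
Proof.
  elim: n => [|n IH]; first by rewrite /= Cmult_0_l Cexp_0.
  rewrite S_INR RtoC_plus Cmult_plus_distr_r Cexp_plus IH Cmult_1_l /=; ring.
Qed.

Definition wz (z : C) : C := Cexp (Ci * z / RtoC 2).

Lemma C2_neq0 : RtoC 2 <> RtoC 0.
Proof. apply/Cmod_gt_0; rewrite Cmod_R Rabs_pos_eq; lra. Qed.

Lemma Cmod_wz z : Cmod (wz z) = exp (- Im z / 2).
Proof.
  rewrite /wz Cmod_Cexp; congr exp.
  have -> : (Ci * z / 2 = RtoC (/ 2) * (Ci * z))%C by rewrite RtoC_inv /Cdiv; [ring | lra].
  rewrite /Re /Im /=; field.
Qed.

Lemma wz_le1 z : 0 <= Im z -> Cmod (wz z) <= 1.
Proof. move=> H; rewrite Cmod_wz -exp_0; apply: exp_mono; lra. Qed.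

Lemma wz_lt1 z : 0 < Im z -> Cmod (wz z) < 1.
Proof. move=> H; rewrite Cmod_wz -exp_0; apply: exp_increasing; lra. Qed.

Lemma wz_neq0 z : wz z <> RtoC 0.
Proof. exact: Cexp_neq_0. Qed.

Definition en (n : Z) (z : C) : C := Cexp (Ci * RtoC (IZR n) * z).

Lemma wz_sqr z : (wz z * wz z)%C = Cexp (Ci * z).
Proof. rewrite /wz -Cexp_plus; congr Cexp; field; exact: C2_neq0. Qed.

Lemma en_succ n z : en (n + 1) z = (en n z * (wz z * wz z))%C.
Proof.
  rewrite wz_sqr /en -Cexp_plus; congr Cexp; rewrite plus_IZR RtoC_plus; ring.
Qed.

Lemma en_pred n z : en (n - 1) z = (en n z / (wz z * wz z))%C.
Proof.
  have H := @wz_neq0 z.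
  have {2}-> : n = ((n - 1) + 1)%Z by lia.
  rewrite en_succ; field; exact: H.
Qed.

Lemma two_cos_wz z : (RtoC 2 * Ccos (z / RtoC 2) = wz z + / wz z)%C.
Proof.
  rewrite /Ccos Cexp_opp.
  have -> : (Ci * (z / 2) = Ci * z / 2)%C by field; exact: C2_neq0.
  rewrite -/(wz z); field; exact: wz_neq0.
Qed.

Lemma Cmod_en n z : Cmod (en n z) = exp (- (IZR n * Im z)).
Proof. rewrite /en Cmod_Cexp /=; congr exp; rewrite /Re /Im /=; ring. Qed.

(** * Infinite products *)

Lemma Cprod_bounded (f : nat -> C) :
  ex_series (fun k => Cmod (1 - f k)) -> exists B, forall N, Cmod (Cprod f N) <= B.
Proof.
  move=> Hf; exists (exp (Series (fun k => Cmod (1 - f k)))) => N.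
  have H0 : forall k, 0 <= Cmod (1 - f k) by move=> k; exact: Cmod_ge_0.
  apply: (Rle_trans _ (exp (Rsum (fun k => Cmod (1 - f k)) N))); last first.
    by apply: exp_mono; apply: Rsum_le_Series.
  elim: N => [|N IH] /=; first by rewrite Cmod_1 exp_0; lra.
  rewrite Cmod_mult exp_plus; apply: Rmult_le_compat => //; try exact: Cmod_ge_0.
  have -> : (f N = 1 - (1 - f N))%C by ring.
  apply: Rle_trans (Cmod_triang_sub _ _) _; rewrite Cmod_1.
  have -> : (1 - (1 - (1 - f N)) = 1 - f N)%C by ring.
  exact: exp_ineq1_le.
Qed.

(** The partial products are bounded, so their increments [Cprod f k * (f k - 1)] are summable and
    the product telescopes into a convergent series. *)
Lemma Cprod_limit (f : nat -> C) : ex_series (fun k => Cmod (1 - f k)) ->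
  exists P, Ctends eventually (Cprod f) P.
Proof.
  move=> Hf; have [B HB] := Cprod_bounded Hf.
  set u := fun k => (Cprod f k * (f k - 1))%C.
  have su : summable u.
    apply: (@summable_le _ (fun k => B * Cmod (1 - f k))); last exact: ex_series_scalR.
    move=> k; rewrite /u Cmod_mult (Cmod_sub_sym (f k)); apply: Rmult_le_compat_r => //; exact: Cmod_ge_0.
  exists (1 + CSeries u)%C.
  have E : forall N, Cprod f N = (1 + Csum u N)%C.
    elim=> [|N IH] /=; first by ring.
    have -> : (1 + (Csum u N + u N) = (1 + Csum u N) + u N)%C by ring.
    rewrite -IH /u; ring.
  move=> e He.
  have [M HM] := series_tail_small (fun k => Cmod_ge_0 (u k)) su He.
  exists M => N HN. rewrite E (CSeries_split N su).
  have -> : (1 + Csum u N - (1 + (Csum u N + CSeries (fun k => u (N + k)%nat))) = - CSeries (fun k => u (N + k)%nat))%C by ring.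
  rewrite Cmod_opp; apply: Rle_lt_trans (CSeries_le (summable_incr su N)) _.
  exact: (proj2 (HM N HN)).
Qed.

Lemma Cprod_neq0 (f : nat -> C) N : (forall k, f k <> RtoC 0) -> Cprod f N <> RtoC 0.
Proof.
  move=> H; elim: N => [|N IH] /=; first exact: C1_nz.
  exact: Cmult_neq_0.
Qed.

Lemma Cprod_limit_neq0 (f : nat -> C) : ex_series (fun k => Cmod (1 - f k)) ->
  (forall k, f k <> RtoC 0) -> exists P, Ctends eventually (Cprod f) P /\ P <> RtoC 0.
Proof.
  move=> Hf Hne; have [P HP] := Cprod_limit Hf; exists P; split => //.
  (* the product of the inverses converges as well *)
  have Hg : ex_series (fun k => Cmod (1 - / f k)).
    have L := ex_series_lim_0 _ Hf.
    move/is_lim_seq_spec: L => /(_ (mkposreal (1/2) ltac:(lra))) [M HM].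
    apply/(ex_series_incr_n _ M).
    move/(ex_series_incr_n _ M): Hf => Hf'.
    apply: ex_series_Rle (ex_series_scalR 2 Hf') => k; split; first exact: Cmod_ge_0.
    have := HM (M + k)%nat ltac:(lia); rewrite Rminus_0_r Rabs_pos_eq /=; last exact: Cmod_ge_0.
    move=> Hk.
    have H0 := Hne (M + k)%nat.
    have -> : (1 - / f (M + k)%nat = - (1 - f (M + k)%nat) * / f (M + k)%nat)%C by field.
    rewrite Cmod_mult Cmod_opp Cmod_inv // Rmult_comm.
    apply: Rmult_le_compat_r; first exact: Cmod_ge_0.
    have -> : 2 = / (1 / 2) by field.
    apply: Rinv_le_contravar; first lra.
    have : 1 <= Cmod (f (M + k)%nat) + Cmod (1 - f (M + k)%nat); last lra.
    rewrite -{1}Cmod_1. have {1}-> : RtoC 1 = (f (M + k)%nat + (1 - f (M + k)%nat))%C by ring.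
    exact: Cmod_triangle.
  have [Q HQ] := Cprod_limit Hg.
  have HPQ := Ctends_mult HP HQ.
  have E : (P * Q)%C = RtoC 1.
    apply: (Ctends_unique (HPQ _)).
    apply: Ctends_ext (Ctends_const (RtoC 1)) => N.
    elim: N => [|N IH] /=; first by ring.
    have -> : (Cprod f N * f N * (Cprod (fun k => / f k) N * / f N) = (Cprod f N * Cprod (fun k => / f k) N) * (f N * / f N))%C by ring.
    rewrite -IH Cinv_r //; ring.
  move=> HP0; move: E; rewrite HP0 Cmult_0_l => E; exact: C1_nz.
Qed.

Lemma CLim_Ctends (u : nat -> C) l : Ctends eventually u l -> CLim u = l.
Proof.
  move=> H; apply: C_ext; rewrite /CLim /=.
  - suff -> : Lim_seq (fun k => Re (u k)) = Re l by [].
    apply: is_lim_seq_unique; apply/is_lim_seq_spec => e.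
    case: (H e (cond_pos e)) => N HN; exists N => n Hn.
    apply: Rle_lt_trans (HN n Hn); exact: (re_le_Cmod (u n - l)).
  - suff -> : Lim_seq (fun k => Im (u k)) = Im l by [].
    apply: is_lim_seq_unique; apply/is_lim_seq_spec => e.
    case: (H e (cond_pos e)) => N HN; exists N => n Hn.
    apply: Rle_lt_trans (HN n Hn); exact: (im_le_Cmod (u n - l)).
Qed.

Lemma Cprod_S (f : nat -> C) N : Cprod f (S N) = (f 0%nat * Cprod (fun k => f (S k)) N)%C.
Proof.
  elim: N => [|N IH]; first by rewrite /=; ring.
  have -> : Cprod f (S (S N)) = (Cprod f (S N) * f (S N))%C by [].
  rewrite IH /=; ring.
Qed.

Lemma powerRZ_m1_succ n : powerRZ (-1) (n + 1) = - powerRZ (-1) n.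
Proof. rewrite powerRZ_add; [rewrite powerRZ_1; ring | lra]. Qed.

Lemma powerRZ_m1_sqr n : powerRZ (-1) n * powerRZ (-1) n = 1.
Proof.
  rewrite -powerRZ_mult.
  have -> : -1 * -1 = 1 by ring. exact: powerRZ_R1.
Qed.

Lemma powerRZ_m1_opp n : powerRZ (-1) (- n) = powerRZ (-1) n.
Proof.
  rewrite powerRZ_neg'.
  have H := powerRZ_m1_sqr n.
  have N : powerRZ (-1) n <> 0 by move=> E; rewrite E in H; lra.
  apply: (Rmult_eq_reg_l (powerRZ (-1) n)) => //.
  by rewrite H Rinv_r.
Qed.

Section AlphaPlus.
Variable a : Z -> C.
Hypothesis Ha : ex_series (fun k => Cmod (1 - a (Z.of_nat k))).
Hypothesis ane0 : forall n, a n <> RtoC 0.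

Lemma a_sum n : ex_series (fun k => Cmod (1 - a (n + Z.of_nat k)%Z)).
Proof. apply: (@ex_series_Zshift (fun n => Cmod (1 - a n)) 0); exact: Ha. Qed.

Lemma prod_ge_spec n : Ctends eventually (Cprod (fun k => a (n + Z.of_nat k)%Z)) (prod_ge n a)
  /\ prod_ge n a <> RtoC 0.
Proof.
  have [P [HP HP0]] := Cprod_limit_neq0 (a_sum n) (fun k => @ane0 _).
  by rewrite /prod_ge (CLim_Ctends HP).
Qed.

Lemma is_prod_ge_prod_ge n : is_prod_ge n a (prod_ge n a).
Proof. have [H1 H2] := prod_ge_spec n; split => //; exact/filterlim_Cmod. Qed.

Lemma prod_ge_step n : prod_ge n a = (a n * prod_ge (n + 1) a)%C.
Proof.
  have [H1 _] := prod_ge_spec n; have [H2 _] := prod_ge_spec (n + 1).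
  have H3 := Ctends_scal (a n) H2.
  apply: (@Ctends_unique _ eventually _ (fun N => Cprod (fun k => a (n + Z.of_nat k)%Z) (S N))).
    move=> e He; case: (H1 e He) => N HN; exists N => m Hm; apply: HN; lia.
  apply: Ctends_ext (H3 _) => N; rewrite Cprod_S Z.add_0_r; congr (_ * _)%C.
  congr Cprod; apply: functional_extensionality => k; congr a; lia.
Qed.

Lemma prod_ge_nat k : prod_ge 0 a = (Cprod (fun k => a (Z.of_nat k)) k * prod_ge (Z.of_nat k) a)%C.
Proof.
  elim: k => [|k IH]; first by rewrite /=; ring.
  rewrite IH prod_ge_step /=.
  have -> : (Z.of_nat k + 1 = Z.pos (Pos.of_succ_nat k))%Z by lia. ring.
Qed.

(** A tail product is the whole product divided by a partial one, and the partial products tend to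
    the whole one, which is not zero. *)
Lemma prod_ge_tends : Ctends Zinf (fun n => prod_ge n a) (RtoC 1).
Proof.
  have [H1 H0] := prod_ge_spec 0.
  have H2 := Ctends_scal (prod_ge 0 a) (Ctends_inv H0 H1).
  rewrite Cinv_r // in H2.
  move=> e He; apply: nat_Zinf; case: (H2 _ _ e He) => N HN; exists N => n Hn.
  have := HN n Hn.
  have -> // : (prod_ge 0 a * / Cprod (fun k => a (0 + Z.of_nat k)%Z) n)%C = prod_ge (Z.of_nat n) a.
  have Hc : Cprod (fun k => a (Z.of_nat k)) n <> RtoC 0 by apply: Cprod_neq0.
  rewrite (prod_ge_nat n) /=; field; exact: Hc.
Qed.

Definition alp (n : Z) : C := alpha_plus_seq a n.

Lemma alp_neq0 n : alp n <> RtoC 0.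
Proof.
  have [_ H] := prod_ge_spec n.
  have Hp : RtoC (powerRZ (-1) n) <> RtoC 0.
    move=> /RtoC_inj H0; have := powerRZ_m1_sqr n; rewrite H0; lra.
  apply: Cmult_neq_0 => // H1; move: (Cinv_r _ H); rewrite H1 Cmult_0_r => E; exact: C1_nz.
Qed.

Lemma alp_succ n : alp (n + 1) = (- a n * alp n)%C.
Proof.
  have [_ H1] := prod_ge_spec (n + 1); have H2 := @ane0 n.
  rewrite /alp /alpha_plus_seq (prod_ge_step n) powerRZ_m1_succ RtoC_opp; field; split => //.
Qed.

Lemma alp_tends : Ctends Zinf (fun n => RtoC (powerRZ (-1) n) * alp n)%C (RtoC 1).
Proof.
  have H := Ctends_inv C1_nz prod_ge_tends.
  have E : (/ 1 = 1)%C by field; exact: C1_nz.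
  rewrite E in H.
  apply: Ctends_ext (H _) => n; rewrite /alp /alpha_plus_seq Cmult_assoc -RtoC_mult powerRZ_m1_sqr; ring.
Qed.

End AlphaPlus.

(** * The Jost solution at plus infinity *)

Definition Fp (a h p : Z -> C) (n : Z) (w : C) : C := CSeries (fun m => kap a h p (m + 4) n * w ^ m)%C.

Lemma Cpow_le1 (w : C) m : Cmod w <= 1 -> Cmod (w ^ m) <= 1.
Proof.
  move=> H; rewrite Cmod_pow -(pow1 m); apply: pow_incr; split => //; exact: Cmod_ge_0.
Qed.

Section Jost.
Variables a h p : Z -> C.
Variable eta : R.
Hypothesis eta0 : 0 <= eta.
Hypothesis Hs : ex_series (fun k => INR k * (wt eta (4 * INR k) * pert a h p (Z.of_nat k))).
Hypothesis ane0 : forall n, a n <> RtoC 0.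
Local Notation kap := (kap a h p).
Local Notation Fp := (Fp a h p).
Let Ps := pert_summable eta0 Hs.

Lemma a_summable : ex_series (fun k => Cmod (1 - a (Z.of_nat k))).
Proof.
  apply: ex_series_Rle Ps => k; split; first exact: Cmod_ge_0.
  by case: (pert_bounds a h p (Z.of_nat k)).
Qed.

Lemma kap_summable n : summable (fun m => kap (m + 4) n).
Proof.
  apply: ex_series_Rle (kap_wsummable eta0 Hs n) => k; split; first exact: Cmod_ge_0.
  have := wt_ge1 (INR (k + 4 * 0)) eta0; have := Cmod_ge_0 (kap (k + 4) n); nra.
Qed.

Lemma Fp_summable n w : Cmod w <= 1 -> summable (fun m => kap (m + 4) n * w ^ m)%C.
Proof.
  move=> Hw; apply: summable_le (kap_summable n) => k; rewrite Cmod_mult.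
  have := Cpow_le1 k Hw; have := Cmod_ge_0 (kap (k + 4) n); have := Cmod_ge_0 (w ^ k); nra.
Qed.

(** The padding makes index shifts exact: the entries brought in by a shift are zeros, so the shift
    amounts to multiplication by a power of [w]. *)
Lemma kap_shift_series c n w : Cmod w <= 1 -> (c <= 4)%nat ->
  summable (fun m => kap (m + c) n * w ^ m)%C /\
  CSeries (fun m => kap (m + c) n * w ^ m)%C = (w ^ (4 - c) * Fp n w)%C.
Proof.
  move=> Hw Hc.
  have H : forall d, (d <= 4)%nat -> summable (fun m => kap (m + (4 - d)) n * w ^ m)%C /\
    CSeries (fun m => kap (m + (4 - d)) n * w ^ m)%C = (w ^ d * Fp n w)%C; last first.
    have := H (4 - c)%nat ltac:(lia). by have -> : (4 - (4 - c) = c)%nat by lia.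
  elim=> [|d IH] Hd.
    split; first exact: Fp_summable. by rewrite /= Cmult_1_l.
  have [S1 E1] := IH ltac:(lia).
  have Ed : forall k, (kap (S k + (4 - S d)) n * w ^ S k)%C = (w * (kap (k + (4 - d)) n * w ^ k))%C.
    move=> k; have -> : (S k + (4 - S d) = k + (4 - d))%nat by lia. rewrite Cpow_S; ring.
  have S2 : summable (fun m => kap (m + (4 - S d)) n * w ^ m)%C.
    apply/summable_S; apply: summable_ext (summable_scal S1 w) => k; by rewrite Ed.
  split => //.
  rewrite (CSeries_incr_1 S2) (CSeries_ext Ed) (CSeries_scal S1) E1 kap_lt4; last lia.
  rewrite Cpow_S; ring.
Qed.

Lemma Fp_back n w : Cmod w <= 1 ->
  Fp (n - 1) w = (Fp n w + w ^ 4 * (Fp n w - a n * a n * Fp (n + 1) w)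
                  + (h n * w ^ 2 + 2 * p n * (w + w ^ 3)) * Fp n w)%C.
Proof.
  move=> Hw.
  have [S0 E0] := @kap_shift_series 0 n w Hw ltac:(lia).
  have [S1 E1] := @kap_shift_series 1 n w Hw ltac:(lia).
  have [S2 E2] := @kap_shift_series 2 n w Hw ltac:(lia).
  have [S3 E3] := @kap_shift_series 3 n w Hw ltac:(lia).
  have [S0' E0'] := @kap_shift_series 0 (n + 1) w Hw ltac:(lia).
  have S4 := Fp_summable n Hw.
  have T : CSeries (fun m => kap (m + 4) (n - 1) * w ^ m)%C =
     (Fp n w + (h n * CSeries (fun m => kap (m + 2) n * w ^ m)
      + (2 * p n * CSeries (fun m => kap (m + 1) n * w ^ m) + (2 * p n * CSeries (fun m => kap (m + 3) n * w ^ m)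
      + (CSeries (fun m => kap (m + 0) n * w ^ m) + - (a n * a n) * CSeries (fun m => kap (m + 0) (n + 1) * w ^ m))))))%C.
    rewrite /Fp -!CSeries_scal // -!CSeries_plus //;
      repeat (first [assumption | apply: summable_plus | apply: summable_scal]).
    apply: CSeries_ext => m; rewrite (kap_back Ps) !Nat.add_0_r; ring.
  rewrite {1}/Fp T E0 E1 E2 E3 E0' /=; ring.
Qed.

Lemma Fp_minus_1_le n w M : Cmod w <= 1 -> (forall N, wsum a h p eta N n <= 1 + M) -> Cmod (Fp n w - 1) <= M.
Proof.
  move=> Hw HM.
  have S0 := Fp_summable n Hw.
  rewrite /Fp (CSeries_incr_1 S0).
  have -> : (kap (0 + 4) n * w ^ 0 + CSeries (fun k => kap (S k + 4) n * w ^ S k) - 1)%C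
    = CSeries (fun k => kap (S k + 4) n * w ^ S k)%C by rewrite /=; ring.
  have S1 := proj2 (summable_S _) S0.
  apply: Rle_trans (CSeries_le S1) _.
  apply: Series_le_bound => [k | N]; first exact: Cmod_ge_0.
  have := HM (S N); rewrite /wsum Rsum_S.
  have -> : wt eta (INR (0 + 4 * 0)) * Cmod (kap (0 + 4) n) = 1.
    by rewrite /= Cmod_1 /wt sqrt_0 Rmult_0_r exp_0 Rmult_1_r.
  move=> H; apply: (Rle_trans _ (Rsum (fun k => wt eta (INR (S k + 4 * 0)) * Cmod (kap (S k + 4) n)) N)); last lra.
  apply: Rsum_le => k _; rewrite Cmod_mult.
  have := Cpow_le1 (S k) Hw; have := Cmod_ge_0 (kap (S k + 4) n); have := Cmod_ge_0 (w ^ S k).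
  have := wt_ge1 (INR (S k + 4 * 0)) eta0; set x := wt _ _; set y := Cmod (kap _ _); set z := Cmod (_ ^ _).
  nra.
Qed.

Lemma Fp_tends w : Cmod w <= 1 -> Ctends Zinf (fun n => Fp n w) (RtoC 1).
Proof.
  move=> Hw e He.
  have [N HN] := wsum_bound eta0 Hs.
  have [M HM] := wpert_tail2_small eta0 Hs (ltac:(lra) : 0 < e / 4).
  apply: nat_Zinf; exists (N + M)%nat => n Hn.
  apply: (Rle_lt_trans _ (4 * wpert_tail2 a h p eta n)); last by have := HM n ltac:(lia); lra.
  apply: Fp_minus_1_le => // K; apply: HN; lia.
Qed.

Definition jost (n : Z) (z : C) : C := (alp a n * en n z * Fp n (wz z))%C.

(** Since [a n * alp (n + 1) = - a n^2 * alp n] and [a (n - 1) * alp (n - 1) = - alp n], dividing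
    the three-term recurrence by [alp n * w^(2 n - 2)] leaves [Fp_back]. The 2 in [h - 2] cancels
    the cross term of [(w + 1 / w)^2]. *)
Lemma jost_solves z : 0 <= Im z ->
  solves_B a (fun n => h n - 2)%C p (wz z + / wz z)%C (fun n => jost n z).
Proof.
  move=> Hz n; have Hw := wz_le1 Hz; rewrite /jost.
  rewrite (Fp_back n Hw) (alp_succ a_summable ane0) en_succ en_pred.
  have E := alp_succ a_summable ane0 (n - 1).
  rewrite Z.sub_add in E.
  have H1 := @wz_neq0 z; have H2 := @ane0 (n - 1)%Z.
  have -> : (alp a (n - 1) = - (alp a n / a (n - 1)%Z))%C by rewrite E; field.
  field; split => //.
Qed.

Lemma jost_tends z : 0 <= Im z ->
  Ctends Zinf (fun n => RtoC (powerRZ (-1) n) * / en n z * jost n z)%C (RtoC 1).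
Proof.
  move=> Hz.
  have H := Ctends_mult (alp_tends a_summable ane0) (Fp_tends (wz_le1 Hz)).
  rewrite Cmult_1_l in H.
  apply: Ctends_ext (H _) => n; rewrite /jost; field; exact: Cexp_neq_0.
Qed.

Lemma Fp_K n w : Cmod w <= 1 ->
  summable (fun m => K_plus a h p (S m) n * w ^ S m)%C /\
  Fp n w = (1 + CSeries (fun m => K_plus a h p (S m) n * w ^ S m))%C.
Proof.
  move=> Hw; have S0 := Fp_summable n Hw.
  have E : forall m, (kap (S m + 4) n * w ^ S m = K_plus a h p (S m) n * w ^ S m)%C.
    by move=> m; rewrite kap_K //; lia.
  split.
    apply: summable_ext E _; exact: (proj2 (summable_S _) S0).
  rewrite /Fp (CSeries_incr_1 S0) (CSeries_ext E) /=; ring.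
Qed.

Lemma Fp_ctends {T : Type} (F : (T -> Prop) -> Prop) {FF : Filter F} n (f : T -> C) (l : C) :
  Cmod l <= 1 -> F (fun t => Cmod (f t) <= 1) -> Ctends F f l -> Ctends F (fun t => Fp n (f t)) (Fp n l).
Proof.
  move=> Hl Hf Hc.
  have Hm m : Ctends F (fun t => kap (m + 4) n * f t ^ m)%C (kap (m + 4) n * l ^ m)%C.
    apply: Ctends_mult (Ctends_const _) _; exact: Ctends_pow.
  have Hb u m : Cmod u <= 1 -> Cmod (kap (m + 4) n * u ^ m) <= Cmod (kap (m + 4) n).
    move=> Hu; rewrite Cmod_mult; have := Cpow_le1 m Hu; have := Cmod_ge_0 (kap (m + 4) n); have := Cmod_ge_0 (u ^ m); nra.
  apply: (CSeries_dominated (kap_summable n)).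
  - by apply: filter_imp Hf => t Ht m; exact: Hb.
  - by move=> m; exact: Hb.
  - exact: Hm.
Qed.

Lemma summable_n_is_sum_ge n (f : Z -> C) : summable (fun k => f (n + Z.of_nat k)%Z) -> is_sum_ge n f (sum_ge n f).
Proof. exact: is_series_CSeries. Qed.

Lemma K_plus_is_sum j n : (1 <= j)%nat ->
  is_sum_ge (n + 1) (kapE a h p j) (sum_ge (n + 1) (kapE a h p j)).
Proof. move=> Hj; apply: summable_n_is_sum_ge; exact: kapE_summable. Qed.

Lemma is_sum_ge_ext n (f g : Z -> C) s : (forall r, f r = g r) -> is_sum_ge n f s -> is_sum_ge n g s.
Proof. by move=> H; have -> : f = g by apply: functional_extensionality. Qed.

Lemma coef_formulas_plus_K : coef_formulas_plus a h p (alpha_plus_seq a) (K_plus a h p).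
Proof.
  move=> n; split; [|split; [|split; [|split; [|split]]]].
  - exists (prod_ge n a); split => //; exact: is_prod_ge_prod_ge a_summable ane0 n.
  - exists (sum_ge (n + 1) (fun r => p r)); split => //.
    apply: summable_n_is_sum_ge; apply: summable_Zshift (0%Z) _ _.
    apply: (@summable_le _ (fun k => pert a h p (Z.of_nat k)) _ Ps) => k.
    by case: (pert_bounds a h p (0 + Z.of_nat k)).
  - rewrite (K_plus_kapE a h p n (j := 2)) //=; last lia.
    rewrite /Cminus Copp_0 !Cplus_0_l.
    refine (is_sum_ge_ext _ (@K_plus_is_sum 2 n ltac:(lia))).
    move=> r; rewrite /kapE /=; ring.
  - rewrite (K_plus_kapE a h p n (j := 3)) //=; last lia. rewrite /Cminus Copp_0 !Cplus_0_l.
    refine (is_sum_ge_ext _ (@K_plus_is_sum 3 n ltac:(lia))).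
    move=> r; rewrite /kapE /=; ring.
  - rewrite (K_plus_kapE a h p n (j := 4)) //=; last lia. 
    have -> : (1 - 1 = 0)%C by ring. rewrite Cplus_0_l.
    refine (is_sum_ge_ext _ (@K_plus_is_sum 4 n ltac:(lia))).
    move=> r; rewrite /kapE /=; ring.
  - move=> m Hm; exists (sum_ge (n + 1) (kapE a h p (m + 4))); split.
      refine (is_sum_ge_ext _ (@K_plus_is_sum (m + 4) n ltac:(lia))).
      move=> r.
      rewrite /kapE.
      have -> : (m + 4 + 2 = (m + 2) + 4)%nat by lia.
      have -> : (m + 4 + 1 = (m + 1) + 4)%nat by lia.
      have -> : (m + 4 + 3 = (m + 3) + 4)%nat by lia.
      rewrite !kap_K; try lia. ring.
    rewrite (K_plus_kapE a h p n (j := m + 4)); last lia.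
    rewrite kap_K //. 
    have -> : Nat.eqb (m + 4) 4 = false by apply/Nat.eqb_neq; lia.
    ring.
Qed.

End Jost.

(** * From the q-difference equation to the three-term recurrence *)

Definition Bop (ah bh ch : Z -> C) (lamh : C) (v : Z -> C) (n : Z) : C :=
  (ah n * v (n + 1)%Z + ah (n - 1)%Z * v (n - 1)%Z
     + (bh n + RtoC 2 * lamh * ch n + lamh * lamh) * v n)%C.

Definition lift (q : R) (v : Z -> C) (t : R) : C := (v (qidx q t) / RtoC (sqrt t))%C.

Section Translate.
Variable q : R.
Hypothesis hq : 1 < q.
Variables a b c : R -> C.

Lemma qpos n : 0 < powerRZ q n.
Proof. apply: powerRZ_lt; lra. Qed.

Lemma ln_q_pos : 0 < ln q.
Proof. rewrite -ln_1; apply: ln_increasing; lra. Qed.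

Lemma qlog_pow n : ln (powerRZ q n) / ln q = IZR n.
Proof.
  rewrite powerRZ_Rpower; last lra. rewrite /Rpower ln_exp; field.
  have := ln_q_pos; lra.
Qed.

Lemma Int_part_IZR n : Int_part (IZR n) = n.
Proof.
  rewrite /Int_part; have E : (n + 1)%Z = up (IZR n) by apply: tech_up; rewrite plus_IZR; lra.
  by rewrite -E; lia.
Qed.

Lemma qidx_pow n : qidx q (powerRZ q n) = n.
Proof. by rewrite /qidx /qlog qlog_pow Int_part_IZR. Qed.

Lemma q_mul n : q * powerRZ q n = powerRZ q (n + 1).
Proof. rewrite powerRZ_add; [rewrite powerRZ_1; ring | lra]. Qed.

Lemma q_div n : powerRZ q n / q = powerRZ q (n - 1).
Proof. have {1}-> : n = (n - 1 + 1)%Z by lia. rewrite -q_mul; field; lra. Qed.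

Lemma qZ_pow n : qZ q (powerRZ q n).
Proof. by exists n. Qed.

Lemma sqrt_q_succ n : sqrt (powerRZ q (n + 1)) = sqrt q * sqrt (powerRZ q n).
Proof. rewrite -q_mul sqrt_mult_alt //; lra. Qed.

Lemma sqrt_q_pos : 0 < sqrt q.
Proof. apply: sqrt_lt_R0; lra. Qed.

Lemma sqrt_pow_pos n : 0 < sqrt (powerRZ q n).
Proof. apply: sqrt_lt_R0; exact: qpos. Qed.

Lemma RtoC_neq0 (x : R) : x <> 0 -> RtoC x <> RtoC 0.
Proof. by move=> H /RtoC_inj. Qed.

Lemma quarter_sqr : Rpower q (- (1 / 4)) * Rpower q (- (1 / 4)) = / sqrt q.
Proof.
  rewrite -Rpower_plus.
  have -> : - (1 / 4) + - (1 / 4) = - / 2 by field.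
  rewrite Rpower_Ropp Rpower_sqrt //; lra.
Qed.

(** The change of variable as an identity between abstract numbers, in reach of [field]: [r] is
    [sqrt q] and [s] is [sqrt t], so [q = r r] and [t = s s], while [k = q^(-1/4)] enters only
    through [k k = 1 / r]. *)
Lemma L_op_algebra (r s k A0 A1 u0 u1 u2 B0 c0 lam : C) :
  r <> RtoC 0 -> s <> RtoC 0 -> (r * r - 1)%C <> RtoC 0 -> (k * k = / r)%C ->
  (s * ((A0 * ((u2 - u0) / ((r * r - 1) * (s * s))) - A1 * ((u0 - u1) / ((r * r - 1) * (s * s / (r * r))))) / ((r * r - 1) * (s * s / (r * r)))
        + (B0 + 2 * lam * c0 + lam * lam) * u0)
   = r * (A0 / ((r * r - 1) * (r * r - 1) * (s * s * (s * s))) * (r * s * u2)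
          + A1 / ((r * r - 1) * (r * r - 1) * ((s * s / (r * r)) * (s * s / (r * r)))) * (s / r * u1)
          + (B0 / r - r * (A0 / ((r * r - 1) * (r * r - 1) * (s * s * (s * s))))
              - A1 / ((r * r - 1) * (r * r - 1) * ((s * s / (r * r)) * (s * s / (r * r)))) / r
              + 2 * (k * lam) * (k * c0) + k * lam * (k * lam)) * (s * u0)))%C.
Proof.
  move=> Hr Hs H1 Hk.
  have -> : (B0 / r - r * (A0 / ((r * r - 1) * (r * r - 1) * (s * s * (s * s))))
              - A1 / ((r * r - 1) * (r * r - 1) * ((s * s / (r * r)) * (s * s / (r * r)))) / r
              + 2 * (k * lam) * (k * c0) + k * lam * (k * lam)
     = B0 / r - r * (A0 / ((r * r - 1) * (r * r - 1) * (s * s * (s * s))))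
              - A1 / ((r * r - 1) * (r * r - 1) * ((s * s / (r * r)) * (s * s / (r * r)))) / r
              + (k * k) * (2 * lam * c0 + lam * lam))%C by ring.
  rewrite Hk; field; repeat split => //.
Qed.

Lemma L_op_Bop lam (u : R -> C) n :
  (RtoC (sqrt (powerRZ q n)) * L_op q a b c lam u (powerRZ q n) =
   RtoC (sqrt q) * Bop (seq_a q a) (seq_b q a b) (seq_p q c) (hat_lam q lam) (qseq q (hat_u u)) n)%C.
Proof.
  rewrite /Bop /seq_a /seq_b /seq_p /qseq /hat_b /hat_a /hat_c /hat_u /hat_lam /L_op /qderiv.
  rewrite q_div.
  have -> : q * powerRZ q (n - 1) = powerRZ q n by rewrite q_mul Z.sub_add.
  rewrite q_mul.
  have S1 := sqrt_q_succ n. have S2 := sqrt_q_succ (n - 1); rewrite Z.sub_add in S2.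
  have P0 := sqrt_pow_pos n. have P1 := sqrt_q_pos.
  have S3 : sqrt (powerRZ q (n - 1)) = sqrt (powerRZ q n) / sqrt q by rewrite S2; field; lra.
  rewrite S1 S3.
  have E1 : powerRZ q n = sqrt (powerRZ q n) * sqrt (powerRZ q n) by rewrite sqrt_sqrt //; left; exact: qpos.
  have Eq : q = sqrt q * sqrt q by rewrite sqrt_sqrt //; lra.
  have E2 : powerRZ q (n - 1) = sqrt (powerRZ q n) * sqrt (powerRZ q n) / (sqrt q * sqrt q) by rewrite -E1 -Eq q_div.
  set A0 := a (powerRZ q n). set A1 := a (powerRZ q (n - 1)).
  set u0 := u (powerRZ q n). set u1 := u (powerRZ q (n - 1)). set u2 := u (powerRZ q (n + 1)).
  set B0 := b _. set c0 := c _.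
  move: E1 Eq E2 P0 P1 (quarter_sqr).
  set s := sqrt (powerRZ q n). set r := sqrt q. set k := Rpower q _.
  move=> E1 Eq E2 P0 P1 Ek.
  have Er : r * r - 1 <> 0 by rewrite -Eq; lra.
  have X1 : RtoC ((q - 1) * powerRZ q n) = ((r * r - 1) * (s * s))%C.
    by rewrite {1}Eq E1 RtoC_mult RtoC_minus !RtoC_mult.
  have X2 : RtoC ((q - 1) * powerRZ q (n - 1)) = ((r * r - 1) * (s * s / (r * r)))%C.
    rewrite {1}Eq E2 RtoC_mult RtoC_minus RtoC_div ?RtoC_mult //; nra.
  have X3 : RtoC ((q - 1) ^ 2 * powerRZ q n ^ 2) = ((r * r - 1) * (r * r - 1) * (s * s * (s * s)))%C.
    have -> : (q - 1) ^ 2 * powerRZ q n ^ 2 = ((q - 1) * powerRZ q n) * ((q - 1) * powerRZ q n) by ring.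
    rewrite RtoC_mult X1; ring.
  have X4 : RtoC ((q - 1) ^ 2 * powerRZ q (n - 1) ^ 2) = ((r * r - 1) * (r * r - 1) * ((s * s / (r * r)) * (s * s / (r * r))))%C.
    have -> : (q - 1) ^ 2 * powerRZ q (n - 1) ^ 2 = ((q - 1) * powerRZ q (n - 1)) * ((q - 1) * powerRZ q (n - 1)) by ring.
    rewrite RtoC_mult X2; ring.
  rewrite X1 X2 X3 X4 RtoC_mult RtoC_div; last lra.
  apply: (@L_op_algebra (RtoC r) (RtoC s) (RtoC k)).
  - apply: RtoC_neq0; lra.
  - apply: RtoC_neq0; lra.
  - rewrite -RtoC_mult -RtoC_minus; exact: RtoC_neq0.
  - rewrite -RtoC_mult Ek RtoC_inv //; lra.
Qed.

Lemma solves_AB lam u : solves_A q a b c lam u <->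
  solves_B (seq_a q a) (seq_b q a b) (seq_p q c) (hat_lam q lam) (qseq q (hat_u u)).
Proof.
  have N1 n : RtoC (sqrt (powerRZ q n)) <> RtoC 0 by apply: RtoC_neq0; have := sqrt_pow_pos n; lra.
  have N2 : RtoC (sqrt q) <> RtoC 0 by apply: RtoC_neq0; have := sqrt_q_pos; lra.
  split.
  - move=> H n; have := L_op_Bop lam u n; rewrite (H _ (qZ_pow n)) Cmult_0_r => E.
    exact: Cmult_eq0_r N2 (eq_sym E).
  - move=> H t [n ->]; have := L_op_Bop lam u n.
    have -> : Bop (seq_a q a) (seq_b q a b) (seq_p q c) (hat_lam q lam) (qseq q (hat_u u)) n = RtoC 0 by exact: H.
    rewrite Cmult_0_r => E; exact: Cmult_eq0_r (N1 n) E.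
Qed.

Lemma hat_u_sqr (u : R -> C) n : Cmod (qseq q (hat_u u) n) ^ 2 = powerRZ q n * Cmod (u (powerRZ q n)) ^ 2.
Proof.
  rewrite /qseq /hat_u Cmod_mult Cmod_R Rabs_pos_eq; last exact: sqrt_pos.
  rewrite Rpow_mult_distr; congr (_ * _). rewrite /= Rmult_1_r sqrt_sqrt //; left; exact: qpos.
Qed.

Lemma qZ_indicator (f : Z -> C) :
  (fun n => match excluded_middle_informative (qZ q (powerRZ q n)) with left _ => f n | right _ => RtoC 0 end) = f.
Proof.
  apply: functional_extensionality => n; case: excluded_middle_informative => // H; case: H; exact: qZ_pow.
Qed.

Lemma in_l2q_l2Z u : in_l2q q u <-> in_l2Z (qseq q (hat_u u)).
Proof.
  rewrite /in_l2q /qintegrable /in_l2Z (qZ_indicator (fun n => RtoC (powerRZ q n) * RtoC (Cmod (u (powerRZ q n)) ^ 2))%C).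
  have -> // : (fun n => (RtoC (powerRZ q n) * RtoC (Cmod (u (powerRZ q n)) ^ 2))%C) = (fun n => RtoC (Cmod (qseq q (hat_u u) n) ^ 2)).
  apply: functional_extensionality => n; by rewrite hat_u_sqr RtoC_mult.
Qed.

Lemma part_i lam u : (in_l2q q u /\ solves_A q a b c lam u) <->
     (in_l2Z (qseq q (hat_u u)) /\
      solves_B (seq_a q a) (seq_b q a b) (seq_p q c) (hat_lam q lam) (qseq q (hat_u u))).
Proof. by rewrite in_l2q_l2Z solves_AB. Qed.

Lemma hat_lift v : qseq q (hat_u (lift q v)) = v.
Proof.
  apply: functional_extensionality => n; rewrite /qseq /hat_u /lift qidx_pow; field.
  apply: RtoC_neq0; have := sqrt_pow_pos n; lra.
Qed.

Lemma hat_u_eq0 u n : qseq q (hat_u u) n = RtoC 0 <-> u (powerRZ q n) = RtoC 0.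
Proof.
  have N1 : RtoC (sqrt (powerRZ q n)) <> RtoC 0 by apply: RtoC_neq0; have := sqrt_pow_pos n; lra.
  rewrite /qseq /hat_u; split => [H | ->]; [exact: Cmult_eq0_r H | by rewrite Cmult_0_r].
Qed.

Lemma part_ii lam : eigenvalue_A q a b c lam <->
     eigenvalue_B (seq_a q a) (seq_b q a b) (seq_p q c) (hat_lam q lam).
Proof.
  split.
  - move=> [u [H1 [H2 [t [[n ->] Hn]]]]]; exists (qseq q (hat_u u)).
    have [H3 H4] := proj1 (part_i lam u) (conj H1 H2).
    split => //; split => //; exists n; by move/hat_u_eq0.
  - move=> [v [H1 [H2 [n Hn]]]]; exists (lift q v).
    rewrite -(hat_lift v) in H1 H2 Hn.
    have [H3 H4] := proj2 (part_i lam (lift q v)) (conj H1 H2).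
    split => //; split => //; exists (powerRZ q n); split; first exact: qZ_pow.
    by move/hat_u_eq0.
Qed.

End Translate.

(** * Reflection: the Jost solution at minus infinity *)

Arguments K_minus : simpl never.

(** [a n] couples the sites [n] and [n + 1], hence the shift by one. *)
Definition refl_a (a : Z -> C) (n : Z) : C := a (- n - 1)%Z.
Definition refl (f : Z -> C) (n : Z) : C := f (- n)%Z.

Lemma refl_sum (f g : Z -> C) n : (forall r, g r = f (- r)%Z) -> sum_le (n - 1) f = sum_ge (- n + 1) g.
Proof.
  move=> H; apply: CSeries_ext => k; rewrite H; congr f; lia.
Qed.

Lemma K_minus_1 a h p n : K_minus a h p 1 n = (RtoC 2 * sum_le (n - 1) (fun r => p r))%C.
Proof. by []. Qed.

Lemma K_minus_2 a h p n :
  K_minus a h p 2 n = sum_le (n - 1) (fun r => h r + RtoC 2 * p r * K_minus a h p 1 r)%C.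
Proof. by []. Qed.

Lemma K_minus_3 a h p n : K_minus a h p 3 n =
  sum_le (n - 1) (fun r => h r * K_minus a h p 1 r + RtoC 2 * p r * (K_minus a h p 2 r + RtoC 1))%C.
Proof. by []. Qed.

Lemma K_minus_4 a h p n : K_minus a h p 4 n =
  sum_le (n - 1) (fun r => (RtoC 1 - a (r - 1)%Z * a (r - 1)%Z) + h r * K_minus a h p 2 r
        + RtoC 2 * p r * (K_minus a h p 3 r + K_minus a h p 1 r))%C.
Proof. by []. Qed.

Lemma K_minus_5 a h p j n : K_minus a h p (S (S (S (S (S j))))) n =
  (K_minus a h p (S j) (n - 1) + sum_le (n - 1) (fun r =>
        (RtoC 1 - a (r - 1)%Z * a (r - 1)%Z) * K_minus a h p (S j) (r - 1) + h r * K_minus a h p (S (S (S j))) r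
        + RtoC 2 * p r * (K_minus a h p (S (S j)) r + K_minus a h p (S (S (S (S j)))) r)))%C.
Proof. by []. Qed.

Global Opaque K_minus.

Lemma K_minus_refl a h p m n : (1 <= m)%nat ->
  K_minus a h p m n = K_plus (refl_a a) (refl h) (refl p) m (- n).
Proof.
  elim/(well_founded_induction lt_wf): m n => m IH n Hm.
  have IH' k r : (k < m)%nat -> (1 <= k)%nat -> K_plus (refl_a a) (refl h) (refl p) k r = K_minus a h p k (- r).
    by move=> H1 H2; rewrite IH // Z.opp_involutive.
  have ra r : refl_a a r = a (- r - 1)%Z by [].
  case: m IH Hm IH' => [|[|[|[|[|m]]]]] IH Hm IH'; first lia.
  - by rewrite K_minus_1 K_plus_1 (refl_sum (g := fun r => refl p r)).
  - rewrite K_minus_2 K_plus_2; apply: refl_sum => r; rewrite !IH' //; lia.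
  - rewrite K_minus_3 K_plus_3; apply: refl_sum => r; rewrite !IH' //; lia.
  - rewrite K_minus_4 K_plus_4; apply: refl_sum => r; rewrite !IH' ?ra //; lia.
  - rewrite (K_minus_5 a h p m n) (K_plus_5 _ _ _ m (- n)).
    have -> : (- n + 1 = - (n - 1))%Z by lia.
    rewrite (IH (S m)); [|lia|lia]. 
    have E5 : (- (n - 1) = - n + 1)%Z by lia.
    refine (f_equal (Cplus _) _). rewrite E5.
    apply: refl_sum => r; rewrite !IH' ?ra; try lia.
    have -> : (- (r + 1) = - r - 1)%Z by lia. by [].
Qed.

Lemma alpha_minus_refl a n : alpha_minus_seq a n = alp (refl_a a) (- n).
Proof.
  rewrite /alpha_minus_seq /alp /alpha_plus_seq.
  rewrite powerRZ_m1_opp.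
  congr (_ * / _)%C; rewrite /prod_le /prod_ge; congr CLim; congr Cprod.
  apply: functional_extensionality => k; rewrite /refl_a; congr a; lia.
Qed.

Lemma is_sum_refl (f g : Z -> C) n s : (forall r, g r = f (- r)%Z) -> is_sum_ge (- n + 1) g s -> is_sum_le (n - 1) f s.
Proof.
  move=> H; rewrite /is_sum_ge /is_sum_le.
  have -> // : (fun k => g (- n + 1 + Z.of_nat k)%Z) = (fun k => f (n - 1 - Z.of_nat k)%Z).
  apply: functional_extensionality => k; rewrite H; congr f; lia.
Qed.

Lemma coef_formulas_refl a h p :
  coef_formulas_plus (refl_a a) (refl h) (refl p) (alpha_plus_seq (refl_a a)) (K_plus (refl_a a) (refl h) (refl p)) ->
  coef_formulas_minus a h p (alpha_minus_seq a) (K_minus a h p).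
Proof.
  move=> H n; case: (H (- n)%Z) => [[P [HP1 HP2]] [[s [Hs1 Hs2]] [H2 [H3 [H4 H5]]]]].
  have ra r : refl_a a r = a (- r - 1)%Z by [].
  have K m r : (1 <= m)%nat -> K_minus a h p m (- r) = K_plus (refl_a a) (refl h) (refl p) m r.
    by move=> Hm; rewrite K_minus_refl // Z.opp_involutive.
  split; [|split; [|split; [|split; [|split]]]].
  - exists P; split; last first.
      by rewrite alpha_minus_refl /alp HP2 powerRZ_m1_opp.
    case: HP1 => HP1 HP0; split => //.
    have -> // : (fun k => a (n - 1 - Z.of_nat k)%Z) = (fun k => refl_a a (- n + Z.of_nat k)%Z).
    apply: functional_extensionality => k; rewrite /refl_a; congr a; lia.
  - exists s; split; last by rewrite K_minus_refl.
    exact: is_sum_refl Hs1.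
  - rewrite (K_minus_refl _ _ _ n (m := 2)); last lia. apply: is_sum_refl H2 => r; rewrite !K //; lia.
  - rewrite (K_minus_refl _ _ _ n (m := 3)); last lia. apply: is_sum_refl H3 => r; rewrite !K //; lia.
  - rewrite (K_minus_refl _ _ _ n (m := 4)); last lia. apply: is_sum_refl H4 => r; rewrite !K ?ra //; lia.
  - move=> m Hm; case: (H5 m Hm) => s' [Hs3 Hs4]; exists s'; split.
      apply: is_sum_refl Hs3 => r; rewrite !K ?ra; try lia.
      have -> : (- r - 1 = - (r + 1))%Z by lia. by rewrite !K //; lia.
    rewrite !K_minus_refl; try lia. rewrite Hs4; congr (K_plus _ _ _ _ _ + _)%C; lia.
Qed.

Definition plus_moment (eta : R) (a h p : Z -> C) : Prop :=
  ex_series (fun k => INR k * (wt eta (4 * INR k) * pert a h p (Z.of_nat k))).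

(** Reflection shifts [a] but not [h] and [p], so the reflected perturbation at [k] mixes the sites
    [- k] and [- k - 1]. It is bounded by the sum of both, and the weights at [k + 1] dominate those
    at [k]. *)
Lemma refl_moment eta a h p : 0 <= eta ->
  plus_moment eta a h p ->
  ex_series (fun k => INR (S k) * (wt eta (4 * INR (S k)) * pert a h p (- Z.of_nat k - 1))) ->
  plus_moment eta (refl_a a) (refl h) (refl p).
Proof.
  move=> He _ H.
  have H' : ex_series (fun k => INR k * (wt eta (4 * INR k) * pert a h p (- Z.of_nat k))).
    apply/(ex_series_incr_1 (fun k => INR k * (wt eta (4 * INR k) * pert a h p (- Z.of_nat k)))).
    apply: ex_series_ext H => k. do 3 f_equal; lia.
  apply: ex_series_Rle (ex_series_plusR H' H) => k.
  have W0 := wt_ge1 (4 * INR k) He.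
  have W1 : wt eta (4 * INR k) <= wt eta (4 * INR (S k)) by apply: wt_mono => //; rewrite S_INR; lra.
  case: (pert_bounds (refl_a a) (refl h) (refl p) (Z.of_nat k)) => P0 _ _ _.
  case: (pert_bounds a h p (- Z.of_nat k)) => P1 _ _ _.
  case: (pert_bounds a h p (- Z.of_nat k - 1)) => P2 _ _ _.
  have K0 := pos_INR k; have K1 := S_INR k.
  split; first by apply: Rmult_le_pos => //; apply: Rmult_le_pos => //; lra.
  have B : pert (refl_a a) (refl h) (refl p) (Z.of_nat k) <= pert a h p (- Z.of_nat k) + pert a h p (- Z.of_nat k - 1).
    rewrite /pert /refl_a /refl.
    have := Cmod_ge_0 (1 - a (- Z.of_nat k)%Z). have := Cmod_ge_0 (h (- Z.of_nat k - 1)%Z).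
    have := Cmod_ge_0 (p (- Z.of_nat k - 1)%Z). lra.
  apply: (Rle_trans _ (INR k * (wt eta (4 * INR k) * (pert a h p (- Z.of_nat k) + pert a h p (- Z.of_nat k - 1))))).
    apply: Rmult_le_compat_l => //; apply: Rmult_le_compat_l => //; lra.
  set x := pert a h p (- Z.of_nat k); set y := pert a h p (- Z.of_nat k - 1).
  have T : INR k * (wt eta (4 * INR k) * y) <= INR (S k) * (wt eta (4 * INR (S k)) * y).
    apply: Rmult_le_compat; [lra | apply: Rmult_le_pos; rewrite /y; lra | lra |].
    apply: Rmult_le_compat_r => //.
  have -> : INR k * (wt eta (4 * INR k) * (x + y)) = INR k * (wt eta (4 * INR k) * x) + INR k * (wt eta (4 * INR k) * y) by ring.
  exact: Rplus_le_compat_l.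
Qed.

Lemma refl_solves a h p lamh v :
  solves_B (refl_a a) (refl h) (refl p) lamh v -> solves_B a h p lamh (fun n => v (- n)%Z).
Proof.
  move=> H n; have := H (- n)%Z; rewrite /refl_a /refl !Z.opp_involutive.
  have -> : (n - 1 = - (- n) - 1)%Z by lia.
  have -> : (- (- n - 1) - 1 = n)%Z by lia.
  have -> : (- (n + 1) = - n - 1)%Z by lia.
  have -> : (- (- - n - 1) = - n + 1)%Z by lia.
  by rewrite Z.opp_involutive => <-; ring.
Qed.

(** * The Jost solutions of the q-difference equation *)

Section QJost.
Variable q : R.
Hypothesis hq : 1 < q.

Lemma powerRZ_inj n m : powerRZ q n = powerRZ q m -> n = m.
Proof. by move=> H; rewrite -(qidx_pow hq n) H qidx_pow. Qed.

Lemma qN_pow n : qN q (powerRZ q n) <-> (1 <= n)%Z.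
Proof.
  split; first by move=> [m [H1 /powerRZ_inj ->]].
  by exists n.
Qed.

Lemma qNinv_pow n : qNinv q (powerRZ q n) <-> (n <= -1)%Z.
Proof.
  split; first by move=> [m [H1 /powerRZ_inj ->]]; lia.
  move=> H; exists (- n)%Z; rewrite Z.opp_involutive; split => //; lia.
Qed.

Lemma CSeries_incr_1_aux (u : nat -> C) : u 0%nat = RtoC 0 -> CSeries u = CSeries (fun k => u (S k)).
Proof. by move=> H; apply: C_ext; rewrite /CSeries /=; apply: Series_incr_1_aux; rewrite H. Qed.

Section Indicator.
Variable g : Z -> C.

Lemma qN_summable : Zsummable (fun n => match excluded_middle_informative (qN q (powerRZ q n)) with
    left _ => g n | right _ => RtoC 0 end) <-> summable (fun k => g (Z.of_nat (S k))).
Proof.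
  set f := fun n => _.
  have E1 k : f (Z.of_nat (S k)) = g (Z.of_nat (S k)).
    rewrite /f; case: excluded_middle_informative => // H; case: H; apply/qN_pow; lia.
  have E2 k : f (- Z.of_nat k - 1)%Z = RtoC 0.
    rewrite /f; case: excluded_middle_informative => // H; move/qN_pow: H; lia.
  split.
  - move=> [H _]; move: (proj2 (summable_S _) H); apply: summable_ext => k; exact: E1.
  - move=> H; split.
      apply/summable_S; apply: summable_ext H => k; by rewrite E1.
    apply: (ex_series_ext (fun k => 0)); first by move=> k; rewrite E2 Cmod_0.
    apply: (ex_series_bounded (B := 0)) => [k | M]; [lra | rewrite Rsum_const; lra].
Qed.

Lemma qN_Zsum : Zsum (fun n => match excluded_middle_informative (qN q (powerRZ q n)) with
    left _ => g n | right _ => RtoC 0 end) = CSeries (fun k => g (Z.of_nat (S k))).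
Proof.
  set f := fun n => _.
  have E1 k : f (Z.of_nat (S k)) = g (Z.of_nat (S k)).
    rewrite /f; case: excluded_middle_informative => // H; case: H; apply/qN_pow; lia.
  have E2 k : f (- Z.of_nat k - 1)%Z = RtoC 0.
    rewrite /f; case: excluded_middle_informative => // H; move/qN_pow: H; lia.
  have E0 : f 0%Z = RtoC 0.
    rewrite /f; case: excluded_middle_informative => // H; move/qN_pow: H; lia.
  rewrite /Zsum (CSeries_incr_1_aux (u := fun k => f (Z.of_nat k))) // (CSeries_ext E1) (CSeries_ext E2) CSeries_0; ring.
Qed.

Lemma qNinv_summable : Zsummable (fun n => match excluded_middle_informative (qNinv q (powerRZ q n)) with
    left _ => g n | right _ => RtoC 0 end) <-> summable (fun k => g (- Z.of_nat (S k))%Z).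
Proof.
  set f := fun n => _.
  have E1 k : f (- Z.of_nat k - 1)%Z = g (- Z.of_nat (S k))%Z.
    have -> : (- Z.of_nat k - 1 = - Z.of_nat (S k))%Z by lia.
    rewrite /f; case: excluded_middle_informative => // H; case: H; apply/qNinv_pow; lia.
  have E2 k : f (Z.of_nat k) = RtoC 0.
    rewrite /f; case: excluded_middle_informative => // H; move/qNinv_pow: H; lia.
  split.
  - move=> [_ H]; apply: summable_ext H => k; exact: E1.
  - move=> H; split; last by apply: summable_ext H => k; rewrite E1.
    apply: (ex_series_ext (fun k => 0)); first by move=> k; rewrite E2 Cmod_0.
    apply: (ex_series_bounded (B := 0)) => [k | M]; [lra | rewrite Rsum_const; lra].
Qed.

Lemma qNinv_Zsum : Zsum (fun n => match excluded_middle_informative (qNinv q (powerRZ q n)) with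
    left _ => g n | right _ => RtoC 0 end) = CSeries (fun k => g (- Z.of_nat (S k))%Z).
Proof.
  set f := fun n => _.
  have E1 k : f (- Z.of_nat k - 1)%Z = g (- Z.of_nat (S k))%Z.
    have -> : (- Z.of_nat k - 1 = - Z.of_nat (S k))%Z by lia.
    rewrite /f; case: excluded_middle_informative => // H; case: H; apply/qNinv_pow; lia.
  have E2 k : f (Z.of_nat k) = RtoC 0.
    rewrite /f; case: excluded_middle_informative => // H; move/qNinv_pow: H; lia.
  rewrite /Zsum (CSeries_ext E1) (CSeries_ext E2) CSeries_0; ring.
Qed.

End Indicator.

Lemma half_log n : ln (powerRZ q n) / (2 * ln q) = IZR n / 2.
Proof.
  have H := ln_q_pos hq.
  have -> : ln (powerRZ q n) / (2 * ln q) = (ln (powerRZ q n) / ln q) / 2 by field; lra.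
  by rewrite qlog_pow.
Qed.

Lemma wz_pow z k : (wz z ^ k)%C = Cexp (Ci * RtoC (INR k / 2) * z).
Proof.
  rewrite /wz -Cexp_nat; congr Cexp; rewrite RtoC_div; [field; exact: C2_neq0 | lra].
Qed.

(** The coefficients of a function [A] on [q^Z], as a power series in [exp (i z / 2)]. *)
Definition coefp (A : R -> R -> C) (n : Z) (k : nat) : C :=
  (RtoC (q - 1) * RtoC (powerRZ q (Z.of_nat k)) * A (powerRZ q n) (powerRZ q (Z.of_nat k)))%C.
Definition coefm (A : R -> R -> C) (n : Z) (k : nat) : C :=
  (RtoC (q - 1) * RtoC (powerRZ q (- Z.of_nat k)) * A (powerRZ q n) (powerRZ q (- Z.of_nat k)))%C.

Lemma q1_neq0 : RtoC (q - 1) <> RtoC 0.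
Proof. apply: RtoC_neq0; lra. Qed.

Lemma qpow_neq0 n : RtoC (powerRZ q n) <> RtoC 0.
Proof. apply: RtoC_neq0; have := qpos hq n; lra. Qed.

(** The weight [(q - 1) r] of the q-integral is absorbed into [coefp], and [ln r / (2 ln q)] is
    [k / 2] at [r = q^k], so the integrand is a monomial in [wz z]. *)
Lemma integrand_plus A n z k :
  (RtoC (powerRZ q (Z.of_nat k)) * jost_integrand_plus q A (powerRZ q n) z (powerRZ q (Z.of_nat k)) =
   / RtoC (q - 1) * (coefp A n k * wz z ^ k))%C.
Proof.
  rewrite /jost_integrand_plus /coefp half_log wz_pow INR_IZR_INZ; field; exact: q1_neq0.
Qed.

Lemma integrand_minus A n z k :
  (RtoC (powerRZ q (- Z.of_nat k)) * jost_integrand_minus q A (powerRZ q n) z (powerRZ q (- Z.of_nat k)) =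
   / RtoC (q - 1) * (coefm A n k * wz z ^ k))%C.
Proof.
  rewrite /jost_integrand_minus /coefm half_log wz_pow INR_IZR_INZ.
  have -> : (- (Ci * RtoC (IZR (- Z.of_nat k) / 2) * z) = Ci * RtoC (IZR (Z.of_nat k) / 2) * z)%C.
    have -> : IZR (- Z.of_nat k) / 2 = - (IZR (Z.of_nat k) / 2) by rewrite opp_IZR; field.
    rewrite RtoC_opp; ring.
  field; exact: q1_neq0.
Qed.

End QJost.

Section QJost2.
Variable q : R.
Hypothesis hq : 1 < q.

Lemma Rpower_half n : Rpower q (IZR n / 2) = sqrt (powerRZ q n).
Proof.
  rewrite powerRZ_Rpower; last lra.
  rewrite -Rpower_sqrt; last by rewrite /Rpower; exact: exp_pos.
  by rewrite Rpower_mult.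
Qed.

Lemma Rpower_mhalf n : Rpower q (- (IZR n / 2)) = / sqrt (powerRZ q n).
Proof. by rewrite Rpower_Ropp Rpower_half. Qed.

Lemma qint_plus A n z : qintegrable q (qN q) (jost_integrand_plus q A (powerRZ q n) z) ->
  summable (fun k => coefp q A n (S k) * wz z ^ S k)%C.
Proof.
  rewrite /qintegrable. move/(qN_summable hq (fun m => RtoC (powerRZ q m) * _)%C) => S1; move: (summable_scal S1 (RtoC (q - 1))).
  apply: summable_ext => k; rewrite integrand_plus //. field; exact: q1_neq0.
Qed.

Lemma qint_plus_conv A n z : summable (fun k => coefp q A n (S k) * wz z ^ S k)%C ->
  qintegrable q (qN q) (jost_integrand_plus q A (powerRZ q n) z).
Proof.
  move=> S1; have H := summable_scal S1 (/ RtoC (q - 1))%C.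
  apply/(qN_summable hq (fun m => RtoC (powerRZ q m) * _)%C).
  apply: summable_ext H => k; by rewrite integrand_plus.
Qed.

Lemma qint_minus A n z : qintegrable q (qNinv q) (jost_integrand_minus q A (powerRZ q n) z) ->
  summable (fun k => coefm q A n (S k) * wz z ^ S k)%C.
Proof.
  rewrite /qintegrable. move/(qNinv_summable hq (fun m => RtoC (powerRZ q m) * _)%C) => S1; move: (summable_scal S1 (RtoC (q - 1))).
  apply: summable_ext => k; rewrite integrand_minus //. field; exact: q1_neq0.
Qed.

Lemma qint_minus_conv A n z : summable (fun k => coefm q A n (S k) * wz z ^ S k)%C ->
  qintegrable q (qNinv q) (jost_integrand_minus q A (powerRZ q n) z).
Proof.
  move=> S1; have H := summable_scal S1 (/ RtoC (q - 1))%C.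
  apply/(qNinv_summable hq (fun m => RtoC (powerRZ q m) * _)%C).
  apply: summable_ext H => k; by rewrite integrand_minus.
Qed.

Lemma jost_form_plusE alpha A n z : summable (fun k => coefp q A n (S k) * wz z ^ S k)%C ->
  jost_form_plus q alpha A (powerRZ q n) z =
  (alpha (powerRZ q n) * en n z * (1 + CSeries (fun k => coefp q A n (S k) * wz z ^ S k)))%C.
Proof.
  move=> H; rewrite /jost_form_plus qlog_pow // -/(en n z); congr (_ * (_ + _))%C.
  rewrite /qint (qN_Zsum hq (fun m => RtoC (powerRZ q m) * jost_integrand_plus q A (powerRZ q n) z (powerRZ q m))%C).
  rewrite (CSeries_ext (fun k => integrand_plus hq A n z (S k))) (CSeries_scal H).
  field; exact: q1_neq0.
Qed.

Lemma jost_form_minusE alpha A n z : summable (fun k => coefm q A n (S k) * wz z ^ S k)%C ->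
  jost_form_minus q alpha A (powerRZ q n) z =
  (alpha (powerRZ q n) * en (- n) z * (1 + CSeries (fun k => coefm q A n (S k) * wz z ^ S k)))%C.
Proof.
  move=> H; rewrite /jost_form_minus qlog_pow //.
  have -> : Cexp (- (Ci * RtoC (IZR n) * z)) = en (- n) z.
    rewrite /en opp_IZR RtoC_opp; congr Cexp; ring.
  congr (_ * (_ + _))%C.
  rewrite /qint (qNinv_Zsum hq (fun m => RtoC (powerRZ q m) * jost_integrand_minus q A (powerRZ q n) z (powerRZ q m))%C).
  rewrite (CSeries_ext (fun k => integrand_minus hq A n z (S k))) (CSeries_scal H).
  field; exact: q1_neq0.
Qed.

Lemma hat_lam_of z : hat_lam q (lam_of q z) = (wz z + / wz z)%C.
Proof.
  rewrite /hat_lam /lam_of -two_cos_wz RtoC_mult.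
  have E : (RtoC (Rpower q (- (1 / 4))) * RtoC (Rpower q (1 / 4)) = 1)%C.
    rewrite -RtoC_mult -Rpower_plus Rplus_opp_l Rpower_O //; lra.
  transitivity ((RtoC (Rpower q (- (1 / 4))) * RtoC (Rpower q (1 / 4))) * (RtoC 2 * Ccos (z / RtoC 2)))%C; first by ring.
  by rewrite E Cmult_1_l.
Qed.

Lemma hat_lam_inj x y : hat_lam q x = hat_lam q y -> x = y.
Proof.
  rewrite /hat_lam => H.
  have N : RtoC (Rpower q (- (1 / 4))) <> RtoC 0.
    apply: RtoC_neq0; have := exp_pos (- (1 / 4) * ln q); rewrite /Rpower; lra.
  have E : (RtoC (Rpower q (- (1 / 4))) * (x - y) = 0)%C.
    have -> : (RtoC (Rpower q (- (1 / 4))) * (x - y) = RtoC (Rpower q (- (1 / 4))) * x - RtoC (Rpower q (- (1 / 4))) * y)%C by ring.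
    rewrite H; ring.
  have -> : x = ((x - y) + y)%C by ring. rewrite (Cmult_eq0_r N E); ring.
Qed.

Variables a b c : R -> C.
Local Notation A := (seq_a q a).
Local Notation H := (seq_h q a b).
Local Notation P := (seq_p q c).

Definition jp (n : Z) (z : C) : C := jost A H P n z.
Definition jm (n : Z) (z : C) : C := jost (refl_a A) (refl H) (refl P) (- n) z.

Lemma coefp_A_plus n k : coefp q (A_plus q a b c) n (S k) = K_plus A H P (S k) n.
Proof.
  rewrite /coefp /A_plus !qidx_pow // Nat2Z.id RtoC_mult; field.
  split; [exact: qpow_neq0 | exact: q1_neq0].
Qed.

Lemma coefm_A_minus n k : coefm q (A_minus q a b c) n (S k) = K_plus (refl_a A) (refl H) (refl P) (S k) (- n).
Proof.
  rewrite /coefm /A_minus !qidx_pow // Z.opp_involutive Nat2Z.id RtoC_mult K_minus_refl; last lia.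
  field. split; [exact: qpow_neq0 | exact: q1_neq0].
Qed.

Hypothesis ha : forall t, qZ q t -> a t <> RtoC 0.
Variable eta : R.
Hypothesis eta0 : 0 <= eta.
Hypothesis Mp : plus_moment eta A H P.
Hypothesis Mm : plus_moment eta (refl_a A) (refl H) (refl P).

Lemma A_neq0 n : A n <> RtoC 0.
Proof.
  rewrite /seq_a /qseq /hat_a => E; apply: (ha (qZ_pow q n)).
  have N : RtoC ((q - 1) ^ 2 * powerRZ q n ^ 2) <> RtoC 0.
    apply: RtoC_neq0; have := qpos hq n => Hp; apply: Rmult_integral_contrapositive_currified; apply: pow_nonzero; lra.
  have -> : a (powerRZ q n) = (RtoC ((q - 1) ^ 2 * powerRZ q n ^ 2) * (a (powerRZ q n) / RtoC ((q - 1) ^ 2 * powerRZ q n ^ 2)))%C by field.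
  by rewrite E Cmult_0_r.
Qed.

Lemma rA_neq0 n : refl_a A n <> RtoC 0.
Proof. exact: A_neq0. Qed.

Lemma summable_plus_K n z : 0 <= Im z -> summable (fun k => coefp q (A_plus q a b c) n (S k) * wz z ^ S k)%C.
Proof.
  move=> Hz; have [S1 _] := Fp_K eta0 Mp n (wz_le1 Hz).
  apply: summable_ext S1 => k; by rewrite coefp_A_plus.
Qed.

Lemma summable_minus_K n z : 0 <= Im z -> summable (fun k => coefm q (A_minus q a b c) n (S k) * wz z ^ S k)%C.
Proof.
  move=> Hz; have [S1 _] := Fp_K eta0 Mm (- n) (wz_le1 Hz).
  apply: summable_ext S1 => k; by rewrite coefm_A_minus.
Qed.

Lemma J_plus_jp n z : 0 <= Im z -> J_plus q a b c (powerRZ q n) z = (/ RtoC (sqrt (powerRZ q n)) * jp n z)%C.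
Proof.
  move=> Hz; rewrite /J_plus (jost_form_plusE _ (summable_plus_K n Hz)).
  have [_ E] := Fp_K eta0 Mp n (wz_le1 Hz).
  have -> : CSeries (fun k => coefp q (A_plus q a b c) n (S k) * wz z ^ S k)%C = CSeries (fun k => K_plus A H P (S k) n * wz z ^ S k)%C.
    by apply: CSeries_ext => k; rewrite coefp_A_plus.
  rewrite -E /alpha_plus qidx_pow // Rpower_mhalf RtoC_inv; last by have := sqrt_pow_pos hq n; lra.
  rewrite /jp /jost /alp; ring.
Qed.

Lemma J_minus_jm n z : 0 <= Im z -> J_minus q a b c (powerRZ q n) z = (/ RtoC (sqrt (powerRZ q n)) * jm n z)%C.
Proof.
  move=> Hz; rewrite /J_minus (jost_form_minusE _ (summable_minus_K n Hz)).
  have [_ E] := Fp_K eta0 Mm (- n) (wz_le1 Hz).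
  have -> : CSeries (fun k => coefm q (A_minus q a b c) n (S k) * wz z ^ S k)%C = CSeries (fun k => K_plus (refl_a A) (refl H) (refl P) (S k) (- n) * wz z ^ S k)%C.
    by apply: CSeries_ext => k; rewrite coefm_A_minus.
  rewrite -E /alpha_minus qidx_pow // Rpower_mhalf RtoC_inv; last by have := sqrt_pow_pos hq n; lra.
  rewrite alpha_minus_refl /jm /jost; ring.
Qed.

Lemma sqrt_neq0 n : RtoC (sqrt (powerRZ q n)) <> RtoC 0.
Proof. apply: RtoC_neq0; have := sqrt_pow_pos hq n; lra. Qed.

Lemma hat_J_plus z : 0 <= Im z -> qseq q (hat_u (fun t => J_plus q a b c t z)) = (fun n => jp n z).
Proof.
  move=> Hz; apply: functional_extensionality => n; rewrite /qseq /hat_u J_plus_jp //; field; exact: sqrt_neq0.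
Qed.

Lemma hat_J_minus z : 0 <= Im z -> qseq q (hat_u (fun t => J_minus q a b c t z)) = (fun n => jm n z).
Proof.
  move=> Hz; apply: functional_extensionality => n; rewrite /qseq /hat_u J_minus_jm //; field; exact: sqrt_neq0.
Qed.

Lemma seq_b_h : (fun n => H n - 2)%C = seq_b q a b.
Proof. apply: functional_extensionality => n; rewrite /seq_h; ring. Qed.

Lemma jp_solves z : 0 <= Im z -> solves_B A (seq_b q a b) P (wz z + / wz z)%C (fun n => jp n z).
Proof. rewrite -seq_b_h; exact: (jost_solves eta0 Mp A_neq0). Qed.

Lemma jm_solves z : 0 <= Im z -> solves_B A (seq_b q a b) P (wz z + / wz z)%C (fun n => jm n z).
Proof.
  move=> Hz; rewrite -seq_b_h.
  exact: (@refl_solves A (fun n => H n - 2)%C P _ _ (jost_solves eta0 Mm rA_neq0 Hz)).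
Qed.

Lemma J_plus_solves z : 0 <= Im z -> solves_A q a b c (lam_of q z) (fun t => J_plus q a b c t z).
Proof. move=> Hz; apply/solves_AB => //; rewrite hat_J_plus // hat_lam_of; exact: jp_solves. Qed.

Lemma J_minus_solves z : 0 <= Im z -> solves_A q a b c (lam_of q z) (fun t => J_minus q a b c t z).
Proof. move=> Hz; apply/solves_AB => //; rewrite hat_J_minus // hat_lam_of; exact: jm_solves. Qed.

Lemma en_inv n z : (/ en n z)%C = Cexp (- (Ci * RtoC (IZR n) * z)).
Proof. by rewrite Cexp_opp. Qed.

Lemma m1_pow k : (-1) ^ k = powerRZ (-1) (Z.of_nat k).
Proof. by rewrite pow_powerRZ. Qed.

Lemma jost_plus_represents : represents_jost_plus q a b c (alpha_plus q a) (A_plus q a b c).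
Proof.
  move=> z Hz; have Hz' : 0 <= Im z by lra.
  split; first by move=> t [n ->]; apply: qint_plus_conv; exact: summable_plus_K.
  split; first exact: J_plus_solves.
  apply/filterlim_Cmod => e He.
  have T := Zinf_nat (jost_tends eta0 Mp A_neq0 Hz' He).
  apply: filter_imp T => n.
  rewrite -/(J_plus q a b c (powerRZ q (Z.of_nat n)) z) J_plus_jp // en_inv RtoC_mult INR_IZR_INZ Rpower_half -m1_pow.
  set x := RtoC ((-1) ^ n); set y := Cexp _; set s := RtoC (sqrt _).
  have -> // : (x * y * jost A H P (Z.of_nat n) z = x * s * y * (/ s * jp (Z.of_nat n) z))%C.
  rewrite /jp; field; exact: sqrt_neq0.
Qed.

Lemma jost_minus_represents : represents_jost_minus q a b c (alpha_minus q a) (A_minus q a b c).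
Proof.
  move=> z Hz; have Hz' : 0 <= Im z by lra.
  split; first by move=> t [n ->]; apply: qint_minus_conv; exact: summable_minus_K.
  split; first exact: J_minus_solves.
  apply/filterlim_Cmod => e He.
  have T := Zinf_nat (jost_tends eta0 Mm rA_neq0 Hz' He).
  apply: filter_imp T => n.
  rewrite -/(J_minus q a b c (powerRZ q (- Z.of_nat n)) z) J_minus_jm // en_inv RtoC_mult INR_IZR_INZ -m1_pow.
  have -> : - (IZR (Z.of_nat n) / 2) = IZR (- Z.of_nat n) / 2 by rewrite opp_IZR; field.
  rewrite Rpower_half /jm Z.opp_involutive.
  set x := RtoC ((-1) ^ n); set y := Cexp _; set s := RtoC (sqrt _); set j := jost _ _ _ _ _.
  have -> // : (x * y * j = x * s * y * (/ s * j))%C.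
  field; exact: sqrt_neq0.
Qed.

Lemma f_plus_jp n z : 0 <= Im z -> f_plus q a b c n z = jp n z.
Proof. move=> Hz; rewrite /f_plus J_plus_jp // Rpower_half; field; exact: sqrt_neq0. Qed.

Lemma f_minus_jm n z : 0 <= Im z -> f_minus q a b c n z = jm n z.
Proof. move=> Hz; rewrite /f_minus J_minus_jm // Rpower_half; field; exact: sqrt_neq0. Qed.

End QJost2.

Lemma first_moment_plus q a b c : 1 < q -> first_moment q a b c -> plus_moment 0 (seq_a q a) (seq_h q a b) (seq_p q c)
  /\ plus_moment 0 (refl_a (seq_a q a)) (refl (seq_h q a b)) (refl (seq_p q c)).
Proof.
  move=> hq [H1 H2].
  have W x : wt 0 x = 1 by rewrite /wt Rmult_0_l exp_0.
  have E n : Cmod (qseq q (fun t => RtoC (Rabs (ln t / ln q) * perturbation q a b c t)) n)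
     = Rabs (IZR n) * pert (seq_a q a) (seq_h q a b) (seq_p q c) n.
    rewrite /qseq qlog_pow // Cmod_R Rabs_pos_eq //.
    apply: Rmult_le_pos; first exact: Rabs_pos.
    by case: (pert_bounds (seq_a q a) (seq_h q a b) (seq_p q c) n).
  have G1 : plus_moment 0 (seq_a q a) (seq_h q a b) (seq_p q c).
    apply: ex_series_ext H1 => k; rewrite E W Rmult_1_l INR_IZR_INZ Rabs_pos_eq //.
    apply: IZR_le; lia.
  split => //; apply: refl_moment => //; first lra.
  apply: ex_series_ext H2 => k; rewrite E W Rmult_1_l INR_IZR_INZ -Rabs_Ropp Rabs_pos_eq.
    by congr (_ * _); rewrite -opp_IZR; congr IZR; lia.
  rewrite -opp_IZR; apply: IZR_le; lia.
Qed.

(** * Second-order estimates and continuity of the complex exponential *)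

Lemma exp_2nd x : Rabs x <= 1 / 2 -> 0 <= exp x - 1 - x <= 2 * (x * x).
Proof.
  move=> Hx. have [H1 H2] := Rabs_le_between x (1/2) => {H2}.
  have {H1} H := H1 Hx. have L := exp_ineq1_le x; split; first lra.
  have U : exp x * (1 - x) <= 1.
    have := exp_ineq1_le (- x) => E; have P0 := exp_pos x.
    have : exp x * (1 - x) <= exp x * exp (- x) by apply: Rmult_le_compat_l; lra.
    by rewrite -exp_plus Rplus_opp_r exp_0.
  have : (1 + x + 2 * (x * x)) * (1 - x) >= 1 by nra.
  nra.
Qed.

Lemma cos_2nd y : Rabs y <= 1 / 2 -> 0 <= 1 - cos y <= y * y / 2.
Proof.
  move=> Hy. have := proj1 (Rabs_le_between y (1/2)) Hy => H.
  have [H1 H2] := COS_bound y; split; first lra.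
  have [H3 _] := pre_cos_bound y 0 ltac:(lra) ltac:(lra).
  move: H3; rewrite /cos_approx /cos_term /=; lra.
Qed.

Lemma sin_2nd y : Rabs y <= 1 / 2 -> Rabs (sin y - y) <= y * y /\ Rabs (sin y) <= 2 * Rabs y.
Proof.
  have pos t : 0 <= t -> t <= 1 / 2 -> 0 <= t - sin t <= t * t.
    move=> H0 H1.
    have [H3 _] := pre_sin_bound t 0 H0 ltac:(lra).
    move: H3; rewrite /sin_approx /sin_term /= => H3.
    have T0 := Rmult_le_pos _ _ H0 H0. have T : t * t * t <= t * t by nra.
    split; last lra.
    case: H0 => [H0 | <-]; last by rewrite sin_0; lra.
    have := sin_lt_x t H0; lra.
  move=> Hy; have := proj1 (Rabs_le_between y (1/2)) Hy => H.
  case: (Rle_lt_dec 0 y) => Hs.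
  - have := pos y Hs ltac:(lra) => T; rewrite (Rabs_pos_eq y) //.
    split; apply: Rabs_le; nra.
  - have := pos (- y) ltac:(lra) ltac:(lra); rewrite sin_neg => T; rewrite (Rabs_left y) //.
    split; apply: Rabs_le; nra.
Qed.

Lemma Cexp_2nd h : Cmod h <= 1 / 2 -> Cmod (Cexp h - 1 - h) <= 8 * Cmod h ^ 2.
Proof.
  move=> Hh. have Hx := Rle_trans _ _ _ (re_le_Cmod h) Hh. have Hy := Rle_trans _ _ _ (im_le_Cmod h) Hh.
  apply: Rle_trans (Cmod_le_ReIm _) _.
  rewrite Cmod2_alt. move: Hx Hy; case: h {Hh} => x y; rewrite /Re /Im /= => Hx Hy.
  have [E1 E2] := exp_2nd Hx. have [C1 C2] := cos_2nd Hy. have [S1 S2] := sin_2nd Hy.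
  have X := proj1 (Rabs_le_between x (1/2)) Hx. have Y := proj1 (Rabs_le_between y (1/2)) Hy.
  have A1 : Rabs (exp x * cos y + - (1) + - x) <= 2 * (x * x) + y * y.
    have -> : exp x * cos y + - (1) + - x = (exp x - 1 - x) - exp x * (1 - cos y) by ring.
    have Ex : 0 < exp x <= 2 by split; [exact: exp_pos | nra].
    apply: Rabs_le; nra.
  have A2 : Rabs (exp x * sin y + - 0 + - y) <= 2 * (2 * Rabs x * Rabs y) + y * y.
    have -> : exp x * sin y + - 0 + - y = (exp x - 1) * sin y + (sin y - y) by ring.
    apply: Rle_trans (Rabs_triang _ _) _; apply: Rplus_le_compat => //.
    rewrite Rabs_mult.
    have : Rabs (exp x - 1) <= 2 * Rabs x.
      have T : Rabs (exp x - 1) <= Rabs (exp x - 1 - x) + Rabs x.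
        have {1}-> : exp x - 1 = (exp x - 1 - x) + x by ring. exact: Rabs_triang.
      rewrite (Rabs_pos_eq (exp x - 1 - x)) // in T.
      have : x * x = Rabs x * Rabs x by rewrite -Rabs_mult Rabs_pos_eq //; nra.
      have := Rabs_pos x; nra.
    move=> T; have := Rabs_pos x; have := Rabs_pos y; have := Rabs_pos (sin y); have := Rabs_pos (exp x - 1); nra.
  have : x * x = Rabs x * Rabs x by rewrite -Rabs_mult Rabs_pos_eq //; nra.
  have : y * y = Rabs y * Rabs y by rewrite -Rabs_mult Rabs_pos_eq //; nra.
  have Q := Rle_0_sqr (Rabs x - Rabs y). rewrite /Rsqr in Q.
  move=> Ey Ex; have := Rle_0_sqr y; have := Rle_0_sqr x; rewrite /Rsqr => T1 T2.
  lra.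
Qed.

Lemma Cexp_1st h : Cmod h <= 1 / 2 -> Cmod (Cexp h - 1) <= 5 * Cmod h.
Proof.
  move=> Hh; have H2 := Cexp_2nd Hh.
  have H1 : Cmod (Cexp h - 1) <= Cmod (Cexp h - 1 - h) + Cmod h.
    have {1}-> : (Cexp h - 1 = (Cexp h - 1 - h) + h)%C by ring.
    exact: Cmod_triangle.
  have E : Cmod h ^ 2 <= Cmod h * (1 / 2).
    rewrite /= Rmult_1_r; apply: Rmult_le_compat_l => //; exact: Cmod_ge_0.
  lra.
Qed.

Lemma Ctends_id (z : C) (P : C -> Prop) : Ctends (within P (@locally C_UniformSpace z)) (fun w => w) z.
Proof.
  move=> e He.
  have H : @locally C_UniformSpace z (fun w => Cmod (w - z) < e).
    refine (proj1 (filterlim_Cmod (F := @locally C_UniformSpace z) (fun w : C => w) z) _ e He).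
    by move=> Q.
  by rewrite /within; apply: filter_imp H => w Hw _.
Qed.

Lemma Ctends_Cexp {T : Type} (F : (T -> Prop) -> Prop) {FF : Filter F} (f : T -> C) l :
  Ctends F f l -> Ctends F (fun t => Cexp (f t)) (Cexp l).
Proof.
  move=> H e He.
  have P0 := exp_pos (Re l).
  have Hd : 0 < Rmin (1 / 2) (e / (10 * exp (Re l))).
    apply: Rmin_pos; [lra | apply: Rdiv_lt_0_compat; lra].
  apply: filter_imp (H _ Hd) => t Ht.
  have -> : f t = (l + (f t - l))%C by ring.
  rewrite Cexp_plus.
  have -> : (Cexp l * Cexp (f t - l) - Cexp l = Cexp l * (Cexp (f t - l) - 1))%C by ring.
  rewrite Cmod_mult Cmod_Cexp.
  have H1 := Rmin_l (1 / 2) (e / (10 * exp (Re l))). have H2 := Rmin_r (1 / 2) (e / (10 * exp (Re l))).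
  have H3 := @Cexp_1st (f t - l)%C ltac:(lra).
  have H4 : Cmod (f t - l) <= e / (10 * exp (Re l)) by lra.
  apply: (Rle_lt_trans _ (exp (Re l) * (5 * (e / (10 * exp (Re l)))))).
    apply: Rmult_le_compat_l; lra.
  have -> : exp (Re l) * (5 * (e / (10 * exp (Re l)))) = e / 2 by field; lra.
  lra.
Qed.

(** * Wronskians *)

Definition Wr (a u v : Z -> C) (n : Z) : C := (a n * (u n * v (n + 1)%Z - u (n + 1)%Z * v n))%C.

(** The discrete Lagrange identity: the diagonal terms cancel. For two solutions it says that the
    Wronskian is constant; with an arbitrary [v] it later estimates coordinates of [v] by its
    image. *)
Lemma Wr_step a b p lamh u v n :
  (Wr a u v n - Wr a u v (n - 1) = u n * Bop a b p lamh v n - Bop a b p lamh u n * v n)%C.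
Proof. rewrite /Wr /Bop Z.sub_add; ring. Qed.

Lemma Z_const (f : Z -> C) : (forall n, f n = f (n - 1)%Z) -> forall n m, f n = f m.
Proof.
  move=> H.
  have up n k : f (n + Z.of_nat k)%Z = f n.
    elim: k => [|k IH]; first by rewrite Z.add_0_r.
    rewrite H -IH; congr f; lia.
  move=> n m; case: (Z.le_ge_cases n m) => Hnm.
  - have -> : m = (n + Z.of_nat (Z.to_nat (m - n)))%Z by lia. by rewrite up.
  - have -> : n = (m + Z.of_nat (Z.to_nat (n - m)))%Z by lia. by rewrite up.
Qed.

Section WrSol.
Variables (a b p : Z -> C) (lamh : C).
Hypothesis ane0 : forall n, a n <> RtoC 0.

Lemma Wr_const u v n m : solves_B a b p lamh u -> solves_B a b p lamh v -> Wr a u v n = Wr a u v m.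
Proof.
  move=> Hu Hv; apply: Z_const => k.
  have E := Wr_step a b p lamh u v k.
  have Eu : Bop a b p lamh u k = RtoC 0 by exact: Hu.
  have Ev : Bop a b p lamh v k = RtoC 0 by exact: Hv.
  have -> : Wr a u v k = ((Wr a u v k - Wr a u v (k - 1)) + Wr a u v (k - 1))%C by ring.
  rewrite E Eu Ev; ring.
Qed.

Lemma solution_zero v n0 : solves_B a b p lamh v -> v n0 = RtoC 0 -> v (n0 + 1)%Z = RtoC 0 ->
  forall n, v n = RtoC 0.
Proof.
  move=> Hv H0 H1.
  have up k : v (n0 + Z.of_nat k)%Z = RtoC 0 /\ v (n0 + Z.of_nat k + 1)%Z = RtoC 0.
    elim: k => [|k [I1 I2]]; first by rewrite Z.add_0_r.
    have -> : (n0 + Z.of_nat (S k) = n0 + Z.of_nat k + 1)%Z by lia.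
    split => //; have := Hv (n0 + Z.of_nat k + 1)%Z; rewrite Z.add_simpl_r I1 I2 !Cmult_0_r !Cplus_0_r => E.
    exact: Cmult_eq0_r (@ane0 _) E.
  have down k : v (n0 - Z.of_nat k)%Z = RtoC 0 /\ v (n0 - Z.of_nat k + 1)%Z = RtoC 0.
    elim: k => [|k [I1 I2]]; first by rewrite Z.sub_0_r.
    have -> : (n0 - Z.of_nat (S k) = n0 - Z.of_nat k - 1)%Z by lia.
    rewrite Z.sub_add; split => //; have := Hv (n0 - Z.of_nat k)%Z; rewrite I1 I2 !Cmult_0_r Cplus_0_r Cplus_0_l => E.
    exact: Cmult_eq0_r (@ane0 _) E.
  move=> n; case: (Z.le_ge_cases n0 n) => H.
  - have -> : n = (n0 + Z.of_nat (Z.to_nat (n - n0)))%Z by lia. exact: proj1 (up _).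
  - have -> : n = (n0 - Z.of_nat (Z.to_nat (n0 - n)))%Z by lia. exact: proj1 (down _).
Qed.

Lemma solves_lincomb u v (x : C) : solves_B a b p lamh u -> solves_B a b p lamh v ->
  solves_B a b p lamh (fun n => u n - x * v n)%C.
Proof.
  move=> Hu Hv n.
  transitivity (Bop a b p lamh u n - x * Bop a b p lamh v n)%C; first by rewrite /Bop; ring.
  have -> : Bop a b p lamh u n = RtoC 0 by exact: Hu.
  have -> : Bop a b p lamh v n = RtoC 0 by exact: Hv.
  ring.
Qed.

(** The combination of [u] and [f] that vanishes at [n0] also vanishes at [n0 + 1], because the
    Wronskian is zero, and two neighbouring zeros propagate. *)
Lemma Wr_zero_prop f u n0 m : solves_B a b p lamh f -> solves_B a b p lamh u ->
  f n0 <> RtoC 0 -> Wr a f u m = RtoC 0 -> forall n, u n = (u n0 / f n0 * f n)%C.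
Proof.
  move=> Hf Hu Hne HW n.
  have Hg := solves_lincomb (u n0 / f n0) Hu Hf.
  have g0 : (u n0 - u n0 / f n0 * f n0 = 0)%C by field.
  have g1 : (u (n0 + 1)%Z - u n0 / f n0 * f (n0 + 1)%Z = 0)%C.
    have E : Wr a f u n0 = RtoC 0 by rewrite (Wr_const n0 m Hf Hu).
    have E2 := Cmult_eq0_r (@ane0 n0) E.
    have -> : (u (n0 + 1)%Z - u n0 / f n0 * f (n0 + 1)%Z = / f n0 * (f n0 * u (n0 + 1)%Z - f (n0 + 1)%Z * u n0))%C by field.
    by rewrite E2 Cmult_0_r.
  have E := solution_zero Hg g0 g1 n.
  have -> : u n = ((u n - u n0 / f n0 * f n) + u n0 / f n0 * f n)%C by ring.
  rewrite E; ring.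
Qed.

End WrSol.

(** * Uniqueness of the Jost solution and of its coefficients *)

Section JostUnique.
Variables a h p : Z -> C.
Hypothesis Hs : plus_moment 0 a h p.
Hypothesis ane0 : forall n, a n <> RtoC 0.
Let e0 : 0 <= 0 := Rle_refl 0.

Lemma a_tends1 : Ctends Zinf a (RtoC 1).
Proof.
  move=> e He; apply: nat_Zinf.
  have L := ex_series_lim_0 _ (a_summable e0 Hs).
  move/is_lim_seq_spec: L => /(_ (mkposreal e He)) [M HM]; exists M => n Hn.
  have := HM n Hn; rewrite Rminus_0_r Rabs_pos_eq; last exact: Cmod_ge_0.
  by rewrite Cmod_sub_sym.
Qed.

Definition jnorm (z : C) (v : Z -> C) (n : Z) : C := (RtoC (powerRZ (-1) n) * / en n z * v n)%C.

Lemma jnorm_inv z v n : v n = (RtoC (powerRZ (-1) n) * en n z * jnorm z v n)%C.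
Proof.
  have E : (RtoC (powerRZ (-1) n) * RtoC (powerRZ (-1) n) = 1)%C by rewrite -RtoC_mult powerRZ_m1_sqr.
  have -> : (RtoC (powerRZ (-1) n) * en n z * jnorm z v n = RtoC (powerRZ (-1) n) * RtoC (powerRZ (-1) n) * v n)%C.
    rewrite /jnorm; field; exact: Cexp_neq_0.
  by rewrite E Cmult_1_l.
Qed.

Lemma Cmod_m1 n : Cmod (RtoC (powerRZ (-1) n)) = 1.
Proof.
  have : Cmod (RtoC (powerRZ (-1) n)) * Cmod (RtoC (powerRZ (-1) n)) = 1.
    by rewrite -Cmod_mult -RtoC_mult powerRZ_m1_sqr Cmod_1.
  have := Cmod_ge_0 (RtoC (powerRZ (-1) n)); nra.
Qed.

Lemma Cmod_en_le1 n z : 0 <= Im z -> (0 <= n)%Z -> Cmod (en n z) <= 1.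
Proof.
  move=> Hz /IZR_le Hn; rewrite Cmod_en -exp_0; apply: exp_mono; nra.
Qed.

(** Up to sign the Wronskian is [en n z * en (n + 1) z] times [a n] times a difference of products
    with equal limits. The exponentials are bounded for [Im z >= 0], so the real axis is
    included. *)
Lemma Wr_jost_lim z u v l m : 0 <= Im z -> Ctends Zinf (jnorm z u) l -> Ctends Zinf (jnorm z v) m ->
  l = m -> Ctends Zinf (Wr a u v) (RtoC 0).
Proof.
  move=> Hz Hu Hv Elm; subst m.
  have Su : Ctends Zinf (fun n => jnorm z u (n + 1)) l by move=> e He; exact: (@Zinf_shift (fun n => Cmod (jnorm z u n - l) < e) 1 (Hu e He)).
  have Sv : Ctends Zinf (fun n => jnorm z v (n + 1)) l by move=> e He; exact: (@Zinf_shift (fun n => Cmod (jnorm z v n - l) < e) 1 (Hv e He)).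
  pose proof (Ctends_mult a_tends1 (Ctends_minus (Ctends_mult Hu Sv) (Ctends_mult Su Hv))) as D.
  have E0 : (1 * (l * l - l * l) = 0)%C by ring.
  rewrite E0 in D.
  have B : Zinf (fun n => Cmod (RtoC (powerRZ (-1) n) * en n z * (RtoC (powerRZ (-1) (n + 1)) * en (n + 1) z)) <= 1).
    exists 0%Z => n Hn; rewrite !Cmod_mult !Cmod_m1.
    have := Cmod_en_le1 Hz Hn; have := @Cmod_en_le1 (n + 1) z Hz ltac:(lia).
    have := Cmod_ge_0 (en n z); have := Cmod_ge_0 (en (n + 1) z); nra.
  apply: Ctends_ext (Ctends_bmult B D) => n.
  rewrite /Wr [in RHS](jnorm_inv z u n) [in RHS](jnorm_inv z u (n + 1)) [in RHS](jnorm_inv z v n) [in RHS](jnorm_inv z v (n + 1)).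
  ring.
Qed.

(** The Wronskian with the constructed solution is constant and tends to 0, so the two are
    proportional; the common normalization at infinity makes the factor 1. *)
Lemma jost_unique z u : 0 <= Im z ->
  solves_B a (fun n => h n - 2)%C p (wz z + / wz z)%C u -> Ctends Zinf (jnorm z u) (RtoC 1) ->
  forall n, u n = jost a h p n z.
Proof.
  move=> Hz Hu Hl n.
  have Hj := jost_solves e0 Hs ane0 Hz.
  have Hjl : Ctends Zinf (jnorm z (fun n => jost a h p n z)) (RtoC 1) := jost_tends e0 Hs ane0 Hz.
  have HW : Wr a (fun n => jost a h p n z) u 0 = RtoC 0.
    apply: (Ctends_unique (F := Zinf) (f := Wr a (fun n => jost a h p n z) u)); last by exact: (Wr_jost_lim Hz Hjl Hl).
    apply: Ctends_ext (Ctends_const _) => k; exact: (Wr_const 0 k Hj Hu).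
  have [N HN] : Zinf (fun n => jost a h p n z <> RtoC 0).
    case: (Hjl 1 Rlt_0_1) => N HN; exists N => k Hk E.
    have := HN k Hk; rewrite /jnorm E Cmult_0_r Cmod_sub_sym.
    have -> : (1 - 0 = 1)%C by ring. rewrite Cmod_1; lra.
  have P := Wr_zero_prop ane0 Hj Hu (HN N (Z.le_refl N)) HW.
  set x := (u N / jost a h p N z)%C in P.
  have E : x = RtoC 1.
    have L1 : Ctends Zinf (jnorm z u) (x * 1)%C.
      apply: Ctends_ext (Ctends_scal x Hjl) => k; rewrite /jnorm (P k); ring.
    rewrite Cmult_1_r in L1; exact: Ctends_unique L1 Hl.
  by rewrite P E Cmult_1_l.
Qed.

End JostUnique.

(** * Power series are determined by their values on the interval from 0 to 1 *)

(** For [0 < t < 1] the point of the upper imaginary axis at which [wz] equals [t]. Along it,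
    identities in [z] become identities of power series in [t]. *)
Definition zt (t : R) : C := (RtoC 2 * (- Ci * RtoC (ln t)))%C.

Lemma wz_zt t : 0 < t -> wz (zt t) = RtoC t.
Proof.
  move=> Ht; rewrite /wz /zt.
  have -> : (Ci * (2 * (- Ci * ln t)) / 2 = RtoC (ln t))%C.
    have -> : (Ci * (2 * (- Ci * ln t)) / 2 = - (Ci * Ci) * ln t)%C by field; exact: C2_neq0.
    have -> : (Ci * Ci = - 1)%C by apply: C_ext => /=; ring. ring.
  apply: C_ext; rewrite /Cexp /= exp_ln // ?cos_0 ?sin_0; ring.
Qed.

Lemma Im_zt t : 0 < t < 1 -> 0 < Im (zt t).
Proof.
  move=> [H0 H1]; have := ln_increasing t 1 H0 H1; rewrite ln_1.
  rewrite /zt /Im /=; lra.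
Qed.

(** [d 0] is minus the rest of the series, and for [t < 1/2] that rest is at most [2 t] times its
    absolute sum at 1/2. Letting [t] tend to 0 finishes. *)
Lemma powser_zero_head (d : nat -> C) :
  (forall t, 0 < t < 1 -> summable (fun k => d k * RtoC t ^ k)%C /\ CSeries (fun k => d k * RtoC t ^ k)%C = RtoC 0) ->
  d 0%nat = RtoC 0.
Proof.
  move=> H.
    have [S1 _] := H (1 / 2) ltac:(lra).
    have S2 := proj2 (summable_S _) S1.
    set M := Series (fun k => Cmod (d (S k) * RtoC (1 / 2) ^ S k)).
    have HM : 0 <= M by apply: Series_ge0 S2 => j; exact: Cmod_ge_0.
    have B t : 0 < t < 1 / 2 -> Cmod (d 0%nat) <= 2 * t * M.
      move=> Ht; have [S3 E] := H t ltac:(lra).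
      move: E; rewrite (CSeries_incr_1 S3) => E.
      have -> : d 0%nat = (- CSeries (fun k => d (S k) * t ^ S k))%C.
        have -> : d 0%nat = ((d 0%nat * t ^ 0 + CSeries (fun k => d (S k) * t ^ S k)) - CSeries (fun k => d (S k) * t ^ S k))%C by rewrite /=; ring.
        rewrite E; ring.
      rewrite Cmod_opp; apply: Rle_trans (CSeries_le (proj2 (summable_S _) S3)) _.
      rewrite /M -Series_scal_l; apply: Series_le; last by exact: ex_series_scalR.
      move=> j; split; first exact: Cmod_ge_0.
      rewrite !Cmod_mult !Cmod_pow !Cmod_R !Rabs_pos_eq; try lra.
      have Pj : t ^ j <= (1 / 2) ^ j by apply: pow_incr; lra.
      have -> : 2 * t * (Cmod (d (S j)) * (1 / 2) ^ S j) = Cmod (d (S j)) * (t * (1 / 2) ^ j) by rewrite /=; field.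
      apply: Rmult_le_compat_l; first exact: Cmod_ge_0.
      by rewrite /=; apply: Rmult_le_compat_l; first lra.
    apply: Cmod_eq_0; apply: Rle_antisym; last exact: Cmod_ge_0.
    apply: le_epsilon => e He; rewrite Rplus_0_l.
    have Hp : 0 < Rmin (1 / 4) (e / (2 * (M + 1))).
      apply: Rmin_pos; [lra | apply: Rdiv_lt_0_compat; lra].
    have m1 := Rmin_l (1 / 4) (e / (2 * (M + 1))); have m2 := Rmin_r (1 / 4) (e / (2 * (M + 1))).
    apply: Rle_trans (B _ (conj Hp _)) _; first lra.
    apply: (Rle_trans _ (2 * (e / (2 * (M + 1))) * M)).
      apply: Rmult_le_compat_r => //; lra.
    have -> : 2 * (e / (2 * (M + 1))) * M = e * (M / (M + 1)) by field; lra.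
    rewrite -{2}(Rmult_1_r e); apply: Rmult_le_compat_l; first lra.
    apply: (Rmult_le_reg_r (M + 1)); first lra.
    have -> : M / (M + 1) * (M + 1) = M by field; lra. lra.
Qed.

Lemma powser_unique (d : nat -> C) :
  (forall t, 0 < t < 1 -> summable (fun k => d k * RtoC t ^ k)%C /\ CSeries (fun k => d k * RtoC t ^ k)%C = RtoC 0) ->
  forall k, d k = RtoC 0.
Proof.
  move=> H k; elim: k d H => [|k IH] d H; first exact: powser_zero_head.
  apply: (IH (fun k => d (S k))) => t Ht.
  have N : RtoC t <> RtoC 0 by apply: RtoC_neq0; lra.
  have [S1 E1] := H t Ht; have S2 := proj2 (summable_S _) S1.
  have Ek j : (/ RtoC t * (d (S j) * RtoC t ^ S j) = d (S j) * RtoC t ^ j)%C by rewrite Cpow_S; field.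
  split; first by apply: summable_ext Ek _; exact: summable_scal.
  rewrite -(CSeries_ext Ek) (CSeries_scal S2).
  move: E1; rewrite (CSeries_incr_1 S1) (powser_zero_head H) Cmult_0_l Cplus_0_l => ->; ring.
Qed.

(** The prefactor [x] is unknown as well, so the series compared have coefficients [x], [x c_k] and
    [y], [y K_k]: the constant term identifies the prefactors, and then [y <> 0] the rest. *)
Lemma coef_unique (x y : C) (c K : nat -> C) : y <> RtoC 0 ->
  (forall t, 0 < t < 1 -> [/\ summable (fun k => c (S k) * RtoC t ^ S k)%C,
     summable (fun k => K (S k) * RtoC t ^ S k)%C &
     (x * (1 + CSeries (fun k => c (S k) * RtoC t ^ S k)) = y * (1 + CSeries (fun k => K (S k) * RtoC t ^ S k)))%C]) ->
  x = y /\ forall k, c (S k) = K (S k).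
Proof.
  move=> Hy H.
  set d := fun k => match k with O => (x - y)%C | S j => (x * c (S j) - y * K (S j))%C end.
  have D : forall k, d k = RtoC 0.
    apply: powser_unique => t Ht; case: (H t Ht) => S1 S2 E.
    have Ek k : (x * (c (S k) * RtoC t ^ S k) - y * (K (S k) * RtoC t ^ S k) = d (S k) * RtoC t ^ S k)%C by rewrite /d; ring.
    have S3 : summable (fun k => d (S k) * RtoC t ^ S k)%C.
      by apply: summable_ext Ek _; apply: summable_minus; exact: summable_scal.
    have S4 : summable (fun k => d k * RtoC t ^ k)%C by apply/summable_S.
    split => //.
    rewrite (CSeries_incr_1 S4) -(CSeries_ext Ek) CSeries_minus; try exact: summable_scal.
    rewrite (CSeries_scal S1) (CSeries_scal S2) /d /=.
    transitivity (x * (1 + CSeries (fun k => c (S k) * RtoC t ^ S k)) - y * (1 + CSeries (fun k => K (S k) * RtoC t ^ S k)))%C; first by rewrite /=; ring.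
    rewrite E; ring.
  have E0 : x = y.
    have -> : x = ((x - y) + y)%C by ring. have -> : (x - y)%C = RtoC 0 by exact: (D 0%nat). ring.
  split => // k.
  have E1 : (y * (c (S k) - K (S k)) = 0)%C.
    rewrite -(D (S k)) /d E0; ring.
  have E2 := Cmult_eq0_r Hy E1.
  have -> : c (S k) = ((c (S k) - K (S k)) + K (S k))%C by ring. rewrite E2; ring.
Qed.

(** * Decaying solutions *)

Section Decay.
Variables a h p : Z -> C.
Hypothesis Hs : plus_moment 0 a h p.
Hypothesis ane0 : forall n, a n <> RtoC 0.
Let e0 : 0 <= 0 := Rle_refl 0.
Local Notation J := (jost a h p).
Local Notation sol z v := (solves_B a (fun n => h n - 2)%C p (wz z + / wz z)%C v).

Lemma jost_near z : 0 <= Im z -> Zinf (fun n => Cmod (en n z) / 2 <= Cmod (J n z) <= 2 * Cmod (en n z)).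
Proof.
  move=> Hz.
  have L := jost_tends e0 Hs ane0 Hz (ltac:(lra) : 0 < 1 / 2).
  apply: filter_imp L => n.
  rewrite -/(jnorm z (fun n => J n z) n) (jnorm_inv z (fun n => J n z) n); set g := jnorm _ _ _ => H.
  rewrite (Cmod_mult _ g) (Cmod_mult _ (en n z)) Cmod_m1 Rmult_1_l.
  have P := Cmod_ge_0 (en n z).
  have U : Cmod g <= 2.
    have -> : g = ((g - 1) + 1)%C by ring.
    apply: Rle_trans (Cmod_triangle _ _) _; rewrite Cmod_1; lra.
  have D : 1 / 2 <= Cmod g.
    have : Cmod 1 <= Cmod g + Cmod (g - 1); last by rewrite Cmod_1; lra.
    have {1}-> : RtoC 1 = (g - (g - 1))%C by ring. exact: Cmod_triang_sub.
  have T1 := Rmult_le_compat_l _ _ _ P D; have T2 := Rmult_le_compat_l _ _ _ P U. split; lra.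
Qed.

Lemma jost_nonzero z : 0 <= Im z -> Zinf (fun n => J n z <> RtoC 0).
Proof.
  move=> Hz; apply: filter_imp (jost_near Hz) => n [H _] E.
  move: H; rewrite E Cmod_0 Cmod_en; have := exp_pos (- (IZR n * Im z)); lra.
Qed.

Lemma jost_l2 z : 0 < Im z -> summable (fun k => RtoC (Cmod (J (Z.of_nat k) z) ^ 2)).
Proof.
  move=> Hz.
  have G : ex_series (fun k => exp (- (2 * Im z)) ^ k).
    apply: ex_series_geom; rewrite Rabs_pos_eq; last by left; exact: exp_pos.
    rewrite -exp_0; apply: exp_increasing; lra.
  apply: (summable_Zbound (f := fun n => RtoC (Cmod (J n z) ^ 2)) (g := fun n => exp (- (2 * Im z)) ^ Z.to_nat n) (B := 4) 0); last first.
    apply: ex_series_ext G => k; by rewrite Nat2Z.id.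
  have [N HN] := jost_near (Rlt_le _ _ Hz).
  exists (Z.max 0 N) => n Hn; have [_ H] := HN n ltac:(lia).
  rewrite Cmod_R Rabs_pos_eq; last exact: pow2_ge_0.
  have -> : exp (- (2 * Im z)) ^ Z.to_nat n = Cmod (en n z) ^ 2.
    rewrite Cmod_en.
    have E : forall x k, exp x ^ k = exp (INR k * x).
      move=> x; elim=> [|k IH]; first by rewrite /= Rmult_0_l exp_0.
      rewrite S_INR /= IH -exp_plus; congr exp; ring.
    rewrite !E INR_IZR_INZ Z2Nat.id; last lia. congr exp; rewrite /=; ring.
  have P := Cmod_ge_0 (J n z). have P2 := Cmod_ge_0 (en n z).
  have : Cmod (J n z) ^ 2 <= (2 * Cmod (en n z)) ^ 2 by apply: pow_incr.
  rewrite Rpow_mult_distr; lra.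
Qed.

(** The Jost solution is bounded near infinity, so its Wronskian with a solution tending to 0 tends
    to 0; being constant, it vanishes. Square-summable solutions enter only through this
    convergence. *)
Lemma decay_prop z v : 0 <= Im z -> sol z v -> Ctends Zinf v (RtoC 0) ->
  exists x, forall n, v n = (x * J n z)%C.
Proof.
  move=> Hz Hv Hl.
  have Hj : sol z (fun n => J n z) by exact: (jost_solves e0 Hs ane0 Hz).
  have Sv : Ctends Zinf (fun n => v (n + 1)%Z) (RtoC 0) by move=> e He; exact: (@Zinf_shift (fun n => Cmod (v n - 0) < e) 1 (Hl e He)).
  have [N HN] := jost_near Hz.
  have B : Zinf (fun n => Cmod (J n z) <= 2).
    exists (Z.max 0 N) => n Hn; have [_ H] := HN n ltac:(lia).
    have := @Cmod_en_le1 n z Hz ltac:(lia); lra.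
  have B' : Zinf (fun n => Cmod (J (n + 1) z) <= 2) by exact: (@Zinf_shift (fun n => Cmod (J n z) <= 2) 1 B).
  have HW : Wr a (fun n => J n z) v 0 = RtoC 0.
    apply: (Ctends_unique (F := Zinf) (f := Wr a (fun n => J n z) v)).
      apply: Ctends_ext (Ctends_const _) => k; exact: (Wr_const 0 k Hj Hv).
    pose proof (Ctends_mult (a_tends1 Hs) (Ctends_minus (Ctends_bmult B Sv) (Ctends_bmult B' Hl))) as D.
    have E : (1 * (0 - 0) = 0)%C by ring.
    rewrite E in D; exact: D.
  have [N' HN'] := jost_nonzero Hz.
  exists (v N' / J N' z)%C => n.
  exact: (Wr_zero_prop ane0 Hj Hv (HN' N' (Z.le_refl _)) HW).
Qed.

(** On the real axis the Jost solution has modulus at least 1/2 far out, so no nonzero multiple of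
    it tends to 0. *)
Lemma decay_zero z v : Im z = 0 -> sol z v -> Ctends Zinf v (RtoC 0) -> forall n, v n = RtoC 0.
Proof.
  move=> Hz Hv Hl.
  have Hz' : 0 <= Im z by lra.
  have [x Hx] := decay_prop Hz' Hv Hl.
  have E1 n : Cmod (en n z) = 1 by rewrite Cmod_en Hz Rmult_0_r Ropp_0 exp_0.
  have Ex : x = RtoC 0.
    apply: Cmod_eq_0; apply: Rle_antisym; last exact: Cmod_ge_0.
    apply: le_epsilon => e He; rewrite Rplus_0_l.
    case: (filter_ex _ (filter_and _ _ (jost_near Hz') (Hl (e / 2) ltac:(lra)))) => n [[H1 _]].
    have -> : (v n - 0 = v n)%C by ring.
    rewrite Hx Cmod_mult E1 in H1 *; have := Cmod_ge_0 x; nra.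
  by move=> n; rewrite Hx Ex Cmult_0_l.
Qed.

End Decay.

Lemma l2_tends (v : Z -> C) : summable (fun k => RtoC (Cmod (v (Z.of_nat k)) ^ 2)) -> Ctends Zinf v (RtoC 0).
Proof.
  move=> /ex_series_lim_0 L e He; apply: nat_Zinf.
  have He2 : 0 < e ^ 2 by apply: pow_lt.
  move/is_lim_seq_spec: L => /(_ (mkposreal _ He2)) [M HM]; exists M => n Hn.
  have -> : (v (Z.of_nat n) - 0 = v (Z.of_nat n))%C by ring.
  have T : Cmod (v (Z.of_nat n)) ^ 2 < e ^ 2.
    apply: Rle_lt_trans (HM n Hn); rewrite Rminus_0_r Cmod_R.
    exact: Rle_trans (Rle_abs _) (Rle_abs _).
  have P := Cmod_ge_0 (v (Z.of_nat n)).
  case: (Rlt_le_dec (Cmod (v (Z.of_nat n))) e) => // Hc.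
  have : e ^ 2 <= Cmod (v (Z.of_nat n)) ^ 2 by apply: pow_incr; lra.
  lra.
Qed.

(** * Square roots, arguments and the parametrization of the plane by [w + 1 / w] *)

Lemma Csqrt_ex (x : C) : exists s, (s * s = x)%C.
Proof.
  case: x => x y.
  set m := Cmod (x, y).
  have Hm : m * m = x * x + y * y.
    have := Cmod2_alt (x, y); rewrite /Re /Im /= -/m; lra.
  have Hx : Rabs x <= m := re_le_Cmod (x, y).
  have Hx1 := Rle_abs x; have Hx2 := Rle_abs (- x); rewrite Rabs_Ropp in Hx2.
  have S1 := sqrt_sqrt ((m + x) / 2) ltac:(lra). have S2 := sqrt_sqrt ((m - x) / 2) ltac:(lra).
  have S3 : sqrt ((m + x) / 2) * sqrt ((m - x) / 2) = Rabs y / 2.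
    rewrite -sqrt_mult; try lra.
    have -> : (m + x) / 2 * ((m - x) / 2) = (Rabs y / 2) * (Rabs y / 2).
      have -> : (Rabs y / 2) * (Rabs y / 2) = (Rabs y * Rabs y) / 4 by field.
      rewrite -Rabs_mult Rabs_pos_eq; last nra. lra.
    apply: sqrt_square; have := Rabs_pos y; lra.
  case: (Rle_lt_dec 0 y) => Hy.
  - exists (sqrt ((m + x) / 2), sqrt ((m - x) / 2)); rewrite Rabs_pos_eq // in S3.
    apply: C_ext; rewrite /Re /Im /=; lra.
  - exists (sqrt ((m + x) / 2), - sqrt ((m - x) / 2)); rewrite Rabs_left // in S3.
    apply: C_ext; rewrite /Re /Im /=; lra.
Qed.

(** [Re z] is twice the angle of [wz z], so this range of angles becomes the interval from [- PI] to
    [3 PI] in [P_plus]. *)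
Lemma angle_ex x y : x * x + y * y = 1 -> exists th, - (PI / 2) <= th <= 3 * (PI / 2) /\ cos th = x /\ sin th = y.
Proof.
  move=> H.
  have Hy : -1 <= y <= 1 by nra.
  have Ex : sqrt (1 - y ^ 2) = Rabs x.
    have -> : 1 - y ^ 2 = Rsqr x by rewrite /Rsqr /=; lra.
    exact: sqrt_Rsqr_abs.
  have [B1 B2] := asin_bound y.
  case: (Rle_lt_dec 0 x) => Hx.
  - exists (asin y); rewrite cos_asin // sin_asin // /Rsqr.
    have -> : 1 - y * y = 1 - y ^ 2 by ring.
    rewrite Ex Rabs_pos_eq //; lra.
  - exists (PI - asin y).
    have -> : PI - asin y = - (asin y - PI) by ring.
    rewrite cos_neg sin_neg cos_minus sin_minus cos_PI sin_PI cos_asin // sin_asin // /Rsqr.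
    have -> : 1 - y * y = 1 - y ^ 2 by ring.
    rewrite Ex Rabs_left //; lra.
Qed.

Lemma wz_ex (w : C) : w <> RtoC 0 -> Cmod w <= 1 -> exists z, [/\ 0 <= Im z, - PI <= Re z <= 3 * PI & wz z = w].
Proof.
  move=> H0 H1. have P := proj1 (Cmod_gt_0 w) H0.
  set r := Cmod w in P H1 *.
  have E2 : Re w / r * (Re w / r) + Im w / r * (Im w / r) = 1.
    have := Cmod2_alt w; rewrite -/r => E.
    have -> : Re w / r * (Re w / r) + Im w / r * (Im w / r) = (Re w ^ 2 + Im w ^ 2) / (r * r) by field; lra.
    rewrite -E; field; lra.
  have [th [Hth [Hc Hsn]]] := angle_ex E2.
  exists (2 * th, - 2 * ln r).
  have Hl : ln r <= 0 by rewrite -ln_1; apply: ln_le.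
  split.
  - rewrite /Im /=; lra.
  - rewrite /Re /=; lra.
  - rewrite /wz.
    have -> : (Ci * ((2 * th)%R, (-2 * ln r)%R) / 2)%C = (ln r, th).
      have -> : ((2 * th)%R, (-2 * ln r)%R) = (RtoC 2 * (th, (- ln r)%R))%C by apply: C_ext; rewrite /Re /Im /=; ring.
      have -> : (Ci * (RtoC 2 * (th, (- ln r)%R)) / 2 = Ci * (th, (- ln r)%R))%C by field; exact: C2_neq0.
      apply: C_ext; rewrite /Re /Im /=; ring.
    apply: C_ext; rewrite /Cexp /Re /Im /= exp_ln // ?Hc ?Hsn /Re /Im; field; lra.
Qed.

(** The two solutions of [w + 1 / w = l] are inverse to each other, so one of them lies in the
    closed unit disk, and [wz] maps [Im z >= 0] onto that disk without its centre. *)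
Lemma joukowski_ex (l : C) : exists z, [/\ 0 <= Im z, - PI <= Re z <= 3 * PI & l = (wz z + / wz z)%C].
Proof.
  have [s Hs] := Csqrt_ex (l / 2 * (l / 2) - 1)%C.
  set w1 := (l / 2 + s)%C; set w2 := (l / 2 - s)%C.
  have E : (w1 * w2 = 1)%C.
    have -> : (w1 * w2 = l / 2 * (l / 2) - s * s)%C by rewrite /w1 /w2; ring.
    rewrite Hs; ring.
  have Esum : (w1 + w2 = l)%C by rewrite /w1 /w2; field; exact: C2_neq0.
  have N1 : w1 <> RtoC 0 by move=> H; rewrite H Cmult_0_l in E; exact: C1_nz.
  have N2 : w2 <> RtoC 0 by move=> H; rewrite H Cmult_0_r in E; exact: C1_nz.
  have EM : Cmod w1 * Cmod w2 = 1 by rewrite -Cmod_mult E Cmod_1.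
  have I1 : (/ w1 = w2)%C.
    transitivity (/ w1 * (w1 * w2))%C; [by rewrite E Cmult_1_r | by field].
  have I2 : (/ w2 = w1)%C.
    transitivity (/ w2 * (w1 * w2))%C; [by rewrite E Cmult_1_r | by field].
  case: (Rle_lt_dec (Cmod w1) 1) => H.
  - have [z [A1 A2 A3]] := wz_ex N1 H; exists z; split => //; by rewrite A3 I1.
  - have H2 : Cmod w2 <= 1 by have := Cmod_ge_0 w2; nra.
    have [z [A1 A2 A3]] := wz_ex N2 H2; exists z; split => //; by rewrite A3 I2 Cplus_comm.
Qed.

Lemma refl_solves_conv a h p lamh v :
  solves_B a h p lamh v -> solves_B (refl_a a) (refl h) (refl p) lamh (fun n => v (- n)%Z).
Proof.
  move=> H; apply: (@refl_solves (refl_a a) (refl h) (refl p) lamh v).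
  have -> : refl_a (refl_a a) = a by apply: functional_extensionality => n; rewrite /refl_a; congr a; lia.
  have -> : refl (refl h) = h by apply: functional_extensionality => n; rewrite /refl Z.opp_involutive.
  by have -> : refl (refl p) = p by apply: functional_extensionality => n; rewrite /refl Z.opp_involutive.
Qed.

(** * Uniqueness of the representation, boundary values and the Wronskian of the Jost solutions *)

Section Main.
Variable q : R.
Hypothesis hq : 1 < q.
Variables a b c : R -> C.
Hypothesis ha : forall t, qZ q t -> a t <> RtoC 0.
Local Notation A := (seq_a q a).
Local Notation H := (seq_h q a b).
Local Notation P := (seq_p q c).
Local Notation A' := (refl_a (seq_a q a)).
Local Notation H' := (refl (seq_h q a b)).
Local Notation P' := (refl (seq_p q c)).
Hypothesis Mp : plus_moment 0 A H P.
Hypothesis Mm : plus_moment 0 A' H' P'.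
Let e0 : 0 <= 0 := Rle_refl 0.
Local Notation jp := (jp q a b c).
Local Notation jm := (jm q a b c).
Let An0 := A_neq0 hq ha.
Let An0' := rA_neq0 hq ha.

Lemma coefp_inj B1 B2 n k : coefp q B1 n (S k) = coefp q B2 n (S k) ->
  B1 (powerRZ q n) (powerRZ q (Z.of_nat (S k))) = B2 (powerRZ q n) (powerRZ q (Z.of_nat (S k))).
Proof.
  rewrite /coefp => E.
  have N : (RtoC (q - 1) * RtoC (powerRZ q (Z.of_nat (S k))))%C <> RtoC 0.
    apply: Cmult_neq_0; [exact: q1_neq0 | exact: qpow_neq0].
  set x := B1 _ _ in E *; set y := B2 _ _ in E *.
  have E2 := @Cmult_eq0_r _ (x - y)%C N.
  have -> : x = ((x - y) + y)%C by ring.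
  rewrite E2; first by ring.
  transitivity (RtoC (q - 1) * RtoC (powerRZ q (Z.of_nat (S k))) * x - RtoC (q - 1) * RtoC (powerRZ q (Z.of_nat (S k))) * y)%C; first by ring.
  rewrite E; ring.
Qed.

Lemma coefm_inj B1 B2 n k : coefm q B1 n (S k) = coefm q B2 n (S k) ->
  B1 (powerRZ q n) (powerRZ q (- Z.of_nat (S k))) = B2 (powerRZ q n) (powerRZ q (- Z.of_nat (S k))).
Proof.
  rewrite /coefm => E.
  have N : (RtoC (q - 1) * RtoC (powerRZ q (- Z.of_nat (S k))))%C <> RtoC 0.
    apply: Cmult_neq_0; [exact: q1_neq0 | exact: qpow_neq0].
  set x := B1 _ _ in E *; set y := B2 _ _ in E *.
  have E2 := @Cmult_eq0_r _ (x - y)%C N.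
  have -> : x = ((x - y) + y)%C by ring.
  rewrite E2; first by ring.
  transitivity (RtoC (q - 1) * RtoC (powerRZ q (- Z.of_nat (S k))) * x - RtoC (q - 1) * RtoC (powerRZ q (- Z.of_nat (S k))) * y)%C; first by ring.
  rewrite E; ring.
Qed.

Lemma alpha_recover (x y : C) n : (RtoC (sqrt (powerRZ q n)) * x = y)%C ->
  x = (RtoC (Rpower q (- (IZR n / 2))) * y)%C.
Proof.
  move=> <-; rewrite Rpower_mhalf // RtoC_inv; last by have := sqrt_pow_pos hq n; lra.
  field; exact: sqrt_neq0.
Qed.

Lemma Cmult_reg_l (x y z : C) : x <> RtoC 0 -> (x * y = x * z)%C -> y = z.
Proof.
  move=> Hx E; have E2 : (x * (y - z) = 0)%C.
    transitivity (x * y - x * z)%C; [ring | rewrite E; ring].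
  have -> : y = ((y - z) + z)%C by ring. rewrite (Cmult_eq0_r Hx E2); ring.
Qed.

(** A competing representation is a normalized solution, hence equals the constructed one for every
    [z] above the real axis. At [zt t] this is an equality of power series in [t], once the common
    factor [en] is cancelled. *)
Lemma plus_unique alpha B : represents_jost_plus q a b c alpha B ->
  forall t, qZ q t -> alpha t = alpha_plus q a t /\ forall r, qN q r -> B t r = A_plus q a b c t r.
Proof.
  move=> HB t [n ->].
  have E z : 0 < Im z -> qseq q (hat_u (fun t => jost_form_plus q alpha B t z)) n = jp n z.
    move=> Hz; have Hz' := Rlt_le _ _ Hz; have [_ [H1 H2]] := HB z Hz.
    move/(solves_AB hq): H1; rewrite (hat_lam_of hq) -(seq_b_h q a b) => H1.
    apply: (jost_unique Mp An0 Hz' H1).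
    move=> e He; apply: nat_Zinf.
    move/filterlim_Cmod: H2 => H2. have := H2 e He. apply: filter_imp => k.
    rewrite /jnorm en_inv /qseq /hat_u RtoC_mult INR_IZR_INZ Rpower_half // -m1_pow.
    set x := RtoC ((-1) ^ k); set y := Cexp _; set s := RtoC (sqrt _); set j := jost_form_plus _ _ _ _ _.
    have -> // : (x * y * (s * j) = x * s * y * j)%C by ring.
  have CU := @coef_unique (RtoC (sqrt (powerRZ q n)) * alpha (powerRZ q n))%C (alp A n)
     (coefp q B n) (fun k => K_plus A H P k n) (@alp_neq0 A (a_summable e0 Mp) An0 n).
  case: CU => [t0 Ht | E1 E2].
    have Hz := Im_zt Ht; have Hz' := Rlt_le _ _ Hz.
    have W := wz_zt (proj1 Ht).
    have S1 := qint_plus hq (proj1 (HB _ Hz) _ (qZ_pow q n)).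
    have [S2 F2] := Fp_K e0 Mp n (wz_le1 Hz').
    have H0 := E _ Hz; rewrite /qseq /hat_u (jost_form_plusE hq alpha S1) /jp /jost F2 in H0.
    rewrite W in S1 S2 H0; split => //.
    apply: (@Cmult_reg_l (en n (zt t0))); first exact: Cexp_neq_0.
    transitivity (RtoC (sqrt (powerRZ q n)) * (alpha (powerRZ q n) * en n (zt t0) * (1 + CSeries (fun k => coefp q B n (S k) * t0 ^ S k))))%C; first by ring.
    rewrite H0; ring.
  split.
  - rewrite /alpha_plus qidx_pow //; exact: alpha_recover.
  - move=> r [m [Hm ->]].
    have -> : m = Z.of_nat (S (Z.to_nat (m - 1))) by lia.
    apply: coefp_inj; by rewrite E2 coefp_A_plus.
Qed.

Lemma minus_unique alpha B : represents_jost_minus q a b c alpha B ->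
  forall t, qZ q t -> alpha t = alpha_minus q a t /\ forall r, qNinv q r -> B t r = A_minus q a b c t r.
Proof.
  move=> HB t [n ->].
  have E z : 0 < Im z -> qseq q (hat_u (fun t => jost_form_minus q alpha B t z)) n = jm n z.
    move=> Hz; have Hz' := Rlt_le _ _ Hz; have [_ [H1 H2]] := HB z Hz.
    move/(solves_AB hq): H1; rewrite (hat_lam_of hq) -(seq_b_h q a b) => /refl_solves_conv H1.
    suff L : Ctends Zinf (jnorm z (fun n => qseq q (hat_u (fun t => jost_form_minus q alpha B t z)) (- n)%Z)) (RtoC 1).
      have := jost_unique Mm An0' Hz' H1 L (- n); by rewrite Z.opp_involutive.
    move=> e He; apply: nat_Zinf.
    move/filterlim_Cmod: H2 => H2. have := H2 e He. apply: filter_imp => k.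
    rewrite /jnorm en_inv /qseq /hat_u RtoC_mult INR_IZR_INZ -m1_pow.
    have -> : - (IZR (Z.of_nat k) / 2) = IZR (- Z.of_nat k) / 2 by rewrite opp_IZR; field.
    rewrite Rpower_half //.
    set x := RtoC ((-1) ^ k); set y := Cexp _; set s := RtoC (sqrt _); set j := jost_form_minus _ _ _ _ _.
    have -> // : (x * y * (s * j) = x * s * y * j)%C by ring.
  have CU := @coef_unique (RtoC (sqrt (powerRZ q n)) * alpha (powerRZ q n))%C (alp A' (- n))
     (coefm q B n) (fun k => K_plus A' H' P' k (- n)) (@alp_neq0 A' (a_summable e0 Mm) An0' (- n)).
  case: CU => [t0 Ht | E1 E2].
    have Hz := Im_zt Ht; have Hz' := Rlt_le _ _ Hz.
    have W := wz_zt (proj1 Ht).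
    have S1 := qint_minus hq (proj1 (HB _ Hz) _ (qZ_pow q n)).
    have [S2 F2] := Fp_K e0 Mm (- n) (wz_le1 Hz').
    have H0 := E _ Hz; rewrite /qseq /hat_u (jost_form_minusE hq alpha S1) /jm /jost F2 in H0.
    rewrite W in S1 S2 H0; split => //.
    apply: (@Cmult_reg_l (en (- n) (zt t0))); first exact: Cexp_neq_0.
    transitivity (RtoC (sqrt (powerRZ q n)) * (alpha (powerRZ q n) * en (- n) (zt t0) * (1 + CSeries (fun k => coefm q B n (S k) * t0 ^ S k))))%C; first by ring.
    rewrite H0; ring.
  split.
  - rewrite /alpha_minus qidx_pow // alpha_minus_refl; exact: alpha_recover.
  - move=> r [m [Hm ->]].
    have -> : (- m = - Z.of_nat (S (Z.to_nat (m - 1))))%Z by lia.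
    apply: coefm_inj; by rewrite E2 coefm_A_minus.
Qed.

Lemma jost_continuous a0 h0 p0 (M0 : plus_moment 0 a0 h0 p0) n z : 0 <= Im z ->
  Ctends (within (fun w => 0 <= Im w) (@locally C_UniformSpace z)) (fun w => jost a0 h0 p0 n w) (jost a0 h0 p0 n z).
Proof.
  move=> Hz; rewrite /jost.
  have I := @Ctends_id z (fun w => 0 <= Im w).
  apply: Ctends_mult.
    apply: Ctends_scal; rewrite /en; apply: Ctends_Cexp; exact: Ctends_scal.
  apply: (Fp_ctends e0 M0 n (wz_le1 Hz)).
    rewrite /within; apply: filter_forall => w; exact: wz_le1.
  rewrite /wz; apply: Ctends_Cexp; rewrite /Cdiv. apply: Ctends_mult (Ctends_const _).
  exact: Ctends_scal.
Qed.

Lemma within_uhp (z : C) (Q : C -> Prop) : (forall w, 0 <= Im w -> Q w) ->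
  within (fun w => 0 <= Im w) (@locally C_UniformSpace z) Q.
Proof. by move=> HQ; rewrite /within; apply: filter_forall. Qed.

Lemma J_plus_continuous t : qZ q t -> continuous_closed_uhp (J_plus q a b c t).
Proof.
  move=> [n ->] z Hz; apply/filterlim_Cmod; rewrite (J_plus_jp hq e0 Mp) //.
  apply: Ctends_ext_loc (Ctends_scal _ (jost_continuous Mp n Hz)).
  apply: within_uhp => w Hw; by rewrite (J_plus_jp hq e0 Mp).
Qed.

Lemma J_minus_continuous t : qZ q t -> continuous_closed_uhp (J_minus q a b c t).
Proof.
  move=> [n ->] z Hz; apply/filterlim_Cmod; rewrite (J_minus_jm hq e0 Mm) //.
  apply: Ctends_ext_loc (Ctends_scal _ (jost_continuous Mm (- n) Hz)).
  apply: within_uhp => w Hw; by rewrite (J_minus_jm hq e0 Mm).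
Qed.

Lemma Phi_at_Wr n z : 0 <= Im z -> Phi_at q a b c n z = Wr A (fun n => jm n z) (fun n => jp n z) n.
Proof. by move=> Hz; rewrite /Phi_at !(f_plus_jp hq e0 Mp) // !(f_minus_jm hq e0 Mm). Qed.

Lemma Phi_const n z : 0 <= Im z -> Phi_at q a b c n z = Phi q a b c z.
Proof.
  move=> Hz; rewrite /Phi !Phi_at_Wr //.
  exact: (Wr_const n 0 (jm_solves hq ha e0 Mm Hz) (jp_solves hq ha e0 Mp Hz)).
Qed.

(** The factor combines [(q - 1)^2 t^2] from the definition of [hat_a], the denominator [(q - 1) t]
    of the q-derivative, and [sqrt t * sqrt (q t)] from the two transformed solutions. *)
Lemma wronskian_Phi n z : 0 <= Im z ->
  wronskian q a (fun s => J_minus q a b c s z) (fun s => J_plus q a b c s z) (powerRZ q n)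
  = (RtoC ((q - 1) / sqrt q) * Phi q a b c z)%C.
Proof.
  move=> Hz; rewrite -(Phi_const n) // Phi_at_Wr // /Wr /wronskian /qderiv q_mul //.
  rewrite !(J_plus_jp hq e0 Mp) // !(J_minus_jm hq e0 Mm) // sqrt_q_succ //.
  rewrite /seq_a /qseq /hat_a.
  set s := sqrt (powerRZ q n). set r := sqrt q.
  have Es : powerRZ q n = s * s by rewrite sqrt_sqrt //; left; exact: qpos.
  have Ps : 0 < s := sqrt_pow_pos hq n. have Pr : 0 < r := sqrt_q_pos hq.
  rewrite Es.
  have -> : RtoC ((q - 1) ^ 2 * (s * s) ^ 2) = (RtoC (q - 1) * RtoC (q - 1) * (s * s * (s * s)))%C.
    have -> : (q - 1) ^ 2 * (s * s) ^ 2 = (q - 1) * (q - 1) * (s * s * (s * s)) by ring.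
    by rewrite !RtoC_mult.
  rewrite RtoC_div ?RtoC_mult; last lra.
  have N1 : RtoC s <> RtoC 0 by apply: RtoC_neq0; lra.
  have N2 : RtoC r <> RtoC 0 by apply: RtoC_neq0; lra.
  have N3 := q1_neq0 hq.
  field; repeat split => //.
Qed.

Lemma Q_fun_Phi z : 0 <= Im z -> Q_fun q a b c z = (RtoC ((q - 1) / sqrt q) * Phi q a b c z)%C.
Proof.
  move=> Hz; have := wronskian_Phi 0 Hz. by have -> : powerRZ q 0 = 1 by [].
Qed.

Lemma Q_fun_zero z : 0 <= Im z -> Q_fun q a b c z = RtoC 0 <-> Phi q a b c z = RtoC 0.
Proof.
  move=> Hz; rewrite Q_fun_Phi //; split => [E | ->]; last by rewrite Cmult_0_r.
  apply: Cmult_eq0_r E; apply: RtoC_neq0; have := sqrt_q_pos hq => Hr.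
  have := Rdiv_lt_0_compat (q - 1) (sqrt q) ltac:(lra) Hr; lra.
Qed.

(** * Eigenvalues and spectral singularities *)

Local Notation solB z v := (solves_B A (seq_b q a b) P (wz z + / wz z)%C v).

Lemma decay_plus z v : 0 <= Im z -> solB z v -> Ctends Zinf v (RtoC 0) ->
  exists x, forall n, v n = (x * jp n z)%C.
Proof. rewrite -(seq_b_h q a b); exact: (decay_prop Mp An0). Qed.

Lemma decay_minus z v : 0 <= Im z -> solB z v -> Ctends Zinf (fun n => v (- n)%Z) (RtoC 0) ->
  exists x, forall n, v n = (x * jm n z)%C.
Proof.
  rewrite -(seq_b_h q a b) => Hz /refl_solves_conv Hv Hl.
  have [x Hx] := decay_prop Mm An0' Hz Hv Hl.
  exists x => n; have := Hx (- n)%Z; by rewrite Z.opp_involutive.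
Qed.

Lemma decay_real z v : Im z = 0 -> solB z v -> Ctends Zinf v (RtoC 0) -> forall n, v n = RtoC 0.
Proof. rewrite -(seq_b_h q a b); exact: (decay_zero Mp An0). Qed.

Lemma l2_right v : in_l2Z v -> Ctends Zinf v (RtoC 0).
Proof. move=> [H1 _]; exact: l2_tends. Qed.

Lemma l2_left v : in_l2Z v -> Ctends Zinf (fun n => v (- n)%Z) (RtoC 0).
Proof.
  move=> [_ H2]; apply: l2_tends; apply/summable_S.
  apply: summable_ext H2 => k. do 4 f_equal; lia.
Qed.

Lemma jp_nonzero z : 0 <= Im z -> exists n, jp n z <> RtoC 0.
Proof. move=> Hz; have [N HN] := jost_nonzero Mp An0 Hz; exists N; apply: HN; lia. Qed.

Lemma jm_nonzero z : 0 <= Im z -> exists n, jm n z <> RtoC 0.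
Proof.
  move=> Hz; have [N HN] := jost_nonzero Mm An0' Hz; exists (- N)%Z.
  rewrite /jm Z.opp_involutive; apply: HN; lia.
Qed.

(** A square-summable solution decays at both ends, hence is a multiple of both Jost solutions,
    which are then proportional. Conversely, a vanishing Wronskian makes the solution that decays at
    plus infinity a multiple of the one that decays at minus infinity. For real [z] no nonzero
    solution decays. *)
Lemma eigen_iff z : 0 <= Im z ->
  eigenvalue_B A (seq_b q a b) P (wz z + / wz z)%C <-> 0 < Im z /\ Phi q a b c z = RtoC 0.
Proof.
  move=> Hz; have Hjp := jp_solves hq ha e0 Mp Hz; have Hjm := jm_solves hq ha e0 Mm Hz.
  split.
  - move=> [v [Hl2 [Hv [n0 Hn0]]]].
    have [Hz0 | Hz0] : Im z = 0 \/ 0 < Im z by lra.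
      by case: Hn0; exact: (decay_real Hz0 Hv (l2_right Hl2)).
    split => //.
    have [x Hx] := decay_plus Hz Hv (l2_right Hl2).
    have [y Hy] := decay_minus Hz Hv (l2_left Hl2).
    have Nx : x <> RtoC 0 by move=> E; apply: Hn0; rewrite Hx E Cmult_0_l.
    have Ny : y <> RtoC 0 by move=> E; apply: Hn0; rewrite Hy E Cmult_0_l.
    rewrite /Phi Phi_at_Wr // /Wr.
    have Ejp n : jp n z = (v n / x)%C by rewrite Hx; field.
    have Ejm n : jm n z = (v n / y)%C by rewrite Hy; field.
    rewrite !Ejp !Ejm; field; split => //.
  - move=> [Hz0 HPhi].
    rewrite /Phi Phi_at_Wr // in HPhi.
    have [n1 Hn1] := jm_nonzero Hz. have [n2 Hn2] := jp_nonzero Hz.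
    have E := Wr_zero_prop An0 Hjm Hjp Hn1 HPhi.
    exists (fun n => jp n z); split; last by split; [exact: Hjp | exists n2].
    split; first exact: (jost_l2 Mp An0 Hz0).
    have L := jost_l2 Mm An0' Hz0.
    set x := (jp n1 z / jm n1 z)%C in E.
    have := summable_scal (proj2 (summable_S _) L) (RtoC (Cmod x ^ 2)).
    apply: summable_ext => k; rewrite E Cmod_mult Rpow_mult_distr RtoC_mult /jm.
    do 5 f_equal; lia.
Qed.

Lemma sigma_d_iff lam : sigma_d q a b c lam <->
  exists z, P_plus z /\ Q_fun q a b c z = RtoC 0 /\ lam = lam_of q z.
Proof.
  rewrite /sigma_d part_ii //; split.
  - have [z [Hz1 Hz2 E]] := joukowski_ex (hat_lam q lam).
    rewrite E => /(eigen_iff Hz1) [Hz3 HP].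
    exists z; split; first by split.
    split; first by apply/Q_fun_zero.
    apply: (@hat_lam_inj q); by rewrite (hat_lam_of hq).
  - move=> [z [[Hz1 Hz2] [HQ ->]]]; have Hz := Rlt_le _ _ Hz2.
    rewrite (hat_lam_of hq); apply/eigen_iff => //; split => //; exact/Q_fun_zero.
Qed.

Lemma sigma_ss_iff lam : sigma_ss q a b c lam <->
  exists z, P_zero z /\ Q_fun q a b c z = RtoC 0 /\ lam = lam_of q z.
Proof.
  split.
  - move=> [z [Hz [HP E]]]; exists z; split => //.
    have Hz0 : 0 <= Im z by case: Hz => ->; lra.
    split; first by apply/Q_fun_zero.
    apply: (@hat_lam_inj q); by rewrite (hat_lam_of hq) E two_cos_wz.
  - move=> [z [Hz [HQ ->]]]; exists z; split => //.
    have Hz0 : 0 <= Im z by case: Hz => ->; lra.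
    split; first exact/Q_fun_zero.
    by rewrite (hat_lam_of hq) two_cos_wz.
Qed.

End Main.

(** * Square-summable two-sided sequences *)

Definition zex (f : Z -> R) : Prop :=
  ex_series (fun k => f (Z.of_nat k)) /\ ex_series (fun k => f (- Z.of_nat k - 1)%Z).

Definition zsum (f : Z -> R) : R :=
  Series (fun k => f (Z.of_nat k)) + Series (fun k => f (- Z.of_nat k - 1)%Z).

Lemma zex_le f g : (forall n, 0 <= f n <= g n) -> zex g -> zex f.
Proof. by move=> H [H1 H2]; split; [apply: ex_series_Rle H1 | apply: ex_series_Rle H2] => k; apply: H. Qed.

Lemma zex_plus f g : zex f -> zex g -> zex (fun n => f n + g n).
Proof. by move=> [H1 H2] [H3 H4]; split; apply: ex_series_plusR. Qed.

Lemma zex_scal x f : zex f -> zex (fun n => x * f n).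
Proof. by move=> [H1 H2]; split; apply: ex_series_scalR. Qed.

Lemma zsum_le f g : (forall n, 0 <= f n <= g n) -> zex g -> zsum f <= zsum g.
Proof. by move=> H [H1 H2]; apply: Rplus_le_compat; apply: Series_le. Qed.

Lemma zsum_plus f g : zex f -> zex g -> zsum (fun n => f n + g n) = zsum f + zsum g.
Proof. move=> [H1 H2] [H3 H4]; rewrite /zsum !Series_plus //; ring. Qed.

Lemma zsum_scal x f : zsum (fun n => x * f n) = x * zsum f.
Proof. rewrite /zsum !Series_scal_l; ring. Qed.

Lemma zsum_ge0 f : (forall n, 0 <= f n) -> zex f -> 0 <= zsum f.
Proof. by move=> H [H1 H2]; apply: Rplus_le_le_0_compat; apply: Series_ge0. Qed.

Lemma zsum_term f n : (forall n, 0 <= f n) -> zex f -> f n <= zsum f.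
Proof.
  move=> H [H1 H2].
  have P1 := Series_ge0 (fun k => H (Z.of_nat k)) H1. have P2 := Series_ge0 (fun k => H (- Z.of_nat k - 1)%Z) H2.
  have term u k : (forall k, 0 <= u k) -> ex_series u -> u k <= Series u.
    move=> Hu eu; apply: Rle_trans (Rsum_le_Series (S k) Hu eu); rewrite /=; have := Rsum_pos k Hu; lra.
  case: (Z.le_gt_cases 0 n) => Hn; rewrite /zsum.
  - have := term _ (Z.to_nat n) (fun k => H (Z.of_nat k)) H1; rewrite Z2Nat.id //; lra.
  - have := term _ (Z.to_nat (- n - 1)) (fun k => H (- Z.of_nat k - 1)%Z) H2.
    have -> : (- Z.of_nat (Z.to_nat (- n - 1)) - 1 = n)%Z by lia. lra.
Qed.

Lemma zshift1 f : zex f -> zex (fun n => f (n + 1)%Z) /\ zsum (fun n => f (n + 1)%Z) = zsum f.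
Proof.
  move=> [H1 H2].
  have E1 : ex_series (fun k => f (Z.of_nat k + 1)%Z).
    move/ex_series_incr_1: H1; apply: ex_series_ext => k; congr f; lia.
  have E2 : ex_series (fun k => f (- Z.of_nat k - 1 + 1)%Z).
    apply/ex_series_incr_1; apply: ex_series_ext H2 => k; congr f; lia.
  split => //; rewrite /zsum (Series_incr_1 _ H1) (Series_incr_1 _ E2).
  rewrite (Series_ext (fun k => f (Z.of_nat (S k))) (fun k => f (Z.of_nat k + 1)%Z)); last by move=> k; congr f; lia.
  rewrite (Series_ext (fun k => f (- Z.of_nat (S k) - 1 + 1)%Z) (fun k => f (- Z.of_nat k - 1)%Z)); last by move=> k; congr f; lia.
  change (f (- Z.of_nat 0 - 1 + 1)%Z) with (f (Z.of_nat 0)); ring.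
Qed.

Lemma zshiftm1 f : zex f -> zex (fun n => f (n - 1)%Z) /\ zsum (fun n => f (n - 1)%Z) = zsum f.
Proof.
  move=> [H1 H2].
  have E1 : ex_series (fun k => f (Z.of_nat k - 1)%Z).
    apply/ex_series_incr_1; apply: ex_series_ext H1 => k; congr f; lia.
  have E2 : ex_series (fun k => f (- Z.of_nat k - 1 - 1)%Z).
    move/ex_series_incr_1: H2; apply: ex_series_ext => k; congr f; lia.
  have E : zex (fun n => f (n - 1)%Z) by [].
  split => //; have [_ <-] := zshift1 E.
  rewrite /zsum; congr (_ + _); apply: Series_ext => k; congr f; lia.
Qed.

Lemma zshift (m : Z) f : zex f -> zex (fun n => f (n + m)%Z) /\ zsum (fun n => f (n + m)%Z) = zsum f.
Proof.
  have pos k : zex f -> zex (fun n => f (n + Z.of_nat k)%Z) /\ zsum (fun n => f (n + Z.of_nat k)%Z) = zsum f.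
    move=> Hf; elim: k => [|k [I1 I2]].
      have -> // : (fun n => f (n + Z.of_nat 0)%Z) = f by apply: functional_extensionality => n; rewrite Z.add_0_r.
    have [J1 J2] := zshift1 I1.
    have -> : (fun n => f (n + Z.of_nat (S k))%Z) = (fun n => f (n + 1 + Z.of_nat k)%Z) by apply: functional_extensionality => n; congr f; lia.
    by rewrite J2.
  have neg k : zex f -> zex (fun n => f (n - Z.of_nat k)%Z) /\ zsum (fun n => f (n - Z.of_nat k)%Z) = zsum f.
    move=> Hf; elim: k => [|k [I1 I2]].
      have -> // : (fun n => f (n - Z.of_nat 0)%Z) = f by apply: functional_extensionality => n; rewrite Z.sub_0_r.
    have [J1 J2] := zshiftm1 I1.
    have -> : (fun n => f (n - Z.of_nat (S k))%Z) = (fun n => f (n - 1 - Z.of_nat k)%Z) by apply: functional_extensionality => n; congr f; lia.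
    by rewrite J2.
  move=> Hf; case: (Z.le_gt_cases 0 m) => Hm.
  - have -> : m = Z.of_nat (Z.to_nat m) by lia. exact: pos.
  - have -> : (fun n => f (n + m)%Z) = (fun n => f (n - Z.of_nat (Z.to_nat (- m)))%Z) by apply: functional_extensionality => n; congr f; lia.
    exact: neg.
Qed.

Lemma Series_finite (u : nat -> R) N : (forall k, (N <= k)%nat -> u k = 0) -> ex_series u /\ Series u = Rsum u N.
Proof.
  move=> H.
  have Z0 : Series (fun k => u (N + k)%nat) = 0.
    rewrite (Series_ext _ (fun _ => 0)); last by move=> k; apply: H; lia.
    rewrite -[RHS](Rmult_0_l (Series (fun _ => 0))) -Series_scal_l; apply: Series_ext => _; ring.
  have E : ex_series u.
    apply/(ex_series_incr_n u N).
    apply: (ex_series_ext (fun _ => 0)); first by move=> k; rewrite H //; lia.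
    apply: (ex_series_bounded (B := 0)) => [k | M]; [lra | rewrite Rsum_const; lra].
  split => //; case: N H Z0 => [|N] H Z0; first by rewrite /= -Z0.
  rewrite (Series_incr_n u (S N)) //; last lia.
  rewrite -sum_n_Reals sum_n_Rsum /= in Z0 *. rewrite Z0; ring.
Qed.

Lemma zfinite f k N B : (forall n, 0 <= f n) -> (forall n, (n < k)%Z \/ (k + Z.of_nat N <= n)%Z -> f n = 0) ->
  (forall n, f n <= B) -> zex f /\ zsum f <= INR N * B.
Proof.
  move=> Hp Hs HB.
  set g := fun n => f (n + k)%Z.
  have Eg1 : forall j : nat, (N <= j)%nat -> g (Z.of_nat j) = 0 by move=> j Hj; apply: Hs; right; lia.
  have Eg2 : forall j : nat, (0 <= j)%nat -> g (- Z.of_nat j - 1)%Z = 0 by move=> j _; apply: Hs; left; lia.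
  have [A1 A2] := Series_finite (u := fun j => g (Z.of_nat j)) Eg1.
  have [B1 B2] := Series_finite (u := fun j => g (- Z.of_nat j - 1)%Z) Eg2.
  have G : zex g by [].
  have [S1 S2] := zshift (- k) G.
  have Ef : (fun n => g (n + - k)%Z) = f by apply: functional_extensionality => n; rewrite /g; congr f; lia.
  rewrite Ef in S1 S2; split => //; rewrite S2 /zsum A2 B2 [Rsum _ 0]/= Rplus_0_r -Rsum_const.
  apply: Rsum_le => j _; exact: HB.
Qed.

Lemma zsum_lower f k M : (forall n, 0 <= f n) -> zex f -> Rsum (fun i => f (k + Z.of_nat i)%Z) M <= zsum f.
Proof.
  move=> Hp Hf; have [S1 S2] := zshift k Hf; rewrite -S2 /zsum.
  have := Series_ge0 (fun j => Hp (- Z.of_nat j - 1 + k)%Z) (proj2 S1).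
  have := Rsum_le_Series M (fun j => Hp (Z.of_nat j + k)%Z) (proj1 S1).
  have -> : Rsum (fun i => f (k + Z.of_nat i)%Z) M = Rsum (fun i => f (Z.of_nat i + k)%Z) M by apply: Rsum_ext => i _; congr f; lia.
  lra.
Qed.

Definition l2 (v : Z -> C) : Prop := zex (fun n => Cmod (v n) ^ 2).
(** The squared norm. Working with squares replaces Minkowski's inequality by
    [(x + y)^2 <= 2 x^2 + 2 y^2]; the factor 2 lost in [l2_plus] is harmless. *)
Definition N2 (v : Z -> C) : R := zsum (fun n => Cmod (v n) ^ 2).

Lemma sqr_pos (x : C) : 0 <= Cmod x ^ 2.
Proof. exact: pow2_ge_0. Qed.

Lemma in_l2Z_l2 v : in_l2Z v <-> l2 v.
Proof.
  have E (x : C) : Cmod (RtoC (Cmod x ^ 2)) = Cmod x ^ 2 by rewrite Cmod_R Rabs_pos_eq //; exact: sqr_pos.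
  split; move=> [H1 H2]; split; [apply: ex_series_ext H1 | apply: ex_series_ext H2 | apply: ex_series_ext H1 | apply: ex_series_ext H2] => k; by rewrite E.
Qed.

Lemma N2_ge0 v : l2 v -> 0 <= N2 v.
Proof. apply: zsum_ge0 => n; exact: sqr_pos. Qed.

Lemma N2_term v n : l2 v -> Cmod (v n) <= sqrt (N2 v).
Proof.
  move=> Hv; rewrite -(sqrt_pow2 (Cmod (v n))); last exact: Cmod_ge_0.
  apply: sqrt_le_1_alt; exact: (zsum_term (f := fun n => Cmod (v n) ^ 2) n (fun n => sqr_pos (v n)) Hv).
Qed.

Lemma sqr_plus_le (x y : C) : Cmod (x + y) ^ 2 <= 2 * Cmod x ^ 2 + 2 * Cmod y ^ 2.
Proof.
  have H := Cmod_triangle x y. have P := Cmod_ge_0 (x + y).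
  have : Cmod (x + y) ^ 2 <= (Cmod x + Cmod y) ^ 2 by apply: pow_incr.
  have := Rle_0_sqr (Cmod x - Cmod y); rewrite /Rsqr; lra.
Qed.

Lemma l2_plus u v : l2 u -> l2 v -> l2 (fun n => u n + v n)%C /\ N2 (fun n => u n + v n)%C <= 2 * N2 u + 2 * N2 v.
Proof.
  move=> Hu Hv; have H := zex_plus (zex_scal 2 Hu) (zex_scal 2 Hv).
  have B n : 0 <= Cmod (u n + v n) ^ 2 <= 2 * Cmod (u n) ^ 2 + 2 * Cmod (v n) ^ 2 by split; [exact: sqr_pos | exact: sqr_plus_le].
  split; first exact: zex_le B H.
  apply: Rle_trans (zsum_le B H) _.
  rewrite zsum_plus ?zsum_scal; [exact: Rle_refl | exact: zex_scal | exact: zex_scal].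
Qed.

Lemma l2_scal x v : l2 v -> l2 (fun n => x * v n)%C /\ N2 (fun n => x * v n)%C = Cmod x ^ 2 * N2 v.
Proof.
  move=> Hv.
  have E : (fun n => Cmod (x * v n) ^ 2) = (fun n => Cmod x ^ 2 * Cmod (v n) ^ 2).
    apply: functional_extensionality => n; by rewrite Cmod_mult Rpow_mult_distr.
  rewrite /l2 /N2 E; split; [exact: zex_scal | exact: zsum_scal].
Qed.

Lemma l2_minus u v : l2 u -> l2 v -> l2 (fun n => u n - v n)%C.
Proof.
  move=> Hu Hv; have [H1 _] := l2_scal (- (1))%C Hv; have [H2 _] := l2_plus Hu H1.
  have -> // : (fun n => u n - v n)%C = (fun n => u n + - (1) * v n)%C.
  apply: functional_extensionality => n; ring.
Qed.

Lemma Z_bounded (f : Z -> R) N : exists B, forall n, (- Z.of_nat N <= n <= Z.of_nat N)%Z -> f n <= B.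
Proof.
  elim: N => [|N [B HB]].
    exists (f 0%Z) => n Hn; have -> : n = 0%Z by lia. lra.
  exists (Rmax B (Rmax (f (Z.of_nat (S N))) (f (- Z.of_nat (S N))%Z))) => n Hn.
  case: (Z.le_gt_cases (Z.abs n) (Z.of_nat N)) => H.
    apply: Rle_trans (HB n ltac:(lia)) (Rmax_l _ _).
  apply: Rle_trans (Rmax_r _ _).
  have [-> | ->] : n = Z.of_nat (S N) \/ n = (- Z.of_nat (S N))%Z by lia.
  - exact: Rmax_l.
  - exact: Rmax_r.
Qed.

Lemma Ctends_two_bounded (f : Z -> C) l m : Ctends Zinf f l -> Ctends Zinf (fun n => f (- n)%Z) m ->
  exists B, forall n, Cmod (f n) <= B.
Proof.
  move=> /Ctends_bounded [N1 H1] /Ctends_bounded [N2 H2].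
  have [B HB] := Z_bounded (fun n => Cmod (f n)) (Z.to_nat (Z.max N1 N2)).
  exists (Rmax B (Rmax (Cmod l + 1) (Cmod m + 1))) => n.
  case: (Z.le_gt_cases (Z.abs n) (Z.of_nat (Z.to_nat (Z.max N1 N2)))) => H.
    apply: Rle_trans (HB n ltac:(lia)) (Rmax_l _ _).
  apply: Rle_trans (Rmax_r _ _).
  case: (Z.le_gt_cases 0 n) => Hn.
  - apply: Rle_trans (H1 n ltac:(lia)) (Rmax_l _ _).
  - apply: Rle_trans (Rmax_r _ _); have := H2 (- n)%Z ltac:(lia); by rewrite Z.opp_involutive.
Qed.

Section BoundedOperator.
Variables (a b p : Z -> C) (lamh : C) (Ba Bb : R).
Hypothesis HBa : forall n, Cmod (a n) <= Ba.
Hypothesis HBb : forall n, Cmod (b n + 2 * lamh * p n + lamh * lamh) <= Bb.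

Lemma Bop_l2 v : l2 v -> l2 (Bop a b p lamh v).
Proof.
  move=> Hv.
  have [V1 _] := zshift1 Hv. have [V2 _] := zshiftm1 Hv.
  have A0 : 0 <= Ba := Rle_trans _ _ _ (Cmod_ge_0 _) (HBa 0%Z).
  have B0 : 0 <= Bb := Rle_trans _ _ _ (Cmod_ge_0 _) (HBb 0%Z).
  apply: zex_le (zex_plus (zex_plus (zex_scal (4 * Ba ^ 2) V1) (zex_scal (4 * Ba ^ 2) V2)) (zex_scal (2 * Bb ^ 2) Hv)) => n.
  split; first exact: sqr_pos.
  rewrite /Bop; apply: Rle_trans (sqr_plus_le _ _) _.
  have Q (x y : C) B : Cmod x <= B -> Cmod (x * y) ^ 2 <= B ^ 2 * Cmod y ^ 2.
    move=> Hx; rewrite Cmod_mult Rpow_mult_distr; apply: Rmult_le_compat_r; first exact: sqr_pos.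
    apply: pow_incr; split => //; exact: Cmod_ge_0.
  have T1 := Q _ (v (n + 1)%Z) _ (HBa n). have T2 := Q _ (v (n - 1)%Z) _ (HBa (n - 1)%Z).
  have T3 := Q _ (v n) _ (HBb n).
  have := sqr_plus_le (a n * v (n + 1)%Z) (a (n - 1)%Z * v (n - 1)%Z). lra.
Qed.

End BoundedOperator.

(** * The operator when a solution is bounded above and below near plus infinity *)

Section Tent.
Variables (a b p : Z -> C) (lamh : C) (f : Z -> C) (Ba Bb : R) (N1 : Z).
Local Notation T := (Bop a b p lamh).
Hypothesis ane0 : forall n, a n <> RtoC 0.
Hypothesis HBa : forall n, Cmod (a n) <= Ba.
Hypothesis HBb : forall n, Cmod (b n + 2 * lamh * p n + lamh * lamh) <= Bb.
Hypothesis Hf : solves_B a b p lamh f.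
Hypothesis Hf1 : forall n, (N1 <= n)%Z -> 1 / 2 <= Cmod (f n) <= 2.

Lemma f_neq0 n : (N1 <= n)%Z -> f n <> RtoC 0.
Proof. move=> Hn E; have := Hf1 Hn; rewrite E Cmod_0; lra. Qed.

(** A jump from 0 to 1 at [k], then a descent of slope [1 / N]. The jump contributes an image that
    does not depend on [N], the slope an error that vanishes as [N] grows. *)
Definition tent (k : Z) (N : nat) (n : Z) : R :=
  if Z_lt_dec n k then 0 else Rmax 0 (1 - IZR (n - k) / INR N).

Definition tentf k N n : C := (RtoC (tent k N n) * f n)%C.

Lemma Rmax0_lip x y : Rabs (Rmax 0 x - Rmax 0 y) <= Rabs (x - y).
Proof.
  rewrite /Rmax; case: (Rle_dec 0 x) => Hx; case: (Rle_dec 0 y) => Hy; rewrite /Rabs;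
    repeat case: Rcase_abs; lra.
Qed.

Variable k : Z.
Hypothesis Hk : (N1 + 1 <= k)%Z.

Section FixN.
Variable N : nat.
Hypothesis HN : (0 < N)%nat.

Lemma INR_pos : 0 < INR N.
Proof. exact: lt_0_INR. Qed.

Lemma tent_lt n : (n < k)%Z -> tent k N n = 0.
Proof. by move=> H; rewrite /tent; case: Z_lt_dec => // H2; lia. Qed.

Lemma tent_ge n : (k <= n)%Z -> tent k N n = Rmax 0 (1 - IZR (n - k) / INR N).
Proof. by move=> H; rewrite /tent; case: Z_lt_dec => // H2; lia. Qed.

Lemma tent_k : tent k N k = 1.
Proof.
  rewrite tent_ge; last lia. rewrite Z.sub_diag Rmax_right; rewrite /Rdiv; lra.
Qed.

Lemma tent_far n : (k + Z.of_nat N <= n)%Z -> tent k N n = 0.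
Proof.
  move=> H; rewrite tent_ge; last lia. rewrite Rmax_left //.
  have H2 : INR N <= IZR (n - k) by rewrite INR_IZR_INZ; apply: IZR_le; lia.
  have P := INR_pos.
  have : 1 <= IZR (n - k) / INR N.
    apply: (Rmult_le_reg_r (INR N)) => //. have -> : IZR (n - k) / INR N * INR N = IZR (n - k) by field; lra. lra.
  lra.
Qed.

Lemma tent_bounds n : 0 <= tent k N n <= 1.
Proof.
  case: (Z.lt_ge_cases n k) => H; first by rewrite tent_lt //; lra.
  rewrite tent_ge //; split; first exact: Rmax_l.
  apply: Rmax_lub; first lra.
  have : 0 <= IZR (n - k) / INR N; last lra.
  apply: Rle_mult_inv_pos; [apply: IZR_le; lia | exact: INR_pos].
Qed.

Lemma tent_diff n : (k <= n)%Z -> Rabs (tent k N (n + 1) - tent k N n) <= 1 / INR N.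
Proof.
  move=> H; rewrite !tent_ge; try lia. apply: Rle_trans (Rmax0_lip _ _) _.
  have P := INR_pos.
  have -> : (n + 1 - k = (n - k) + 1)%Z by lia. rewrite plus_IZR.
  have -> : 1 - (IZR (n - k) + 1) / INR N - (1 - IZR (n - k) / INR N) = - (1 / INR N) by field; lra.
  rewrite Rabs_Ropp Rabs_pos_eq; [lra | apply: Rle_mult_inv_pos; lra].
Qed.

Lemma tentf_l2 : l2 (tentf k N).
Proof.
  refine (proj1 (zfinite (k := k) (N := N) (B := 4) _ _ _)) => n.
  - exact: sqr_pos.
  - rewrite /tentf; case=> H; [rewrite tent_lt // | rewrite tent_far //]; rewrite Cmult_0_l Cmod_0; ring.
  - rewrite /tentf; case: (Z.lt_ge_cases n k) => H.
      rewrite tent_lt // Cmult_0_l Cmod_0; lra.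
    rewrite Cmod_mult Cmod_R.
    have B := tent_bounds n; have F := @Hf1 n ltac:(lia).
    rewrite Rabs_pos_eq; last lra.
    have : tent k N n * Cmod (f n) <= 2.
      apply: (Rle_trans _ (1 * 2)); [apply: Rmult_le_compat; lra | lra].
    have : 0 <= tent k N n * Cmod (f n) by apply: Rmult_le_pos; lra.
    nra.
Qed.

(** What the operator makes of [f] cut off sharply to the left of [k]: as [f] is a solution, only
    the two sites next to the cut survive. *)
Definition cut_image (n : Z) : C :=
  if Z.eq_dec n (k - 1) then (a (k - 1)%Z * f k)%C else
  if Z.eq_dec n k then (- (a (k - 1)%Z * f (k - 1)%Z))%C else RtoC 0.

Definition tent_rest (n : Z) : C := (T (tentf k N) n - cut_image n)%C.

Lemma tent_rest_zero n : (n < k)%Z \/ (k + Z.of_nat (S N) <= n)%Z -> tent_rest n = RtoC 0.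
Proof.
  rewrite /tent_rest /cut_image => Hn; case: Z.eq_dec => E1.
    rewrite [is_left _]/= /Bop /tentf E1 Z.sub_add tent_k !tent_lt; try lia. ring.
  case: Z.eq_dec => E2; first lia.
  rewrite ![is_left _]/= /Bop /tentf.
  case: Hn => Hn; [rewrite !tent_lt; try lia | rewrite !tent_far; try lia]; rewrite /=; ring.
Qed.

Lemma tent_rest_bound n : Cmod (tent_rest n) <= 4 * Ba / INR N.
Proof.
  have P := INR_pos.
  have A0 : 0 <= Ba := Rle_trans _ _ _ (Cmod_ge_0 _) (HBa 0%Z).
  have Pos : 0 <= 4 * Ba / INR N by apply: Rle_mult_inv_pos; lra.
  have D x m : (k <= m)%Z -> (N1 <= x)%Z -> forall y, Cmod (a y * (RtoC (tent k N (m + 1) - tent k N m) * f x)) <= 2 * Ba / INR N.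
    move=> Hm Hx y; rewrite !Cmod_mult Cmod_R.
    have H1 := tent_diff Hm; have [_ H2] := Hf1 Hx; have H3 := HBa y.
    have -> : 2 * Ba / INR N = Ba * (1 / INR N * 2) by field; lra.
    apply: Rmult_le_compat => //; try exact: Cmod_ge_0.
      apply: Rmult_le_pos; [exact: Rabs_pos | exact: Cmod_ge_0].
    apply: Rmult_le_compat => //; [exact: Rabs_pos | exact: Cmod_ge_0].
  case: (Z.lt_ge_cases n k) => Hn; first by rewrite tent_rest_zero ?Cmod_0 //; left.
  have E0 : T f n = RtoC 0 by exact: Hf.
  rewrite /tent_rest /cut_image; case: Z.eq_dec => E1; first lia.
  case: Z.eq_dec => E2.
  - subst n. rewrite /Bop /tentf tent_k (tent_lt (n := k - 1)); last lia.
    have -> : (a k * (tent k N (k + 1) * f (k + 1)%Z) + a (k - 1)%Z * (0 * f (k - 1)%Z) + (b k + 2 * lamh * p k + lamh * lamh) * (1 * f k) - - (a (k - 1)%Z * f (k - 1)%Z)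
       = T f k + a k * (RtoC (tent k N (k + 1) - tent k N k) * f (k + 1)%Z))%C.
      rewrite /Bop tent_k RtoC_minus; ring.
    rewrite E0 Cplus_0_l; apply: Rle_trans (D _ _ _ _ _) _; try lia.
    apply: Rmult_le_compat_r; [left; exact: Rinv_0_lt_compat | lra].
  - have -> : (T (tentf k N) n - 0 = RtoC (tent k N n) * T f n + (a n * (RtoC (tent k N (n + 1) - tent k N n) * f (n + 1)%Z) - a (n - 1)%Z * (RtoC (tent k N (n - 1 + 1) - tent k N (n - 1)) * f (n - 1)%Z)))%C.
      rewrite Z.sub_add !RtoC_minus /Bop /tentf; ring.
    rewrite E0 Cmult_0_r Cplus_0_l; apply: Rle_trans (Cmod_triang_sub _ _) _.
    have := D (n + 1)%Z n ltac:(lia) ltac:(lia) n. have := D (n - 1)%Z (n - 1)%Z ltac:(lia) ltac:(lia) (n - 1)%Z.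
    have -> : 4 * Ba / INR N = 2 * Ba / INR N + 2 * Ba / INR N by field; lra. lra.
Qed.

(** At most [N + 1] entries of size [4 Ba / N], so the squared norm is of order [1 / N]. *)
Lemma tent_rest_N2 : l2 tent_rest /\ N2 tent_rest <= 32 * Ba ^ 2 / INR N.
Proof.
  have P := INR_pos.
  have [H1 H2] : l2 tent_rest /\ N2 tent_rest <= INR (S N) * (4 * Ba / INR N) ^ 2.
    apply: (zfinite (k := k)) => n.
    - exact: sqr_pos.
    - by move=> /tent_rest_zero ->; rewrite Cmod_0 /=; ring.
    - apply: pow_incr; split; [exact: Cmod_ge_0 | exact: tent_rest_bound].
  split => //; apply: Rle_trans H2 _.
  have : 1 <= INR N by rewrite -INR_1; apply: le_INR; lia.
  move=> H3; rewrite S_INR.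
  have -> : (INR N + 1) * (4 * Ba / INR N) ^ 2 = 16 * Ba ^ 2 / INR N * ((INR N + 1) / INR N) by field; lra.
  have -> : 32 * Ba ^ 2 / INR N = 16 * Ba ^ 2 / INR N * 2 by field; lra.
  apply: Rmult_le_compat_l.
    apply: Rle_mult_inv_pos => //; have := pow2_ge_0 Ba; lra.
  apply: (Rmult_le_reg_r (INR N)) => //.
  have -> : (INR N + 1) / INR N * INR N = INR N + 1 by field; lra. lra.
Qed.

End FixN.

Lemma cut_image_l2 : l2 cut_image.
Proof.
  have [B HB] := Z_bounded (fun n => Cmod (cut_image n) ^ 2) (Z.to_nat (Z.abs k + 1)).
  refine (proj1 (zfinite (k := k - 1) (N := 2) (B := Rmax 0 B) _ _ _)) => n.
  - exact: sqr_pos.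
  - move=> H; rewrite /cut_image; case: Z.eq_dec => E1; first lia. case: Z.eq_dec => E2; first lia.
    rewrite Cmod_0 /=; ring.
  - case: (Z.le_gt_cases (Z.abs n) (Z.abs k + 1)) => Hn.
      apply: Rle_trans (HB n ltac:(lia)) (Rmax_r _ _).
    rewrite /cut_image; case: Z.eq_dec => E1; first lia. case: Z.eq_dec => E2; first lia.
    rewrite Cmod_0 /= Rmult_0_l; exact: Rmax_l.
Qed.

(** The truncations have unbounded norm while their images stay bounded. *)
Lemma T_not_bounded_below : ~ exists M, forall v, l2 v -> N2 v <= M * N2 (T v).
Proof.
  move=> [M HM].
  have A2 := pow2_ge_0 Ba.
  set C0 := 2 * N2 cut_image + 64 * Ba ^ 2.
  have P0 := N2_ge0 cut_image_l2.
  (* On the first half of a tent of length [2 (m + 1)] both the tent and [|f|] are at least 1/2, so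
     each squared term is at least 1/16. *)
  have [m Hm] := INR_unbounded (16 * (Rabs M * C0)).
  have Hm0 : (0 < 2 * S m)%nat by lia.
  have [R1 R2] := tent_rest_N2 Hm0.
  have HT : N2 (T (tentf k (2 * S m))) <= C0.
    have [_ L] := l2_plus cut_image_l2 R1.
    have E : (fun n => cut_image n + tent_rest (2 * S m) n)%C = T (tentf k (2 * S m)).
      apply: functional_extensionality => n; rewrite /tent_rest; ring.
    rewrite E in L; apply: Rle_trans L _; rewrite /C0.
    have : 32 * Ba ^ 2 / INR (2 * S m) <= 32 * Ba ^ 2.
      have I : 1 <= INR (2 * S m) by rewrite -INR_1; apply: le_INR; lia.
      apply: (Rmult_le_reg_r (INR (2 * S m))); first lra.
      have -> : 32 * Ba ^ 2 / INR (2 * S m) * INR (2 * S m) = 32 * Ba ^ 2 by field; lra. nra.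
    lra.
  have Lt := tentf_l2 Hm0.
  have T0 : 0 <= N2 (T (tentf k (2 * S m))) by apply: N2_ge0; exact: (Bop_l2 HBa HBb).
  have LB := zsum_lower k (S m) (fun n => sqr_pos (tentf k (2 * S m) n)) Lt.
  have LB2 : INR (S m) * (1 / 16) <= N2 (tentf k (2 * S m)).
    apply: Rle_trans LB; rewrite -Rsum_const; apply: Rsum_le => i Hi.
    rewrite /tentf Cmod_mult Cmod_R tent_ge; [|lia..].
    have -> : (k + Z.of_nat i - k)%Z = Z.of_nat i by lia.
    have [F1 _] := @Hf1 (k + Z.of_nat i)%Z ltac:(lia).
    have Q : 1 / 2 <= Rmax 0 (1 - IZR (Z.of_nat i) / INR (2 * S m)).
      apply: Rle_trans (Rmax_r _ _). rewrite -INR_IZR_INZ mult_INR (_ : INR 2 = 2) //.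
      have Hi' : INR i <= INR (S m) by apply: le_INR; lia.
      have Ps : 0 < INR (S m) by apply: lt_0_INR; lia.
      have : INR i / (2 * INR (S m)) <= 1 / 2; last lra.
      apply: (Rmult_le_reg_r (2 * INR (S m))); first lra.
      have -> : INR i / (2 * INR (S m)) * (2 * INR (S m)) = INR i by field; lra. lra.
    rewrite Rabs_pos_eq; last lra.
    set x := Rmax _ _ in Q *. 
    have : 1 / 4 <= x * Cmod (f (k + Z.of_nat i)%Z).
      apply: (Rle_trans _ (1 / 2 * (1 / 2))); [lra | apply: Rmult_le_compat; lra].
    nra.
  have := HM _ Lt; have MA := Rle_abs M.
  have : M * N2 (T (tentf k (2 * S m))) <= Rabs M * C0.
    apply: (Rle_trans _ (Rabs M * N2 (T (tentf k (2 * S m))))); first by apply: Rmult_le_compat_r.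
    apply: Rmult_le_compat_l => //; exact: Rabs_pos.
  have : INR m <= INR (S m) by apply: le_INR; lia.
  lra.
Qed.

End Tent.

(** * Density of the range *)

Section Density.
Variables (a b p : Z -> C) (lamh : C) (f : Z -> C) (Ba Bb : R) (N1 : Z).
Local Notation T := (Bop a b p lamh).
Hypothesis ane0 : forall n, a n <> RtoC 0.
Hypothesis HBa : forall n, Cmod (a n) <= Ba.
Hypothesis HBb : forall n, Cmod (b n + 2 * lamh * p n + lamh * lamh) <= Bb.
Hypothesis Hf : solves_B a b p lamh f.
Hypothesis Hf1 : forall n, (N1 <= n)%Z -> 1 / 2 <= Cmod (f n) <= 2.

Definition range_closure (g : Z -> C) : Prop :=
  l2 g /\ forall eps, 0 < eps -> exists u, l2 u /\ N2 (fun n => T u n - g n)%C < eps.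

Lemma range_closure_ext g g' : (forall n, g n = g' n) -> range_closure g -> range_closure g'.
Proof. by move=> H; have -> : g = g' by apply: functional_extensionality. Qed.

Lemma l2_T u : l2 u -> l2 (T u).
Proof. exact: (Bop_l2 HBa HBb). Qed.

Lemma range_closure_T u : l2 u -> range_closure (T u).
Proof.
  move=> Hu; split; first exact: l2_T.
  move=> e He; exists u; split => //.
  have -> : (fun n => T u n - T u n)%C = (fun n => 0 * T u n)%C by apply: functional_extensionality => n; ring.
  have [_ ->] := l2_scal 0 (l2_T Hu); rewrite Cmod_0 /= !Rmult_0_l; lra.
Qed.

Lemma range_closure_lim g : l2 g -> (forall eps, 0 < eps -> exists g', range_closure g' /\ N2 (fun n => g n - g' n)%C < eps) -> range_closure g.
Proof.
  move=> Hg H; split => // e He.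
  have [g' [[Hg' H1] H2]] := H (e / 4) ltac:(lra).
  have [u [Hu H3]] := H1 (e / 4) ltac:(lra).
  exists u; split => //.
  have D1 := l2_minus (l2_T Hu) Hg'. have D2 := l2_minus Hg' Hg.
  have [_ L] := l2_plus D1 D2.
  have E1 : (fun n => T u n - g' n + (g' n - g n))%C = (fun n => T u n - g n)%C by apply: functional_extensionality => n; ring.
  have E2 : N2 (fun n => g' n - g n)%C = N2 (fun n => g n - g' n)%C.
    rewrite /N2; congr zsum; apply: functional_extensionality => n; by rewrite Cmod_sub_sym.
  rewrite E1 E2 in L; lra.
Qed.

Lemma range_closure_plus g h : range_closure g -> range_closure h -> range_closure (fun n => g n + h n)%C.
Proof.
  move=> [Hg G] [Hh K]; have [Hgh _] := l2_plus Hg Hh; split => // e He.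
  have [u [Hu H1]] := G (e / 4) ltac:(lra). have [v [Hv H2]] := K (e / 4) ltac:(lra).
  have [Huv _] := l2_plus Hu Hv.
  exists (fun n => u n + v n)%C; split => //.
  have [_ L] := l2_plus (l2_minus (l2_T Hu) Hg) (l2_minus (l2_T Hv) Hh).
  have E : (fun n => T u n - g n + (T v n - h n))%C = (fun n => T (fun n => u n + v n)%C n - (g n + h n))%C.
    by apply: functional_extensionality => n; rewrite /Bop; ring.
  rewrite E in L; lra.
Qed.

Lemma range_closure_scal x g : range_closure g -> range_closure (fun n => x * g n)%C.
Proof.
  move=> [Hg G]; have [Hxg _] := l2_scal x Hg; split => // e He.
  have P := sqr_pos x.
  have He' : 0 < e / (Cmod x ^ 2 + 1) by apply: Rdiv_lt_0_compat; lra.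
  have [u [Hu H1]] := G _ He'.
  exists (fun n => x * u n)%C; split; first by have [] := l2_scal x Hu.
  have E : (fun n => T (fun n => x * u n)%C n - x * g n)%C = (fun n => x * (T u n - g n))%C.
    by apply: functional_extensionality => n; rewrite /Bop; ring.
  have D := l2_minus (l2_T Hu) Hg. have [_ L] := l2_scal x D.
  rewrite E L. have P2 := N2_ge0 D.
  apply: (Rle_lt_trans _ ((Cmod x ^ 2 + 1) * N2 (fun n => T u n - g n)%C)); first by apply: Rmult_le_compat_r; lra.
  have := Rmult_lt_compat_l (Cmod x ^ 2 + 1) _ _ ltac:(lra) H1.
  have -> : (Cmod x ^ 2 + 1) * (e / (Cmod x ^ 2 + 1)) = e by field; lra. lra.
Qed.

Definition delta (k n : Z) : C := if Z.eq_dec n k then RtoC 1 else RtoC 0.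

Lemma delta_same k : delta k k = RtoC 1.
Proof. by rewrite /delta; case: Z.eq_dec. Qed.

Lemma delta_diff k n : n <> k -> delta k n = RtoC 0.
Proof. by move=> H; rewrite /delta; case: Z.eq_dec. Qed.

Lemma delta_l2 k : l2 (delta k).
Proof.
  refine (proj1 (zfinite (k := k) (N := 1) (B := 1) _ _ _)) => n.
  - exact: sqr_pos.
  - move=> H; rewrite delta_diff ?Cmod_0 /=; [ring | lia].
  - rewrite /delta; case: Z.eq_dec => ?; rewrite /is_left ?Cmod_0 ?Cmod_1 /=; lra.
Qed.

(** The remainders of longer and longer tents tend to 0 in norm, so [cut_image] is a limit of
    images, its formal preimage being the non-summable cut-off of [f]. Division by [a (k - 1)] gives
    this combination. *)
Lemma range_closure_psi k : (N1 + 1 <= k)%Z -> range_closure (fun n => f k * delta (k - 1) n - f (k - 1)%Z * delta k n)%C.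
Proof.
  move=> Hk.
  have Hphi : range_closure (cut_image a f k).
    apply: (range_closure_lim (cut_image_l2 a f k)).
    move=> e He.
    have A2 := pow2_ge_0 Ba.
    have [m Hm] := INR_unbounded (32 * Ba ^ 2 / e).
    have Hm0 : (0 < S m)%nat by lia.
    exists (T (tentf f k (S m))); split; first by apply: range_closure_T; exact: (tentf_l2 Hf1 Hk Hm0).
    have [R1 R2] := tent_rest_N2 HBa Hf Hf1 Hk Hm0.
    have -> : N2 (fun n => cut_image a f k n - T (tentf f k (S m)) n)%C = N2 (tent_rest a b p lamh f k (S m)).
      rewrite /N2; congr zsum; apply: functional_extensionality => n; by rewrite /tent_rest Cmod_sub_sym.
    apply: Rle_lt_trans R2 _.
    have P : 0 < INR (S m) by apply: lt_0_INR; lia.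
    have Q : 32 * Ba ^ 2 / e < INR (S m) by apply: (Rlt_le_trans _ _ _ Hm); apply: le_INR; lia.
    apply: (Rmult_lt_reg_r (INR (S m))) => //.
    have -> : 32 * Ba ^ 2 / INR (S m) * INR (S m) = 32 * Ba ^ 2 / e * e by field; lra.
    rewrite Rmult_comm; exact: Rmult_lt_compat_l.
  have N := @ane0 (k - 1)%Z.
  apply: range_closure_ext (range_closure_scal (/ a (k - 1)%Z) Hphi) => n; rewrite /cut_image /delta.
  case: Z.eq_dec => E1; case: Z.eq_dec => E2; rewrite /is_left; try lia; field; exact: N.
Qed.

Lemma fne0 n : (N1 <= n)%Z -> f n <> RtoC 0.
Proof. exact: (f_neq0 Hf1). Qed.

(** Neighbouring combinations from [range_closure_psi] are rescaled so that the intermediate unit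
    vectors cancel. *)
Lemma range_closure_chain k j : (N1 <= k)%Z -> range_closure (fun n => f k / f (k + Z.of_nat j)%Z * delta (k + Z.of_nat j) n - delta k n)%C.
Proof.
  move=> Hk; elim: j => [|j IH].
    have Fk := fne0 Hk.
    apply: range_closure_ext (range_closure_scal 0 (range_closure_T (delta_l2 0))) => n; rewrite Z.add_0_r; field; exact: Fk.
  have F1 := @fne0 (k + Z.of_nat j)%Z ltac:(lia). have F2 := @fne0 (k + Z.of_nat (S j))%Z ltac:(lia).
  have := @range_closure_psi (k + Z.of_nat (S j)) ltac:(lia).
  have -> : (k + Z.of_nat (S j) - 1 = k + Z.of_nat j)%Z by lia.
  move=> /(range_closure_scal (- (f k / (f (k + Z.of_nat j)%Z * f (k + Z.of_nat (S j))%Z)))) Q.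
  apply: range_closure_ext (range_closure_plus IH Q) => n; field; split => //.
Qed.

(** Averaging the chain over [j < N] shows that [delta k] differs from an element of the closure by
    [1 / N] times the sum of [f k / f (k + j) * delta (k + j)]. These terms have disjoint supports
    and coefficients of modulus at most 4, so the squared norm of the average is at most
    [16 / N]. *)
Lemma range_closure_delta_far k : (N1 <= k)%Z -> range_closure (delta k).
Proof.
  move=> Hk.
  set y := fun N n => if Z_lt_dec n k then RtoC 0 else if Z_lt_dec n (k + Z.of_nat N) then (f k / f n)%C else RtoC 0.
  have S N : range_closure (fun n => y N n - RtoC (INR N) * delta k n)%C.
    elim: N => [|N IH].
      apply: range_closure_ext (range_closure_scal 0 (range_closure_T (delta_l2 0))) => n; rewrite /y.
      case: Z_lt_dec => H1; rewrite /is_left; first by rewrite /=; ring.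
      case: Z_lt_dec => H2; [lia | rewrite /=; ring].
    apply: range_closure_ext (range_closure_plus IH (range_closure_chain N Hk)) => n; rewrite S_INR RtoC_plus.
    suff -> : y (S N) n = (y N n + f k / f (k + Z.of_nat N)%Z * delta (k + Z.of_nat N) n)%C by ring.
    rewrite /y; case: (Z.eq_dec n (k + Z.of_nat N)) => E.
      rewrite E delta_same; case: Z_lt_dec => H1; first lia.
      case: Z_lt_dec => H2; last lia. case: Z_lt_dec => H3; first lia. rewrite /is_left; ring.
    rewrite (delta_diff E); case: Z_lt_dec => H1; rewrite /is_left; first ring.
    case: Z_lt_dec => H2; case: Z_lt_dec => H3; try lia; rewrite /is_left; ring.
  apply: range_closure_lim (delta_l2 k) _ => e He.
  have [m Hm] := INR_unbounded (16 / e).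
  have P : 0 < INR (Datatypes.S m) by apply: lt_0_INR; lia.
  have Q : 16 / e < INR (Datatypes.S m) by apply: (Rlt_le_trans _ _ _ Hm); apply: le_INR; lia.
  have Pc : RtoC (INR (Datatypes.S m)) <> RtoC 0 by apply: RtoC_neq0; lra.
  exists (fun n => - / RtoC (INR (Datatypes.S m)) * (y (Datatypes.S m) n - RtoC (INR (Datatypes.S m)) * delta k n))%C.
  split; first exact: range_closure_scal (S _).
  have -> : (fun n => delta k n - - / RtoC (INR (Datatypes.S m)) * (y (Datatypes.S m) n - RtoC (INR (Datatypes.S m)) * delta k n))%C
     = (fun n => / RtoC (INR (Datatypes.S m)) * y (Datatypes.S m) n)%C.
    apply: functional_extensionality => n; field; exact: Pc.
  have [Y1 Y2] : l2 (y (Datatypes.S m)) /\ N2 (y (Datatypes.S m)) <= INR (Datatypes.S m) * 16.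
    apply: (zfinite (k := k)) => n.
    - exact: sqr_pos.
    - rewrite /y => H; case: Z_lt_dec => H1; rewrite /is_left; first by rewrite Cmod_0 /=; ring.
      case: Z_lt_dec => H2; rewrite /is_left; [lia | by rewrite Cmod_0 /=; ring].
    - rewrite /y; case: Z_lt_dec => H1; rewrite /is_left; first by rewrite Cmod_0; lra.
      case: Z_lt_dec => H2; rewrite /is_left; last by rewrite Cmod_0; lra.
      have [F1 F2] := Hf1 Hk. have [F3 F4] := @Hf1 n ltac:(lia).
      rewrite Cmod_div; last by apply: fne0; lia.
      have : Cmod (f k) / Cmod (f n) <= 4.
        apply: (Rmult_le_reg_r (Cmod (f n))); first lra.
        have -> : Cmod (f k) / Cmod (f n) * Cmod (f n) = Cmod (f k) by field; lra. lra.
      have : 0 <= Cmod (f k) / Cmod (f n) by apply: Rle_mult_inv_pos; lra.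
      nra.
  have [_ ->] := l2_scal (/ RtoC (INR (Datatypes.S m))) Y1.
  rewrite Cmod_inv // Cmod_R Rabs_pos_eq; last lra.
  apply: (Rle_lt_trans _ ((/ INR (Datatypes.S m)) ^ 2 * (INR (Datatypes.S m) * 16))).
    apply: Rmult_le_compat_l => //; exact: pow2_ge_0.
  have -> : (/ INR (Datatypes.S m)) ^ 2 * (INR (Datatypes.S m) * 16) = 16 / INR (Datatypes.S m) by field; lra.
  apply: (Rmult_lt_reg_r (INR (Datatypes.S m))) => //.
  have -> : 16 / INR (Datatypes.S m) * INR (Datatypes.S m) = 16 / e * e by field; lra.
  rewrite Rmult_comm; exact: Rmult_lt_compat_l.
Qed.

(** To the left of [N1] no bounds on [f] are available. There the image of [delta k], which involves
    only the sites [k - 1], [k] and [k + 1], is solved for [delta (k - 1)]. *)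
Lemma range_closure_delta m : range_closure (delta m).
Proof.
  have back k : range_closure (delta k) -> range_closure (delta (k + 1)) -> range_closure (delta (k - 1)).
    move=> H1 H2.
    have Na := @ane0 (k - 1)%Z.
    have H3 := range_closure_plus (range_closure_T (delta_l2 k)) (range_closure_plus (range_closure_scal (- a k) H2) (range_closure_scal (- (b k + 2 * lamh * p k + lamh * lamh)) H1)).
    apply: range_closure_ext (range_closure_scal (/ a (k - 1)%Z) H3) => n; rewrite /Bop /delta.
    case: (Z.eq_dec n (k - 1)) => E; rewrite /is_left.
      subst n; case: Z.eq_dec => E1; last lia. case: Z.eq_dec => E2; first lia.
      case: Z.eq_dec => E3; first lia. case: Z.eq_dec => E4; first lia. rewrite /is_left; field; exact: Na.
    case: Z.eq_dec => E1; first lia.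
    case: (Z.eq_dec n k) => E2.
      subst n; case: Z.eq_dec => E3; first lia. case: Z.eq_dec => E4; first lia. rewrite /is_left; field; exact: Na.
    case: Z.eq_dec => E3; case: Z.eq_dec => E4; try lia; rewrite /is_left; last by field; exact: Na.
    have -> : n = (k + 1)%Z by lia. rewrite Z.add_simpl_r. field; exact: Na.
  have both r : range_closure (delta (N1 - Z.of_nat r)) /\ range_closure (delta (N1 - Z.of_nat r + 1)).
    elim: r => [|r [I1 I2]]; first by split; apply: range_closure_delta_far; lia.
    have -> : (N1 - Z.of_nat (S r) = N1 - Z.of_nat r - 1)%Z by lia.
    rewrite Z.sub_add; split => //; exact: back.
  case: (Z.le_gt_cases N1 m) => H; first exact: range_closure_delta_far.
  have -> : m = (N1 - Z.of_nat (Z.to_nat (N1 - m)))%Z by lia.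
  exact: proj1 (both _).
Qed.

Lemma T_dense_range g : l2 g -> range_closure g.
Proof.
  move=> Hg.
  set y := fun N n => if Z_lt_dec n (- Z.of_nat N) then RtoC 0 else if Z_lt_dec n (Z.of_nat N) then g n else RtoC 0.
  have Y N : range_closure (y N).
    elim: N => [|N IH].
      apply: range_closure_ext (range_closure_scal 0 (range_closure_T (delta_l2 0))) => n; rewrite /y.
      by case: Z_lt_dec => H1; rewrite /is_left; ring.
    have D := range_closure_plus IH (range_closure_plus (range_closure_scal (g (Z.of_nat N)) (range_closure_delta (Z.of_nat N)))
          (range_closure_scal (g (- Z.of_nat N - 1)%Z) (range_closure_delta (- Z.of_nat N - 1)))).
    apply: range_closure_ext D => n; rewrite /y /delta.
    case: (Z.eq_dec n (Z.of_nat N)) => [E1 | E1].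
      subst n; repeat (case: Z_lt_dec => ?; try lia). case: Z.eq_dec => ?; first lia. rewrite /is_left; ring.
    case: (Z.eq_dec n (- Z.of_nat N - 1)) => [E2 | E2].
      subst n; repeat (case: Z_lt_dec => ?; try lia). rewrite /is_left; ring.
    repeat (case: Z_lt_dec => ?; try lia); rewrite /is_left; ring.
  apply: (range_closure_lim Hg) => e He.
  have [M1 T1] := series_tail_small (fun k => sqr_pos (g (Z.of_nat k))) (proj1 Hg) (ltac:(lra) : 0 < e / 2).
  have [M2 T2] := series_tail_small (fun k => sqr_pos (g (- Z.of_nat k - 1)%Z)) (proj2 Hg) (ltac:(lra) : 0 < e / 2).
  set N := (M1 + M2)%nat.
  exists (y N); split; first exact: Y.
  have E1 : Series (fun k => Cmod (g (Z.of_nat k) - y N (Z.of_nat k)) ^ 2) = Series (fun k => Cmod (g (Z.of_nat (N + k))) ^ 2).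
    rewrite (@Series_incr_n_aux _ N).
      apply: Series_ext => k; rewrite /y; repeat (case: Z_lt_dec => ?; try lia); rewrite /is_left /Cminus Copp_0 Cplus_0_r //.
    move=> k Hk; rewrite /y; repeat (case: Z_lt_dec => ?; try lia); rewrite /is_left /Cminus Cplus_opp_r Cmod_0 /=; ring.
  have E2 : Series (fun k => Cmod (g (- Z.of_nat k - 1)%Z - y N (- Z.of_nat k - 1)%Z) ^ 2) = Series (fun k => Cmod (g (- Z.of_nat (N + k) - 1)%Z) ^ 2).
    rewrite (@Series_incr_n_aux _ N).
      apply: Series_ext => k; rewrite /y; repeat (case: Z_lt_dec => ?; try lia); rewrite /is_left /Cminus Copp_0 Cplus_0_r //.
    move=> k Hk; rewrite /y; repeat (case: Z_lt_dec => ?; try lia); rewrite /is_left /Cminus Cplus_opp_r Cmod_0 /=; ring.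
  rewrite /N2 /zsum E1 E2.
  have := T1 N ltac:(lia). have := T2 N ltac:(lia). lra.
Qed.

End Density.

(** * The operator is bounded below off the continuous spectrum *)

(** Shift invariance of [zsum] turns a one-step estimate into a global one: a first-order difference
    operator whose coefficient has modulus [rho < 1] is bounded below, whichever direction [s] the
    step takes. *)
Lemma contraction_bound (s : Z) rho (x y : Z -> C) : 0 <= rho < 1 -> l2 x -> l2 y ->
  (forall n, Cmod (x (n + s)%Z) <= Cmod (y n) + rho * Cmod (x n)) -> N2 x <= / (1 - rho) ^ 2 * N2 y.
Proof.
  move=> Hr Hx Hy H.
  have Hi : 0 < / (1 - rho) by apply: Rinv_0_lt_compat; lra.
  (* convexity: (A + rho B)^2 <= A^2 / (1 - rho) + rho B^2 *)
  have B n : 0 <= Cmod (x (n + s)%Z) ^ 2 <= / (1 - rho) * Cmod (y n) ^ 2 + rho * Cmod (x n) ^ 2.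
    split; first exact: sqr_pos.
    apply: (Rle_trans _ ((Cmod (y n) + rho * Cmod (x n)) ^ 2)).
      apply: pow_incr; split => //; exact: Cmod_ge_0.
    set A := Cmod (y n); set D := Cmod (x n).
    have E : / (1 - rho) * A ^ 2 + rho * D ^ 2 - (A + rho * D) ^ 2 = / (1 - rho) * (rho * (A - (1 - rho) * D) ^ 2) by field; lra.
    have : 0 <= / (1 - rho) * (rho * (A - (1 - rho) * D) ^ 2).
      apply: Rmult_le_pos; first lra. apply: Rmult_le_pos; [lra | exact: pow2_ge_0].
    lra.
  have Z1 := zex_scal (/ (1 - rho)) Hy. have Z2 := zex_scal rho Hx.
  have := zsum_le B (zex_plus Z1 Z2).
  rewrite (zsum_plus Z1 Z2) !zsum_scal.
  have [_ ->] := zshift s Hx; rewrite -/(N2 x) -/(N2 y) => L.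
  have -> : / (1 - rho) ^ 2 * N2 y = / (1 - rho) * (/ (1 - rho) * N2 y) by field; lra.
  apply: (Rmult_le_reg_l (1 - rho)); first lra.
  have -> : (1 - rho) * (/ (1 - rho) * (/ (1 - rho) * N2 y)) = / (1 - rho) * N2 y by field; lra.
  lra.
Qed.

Section BoundedBelow.
Variables (a b p : Z -> C) (lamh w : C) (f g : Z -> C) (Ba Bb : R).
Local Notation T := (Bop a b p lamh).
Hypothesis ane0 : forall n, a n <> RtoC 0.
Hypothesis HBa : forall n, Cmod (a n) <= Ba.
Hypothesis HBb : forall n, Cmod (b n + 2 * lamh * p n + lamh * lamh) <= Bb.
Hypothesis Hf : solves_B a b p lamh f.
Hypothesis Hg : solves_B a b p lamh g.
Hypothesis HW : Wr a g f 0 <> RtoC 0.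
Hypothesis Sf : summable (fun k => f (Z.of_nat k)).
Hypothesis Sg : summable (fun k => g (- Z.of_nat k)%Z).

Lemma summable_tends0 (u : nat -> C) : summable u -> Ctends eventually u (RtoC 0).
Proof.
  move=> /ex_series_lim_0 L e He; move/is_lim_seq_spec: L => /(_ (mkposreal _ He)) [M HM]; exists M => n Hn.
  have := HM n Hn; rewrite Rminus_0_r Rabs_pos_eq; last exact: Cmod_ge_0.
  by have -> : (u n - 0 = u n)%C by ring.
Qed.

(** Summing the Lagrange identity over [k >= 1] writes the Wronskian at 0 as minus the sum of
    [f k * T v k]; the boundary term disappears because [f] tends to 0 and [v] is bounded. Each
    [|T v k|] is at most the norm of [T v], so absolute summability of [f] suffices. *)
Lemma Wr_bound_plus v : l2 v -> Cmod (Wr a f v 0) <= sqrt (N2 (T v)) * Series (fun k => Cmod (f (Z.of_nat k))).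
Proof.
  move=> Hv; have HT := Bop_l2 HBa HBb Hv.
  set G := sqrt (N2 (T v)).
  have G0 : 0 <= G := sqrt_pos _.
  have step k : Wr a f v (Z.of_nat (S k)) = (Wr a f v (Z.of_nat k) + f (Z.of_nat (S k)) * T v (Z.of_nat (S k)))%C.
    have := Wr_step a b p lamh f v (Z.of_nat (S k)).
    have -> : Bop a b p lamh f (Z.of_nat (S k)) = RtoC 0 by exact: Hf.
    have -> : (Z.of_nat (S k) - 1 = Z.of_nat k)%Z by lia.
    rewrite Cmult_0_l => E.
    have -> : Wr a f v (Z.of_nat (S k)) = ((Wr a f v (Z.of_nat (S k)) - Wr a f v (Z.of_nat k)) + Wr a f v (Z.of_nat k))%C by ring.
    rewrite E; ring.
  have B M : Cmod (Wr a f v 0) <= Cmod (Wr a f v (Z.of_nat M)) + G * (Rsum (fun k => Cmod (f (Z.of_nat k))) (S M)).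
    elim: M => [|M IH].
      have := Rmult_le_pos _ _ G0 (Rsum_pos 1 (fun k => Cmod_ge_0 (f (Z.of_nat k)))).
      change (Z.of_nat 0) with 0%Z; lra.
    have E : Wr a f v (Z.of_nat M) = (Wr a f v (Z.of_nat (S M)) - f (Z.of_nat (S M)) * T v (Z.of_nat (S M)))%C.
      rewrite step; ring.
    have L : Cmod (Wr a f v (Z.of_nat M)) <= Cmod (Wr a f v (Z.of_nat (S M))) + G * Cmod (f (Z.of_nat (S M))).
      rewrite {1}E; apply: Rle_trans (Cmod_triang_sub _ _) _; apply: Rplus_le_compat_l.
      rewrite Cmod_mult Rmult_comm; apply: Rmult_le_compat_r; [exact: Cmod_ge_0 | exact: N2_term].
    have -> : Rsum (fun k => Cmod (f (Z.of_nat k))) (S (S M)) = Rsum (fun k => Cmod (f (Z.of_nat k))) (S M) + Cmod (f (Z.of_nat (S M))) by [].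
    lra.
  have Lf := summable_tends0 Sf.
  have Lf1 : Ctends eventually (fun k => f (Z.of_nat k + 1)%Z) (RtoC 0).
    refine (Ctends_ext _ (summable_tends0 (proj2 (summable_S _) Sf))) => k; congr f; lia.
  have Bv n : Cmod (v n) <= sqrt (N2 v) := N2_term n Hv.
  have LW : Ctends eventually (fun k => Wr a f v (Z.of_nat k)) (RtoC 0).
    have L1 : Ctends eventually (fun k => a (Z.of_nat k) * v (Z.of_nat k + 1)%Z * f (Z.of_nat k))%C (RtoC 0).
      apply: (Ctends_bmult (B := Ba * sqrt (N2 v))) Lf; apply: filter_forall => k; rewrite Cmod_mult.
      apply: Rmult_le_compat; [exact: Cmod_ge_0 | exact: Cmod_ge_0 | exact: HBa | exact: Bv].
    have L2 : Ctends eventually (fun k => a (Z.of_nat k) * v (Z.of_nat k) * f (Z.of_nat k + 1)%Z)%C (RtoC 0).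
      apply: (Ctends_bmult (B := Ba * sqrt (N2 v))) Lf1; apply: filter_forall => k; rewrite Cmod_mult.
      apply: Rmult_le_compat; [exact: Cmod_ge_0 | exact: Cmod_ge_0 | exact: HBa | exact: Bv].
    pose proof (Ctends_minus L1 L2) as L3.
    have E : (0 - 0 = 0)%C by ring. rewrite E in L3.
    refine (Ctends_ext _ L3) => k; rewrite /Wr; ring.
  apply: le_epsilon => e He.
  have [M HM] := LW e He.
  have := HM M (le_n M); have -> : (Wr a f v (Z.of_nat M) - 0 = Wr a f v (Z.of_nat M))%C by ring.
  have R1 := Rsum_le_Series (S M) (fun k => Cmod_ge_0 (f (Z.of_nat k))) Sf.
  have R2 := Rmult_le_compat_l _ _ _ G0 R1.
  have := B M; lra.
Qed.

End BoundedBelow.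

Section BoundedBelow2.
Variables (a b p : Z -> C) (lamh w : C) (f g : Z -> C) (Ba Bb : R).
Local Notation T := (Bop a b p lamh).
Hypothesis ane0 : forall n, a n <> RtoC 0.
Hypothesis HBa : forall n, Cmod (a n) <= Ba.
Hypothesis HBb : forall n, Cmod (b n + 2 * lamh * p n + lamh * lamh) <= Bb.
Hypothesis Hf : solves_B a b p lamh f.
Hypothesis Hg : solves_B a b p lamh g.
Hypothesis HW : Wr a g f 0 <> RtoC 0.
Hypothesis Sf : summable (fun k => f (Z.of_nat k)).
Hypothesis Sg : summable (fun k => g (- Z.of_nat k)%Z).

Lemma refl_a_bound n : Cmod (refl_a a n) <= Ba.
Proof. exact: HBa. Qed.

Lemma zsum_refl u : zex u -> zex (fun n => u (- n)%Z) /\ zsum (fun n => u (- n)%Z) = zsum u.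
Proof.
  move=> Hu; have [[S1 S2] E] := zshift 1 Hu.
  have E1 : ex_series (fun k => u (- Z.of_nat k)%Z) by apply: ex_series_ext S2 => k; congr u; lia.
  have E2 : ex_series (fun k => u (- (- Z.of_nat k - 1))%Z) by apply: ex_series_ext S1 => k; congr u; lia.
  split => //; rewrite -E /zsum Rplus_comm; congr (_ + _); apply: Series_ext => k; congr u; lia.
Qed.

Lemma Bop_refl v n : Bop (refl_a a) (refl b) (refl p) lamh (fun n => v (- n)%Z) n = T v (- n).
Proof.
  rewrite /Bop /refl_a /refl.
  have -> : (- (n + 1) = - n - 1)%Z by lia.
  have -> : (- (n - 1) - 1 = - n)%Z by lia. have -> : (- (n - 1) = - n + 1)%Z by lia. ring.
Qed.

(** Reflection turns the Wronskian at -1 into one at 0, up to sign. One more step of the Lagrange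
    identity leads from -1 to 0 and accounts for the additional [Cmod (g 0)]. *)
Lemma Wr_bound_minus v : l2 v -> exists C0, 0 <= C0 /\ forall v, l2 v -> Cmod (Wr a g v 0) <= C0 * sqrt (N2 (T v)).
Proof.
  move=> _.
  set C0 := Series (fun k => Cmod (g (- Z.of_nat k)%Z)).
  have P0 : 0 <= C0 by apply: Series_ge0 Sg => k; exact: Cmod_ge_0.
  exists (Cmod (g 0%Z) + C0); split; first by have := Cmod_ge_0 (g 0%Z); lra.
  move=> u Hu.
  have Hu' : l2 (fun n => u (- n)%Z) by exact: (proj1 (zsum_refl Hu)).
  have HBb' n : Cmod (refl b n + 2 * lamh * refl p n + lamh * lamh) <= Bb by exact: HBb.
  have HT := Bop_l2 HBa HBb Hu.
  have := Wr_bound_plus refl_a_bound HBb' (refl_solves_conv Hg) Sg Hu'.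
  have -> : N2 (Bop (refl_a a) (refl b) (refl p) lamh (fun n => u (- n)%Z)) = N2 (T u).
    rewrite /N2 -(proj2 (zsum_refl HT)); congr zsum; apply: functional_extensionality => n; by rewrite Bop_refl.
  have -> : Wr (refl_a a) (fun n => g (- n)%Z) (fun n => u (- n)%Z) 0 = (- Wr a g u (-1))%C.
    rewrite /Wr /refl_a /=; ring.
  rewrite Cmod_opp -/C0 => L.
  have := Wr_step a b p lamh g u 0.
  have -> : Bop a b p lamh g 0 = RtoC 0 by exact: Hg.
  move=> E.
  have -> : Wr a g u 0 = (g 0%Z * T u 0 + Wr a g u (-1))%C.
    have -> : Wr a g u 0 = ((Wr a g u 0 - Wr a g u (0 - 1)) + Wr a g u (0 - 1))%C by ring.
    rewrite E /=; ring.
  apply: Rle_trans (Cmod_triangle _ _) _; rewrite Cmod_mult.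
  have := Rmult_le_compat_l _ _ _ (Cmod_ge_0 (g 0%Z)) (N2_term 0 HT). lra.
Qed.

Definition coord_bounded (n : Z) : Prop :=
  exists C0, 0 <= C0 /\ forall v, l2 v -> Cmod (v n) <= C0 * sqrt (N2 (T v)).

(** Cramer's rule: the Wronskians of [v] with [f] and [g] at 0 are two linear equations for [v 0]
    and [v 1], solvable because [Wr a g f 0] is not zero, and both are bounded by the norm of
    [T v]. *)
Lemma coord_0_1 : coord_bounded 0 /\ coord_bounded 1.
Proof.
  have Z0 : l2 (fun _ => RtoC 0).
    have [] := @zfinite (fun n => Cmod (RtoC 0) ^ 2) 0 0 0 => // n; rewrite ?Cmod_0 /=; lra.
  have [Cm [Cm0 HCm]] := Wr_bound_minus Z0.
  set Cp := Series (fun k => Cmod (f (Z.of_nat k))).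
  have Cp0 : 0 <= Cp by apply: Series_ge0 Sf => k; exact: Cmod_ge_0.
  have HCp v : l2 v -> Cmod (Wr a f v 0) <= Cp * sqrt (N2 (T v)).
    move=> Hv; rewrite Rmult_comm; exact: (Wr_bound_plus HBa HBb Hf Sf Hv).
  have PW := proj1 (Cmod_gt_0 _) HW.
  have gen (x y u : C) v : l2 v -> u = (/ Wr a g f 0 * (x * Wr a g v 0 - y * Wr a f v 0))%C ->
     Cmod u <= / Cmod (Wr a g f 0) * (Cmod x * Cm + Cmod y * Cp) * sqrt (N2 (T v)).
    move=> Hv ->; rewrite Cmod_mult Cmod_inv // Rmult_assoc; apply: Rmult_le_compat_l.
      left; exact: Rinv_0_lt_compat.
    apply: Rle_trans (Cmod_triang_sub _ _) _; rewrite (Cmod_mult x) (Cmod_mult y).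
    have := Rmult_le_compat_l _ _ _ (Cmod_ge_0 x) (HCm v Hv).
    have := Rmult_le_compat_l _ _ _ (Cmod_ge_0 y) (HCp v Hv). lra.
  have pos x y : 0 <= / Cmod (Wr a g f 0) * (Cmod x * Cm + Cmod y * Cp).
    apply: Rmult_le_pos; first by left; exact: Rinv_0_lt_compat.
    have := Rmult_le_pos _ _ (Cmod_ge_0 x) Cm0; have := Rmult_le_pos _ _ (Cmod_ge_0 y) Cp0; lra.
  have Na := @ane0 0%Z.
  have ND : (g 0%Z * f 1%Z - g 1%Z * f 0%Z)%C <> RtoC 0.
    move=> E; apply: HW; by rewrite /Wr [(0 + 1)%Z]/= E Cmult_0_r.
  split.
  - exists (/ Cmod (Wr a g f 0) * (Cmod (f 0%Z) * Cm + Cmod (g 0%Z) * Cp)); split => // v Hv.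
    apply: gen => //; rewrite /Wr /=; field; split => //.
  - exists (/ Cmod (Wr a g f 0) * (Cmod (f 1%Z) * Cm + Cmod (g 1%Z) * Cp)); split => // v Hv.
    apply: gen => //; rewrite /Wr /=; field; split => //.
Qed.

(** The expression for [T v k] is solved for the outer neighbour on either side. The constants
    depend on [n], so this is of use for finitely many coordinates at a time. *)
Lemma coord_all n : coord_bounded n.
Proof.
  have TB v m : l2 v -> Cmod (T v m) <= sqrt (N2 (T v)).
    move=> Hv; apply: N2_term; exact: (Bop_l2 HBa HBb Hv).
  have next k : coord_bounded (k - 1) -> coord_bounded k -> coord_bounded (k + 1).
    move=> [C1 [P1 H1]] [C2 [P2 H2]].
    set be := (b k + 2 * lamh * p k + lamh * lamh)%C.
    have PA := proj1 (Cmod_gt_0 _) (@ane0 k).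
    have Q1 := Rmult_le_pos _ _ (Cmod_ge_0 (a (k - 1)%Z)) P1.
    have Q2 := Rmult_le_pos _ _ (Cmod_ge_0 be) P2.
    exists (/ Cmod (a k) * (1 + Cmod (a (k - 1)%Z) * C1 + Cmod be * C2)); split.
      apply: Rmult_le_pos; [left; exact: Rinv_0_lt_compat | lra].
    move=> v Hv.
    have -> : v (k + 1)%Z = (/ a k * (T v k - a (k - 1)%Z * v (k - 1)%Z - be * v k))%C.
      rewrite /Bop /be; field; exact: ane0.
    rewrite Cmod_mult Cmod_inv // Rmult_assoc; apply: Rmult_le_compat_l; first by left; exact: Rinv_0_lt_compat.
    apply: Rle_trans (Cmod_triang_sub _ _) _.
    have := Cmod_triang_sub (T v k) (a (k - 1)%Z * v (k - 1)%Z).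
    rewrite (Cmod_mult (a _)) (Cmod_mult be).
    have := TB v k Hv.
    have := Rmult_le_compat_l _ _ _ (Cmod_ge_0 (a (k - 1)%Z)) (H1 v Hv).
    have := Rmult_le_compat_l _ _ _ (Cmod_ge_0 be) (H2 v Hv). lra.
  have prev k : coord_bounded k -> coord_bounded (k + 1) -> coord_bounded (k - 1).
    move=> [C1 [P1 H1]] [C2 [P2 H2]].
    set be := (b k + 2 * lamh * p k + lamh * lamh)%C.
    have PA := proj1 (Cmod_gt_0 _) (@ane0 (k - 1)%Z).
    have Q1 := Rmult_le_pos _ _ (Cmod_ge_0 (a k)) P2.
    have Q2 := Rmult_le_pos _ _ (Cmod_ge_0 be) P1.
    exists (/ Cmod (a (k - 1)%Z) * (1 + Cmod (a k) * C2 + Cmod be * C1)); split.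
      apply: Rmult_le_pos; [left; exact: Rinv_0_lt_compat | lra].
    move=> v Hv.
    have -> : v (k - 1)%Z = (/ a (k - 1)%Z * (T v k - a k * v (k + 1)%Z - be * v k))%C.
      rewrite /Bop /be; field; exact: ane0.
    rewrite Cmod_mult Cmod_inv // Rmult_assoc; apply: Rmult_le_compat_l; first by left; exact: Rinv_0_lt_compat.
    apply: Rle_trans (Cmod_triang_sub _ _) _.
    have := Cmod_triang_sub (T v k) (a k * v (k + 1)%Z).
    rewrite (Cmod_mult (a _)) (Cmod_mult be).
    have := TB v k Hv.
    have := Rmult_le_compat_l _ _ _ (Cmod_ge_0 (a k)) (H2 v Hv).
    have := Rmult_le_compat_l _ _ _ (Cmod_ge_0 be) (H1 v Hv). lra.
  have [c0 c1] := coord_0_1.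
  have up k : coord_bounded (Z.of_nat k) /\ coord_bounded (Z.of_nat k + 1).
    elim: k => [|k [I1 I2]] //.
    have -> : Z.of_nat (S k) = (Z.of_nat k + 1)%Z by lia.
    split => //; apply: next => //; by rewrite Z.add_simpl_r.
  have down k : coord_bounded (- Z.of_nat k) /\ coord_bounded (- Z.of_nat k + 1).
    elim: k => [|k [I1 I2]] //.
    have -> : (- Z.of_nat (S k) = - Z.of_nat k - 1)%Z by lia.
    rewrite Z.sub_add; split => //; exact: prev.
  case: (Z.le_gt_cases 0 n) => Hn.
  - have -> : n = Z.of_nat (Z.to_nat n) by lia. exact: proj1 (up _).
  - have -> : n = (- Z.of_nat (Z.to_nat (- n)))%Z by lia. exact: proj1 (down _).
Qed.

Hypothesis Hw0 : w <> RtoC 0.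
Hypothesis Hw1 : Cmod w < 1.
Hypothesis Hlam : lamh = (w + / w)%C.
Definition dev (n : Z) : R := Cmod (1 - a n) + Cmod (1 - a (n - 1)%Z) + Cmod (b n + 2 + 2 * lamh * p n).
Hypothesis Hdev : forall e, 0 < e -> exists N, forall n, (N <= Z.abs n)%Z -> dev n < e.

(** The free operator, with [a = 1], [b = -2] and [p = 0]: its diagonal entry [lamh^2 - 2] equals
    [w^2 + 1 / w^2]. *)
Definition T0 (v : Z -> C) (n : Z) : C := (v (n + 1)%Z + v (n - 1)%Z + (w * w + / w * / w) * v n)%C.

(** [T0] factors as [v |-> y |-> y n + y (n - 1) / w^2] with [y n = v (n + 1) + w^2 v n]. *)
Lemma T0_bounded_below : exists C0, 0 < C0 /\ forall v, l2 v -> l2 (T0 v) -> N2 v <= C0 * N2 (T0 v).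
Proof.
  set rho := Cmod (w * w).
  have P := Cmod_ge_0 w.
  have Hr : 0 <= rho < 1 by rewrite /rho Cmod_mult; split; nra.
  have Hi : 0 < / (1 - rho) ^ 2 by apply: Rinv_0_lt_compat; apply: pow_lt; lra.
  exists (/ (1 - rho) ^ 2 * / (1 - rho) ^ 2); split; first by apply: Rmult_lt_0_compat.
  move=> v Hv HT.
  set y := fun n => (v (n + 1)%Z + (w * w) * v n)%C.
  have Hy : l2 y.
    have [S1 _] := zshift1 Hv. have [S2 _] := l2_scal (w * w)%C Hv.
    exact: (proj1 (l2_plus (u := fun n => v (n + 1)%Z) S1 S2)).
  have L1 : N2 v <= / (1 - rho) ^ 2 * N2 y.
    apply: (@contraction_bound 1 rho) => // n.
    have -> : v (n + 1)%Z = (y n - w * w * v n)%C by rewrite /y; ring.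
    apply: Rle_trans (Cmod_triang_sub _ _) _; rewrite (Cmod_mult (w * w)); exact: Rle_refl.
  have L2 : N2 y <= / (1 - rho) ^ 2 * N2 (T0 v).
    apply: (@contraction_bound (-1) rho) => // n.
    have -> : (n + -1 = n - 1)%Z by lia.
    have -> : y (n - 1)%Z = (w * w * T0 v n - w * w * y n)%C.
      rewrite /y /T0 Z.sub_add; field; exact: Hw0.
    apply: Rle_trans (Cmod_triang_sub _ _) _; rewrite !(Cmod_mult (w * w)) -/rho.
    have := Cmod_ge_0 (T0 v n); nra.
  rewrite Rmult_assoc; apply: Rle_trans L1 _; apply: Rmult_le_compat_l => //; lra.
Qed.

Lemma sqr_le_mult (x y z : R) : 0 <= x -> 0 <= y -> 0 <= z -> (x + y + z) ^ 2 <= 3 * (x ^ 2 + y ^ 2 + z ^ 2).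
Proof.
  move=> _ _ _; have := pow2_ge_0 (x - y); have := pow2_ge_0 (x - z); have := pow2_ge_0 (y - z). lra.
Qed.

(** [T0 v] is [T v] plus a perturbation which is small relative to [v] far out and, on the remaining
    finitely many sites, controlled by [T v] through [coord_all]. The small part is absorbed on the
    left. *)
Lemma T_bounded_below : exists M, forall v, l2 v -> N2 v <= M * N2 (T v).
Proof.
  have [C0 [C0p HC0]] := T0_bounded_below.
  (* [sqr_le_mult] gives a factor 3, the three shifted copies of [N2 v] another 3, and [l2_plus] a
     2, so that [C0 * 18 e = 1/2] of [N2 v] is left to absorb. *)
  set e := / (36 * C0).
  have He : 0 < e by apply: Rinv_0_lt_compat; lra.
  (* The minimum with 1 makes the square of [dev] at most [dev], hence below [e]. *)
  have He2 : 0 < Rmin 1 e by apply: Rmin_pos; lra.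
  have [N HN] := Hdev He2.
  set N' := Z.to_nat N.
  have PT v : l2 v -> 0 <= N2 (T v) by move=> Hv; apply: N2_ge0; exact: (Bop_l2 HBa HBb Hv).
  have sq v : l2 v -> sqrt (N2 (T v)) ^ 2 = N2 (T v) by move=> Hv; rewrite /= Rmult_1_r sqrt_sqrt //; exact: PT.
  have ex n : exists F, 0 <= F /\ forall v, l2 v -> Cmod (v n) ^ 2 <= F * N2 (T v).
    have [Cn [Pn Hn]] := coord_all n; exists (Cn ^ 2); split; first exact: pow2_ge_0.
    move=> v Hv; rewrite -(sq v Hv) -Rpow_mult_distr; apply: pow_incr; split; [exact: Cmod_ge_0 | exact: Hn].
  (* Choosing the constants as a function of the site allows their maximum over a finite range to be
     taken. *)
  pose F n := proj1_sig (ClassicalEpsilon.constructive_indefinite_description _ (ex n)).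
  have HF n : 0 <= F n /\ forall v, l2 v -> Cmod (v n) ^ 2 <= F n * N2 (T v).
    exact: (proj2_sig (ClassicalEpsilon.constructive_indefinite_description _ (ex n))).
  set D := fun n => 3 * dev n ^ 2 * (F (n + 1)%Z + F (n - 1)%Z + F n).
  have D0 n : 0 <= D n.
    rewrite /D; have := pow2_ge_0 (dev n); have := proj1 (HF (n + 1)%Z); have := proj1 (HF (n - 1)%Z); have := proj1 (HF n).
    move=> A1 A2 A3 A4; apply: Rmult_le_pos; lra.
  have [B HB] := Z_bounded D N'.
  have B0 : 0 <= B by apply: Rle_trans (D0 0%Z) (HB 0%Z _); lia.
  set K := INR (2 * N' + 1) * B.
  exists (2 * (C0 * (2 + 2 * K))) => v Hv.
  have HT := Bop_l2 HBa HBb Hv.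
  set G := N2 (T v). have G0 : 0 <= G := PT v Hv.
  set d := fun n => (T0 v n - T v n)%C.
  have dE n : d n = ((1 - a n) * v (n + 1)%Z + (1 - a (n - 1)%Z) * v (n - 1)%Z - (b n + 2 + 2 * lamh * p n) * v n)%C.
    rewrite /d /T0 /Bop Hlam; field; exact: Hw0.
  have dev0 n : 0 <= dev n.
    rewrite /dev; have := Cmod_ge_0 (1 - a n); have := Cmod_ge_0 (1 - a (n - 1)%Z); have := Cmod_ge_0 (b n + 2 + 2 * lamh * p n); lra.
  have dB n : Cmod (d n) ^ 2 <= 3 * dev n ^ 2 * (Cmod (v (n + 1)%Z) ^ 2 + Cmod (v (n - 1)%Z) ^ 2 + Cmod (v n) ^ 2).
    apply: (Rle_trans _ ((dev n * Cmod (v (n + 1)%Z) + dev n * Cmod (v (n - 1)%Z) + dev n * Cmod (v n)) ^ 2)).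
      apply: pow_incr; split; first exact: Cmod_ge_0.
      rewrite dE; apply: Rle_trans (Cmod_triang_sub _ _) _.
      have := Cmod_triangle ((1 - a n) * v (n + 1)%Z) ((1 - a (n - 1)%Z) * v (n - 1)%Z).
      rewrite (Cmod_mult (1 - a n)) (Cmod_mult (1 - a (n - 1)%Z)) (Cmod_mult (b n + 2 + 2 * lamh * p n)).
      have X1 := Cmod_ge_0 (1 - a n); have X2 := Cmod_ge_0 (1 - a (n - 1)%Z); have X3 := Cmod_ge_0 (b n + 2 + 2 * lamh * p n).
      have Y1 : Cmod (1 - a n) <= dev n by rewrite /dev; lra.
      have Y2 : Cmod (1 - a (n - 1)%Z) <= dev n by rewrite /dev; lra.
      have Y3 : Cmod (b n + 2 + 2 * lamh * p n) <= dev n by rewrite /dev; lra.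
      have := Rmult_le_compat_r _ _ _ (Cmod_ge_0 (v (n + 1)%Z)) Y1.
      have := Rmult_le_compat_r _ _ _ (Cmod_ge_0 (v (n - 1)%Z)) Y2.
      have := Rmult_le_compat_r _ _ _ (Cmod_ge_0 (v n)) Y3. lra.
    have := @sqr_le_mult (dev n * Cmod (v (n + 1)%Z)) (dev n * Cmod (v (n - 1)%Z)) (dev n * Cmod (v n))
      ltac:(apply: Rmult_le_pos => //; exact: Cmod_ge_0) ltac:(apply: Rmult_le_pos => //; exact: Cmod_ge_0) ltac:(apply: Rmult_le_pos => //; exact: Cmod_ge_0).
    rewrite !Rpow_mult_distr; lra.
  set near := fun n => if Z_lt_dec (Z.abs n) (Z.of_nat N' + 1) then B * G else 0.
  have nearZ : zex near /\ zsum near <= INR (2 * N' + 1) * (B * G).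
    apply: (zfinite (k := (- Z.of_nat N')%Z)) => n; rewrite /near; case: Z_lt_dec => H; rewrite /is_left; try lra; try lia.
    - exact: Rmult_le_pos.
    - exact: Rmult_le_pos.
  have [S1 E1] := zshift1 Hv. have [S2 E2] := zshiftm1 Hv.
  have VZ := zex_plus (zex_plus S1 S2) Hv.
  have dle n : 0 <= Cmod (d n) ^ 2 <= near n + 3 * e * (Cmod (v (n + 1)%Z) ^ 2 + Cmod (v (n - 1)%Z) ^ 2 + Cmod (v n) ^ 2).
    split; first exact: sqr_pos.
    have V0 := sqr_pos (v (n + 1)%Z); have V1 := sqr_pos (v (n - 1)%Z); have V2 := sqr_pos (v n).
    rewrite /near; case: Z_lt_dec => H; rewrite /is_left.
    - have : Cmod (d n) ^ 2 <= D n * G.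
        apply: Rle_trans (dB n) _.
        have -> : D n * G = 3 * dev n ^ 2 * ((F (n + 1)%Z + F (n - 1)%Z + F n) * G) by rewrite /D; ring.
        apply: Rmult_le_compat_l.
          have := pow2_ge_0 (dev n); lra.
        have := proj2 (HF (n + 1)%Z) v Hv; have := proj2 (HF (n - 1)%Z) v Hv; have := proj2 (HF n) v Hv.
        rewrite -/G; lra.
      have := Rmult_le_compat_r _ _ _ G0 (HB n ltac:(lia)).
      have : 0 <= 3 * e * (Cmod (v (n + 1)%Z) ^ 2 + Cmod (v (n - 1)%Z) ^ 2 + Cmod (v n) ^ 2) by apply: Rmult_le_pos; lra.
      lra.
    - rewrite Rplus_0_l; apply: Rle_trans (dB n) _; apply: Rmult_le_compat_r; first lra.
      have := HN n ltac:(lia). have := Rmin_l 1 e; have := Rmin_r 1 e; have := dev0 n.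
      move=> A1 A2 A3 A4. have : dev n ^ 2 <= dev n by nra.
      lra.
  have DZ := zex_plus (proj1 nearZ) (zex_scal (3 * e) VZ).
  have Hd : l2 d := zex_le dle DZ.
  have Nd : N2 d <= K * G + 9 * e * N2 v.
    apply: Rle_trans (zsum_le dle DZ) _.
    rewrite (zsum_plus (proj1 nearZ) (zex_scal (3 * e) VZ)) zsum_scal (zsum_plus (zex_plus S1 S2) Hv) (zsum_plus S1 S2) E1 E2 -/(N2 v).
    have := proj2 nearZ; rewrite /K; lra.
  have [HT0 NT0] := l2_plus HT Hd.
  have ET : (fun n => T v n + d n)%C = T0 v by apply: functional_extensionality => n; rewrite /d; ring.
  rewrite ET in HT0 NT0.
  have L := HC0 v Hv HT0.
  have Nv := N2_ge0 Hv.
  have L2 : N2 v <= C0 * (2 * G + 2 * (K * G + 9 * e * N2 v)).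
    apply: Rle_trans L _; apply: Rmult_le_compat_l; first lra. rewrite -/G in NT0; lra.
  have Ee : C0 * (2 * (9 * e * N2 v)) = N2 v / 2 by rewrite /e; field; lra.
  have : N2 v <= C0 * (2 * G + 2 * (K * G)) + N2 v / 2 by rewrite -Ee; lra.
  lra.
Qed.

End BoundedBelow2.

(** * The continuous spectrum *)

Lemma pert_small a h p e : plus_moment 0 a h p -> 0 < e -> Zinf (fun n => pert a h p n < e).
Proof.
  move=> M He; apply: nat_Zinf.
  have L := ex_series_lim_0 _ (pert_summable (Rle_refl 0) M).
  move/is_lim_seq_spec: L => /(_ (mkposreal e He)) [N HN]; exists N => n Hn.
  have := HN n Hn; rewrite Rminus_0_r => H; exact: Rle_lt_trans (Rle_abs _) H.
Qed.

Lemma jost_l1 a h p z : plus_moment 0 a h p -> (forall n, a n <> RtoC 0) -> 0 < Im z ->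
  summable (fun k => jost a h p (Z.of_nat k) z).
Proof.
  move=> M a0 Hz.
  have G : ex_series (fun k => exp (- Im z) ^ k).
    apply: ex_series_geom; rewrite Rabs_pos_eq; last by left; exact: exp_pos.
    rewrite -exp_0; apply: exp_increasing; lra.
  apply: (summable_Zbound (f := fun n => jost a h p n z) (g := fun n => exp (- Im z) ^ Z.to_nat n) (B := 2) 0); last first.
    apply: ex_series_ext G => k; by rewrite Nat2Z.id.
  have [N HN] := jost_near M a0 (Rlt_le _ _ Hz).
  exists (Z.max 0 N) => n Hn; have [_ H] := HN n ltac:(lia).
  have -> // : exp (- Im z) ^ Z.to_nat n = Cmod (en n z).
  have E : forall x k, exp x ^ k = exp (INR k * x).
    move=> x; elim=> [|k IH]; first by rewrite /= Rmult_0_l exp_0.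
    rewrite S_INR /= IH -exp_plus; congr exp; ring.
  rewrite Cmod_en E INR_IZR_INZ Z2Nat.id; last lia. congr exp; ring.
Qed.

Section SigmaC.
Variable q : R.
Hypothesis hq : 1 < q.
Variables a b c : R -> C.
Hypothesis ha : forall t, qZ q t -> a t <> RtoC 0.
Local Notation A := (seq_a q a).
Local Notation H := (seq_h q a b).
Local Notation P := (seq_p q c).
Local Notation A' := (refl_a (seq_a q a)).
Local Notation H' := (refl (seq_h q a b)).
Local Notation P' := (refl (seq_p q c)).
Hypothesis Mp : plus_moment 0 A H P.
Hypothesis Mm : plus_moment 0 A' H' P'.
Let e0 : 0 <= 0 := Rle_refl 0.
Local Notation jp := (jp q a b c).
Local Notation jm := (jm q a b c).
Let An0 := A_neq0 hq ha.
Let An0' := rA_neq0 hq ha.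

Lemma coefs_tend : [/\ Ctends Zinf A (RtoC 1), Ctends Zinf H (RtoC 0) & Ctends Zinf P (RtoC 0)].
Proof.
  split; move=> e He; apply: filter_imp (pert_small Mp He) => n L; case: (pert_bounds A H P n) => _ L1 L2 L3.
  - rewrite Cmod_sub_sym; lra.
  - have -> : (H n - 0 = H n)%C by ring. lra.
  - have -> : (P n - 0 = P n)%C by ring. lra.
Qed.

Lemma coefs_tend' : [/\ Ctends Zinf (fun n => A (- n)%Z) (RtoC 1), Ctends Zinf (fun n => H (- n)%Z) (RtoC 0) & Ctends Zinf (fun n => P (- n)%Z) (RtoC 0)].
Proof.
  split; move=> e He.
  - apply: filter_imp (Zinf_shift (-1) (pert_small Mm He)) => n; case: (pert_bounds A' H' P' (n + -1)) => _ L1 _ _ L.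
    move: L1; rewrite /refl_a; have -> : (- (n + -1) - 1 = - n)%Z by lia.
    move=> L1; rewrite Cmod_sub_sym; exact: Rle_lt_trans L1 L.
  - apply: filter_imp (pert_small Mm He) => n L; case: (pert_bounds A' H' P' n) => _ _ L2 _.
    have -> : (H (- n)%Z - 0 = H (- n)%Z)%C by ring. exact: Rle_lt_trans L2 L.
  - apply: filter_imp (pert_small Mm He) => n L; case: (pert_bounds A' H' P' n) => _ _ _ L3.
    have -> : (P (- n)%Z - 0 = P (- n)%Z)%C by ring. exact: Rle_lt_trans L3 L.
Qed.

Lemma A_bounded : exists B, forall n, Cmod (A n) <= B.
Proof. have [H1 _ _] := coefs_tend; have [H2 _ _] := coefs_tend'; exact: Ctends_two_bounded H1 H2. Qed.

Lemma be_bounded l : exists B, forall n, Cmod (seq_b q a b n + 2 * l * P n + l * l) <= B.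
Proof.
  have [_ H1 H2] := coefs_tend; have [_ H3 H4] := coefs_tend'.
  have [B1 L1] := Ctends_two_bounded H1 H3. have [B2 L2] := Ctends_two_bounded H2 H4.
  exists (B1 + 2 + Cmod (2 * l) * B2 + Cmod (l * l)) => n.
  have -> : (seq_b q a b n + 2 * l * P n + l * l = H n - 2 + 2 * l * P n + l * l)%C by rewrite -(seq_b_h q a b).
  have T1 := Cmod_triangle (H n - 2 + 2 * l * P n) (l * l).
  have T2 := Cmod_triangle (H n - 2) (2 * l * P n).
  have T3 := Cmod_triang_sub (H n) 2. rewrite Cmod_R Rabs_pos_eq in T3; last lra.
  have T4 : Cmod (2 * l * P n) <= Cmod (2 * l) * B2.
    rewrite (Cmod_mult (2 * l)); apply: Rmult_le_compat_l; [exact: Cmod_ge_0 | exact: L2].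
  have := L1 n; lra.
Qed.

Lemma dev_small l e : 0 < e -> exists N, forall n, (N <= Z.abs n)%Z -> dev A (seq_b q a b) P l n < e.
Proof.
  move=> He.
  have [H1 H2 H3] := coefs_tend; have [K1 K2 K3] := coefs_tend'.
  set r := Cmod (2 * l). have Pr : 0 <= r := Cmod_ge_0 _.
  have He2 : 0 < e / (4 * (r + 1)) by apply: Rdiv_lt_0_compat; lra.
  have Hr : r * (e / (4 * (r + 1))) < e / 4.
    have -> : e / 4 = (r + 1) * (e / (4 * (r + 1))) by field; lra. apply: Rmult_lt_compat_r => //; lra.
  have [N1 L1] := H1 (e / 4) ltac:(lra). have [N2 L2] := H2 (e / 4) ltac:(lra). have [N3 L3] := H3 _ He2.
  have [N4 L4] := K1 (e / 4) ltac:(lra). have [N5 L5] := K2 (e / 4) ltac:(lra). have [N6 L6] := K3 _ He2.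
  exists (Z.max (Z.max (Z.max N1 N2) (Z.max N3 N4)) (Z.max (Z.max N5 N6) 0) + 1)%Z => n Hn.
  have E0 x : (x - 0 = x)%C by move=> *; ring.
  have U m : (Z.max (Z.max (Z.max N1 N2) (Z.max N3 N4)) (Z.max (Z.max N5 N6) 0) <= Z.abs m)%Z ->
     [/\ Cmod (1 - A m) < e / 4, Cmod (H m) < e / 4 & Cmod (P m) < e / (4 * (r + 1))].
    move=> Hm; case: (Z.le_gt_cases 0 m) => Hs.
    - have := L1 m ltac:(lia); have := L2 m ltac:(lia); have := L3 m ltac:(lia).
      rewrite !E0 (Cmod_sub_sym (A m)) => X Y Z; split => //.
    - have := L4 (- m)%Z ltac:(lia); have := L5 (- m)%Z ltac:(lia); have := L6 (- m)%Z ltac:(lia).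
      rewrite !Z.opp_involutive !E0 (Cmod_sub_sym (A m)) => X Y Z; split => //.
  have [U1 U2 U3] := U n ltac:(lia). have [V1 _ _] := U (n - 1)%Z ltac:(lia).
  rewrite /dev.
  have -> : (seq_b q a b n + 2 + 2 * l * P n = H n + 2 * l * P n)%C by rewrite /seq_h; ring.
  have T := Cmod_triangle (H n) (2 * l * P n). rewrite (Cmod_mult (2 * l)) -/r in T.
  have := Rmult_le_compat_l _ _ _ Pr (Rlt_le _ _ U3). lra.
Qed.

Variables (lam z : C).
Hypothesis Hz : 0 <= Im z.
Hypothesis Hlam : hat_lam q lam = (wz z + / wz z)%C.
Local Notation T := (Bop A (seq_b q a b) P (hat_lam q lam)).
Local Notation hat u := (qseq q (hat_u u)).

Lemma norm_qE u : norm_q q u = sqrt ((q - 1) * N2 (hat u)).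
Proof.
  rewrite /norm_q /qint (qZ_indicator q (fun n => RtoC (powerRZ q n) * RtoC (Cmod (u (powerRZ q n)) ^ 2))%C).
  congr sqrt; rewrite Re_mult /N2 /zsum /Zsum /CSeries.
  have -> : Im (RtoC (q - 1)) = 0 by []. rewrite Rmult_0_l Rminus_0_r; congr (_ * _).
  rewrite Re_plus [Re (Series _, _)]/=  [Re (Series _, _)]/=; congr (_ + _); apply: Series_ext => k;
    rewrite hat_u_sqr //; rewrite /Re /=; ring.
Qed.

Lemma hat_L u : hat (L_op q a b c lam u) = (fun n => RtoC (sqrt q) * T (hat u) n)%C.
Proof. apply: functional_extensionality => n; exact: (L_op_Bop hq). Qed.

Lemma sqrtq_neq0 : RtoC (sqrt q) <> RtoC 0.
Proof. apply: RtoC_neq0; have := sqrt_q_pos hq; lra. Qed.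

(** The coefficients are bounded, so the operator is defined on all of [l2] and the domain condition
    on the image is automatic. *)
Lemma L_dom_l2 u : L_dom q a b c lam u <-> l2 (hat u).
Proof.
  rewrite /L_dom !(in_l2q_l2Z hq) !in_l2Z_l2 hat_L; split; first by case.
  move=> Hu; split => //.
  have [Ba HBa] := A_bounded. have [Bb HBb] := be_bounded (hat_lam q lam).
  exact: (proj1 (l2_scal _ (Bop_l2 HBa HBb Hu))).
Qed.

Lemma N2_hat_L u : l2 (hat u) -> N2 (hat (L_op q a b c lam u)) = q * N2 (T (hat u)).
Proof.
  move=> Hu; have [Ba HBa] := A_bounded. have [Bb HBb] := be_bounded (hat_lam q lam).
  rewrite hat_L (proj2 (l2_scal _ (Bop_l2 HBa HBb Hu))) Cmod_R Rabs_pos_eq; last by left; exact: sqrt_q_pos.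
  rewrite /= Rmult_1_r sqrt_sqrt //; lra.
Qed.

(** For real [z] the Jost solution at plus infinity has modulus between 1/2 and 2 far out, which is
    what the tent construction requires for the density of the range and the unbounded inverse;
    injectivity is the absence of decaying solutions. *)
Lemma sigma_c_real : Im z = 0 -> sigma_c q a b c lam.
Proof.
  move=> Hz0.
  have [Ba HBa] := A_bounded. have [Bb HBb] := be_bounded (hat_lam q lam).
  have Hjp : solves_B A (seq_b q a b) P (hat_lam q lam) (fun n => jp n z) by rewrite Hlam; exact: (jp_solves hq ha e0 Mp Hz).
  have [N1 HN1] := jost_near Mp An0 Hz.
  have F n : (N1 <= n)%Z -> 1 / 2 <= Cmod (jp n z) <= 2.
    move=> Hn; have := HN1 n Hn; rewrite /jp Cmod_en Hz0 Rmult_0_r Ropp_0 exp_0; lra.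
  split; [|split].
  - move=> u /L_dom_l2 Hu HL t [n ->].
    have S : solves_B A (seq_b q a b) P (hat_lam q lam) (hat u).
      apply/(solves_AB hq) => t' Ht'; exact: HL.
    rewrite Hlam in S; apply/(hat_u_eq0 hq).
    apply: (decay_real hq ha Mp Hz0 S); apply: l2_right; exact/in_l2Z_l2.
  - move=> g eps /(in_l2q_l2Z hq) /in_l2Z_l2 Hg He.
    set g1 := fun n => (/ RtoC (sqrt q) * hat g n)%C.
    have Hg1 : l2 g1 := proj1 (l2_scal _ Hg).
    have [_ D] := T_dense_range An0 HBa HBb Hjp F Hg1.
    have He' : 0 < eps ^ 2 / ((q - 1) * q).
      apply: Rdiv_lt_0_compat; [exact: pow_lt | apply: Rmult_lt_0_compat; lra].
    have [v [Hv L]] := D _ He'.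
    exists (lift q v); split; first by apply/L_dom_l2; rewrite hat_lift.
    rewrite norm_qE.
    have -> : hat (fun t => L_op q a b c lam (lift q v) t - g t)%C = (fun n => RtoC (sqrt q) * (T v n - g1 n))%C.
      apply: functional_extensionality => n.
      have -> : hat (fun t => L_op q a b c lam (lift q v) t - g t)%C n = (hat (L_op q a b c lam (lift q v)) n - hat g n)%C.
        rewrite /qseq /hat_u; ring.
      rewrite hat_L hat_lift // /g1; field; exact: sqrtq_neq0.
    rewrite (proj2 (l2_scal _ (l2_minus (Bop_l2 HBa HBb Hv) Hg1))) Cmod_R Rabs_pos_eq; last by left; exact: sqrt_q_pos.
    have -> : sqrt q ^ 2 = q by rewrite /= Rmult_1_r sqrt_sqrt //; lra.
    rewrite -(sqrt_pow2 eps); last lra.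
    apply: sqrt_lt_1_alt; split.
      apply: Rmult_le_pos; first lra. apply: Rmult_le_pos; first lra.
      apply: N2_ge0; exact: l2_minus (Bop_l2 HBa HBb Hv) Hg1.
    have Q : 0 < (q - 1) * q by apply: Rmult_lt_0_compat; lra.
    have := Rmult_lt_compat_l _ _ _ Q L.
    have -> : (q - 1) * q * (eps ^ 2 / ((q - 1) * q)) = eps ^ 2 by field; lra. lra.
  - move=> [M HM].
    apply: (T_not_bounded_below HBa HBb Hjp F (Z.le_refl (N1 + 1))).
    exists (M ^ 2 * q) => v Hv.
    have Ht : l2 (hat (lift q v)) by rewrite hat_lift.
    have := HM (lift q v) (proj2 (L_dom_l2 _) Ht).
    rewrite !norm_qE N2_hat_L // hat_lift //.
    have HTv := N2_ge0 (Bop_l2 HBa HBb Hv). have Nv := N2_ge0 Hv.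
    move=> L.
    have X0 : 0 <= (q - 1) * N2 v by apply: Rmult_le_pos; lra.
    have Y0 : 0 <= (q - 1) * (q * N2 (T v)) by apply: Rmult_le_pos; [lra | apply: Rmult_le_pos; lra].
    have S : (q - 1) * N2 v <= M ^ 2 * ((q - 1) * (q * N2 (T v))).
      rewrite -{1}(sqrt_sqrt _ X0) -(sqrt_sqrt _ Y0).
      have P0 := sqrt_pos ((q - 1) * N2 v).
      set s := sqrt _ in L P0 *; set t := sqrt ((q - 1) * (q * _)) in L *.
      have : s * s <= (M * t) * (M * t) by apply: Rmult_le_compat.
      lra.
    apply: (Rmult_le_reg_l (q - 1)); first lra. lra.
Qed.

(** Either the Wronskian vanishes and an eigenfunction destroys injectivity, or the two decaying
    Jost solutions are independent and the operator is bounded below, so that its inverse is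
    bounded. *)
Lemma sigma_c_nonreal : 0 < Im z -> ~ sigma_c q a b c lam.
Proof.
  move=> Hz1 [S1 [_ S3]].
  have [Ba HBa] := A_bounded. have [Bb HBb] := be_bounded (hat_lam q lam).
  case: (excluded_middle_informative (Phi q a b c z = RtoC 0)) => HP.
  - have : eigenvalue_A q a b c lam.
      apply/(part_ii hq); rewrite Hlam; exact: (proj2 (eigen_iff hq ha Mp Mm Hz) (conj Hz1 HP)).
    move=> [u [H1 [H2 [t [Ht Hn]]]]]; apply: Hn; apply: S1 => //.
    apply/L_dom_l2; apply/in_l2Z_l2; exact/(in_l2q_l2Z hq).
  - apply: S3.
    have Hjp : solves_B A (seq_b q a b) P (hat_lam q lam) (fun n => jp n z) by rewrite Hlam; exact: (jp_solves hq ha e0 Mp Hz).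
    have Hjm : solves_B A (seq_b q a b) P (hat_lam q lam) (fun n => jm n z) by rewrite Hlam; exact: (jm_solves hq ha e0 Mm Hz).
    have Sf : summable (fun k => jp (Z.of_nat k) z) := jost_l1 Mp An0 Hz1.
    have Sg : summable (fun k => jm (- Z.of_nat k) z).
      apply: summable_ext (jost_l1 Mm An0' Hz1) => k; by rewrite /jm Z.opp_involutive.
    have HW : Wr A (fun n => jm n z) (fun n => jp n z) 0 <> RtoC 0.
      by move=> E; apply: HP; rewrite /Phi (Phi_at_Wr hq Mp Mm).
    have [M HM] := T_bounded_below An0 HBa HBb Hjp Hjm HW Sf Sg (@wz_neq0 z) (wz_lt1 Hz1) Hlam (dev_small (hat_lam q lam)).
    exists (sqrt (Rabs M)) => u /L_dom_l2 Hu.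
    rewrite !norm_qE N2_hat_L // -sqrt_mult_alt; last exact: Rabs_pos.
    apply: sqrt_le_1_alt.
    have HTv := N2_ge0 (Bop_l2 HBa HBb Hu).
    have L : N2 (hat u) <= Rabs M * N2 (T (hat u)).
      apply: Rle_trans (HM _ Hu) _; apply: Rmult_le_compat_r => //; exact: Rle_abs.
    have R0 := Rabs_pos M. have MT := Rmult_le_pos _ _ R0 HTv.
    have -> : Rabs M * ((q - 1) * (q * N2 (T (hat u)))) = (q - 1) * (q * (Rabs M * N2 (T (hat u)))) by ring.
    apply: Rmult_le_compat_l; first lra. nra.
Qed.

(** [w |-> w + 1 / w] sends the unit circle into the segment from -2 to 2 and no point of the
    punctured open disk there: a real value with [|w| < 1] forces [w] to be real, and then
    [|w + 1 / w| > 2]. *)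
Lemma real_iff : (Im lam = 0 /\ - (2 * Rpower q (1 / 4)) <= Re lam <= 2 * Rpower q (1 / 4)) <-> Im z = 0.
Proof.
  have Pk : 0 < Rpower q (1 / 4) by rewrite /Rpower; exact: exp_pos.
  set k := Rpower q (1 / 4) in Pk *.
  have El : lam = (RtoC k * (wz z + / wz z))%C.
    rewrite -Hlam /hat_lam.
    have E : (RtoC k * RtoC (Rpower q (- (1 / 4))) = 1)%C.
      rewrite -RtoC_mult -Rpower_plus Rplus_opp_r Rpower_O //; lra.
    by rewrite Cmult_assoc E Cmult_1_l.
  have W0 := @wz_neq0 z. have WM := Cmod_wz z.
  move: El W0 WM; set w := wz z => El W0 WM.
  have Pw := proj1 (Cmod_gt_0 _) W0.
  have Ew : Cmod w ^ 2 = Re w ^ 2 + Im w ^ 2 := Cmod2_alt w.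
  have Ei : (/ w = ((Re w / Cmod w ^ 2)%R, (- Im w / Cmod w ^ 2)%R))%C.
    rewrite Ew /Cinv /Re /Im /=. apply: C_ext; rewrite /Re /Im /=; field; 
    rewrite -/(Re w) -/(Im w); have := pow_lt _ 2 Pw; rewrite Ew /=; lra.
  have ER : Re lam = k * (Re w + Re w / Cmod w ^ 2) by rewrite El Ei /Re /Im /=; ring.
  have EI : Im lam = k * (Im w - Im w / Cmod w ^ 2) by rewrite El Ei /Re /Im /=; field; lra.
  split.
  - move=> [HI HR].
    case: (Rle_lt_or_eq_dec 0 (Im z) Hz) => // Hz1.
    have Hr : Cmod w < 1 by apply: wz_lt1.
    have R2 : 0 < Cmod w ^ 2 < 1 by split; [exact: pow_lt | nra].
    set r2 := Cmod w ^ 2 in R2 Ew ER EI *.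
    have I0 : Im w = 0.
      have E : Im w * (r2 - 1) = 0.
        have : k * (Im w - Im w / r2) * (r2 / k) = 0 by rewrite -EI HI; ring.
        have -> : k * (Im w - Im w / r2) * (r2 / k) = Im w * (r2 - 1) by field; lra. by [].
      case: (Rmult_integral _ _ E) => //; lra.
    rewrite I0 in Ew.
    have Er : Re w + Re w / r2 = Re w + / Re w.
      have : Re w <> 0 by move=> E; rewrite E in Ew; lra.
      move=> N; rewrite Ew; field; lra.
    rewrite ER Er in HR.
    have Hx : -2 <= Re w + / Re w <= 2 by split; apply: (Rmult_le_reg_l k) => //; lra.
    have Nx : Re w <> 0 by move=> E; rewrite E in Ew; lra.
    set x := Re w in Ew Hx Nx.
    have Q : (x + / x) ^ 2 = x ^ 2 + 2 + (/ x) ^ 2 by field.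
    have Q2 : (x + / x) ^ 2 <= 4 by nra.
    have Q3 : x ^ 2 * (/ x) ^ 2 = 1 by field.
    have : (x ^ 2 - (/ x) ^ 2) ^ 2 = (x ^ 2 + (/ x) ^ 2) ^ 2 - 4 * (x ^ 2 * (/ x) ^ 2) by ring.
    have := pow2_ge_0 (/ x); nra.
  - move=> Hz0.
    have Hr : Cmod w = 1 by rewrite WM Hz0 /Rdiv Ropp_0 Rmult_0_l exp_0.
    rewrite Hr in ER EI Ew.
    have Rw : -1 <= Re w <= 1 by nra.
    split; first by rewrite EI; field.
    rewrite ER; split; nra.
Qed.

Lemma sigma_c_iff_aux : sigma_c q a b c lam <->
  Im lam = 0 /\ - (2 * Rpower q (1 / 4)) <= Re lam <= 2 * Rpower q (1 / 4).
Proof.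
  rewrite real_iff; split.
  - move=> S; case: (Rle_lt_or_eq_dec 0 (Im z) Hz) => // Hz1; by case: (sigma_c_nonreal Hz1 S).
  - exact: sigma_c_real.
Qed.

End SigmaC.

Lemma sigma_c_iff q a b c : 1 < q -> (forall t, qZ q t -> a t <> RtoC 0) ->
  plus_moment 0 (seq_a q a) (seq_h q a b) (seq_p q c) ->
  plus_moment 0 (refl_a (seq_a q a)) (refl (seq_h q a b)) (refl (seq_p q c)) ->
  forall lam, sigma_c q a b c lam <->
  Im lam = 0 /\ - (2 * Rpower q (1 / 4)) <= Re lam <= 2 * Rpower q (1 / 4).
Proof.
  move=> hq ha Mp Mm lam; have [z [Hz _ Hl]] := joukowski_ex (hat_lam q lam).
  exact: (sigma_c_iff_aux hq ha Mp Mm Hz Hl).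
Qed.

(** * Stretched exponential weights *)

Lemma pow_le_fact_exp x n : 0 <= x -> x ^ n <= INR (fact n) * exp x.
Proof.
  move=> Hx; have H := exp_ge_taylor x n Hx.
  have F := INR_fact_lt_0 n.
  have T : x ^ n / INR (fact n) <= sum_f_R0 (fun k => x ^ k / INR (fact k)) n.
    have P : forall k, 0 <= x ^ k / INR (fact k).
      move=> k; apply: Rle_mult_inv_pos; [exact: pow_le | exact: INR_fact_lt_0].
    case: n {H F} => [|n]; first by rewrite /=; lra.
    rewrite tech5; have := cond_pos_sum (fun k => x ^ k / INR (fact k)) n P; lra.
  have -> : x ^ n = INR (fact n) * (x ^ n / INR (fact n)) by field; lra.
  apply: Rmult_le_compat_l; lra.
Qed.

(** The power [k] of [m] is the power [2 k] of [sqrt m], which is why [(2 k)!] appears; this fixes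
    the growth of all Taylor coefficients below. *)
Lemma pow_le_wt eta (m k : nat) : 0 < eta ->
  INR m ^ k <= INR (fact (2 * k)) / (eta ^ 2) ^ k * wt eta (INR m).
Proof.
  move=> He.
  have H := @pow_le_fact_exp (eta * sqrt (INR m)) (2 * k) (Rmult_le_pos _ _ (Rlt_le _ _ He) (sqrt_pos _)).
  have P : 0 < (eta ^ 2) ^ k by apply: pow_lt; exact: pow_lt.
  have E : (eta * sqrt (INR m)) ^ (2 * k) = (eta ^ 2) ^ k * INR m ^ k.
    rewrite pow_mult Rpow_mult_distr Rpow_mult_distr; congr (_ * _ ^ _).
    rewrite /= Rmult_1_r sqrt_sqrt //; exact: pos_INR.
  rewrite E in H.
  apply: (Rmult_le_reg_l ((eta ^ 2) ^ k)) => //.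
  have -> : (eta ^ 2) ^ k * (INR (fact (2 * k)) / (eta ^ 2) ^ k * wt eta (INR m)) = INR (fact (2 * k)) * wt eta (INR m) by field; lra.
  exact: H.
Qed.

Lemma ex_series_inv_sqr : ex_series (fun k => / (INR (S k)) ^ 2).
Proof.
  apply: (ex_series_bounded (B := 2)).
    move=> k; left; apply: Rinv_0_lt_compat; apply: pow_lt; apply: lt_0_INR; lia.
  move=> M; suff : Rsum (fun k => / INR (S k) ^ 2) M <= 2 - 2 / INR (S M).
    have : 0 < 2 / INR (S M) by apply: Rdiv_lt_0_compat; [lra | apply: lt_0_INR; lia]. lra.
  elim: M => [|M IH]; first by rewrite /=; lra.
  change (Rsum (fun k => / INR (S k) ^ 2) (S M)) with (Rsum (fun k => / INR (S k) ^ 2) M + / INR (S M) ^ 2).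
  have P : 0 < INR (S M) by apply: lt_0_INR; lia.
  rewrite (S_INR (S M)). move: P IH; set x := INR (S M) => P IH.
  have X1 : 1 <= x by rewrite /x -INR_1; apply: le_INR; lia.
  have : / x ^ 2 <= 2 / x - 2 / (x + 1); last lra.
  apply: (Rmult_le_reg_r (x ^ 2 * (x + 1))); first by apply: Rmult_lt_0_compat; [exact: pow_lt | lra].
  have -> : / x ^ 2 * (x ^ 2 * (x + 1)) = x + 1 by field; lra.
  have -> : (2 / x - 2 / (x + 1)) * (x ^ 2 * (x + 1)) = 2 * x by field; lra. lra.
Qed.

Lemma ex_series_exp_sqrt c : 0 < c -> ex_series (fun k => INR k * exp (- (c * sqrt (INR k)))).
Proof.
  move=> Hc; apply/ex_series_incr_1.
  set K := INR (fact (2 * 3)) / (c ^ 2) ^ 3.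
  have K0 : 0 < K by apply: Rdiv_lt_0_compat; [exact: INR_fact_lt_0 | apply: pow_lt; exact: pow_lt].
  apply: ex_series_Rle (ex_series_scalR K ex_series_inv_sqr) => k.
  have P : 0 < INR (S k) by apply: lt_0_INR; lia.
  split; first by apply: Rmult_le_pos; [lra | left; exact: exp_pos].
  have H := pow_le_wt (S k) 3 Hc; rewrite -/K /wt in H.
  rewrite exp_Ropp; have E0 := exp_pos (c * sqrt (INR (S k))).
  apply: (Rmult_le_reg_r (exp (c * sqrt (INR (S k))) * INR (S k) ^ 2)).
    apply: Rmult_lt_0_compat => //; exact: pow_lt.
  have -> : INR (S k) * / exp (c * sqrt (INR (S k))) * (exp (c * sqrt (INR (S k))) * INR (S k) ^ 2) = INR (S k) ^ 3 by field; lra.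
  have -> : K * / INR (S k) ^ 2 * (exp (c * sqrt (INR (S k))) * INR (S k) ^ 2) = K * exp (c * sqrt (INR (S k))) by field; lra.
  exact: H.
Qed.

Lemma wt_4 eta x : 0 <= x -> wt eta (4 * x) = exp (2 * eta * sqrt x).
Proof.
  move=> Hx; rewrite /wt sqrt_mult; try lra.
  have -> : sqrt 4 = 2 by rewrite -(sqrt_square 2); [congr sqrt; ring | lra].
  congr exp; ring.
Qed.

(** For [n <> 0] one has [|n| >= 1], so [delta >= 1/2] gives [|n|^delta >= sqrt |n|] and every
    admissible exponent reduces to the borderline one. *)
Lemma exp_decay_pert q a b c eps delta : 1 < q -> 0 < eps -> 1 / 2 <= delta -> exp_decay q a b c eps delta ->
  exists M, 0 <= M /\ forall n, pert (seq_a q a) (seq_h q a b) (seq_p q c) n <= M * exp (- (eps * sqrt (Rabs (IZR n)))).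
Proof.
  move=> hq He Hd [M HM]; exists M.
  have B n : exp (eps * sqrt (Rabs (IZR n))) * pert (seq_a q a) (seq_h q a b) (seq_p q c) n <= M.
    apply: Rle_trans (HM _ (qZ_pow q n)); rewrite qlog_pow //.
    apply: Rmult_le_compat_r; first by case: (pert_bounds (seq_a q a) (seq_h q a b) (seq_p q c) n).
    apply: exp_mono; apply: Rmult_le_compat_l; first lra.
    rewrite /pow_nonneg; case: Req_EM_T => E; rewrite /is_left.
      rewrite E sqrt_0; lra.
    have P := Rabs_pos (IZR n).
    have I : 1 <= Rabs (IZR n).
      rewrite -abs_IZR; apply: IZR_le. have : n <> 0%Z by move=> E0; apply: E; rewrite E0 Rabs_R0. lia.
    rewrite -Rpower_sqrt; last lra.
    apply: Rle_Rpower => //; lra.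
  have M0 : 0 <= M.
    apply: Rle_trans (B 0%Z); apply: Rmult_le_pos; first by left; exact: exp_pos.
    by case: (pert_bounds (seq_a q a) (seq_h q a b) (seq_p q c) 0).
  split => // n; rewrite exp_Ropp; have E0 := exp_pos (eps * sqrt (Rabs (IZR n))).
  apply: (Rmult_le_reg_l (exp (eps * sqrt (Rabs (IZR n))))) => //.
  have -> : exp (eps * sqrt (Rabs (IZR n))) * (M * / exp (eps * sqrt (Rabs (IZR n)))) = M by field; lra.
  exact: B.
Qed.

(** For [eta <= eps / 4] the weight at [4 k] is at most [exp (eps / 2 * sqrt k)]. This takes half of
    the available decay, and the other half makes the moment converge. *)
Lemma exp_decay_moments q a b c eps delta eta : 1 < q -> 0 < eps -> 1 / 2 <= delta -> exp_decay q a b c eps delta ->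
  0 <= eta <= eps / 4 ->
  plus_moment eta (seq_a q a) (seq_h q a b) (seq_p q c) /\
  plus_moment eta (refl_a (seq_a q a)) (refl (seq_h q a b)) (refl (seq_p q c)).
Proof.
  move=> hq He Hd Hdec Heta.
  have [M [M0 HM]] := exp_decay_pert hq He Hd Hdec.
  have G := ex_series_scalR M (ex_series_exp_sqrt (ltac:(lra) : 0 < eps / 2)).
  have term k n : Rabs (IZR n) = INR k ->
     0 <= INR k * (wt eta (4 * INR k) * pert (seq_a q a) (seq_h q a b) (seq_p q c) n) <= M * (INR k * exp (- (eps / 2 * sqrt (INR k)))).
    move=> En; case: (pert_bounds (seq_a q a) (seq_h q a b) (seq_p q c) n) => P0 _ _ _.
    have W := wt_ge1 (4 * INR k) (proj1 Heta). have K0 := pos_INR k.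
    split; first by apply: Rmult_le_pos => //; apply: Rmult_le_pos; lra.
    have -> : M * (INR k * exp (- (eps / 2 * sqrt (INR k)))) = INR k * (exp (eps / 2 * sqrt (INR k)) * (M * exp (- (eps * sqrt (INR k))))).
      have -> : exp (eps / 2 * sqrt (INR k)) * (M * exp (- (eps * sqrt (INR k)))) = M * (exp (eps / 2 * sqrt (INR k)) * exp (- (eps * sqrt (INR k)))) by ring.
      rewrite -exp_plus. have -> : eps / 2 * sqrt (INR k) + - (eps * sqrt (INR k)) = - (eps / 2 * sqrt (INR k)) by field. ring.
    apply: Rmult_le_compat_l => //; apply: Rmult_le_compat => //; first lra.
    - rewrite wt_4 //; apply: exp_mono; apply: Rmult_le_compat_r; [exact: sqrt_pos | lra].
    - rewrite -En; exact: HM.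
  have G1 : plus_moment eta (seq_a q a) (seq_h q a b) (seq_p q c).
    apply: ex_series_Rle G => k; apply: term; rewrite -INR_IZR_INZ Rabs_pos_eq //; exact: pos_INR.
  split => //; apply: refl_moment => //; first lra.
  move/ex_series_incr_1: G; apply: ex_series_Rle => k; apply: (term (S k)).
  have -> : (- Z.of_nat k - 1 = - Z.of_nat (S k))%Z by lia.
  rewrite opp_IZR Rabs_Ropp -INR_IZR_INZ Rabs_pos_eq //; exact: pos_INR.
Qed.

(** * Products of power series *)

Definition conv (u v : nat -> C) (n : nat) : C := Csum (fun k => u k * v (n - k)%nat)%C (S n).

Lemma sum_f_Rsum f n : sum_f_R0 f n = Rsum f (S n).
Proof. by rewrite -sum_n_Reals sum_n_Rsum. Qed.

Lemma Re_Csum u n : Re (Csum u n) = Rsum (fun k => Re (u k)) n.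
Proof. by elim: n => [|n IH] //=; rewrite -IH. Qed.

Lemma Im_Csum u n : Im (Csum u n) = Rsum (fun k => Im (u k)) n.
Proof. by elim: n => [|n IH] //=; rewrite -IH. Qed.

Lemma Rsum_minus (u v : nat -> R) M : Rsum (fun k => u k - v k) M = Rsum u M - Rsum v M.
Proof. elim: M => [|M IH] /=; [ring | rewrite IH; ring]. Qed.

Lemma CSeries_conv u v : summable u -> summable v -> CSeries (conv u v) = (CSeries u * CSeries v)%C.
Proof.
  move=> su sv.
  have A1 := summable_Re_abs su; have A2 := summable_Im_abs su; have A3 := summable_Re_abs sv; have A4 := summable_Im_abs sv.
  have M (x y : nat -> R) : ex_series (fun k => Rabs (x k)) -> ex_series (fun k => Rabs (y k)) ->
     is_series (fun n => sum_f_R0 (fun k => x k * y (n - k)%nat) n) (Series x * Series y).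
    move=> Hx Hy; apply: is_series_mult => //; apply: Series_correct; exact: ex_series_Rabs.
  apply: C_ext; rewrite /CSeries.
  - change (Series (fun n => Re (conv u v n)) = Series (fun k => Re (u k)) * Series (fun k => Re (v k))
       - Series (fun k => Im (u k)) * Series (fun k => Im (v k))).
    apply: is_series_unique; apply: is_series_ext (is_series_minus _ _ _ _ (M _ _ A1 A3) (M _ _ A2 A4)) => n.
    transitivity (sum_f_R0 (fun k => Re (u k) * Re (v (n - k)%nat)) n - sum_f_R0 (fun k => Im (u k) * Im (v (n - k)%nat)) n) => //.
    by rewrite !sum_f_Rsum Re_Csum -Rsum_minus.
  - change (Series (fun n => Im (conv u v n)) = Series (fun k => Re (u k)) * Series (fun k => Im (v k))
       + Series (fun k => Im (u k)) * Series (fun k => Re (v k))).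
    apply: is_series_unique; apply: is_series_ext (is_series_plus _ _ _ _ (M _ _ A1 A4) (M _ _ A2 A3)) => n.
    transitivity (sum_f_R0 (fun k => Re (u k) * Im (v (n - k)%nat)) n + sum_f_R0 (fun k => Im (u k) * Re (v (n - k)%nat)) n) => //.
    by rewrite !sum_f_Rsum Im_Csum -Rsum_plus.
Qed.

Definition wsummable (eta : R) (g : nat -> C) : Prop := ex_series (fun m => wt eta (INR m) * Cmod (g m)).

Lemma wsummable_summable eta g : 0 <= eta -> wsummable eta g -> summable g.
Proof.
  move=> He; apply: ex_series_Rle => k; split; first exact: Cmod_ge_0.
  have := wt_ge1 (INR k) He; have := Cmod_ge_0 (g k); nra.
Qed.

(** The weight at [n] is at most the product of the weights at [k] and [n - k], so the weighted norm
    is submultiplicative under convolution. *)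
Lemma wsummable_conv eta u v : 0 <= eta -> wsummable eta u -> wsummable eta v -> wsummable eta (conv u v).
Proof.
  move=> He Hu Hv.
  have Wp g k : 0 <= wt eta (INR k) * Cmod (g k).
    apply: Rmult_le_pos; [have := wt_ge1 (INR k) He; lra | exact: Cmod_ge_0].
  have S := is_series_mult _ _ _ _ (Series_correct _ Hu) (Series_correct _ Hv) (ex_series_abs (Wp u) Hu) (ex_series_abs (Wp v) Hv).
  have E : ex_series (fun n => sum_f_R0 (fun k => wt eta (INR k) * Cmod (u k) * (wt eta (INR (n - k)) * Cmod (v (n - k)%nat))) n).
    by eexists; exact: S.
  apply: ex_series_Rle E => n; split; first exact: Wp.
  rewrite sum_f_Rsum; apply: (Rle_trans _ (wt eta (INR n) * Rsum (fun k => Cmod (u k * v (n - k)%nat)) (Datatypes.S n))).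
    apply: Rmult_le_compat_l; [have := wt_ge1 (INR n) He; lra | exact: Cmod_Csum].
  rewrite -Rsum_scal; apply: Rsum_le => k Hk; rewrite Cmod_mult.
  have En : INR n = INR k + INR (n - k) by rewrite -plus_INR; congr INR; lia.
  have W := wt_subadd He (pos_INR k) (pos_INR (n - k)); rewrite -En in W.
  have := Rmult_le_compat_r _ _ _ (Rmult_le_pos _ _ (Cmod_ge_0 (u k)) (Cmod_ge_0 (v (n - k)%nat))) W. lra.
Qed.

(** The weighted Wiener algebra of absolutely convergent power series on the closed disk; values
    outside the disk are left free. *)
Definition wiener (eta : R) (F : C -> C) : Prop :=
  exists g, wsummable eta g /\ forall w, Cmod w <= 1 -> F w = CSeries (fun m => g m * w ^ m)%C.

Lemma wsummable_pow eta g w : 0 <= eta -> wsummable eta g -> Cmod w <= 1 -> summable (fun m => g m * w ^ m)%C.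
Proof.
  move=> He Hg Hw; apply: summable_le (wsummable_summable He Hg) => k; rewrite Cmod_mult.
  have := Cpow_le1 k Hw; have := Cmod_ge_0 (g k); have := Cmod_ge_0 (w ^ k); nra.
Qed.

Lemma wiener_mult eta F G : 0 <= eta -> wiener eta F -> wiener eta G -> wiener eta (fun w => F w * G w)%C.
Proof.
  move=> He [f [Hf Ef]] [g [Hg Eg]]; exists (conv f g); split; first exact: wsummable_conv.
  move=> w Hw; rewrite (Ef w Hw) (Eg w Hw) -CSeries_conv; try exact: (wsummable_pow He _ Hw).
  apply: CSeries_ext => n; rewrite /conv Cmult_comm -Csum_scal; apply: Csum_ext => k Hk.
  have -> : (w ^ n = w ^ k * w ^ (n - k))%C by rewrite -Cpow_add_r; congr Cpow; lia. ring.
Qed.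

Lemma wiener_scal eta (x : C) F : 0 <= eta -> wiener eta F -> wiener eta (fun w => x * F w)%C.
Proof.
  move=> He [f [Hf Ef]]; exists (fun m => x * f m)%C; split.
    apply: ex_series_ext (ex_series_scalR (Cmod x) Hf) => k; rewrite Cmod_mult /=; ring.
  move=> w Hw; rewrite (Ef w Hw) -CSeries_scal; last exact: (wsummable_pow He Hf Hw).
  apply: CSeries_ext => k; ring.
Qed.

Lemma wiener_minus eta F G : 0 <= eta -> wiener eta F -> wiener eta G -> wiener eta (fun w => F w - G w)%C.
Proof.
  move=> He [f [Hf Ef]] [g [Hg Eg]]; exists (fun m => f m - g m)%C; split.
    apply: ex_series_Rle (ex_series_plusR Hf Hg) => k.
    have W := wt_ge1 (INR k) He; have C0 := Cmod_ge_0 (f k - g k); have T := Cmod_triang_sub (f k) (g k).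
    split; first by apply: Rmult_le_pos; lra. nra.
  move=> w Hw; rewrite (Ef w Hw) (Eg w Hw) -CSeries_minus; try exact: (wsummable_pow He _ Hw).
  apply: CSeries_ext => k; ring.
Qed.

Lemma wsummable_finite eta g N : (forall m, (N <= m)%nat -> g m = RtoC 0) -> wsummable eta g.
Proof.
  move=> H; refine (proj1 (Series_finite (N := N) _)) => k Hk; by rewrite H // Cmod_0 Rmult_0_r.
Qed.

Lemma wiener_const eta (x : C) : wiener eta (fun _ => x).
Proof.
  set g := fun m => match m with O => x | _ => RtoC 0 end.
  exists g; split; first by apply: (@wsummable_finite _ _ 1) => -[|m] // H; lia.
  move=> w Hw.
  have S0 : summable (fun m => g m * w ^ m)%C.
    apply: (ex_series_ext (fun m => Cmod (g m * w ^ m))) => //.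
    refine (proj1 (Series_finite (N := 1) _)) => -[|k] Hk; first lia. by rewrite /g Cmult_0_l Cmod_0.
  rewrite (CSeries_incr_1 S0) (CSeries_ext (v := fun _ => RtoC 0)); last by move=> k; rewrite /g Cmult_0_l.
  rewrite CSeries_0 /=; ring.
Qed.

Lemma wiener_id eta : wiener eta (fun w => w).
Proof.
  set g := fun m => match m with 1%nat => RtoC 1 | _ => RtoC 0 end.
  exists g; split; first by apply: (@wsummable_finite _ _ 2) => -[|[|m]] // H; lia.
  move=> w Hw.
  have S0 : summable (fun m => g m * w ^ m)%C.
    refine (proj1 (Series_finite (N := 2) _)) => -[|[|k]] Hk; try lia. by rewrite /g Cmult_0_l Cmod_0.
  rewrite (CSeries_incr_1 S0) (CSeries_incr_1 (proj2 (summable_S _) S0)).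
  rewrite (CSeries_ext (v := fun _ => RtoC 0)); last by move=> k; rewrite /g Cmult_0_l.
  rewrite CSeries_0 /=; ring.
Qed.

Lemma wiener_pow eta n : 0 <= eta -> wiener eta (fun w => w ^ n)%C.
Proof.
  move=> He; elim: n => [|n IH]; first exact: wiener_const.
  exact: (wiener_mult He (wiener_id eta) IH).
Qed.

Lemma wiener_weaken eta F : 0 <= eta -> wiener eta F -> wiener 0 F.
Proof.
  move=> He [f [Hf Ef]]; exists f; split => //.
  apply: ex_series_ext (wsummable_summable He Hf) => k; by rewrite /wt Rmult_0_l exp_0 Rmult_1_l.
Qed.

Lemma wiener_rot eta F (x : C) : 0 <= eta -> Cmod x = 1 -> wiener eta F -> wiener eta (fun w => F (w * x)%C).
Proof.
  move=> He Hx [f [Hf Ef]]; exists (fun m => f m * x ^ m)%C; split.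
    apply: ex_series_ext Hf => k; by rewrite Cmod_mult Cmod_pow Hx pow1 Rmult_1_r.
  move=> w Hw; rewrite Ef; last by rewrite Cmod_mult Hx Rmult_1_r.
  apply: CSeries_ext => k; rewrite Cpow_mult_l; ring.
Qed.

Lemma powser_at_0 (g : nat -> C) : CSeries (fun m => g m * RtoC 0 ^ m)%C = g 0%nat.
Proof.
  have S0 : summable (fun m => g m * RtoC 0 ^ m)%C.
    refine (proj1 (Series_finite (N := 1) _)) => -[|k] Hk; first lia. by rewrite Cpow_S Cmult_0_l Cmult_0_r Cmod_0.
  rewrite (CSeries_incr_1 S0) (CSeries_ext (v := fun _ => RtoC 0)); last by move=> k; rewrite Cpow_S Cmult_0_l Cmult_0_r.
  rewrite CSeries_0 /=; ring.
Qed.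

(** * Taylor expansion of a power series at a point of the closed disk *)

(** [tay w0 k m] is the coefficient [binomial(m, k) w0^(m - k)], and [bin k m] the binomial itself. *)
Fixpoint tay (w0 : C) (k m : nat) {struct m} : C :=
  match m with
  | O => match k with O => RtoC 1 | _ => RtoC 0 end
  | S m' => (w0 * tay w0 k m' + match k with O => RtoC 0 | S k' => tay w0 k' m' end)%C
  end.

Fixpoint bin (k m : nat) {struct m} : R :=
  match m with
  | O => match k with O => 1 | _ => 0 end
  | S m' => bin k m' + match k with O => 0 | S k' => bin k' m' end
  end.

Lemma bin_pos k m : 0 <= bin k m.
Proof.
  elim: m k => [|m IH] k /=; first by case: k => [|k]; lra.
  have := IH k; case: k => [|k]; first lra. have := IH k; lra.
Qed.

Lemma tay_le_bin w0 k m : Cmod w0 <= 1 -> Cmod (tay w0 k m) <= bin k m.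
Proof.
  move=> H; elim: m k => [|m IH] k /=.
    case: k => [|k]; rewrite ?Cmod_1 ?Cmod_0; lra.
  apply: Rle_trans (Cmod_triangle _ _) _; apply: Rplus_le_compat.
    rewrite Cmod_mult; have := IH k; have := Cmod_ge_0 (tay w0 k m); have := Cmod_ge_0 w0; nra.
  case: k => [|k] //; rewrite Cmod_0; lra.
Qed.

Lemma tay_0 w0 m : tay w0 0 m = (w0 ^ m)%C.
Proof. by elim: m => [|m IH] //=; rewrite IH Cplus_0_r. Qed.

Lemma bin_0 m : bin 0 m = 1.
Proof. by elim: m => [|m IH] //=; rewrite IH Rplus_0_r. Qed.

Lemma pow_S_ge (x : R) k : 0 <= x -> x ^ S k + INR (S k) * x ^ k <= (x + 1) ^ S k.
Proof.
  move=> Hx; elim: k => [|k IH]; first by rewrite /=; lra.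
  have P : 0 <= x ^ k by exact: pow_le.
  have -> : (x + 1) ^ S (S k) = (x + 1) * (x + 1) ^ S k by [].
  have : (x + 1) * (x ^ S k + INR (S k) * x ^ k) <= (x + 1) * (x + 1) ^ S k by apply: Rmult_le_compat_l; lra.
  have K0 := pos_INR (S k). have Q := Rmult_le_pos _ _ K0 P.
  rewrite (S_INR (S k)) -!tech_pow_Rmult; lra.
Qed.

(** Pascal's rule is compared with [pow_S_ge], the first two terms of the binomial expansion of
    [(x + 1)^(k + 1)]. *)
Lemma bin_le k m : bin k m * INR (fact k) <= INR m ^ k.
Proof.
  elim: m k => [|m IH] k.
    case: k => [|k]; rewrite /=; [lra | rewrite !Rmult_0_l; lra].
  case: k => [|k]; first by rewrite bin_0 /=; lra.
  have E : bin (S k) (S m) = bin (S k) m + bin k m by [].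
  rewrite E S_INR; apply: Rle_trans (pow_S_ge k (pos_INR m)).
  have H1 := IH (S k); have H2 := IH k.
  have F : INR (fact (S k)) = INR (S k) * INR (fact k) by rewrite -mult_INR.
  have := Rmult_le_compat_l _ _ _ (pos_INR (S k)) H2. rewrite F in H1 *; lra.
Qed.

Lemma bin_le_pow k m : bin k m <= INR m ^ k.
Proof.
  have := bin_le k m; have B := bin_pos k m.
  have : 1 <= INR (fact k) by rewrite -INR_1; apply: le_INR; have := lt_O_fact k; lia.
  nra.
Qed.

(** The Taylor remainder of a single monomial. Bounding it for each [m] and summing yields Taylor's
    formula also at boundary points, without derivatives or paths of integration. *)
Definition rem (w0 w : C) (N m : nat) : C := (w ^ m - Csum (fun i => tay w0 i m * (w - w0) ^ i) N)%C.

Lemma rem_S w0 w N m : rem w0 w (S N) (S m) = (w * rem w0 w (S N) m + tay w0 N m * (w - w0) ^ S N)%C.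
Proof.
  rewrite /rem.
  have E : forall K, Csum (fun i => tay w0 i (S m) * (w - w0) ^ i)%C (S K) =
     (w0 * Csum (fun i => tay w0 i m * (w - w0) ^ i) (S K) + (w - w0) * Csum (fun i => tay w0 i m * (w - w0) ^ i) K)%C.
    elim=> [|K IH]; first by rewrite /=; ring.
    have -> : Csum (fun i => tay w0 i (S m) * (w - w0) ^ i)%C (S (S K)) = (Csum (fun i => tay w0 i (S m) * (w - w0) ^ i) (S K) + tay w0 (S K) (S m) * (w - w0) ^ S K)%C by [].
    rewrite IH /=; ring.
  rewrite E Cpow_S /=; ring.
Qed.

(** [rem_S] has the shape of Pascal's rule, and all other factors have modulus at most 1, so the
    remainder is dominated by a binomial coefficient. *)
Lemma rem_le w0 w N m : Cmod w0 <= 1 -> Cmod w <= 1 -> Cmod (rem w0 w N m) <= bin N m * Cmod (w - w0) ^ N.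
Proof.
  move=> H0 H1; case: N => [|N].
    rewrite /rem /= bin_0. have -> : (w ^ m - 0 = w ^ m)%C by ring. have := Cpow_le1 m H1; lra.
  elim: m => [|m IH].
    have -> : rem w0 w (S N) 0 = RtoC 0.
      rewrite /rem; have E : forall K, Csum (fun i => tay w0 i 0 * (w - w0) ^ i)%C (S K) = RtoC 1.
        elim=> [|K IH]; first by rewrite /=; ring.
        have -> : Csum (fun i => tay w0 i 0 * (w - w0) ^ i)%C (S (S K)) = (Csum (fun i => tay w0 i 0 * (w - w0) ^ i) (S K) + RtoC 0 * (w - w0) ^ S K)%C by [].
        rewrite IH; ring.
      rewrite E /=; ring.
    rewrite Cmod_0; apply: Rmult_le_pos; [exact: bin_pos | apply: pow_le; exact: Cmod_ge_0].
  rewrite rem_S; apply: Rle_trans (Cmod_triangle _ _) _.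
  have E : bin (S N) (S m) = bin (S N) m + bin N m by [].
  rewrite E Rmult_plus_distr_r; apply: Rplus_le_compat.
    rewrite Cmod_mult; have := Cmod_ge_0 (rem w0 w (S N) m); have := Cmod_ge_0 w; nra.
  rewrite Cmod_mult Cmod_pow; apply: Rmult_le_compat_r; [apply: pow_le; exact: Cmod_ge_0 | exact: tay_le_bin].
Qed.

Section Taylor.
Variables (eta : R) (g : nat -> C).
Hypothesis eta0 : 0 < eta.
Hypothesis Hg : wsummable eta g.
Let F (w : C) := CSeries (fun m => g m * w ^ m)%C.

Definition gsum : R := Series (fun m => wt eta (INR m) * Cmod (g m)).

Lemma gsum_pos : 0 <= gsum.
Proof.
  apply: Series_ge0 Hg => k; apply: Rmult_le_pos; [have := wt_ge1 (INR k) (Rlt_le _ _ eta0); lra | exact: Cmod_ge_0].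
Qed.

Lemma g_pow_ex k : ex_series (fun m => INR m ^ k * Cmod (g m)).
Proof.
  apply: ex_series_Rle (ex_series_scalR (INR (fact (2 * k)) / (eta ^ 2) ^ k) Hg) => m.
  have P := Cmod_ge_0 (g m).
  split; first by apply: Rmult_le_pos => //; apply: pow_le; exact: pos_INR.
  have := Rmult_le_compat_r _ _ _ P (pow_le_wt m k eta0). lra.
Qed.

Lemma g_bin_ex k : ex_series (fun m => bin k m * Cmod (g m)).
Proof.
  apply: ex_series_Rle (g_pow_ex k) => m; have P := Cmod_ge_0 (g m).
  split; first by apply: Rmult_le_pos => //; exact: bin_pos.
  apply: Rmult_le_compat_r => //; exact: bin_le_pow.
Qed.

(** The [k!] in the denominator of the binomial coefficient tempers the [(2 k)!] of [pow_le_wt]: the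
    quotient is at most [(4 k)^k], which is slow enough for the exponential smallness in
    [flat_exp]. *)
Lemma g_bin_sum k : Series (fun m => bin k m * Cmod (g m)) <= INR (fact (2 * k)) / (INR (fact k) * (eta ^ 2) ^ k) * gsum.
Proof.
  have Fk := INR_fact_lt_0 k.
  have Ek : 0 < (eta ^ 2) ^ k by apply: pow_lt; exact: pow_lt.
  rewrite /gsum -Series_scal_l; apply: Series_le; last exact: ex_series_scalR.
  move=> m; have P := Cmod_ge_0 (g m); split; first by apply: Rmult_le_pos => //; exact: bin_pos.
  rewrite -Rmult_assoc; apply: Rmult_le_compat_r => //.
  apply: (Rmult_le_reg_r (INR (fact k))) => //.
  apply: Rle_trans (bin_le k m) _; apply: Rle_trans (pow_le_wt m k eta0) _.
  apply: Req_le; field; lra.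
Qed.

Definition tcoef (w0 : C) (k : nat) : C := CSeries (fun m => g m * tay w0 k m)%C.

Lemma g_tay_summable w0 k : Cmod w0 <= 1 -> summable (fun m => g m * tay w0 k m)%C.
Proof.
  move=> H0; apply: summable_le (g_bin_ex k) => m; rewrite Cmod_mult Rmult_comm.
  apply: Rmult_le_compat_r; [exact: Cmod_ge_0 | exact: tay_le_bin].
Qed.

Lemma taylor_bound w0 w N : Cmod w0 <= 1 -> Cmod w <= 1 ->
  Cmod (F w - Csum (fun i => tcoef w0 i * (w - w0) ^ i) N)%C <= Series (fun m => bin N m * Cmod (g m)) * Cmod (w - w0) ^ N.
Proof.
  move=> H0 H1.
  have Hw := wsummable_pow (Rlt_le _ _ eta0) Hg H1.
  have E : forall K, summable (fun m => g m * rem w0 w K m)%C /\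
     (F w - Csum (fun i => tcoef w0 i * (w - w0) ^ i) K)%C = CSeries (fun m => g m * rem w0 w K m)%C.
    elim=> [|K [I1 I2]].
      have X m : (g m * w ^ m = g m * rem w0 w 0 m)%C by rewrite /rem /=; ring.
      split; first by apply: summable_ext X Hw.
      rewrite -(CSeries_ext X) /= /F; ring.
    have St := summable_scal (g_tay_summable K H0) ((w - w0) ^ K)%C.
    have X m : (g m * rem w0 w K m - (w - w0) ^ K * (g m * tay w0 K m) = g m * rem w0 w (S K) m)%C by rewrite /rem /=; ring.
    split; first by apply: summable_ext X _; exact: summable_minus.
    rewrite -(CSeries_ext X) (CSeries_minus I1 St) -I2 (CSeries_scal (g_tay_summable K H0)) /= -/(tcoef w0 K); ring.
  have [S1 ->] := E N.
  apply: Rle_trans (CSeries_le S1) _; rewrite -Series_scal_r; apply: Series_le; last first.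
    have := ex_series_scalR (Cmod (w - w0) ^ N) (g_bin_ex N); apply: ex_series_ext => m; rewrite /=; ring.
  move=> m; split; first exact: Cmod_ge_0.
  rewrite Cmod_mult; have := Rmult_le_compat_l _ _ _ (Cmod_ge_0 (g m)) (rem_le N m H0 H1). lra.
Qed.

Lemma flat_bound w0 w N : Cmod w0 <= 1 -> Cmod w <= 1 -> (forall k, tcoef w0 k = RtoC 0) ->
  Cmod (F w) <= gsum * (INR (fact (2 * N)) / INR (fact N) * (Cmod (w - w0) / eta ^ 2) ^ N).
Proof.
  move=> H0 H1 Hflat.
  have := taylor_bound N H0 H1.
  have -> : Csum (fun i => tcoef w0 i * (w - w0) ^ i)%C N = RtoC 0.
    elim: N => [|N IH] //=; rewrite IH Hflat; ring.
  have -> : (F w - 0 = F w)%C by ring. move=> H.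
  have PN : 0 <= Cmod (w - w0) ^ N by apply: pow_le; exact: Cmod_ge_0.
  have := Rmult_le_compat_r _ _ _ PN (g_bin_sum N).
  have Fk := INR_fact_lt_0 N. have Ek : 0 < (eta ^ 2) ^ N by apply: pow_lt; exact: pow_lt.
  have -> : (Cmod (w - w0) / eta ^ 2) ^ N = Cmod (w - w0) ^ N / (eta ^ 2) ^ N.
    rewrite /Rdiv Rpow_mult_distr pow_inv //.
  have -> : INR (fact (2 * N)) / (INR (fact N) * (eta ^ 2) ^ N) * gsum * Cmod (w - w0) ^ N =
     gsum * (INR (fact (2 * N)) / INR (fact N) * (Cmod (w - w0) ^ N / (eta ^ 2) ^ N)) by field; lra.
  lra.
Qed.

(** The last [N] factors of [(2 N)!] are each at most [2 N]; the 4 leaves some slack. *)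
Lemma fact_2N N : INR (fact (2 * N)) / INR (fact N) <= (4 * INR N) ^ N.
Proof.
  have E : forall K, INR (fact (N + K)) <= INR (fact N) * (INR (N + K)) ^ K.
    elim=> [|K IH]; first by rewrite Nat.add_0_r /=; lra.
    rewrite Nat.add_succ_r. change (fact (S (N + K))) with (S (N + K) * fact (N + K))%nat. rewrite mult_INR.
    have P := pos_INR (N + K). have Q : INR (N + K) <= INR (S (N + K)) by apply: le_INR; lia.
    have W : INR (N + K) ^ K <= INR (S (N + K)) ^ K by apply: pow_incr.
    have Fk := INR_fact_lt_0 N.
    have -> : INR (fact N) * INR (S (N + K)) ^ S K = INR (S (N + K)) * (INR (fact N) * INR (S (N + K)) ^ K) by rewrite /=; ring.
    apply: Rmult_le_compat_l; first exact: pos_INR.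
    apply: Rle_trans IH _; apply: Rmult_le_compat_l; lra.
  have Fk := INR_fact_lt_0 N.
  apply: (Rmult_le_reg_r (INR (fact N))) => //.
  have -> : INR (fact (2 * N)) / INR (fact N) * INR (fact N) = INR (fact (N + N)).
    have -> : (2 * N = N + N)%nat by lia. field; lra.
  apply: Rle_trans (E N) _; rewrite Rmult_comm; apply: Rmult_le_compat_r; first lra.
  apply: pow_incr; rewrite plus_INR; have := pos_INR N; lra.
Qed.

(** The Taylor expansion is taken to the order [floor (eta^2 / (8 t))]. *)
Lemma flat_exp w0 w t : Cmod w0 <= 1 -> Cmod w <= 1 -> (forall k, tcoef w0 k = RtoC 0) ->
  0 < t -> Cmod (w - w0) <= t -> Cmod (F w) <= 2 * gsum * exp (- (ln 2 * eta ^ 2 / (8 * t))).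
Proof.
  move=> H0 H1 Hflat Ht Hd.
  have E2 : 0 < eta ^ 2 by exact: pow_lt.
  set X := eta ^ 2 / (8 * t).
  have X0 : 0 < X by apply: Rdiv_lt_0_compat; lra.
  have [N [N1 N2]] := nfloor_ex X (Rlt_le _ _ X0).
  have B := flat_bound N H0 H1 Hflat.
  have G := gsum_pos. have F0 := fact_2N N.
  have XE : X * (8 * t) = eta ^ 2 by rewrite /X; field; lra.
  have NI := pos_INR N.
  have P1 : (Cmod (w - w0) / eta ^ 2) ^ N <= (t / eta ^ 2) ^ N.
    apply: pow_incr; split.
      apply: Rmult_le_pos; [exact: Cmod_ge_0 | left; exact: Rinv_0_lt_compat].
    apply: Rmult_le_compat_r => //; left; exact: Rinv_0_lt_compat.
  (* The order satisfies [N <= eta^2 / (8 t)], so the base [4 N t / eta^2] is at most 1/2. *)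
  have P2 : (4 * INR N) ^ N * (t / eta ^ 2) ^ N <= (1 / 2) ^ N.
    rewrite -Rpow_mult_distr; apply: pow_incr; split.
      apply: Rmult_le_pos; first lra. apply: Rmult_le_pos; first lra. left; exact: Rinv_0_lt_compat.
    apply: (Rmult_le_reg_r (eta ^ 2)) => //.
    have -> : 4 * INR N * (t / eta ^ 2) * eta ^ 2 = 4 * INR N * t by field; lra.
    nra.
  have P3 : (1 / 2) ^ N = exp (- (INR N * ln 2)).
    rewrite exp_Ropp; have -> : exp (INR N * ln 2) = 2 ^ N by apply: (Rpower_pow N 2); lra.
    by rewrite /Rdiv Rmult_1_l pow_inv.
  have L2 : 0 < ln 2 by have := ln_lt_2; lra.
  (* The factor 2 pays for rounding down, as [N > X - 1]. *)
  have P4 : exp (- (INR N * ln 2)) <= 2 * exp (- (ln 2 * X)).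
    rewrite -{2}(exp_ln 2); last lra. rewrite -exp_plus; apply: exp_mono; nra.
  have -> : ln 2 * eta ^ 2 / (8 * t) = ln 2 * X by rewrite /X; field; lra.
  have P5 : INR (fact (2 * N)) / INR (fact N) * (Cmod (w - w0) / eta ^ 2) ^ N <= (4 * INR N) ^ N * (t / eta ^ 2) ^ N.
    apply: Rmult_le_compat => //.
      apply: Rmult_le_pos; [exact: pos_INR | left; apply: Rinv_0_lt_compat; exact: INR_fact_lt_0].
    apply: pow_le; apply: Rmult_le_pos; [exact: Cmod_ge_0 | left; exact: Rinv_0_lt_compat].
  have P6 : INR (fact (2 * N)) / INR (fact N) * (Cmod (w - w0) / eta ^ 2) ^ N <= 2 * exp (- (ln 2 * X)) by lra.
  have := Rmult_le_compat_l _ _ _ G P6; lra.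
Qed.
End Taylor.

(** * A flat point on the unit circle *)

Definition cis (t : R) : C := Cexp (Ci * RtoC t).

Lemma cisE t : cis t = (cos t, sin t).
Proof.
  rewrite /cis /Cexp; have -> : (Ci * RtoC t)%C = (0, t) by apply: C_ext; rewrite /=; ring.
  by rewrite /= exp_0 !Rmult_1_l.
Qed.

Lemma Cmod_cis t : Cmod (cis t) = 1.
Proof.
  rewrite /cis Cmod_Cexp. have -> : Re (Ci * RtoC t) = 0 by rewrite /=; ring. exact: exp_0.
Qed.

Lemma cis_plus s t : cis (s + t) = (cis s * cis t)%C.
Proof. by rewrite /cis RtoC_plus Cmult_plus_distr_l Cexp_plus. Qed.

Lemma cis_nat t n : cis (INR n * t) = (cis t ^ n)%C.
Proof.
  rewrite /cis -Cexp_nat RtoC_mult; congr Cexp; ring.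
Qed.

Lemma cis_2PI : cis (2 * PI) = RtoC 1.
Proof. by rewrite cisE cos_2PI sin_2PI. Qed.

Lemma cis_neq1 t : 0 < t < 2 * PI -> cis t <> RtoC 1.
Proof.
  move=> Ht; rewrite cisE => H.
  have Hc : cos t = 1 by case: H.
  have S : 0 < sin (t / 2) by apply: sin_gt_0; lra.
  have : cos t = 1 - 2 * sin (t / 2) * sin (t / 2) by rewrite -cos_2a_sin; congr cos; field.
  nra.
Qed.

Lemma cis_minus1 t : 0 <= t <= 2 * PI -> Cmod (cis t - 1) <= t.
Proof.
  move=> Ht.
  have S0 : 0 <= sin (t / 2) by apply: sin_ge_0; lra.
  have S1 : sin (t / 2) <= t / 2.
    case: (Req_dec t 0) => [-> | Hn]; first by rewrite /Rdiv Rmult_0_l sin_0; lra.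
    left; apply: sin_lt_x; lra.
  have E : cos t = 1 - 2 * sin (t / 2) * sin (t / 2) by rewrite -cos_2a_sin; congr cos; field.
  have Q := sin2_cos2 t; rewrite /Rsqr in Q.
  rewrite -[X in _ <= X](sqrt_square t); last lra. rewrite /Cmod; apply: sqrt_le_1_alt; rewrite cisE.
  apply: (Rle_trans _ ((2 * sin (t / 2)) * (2 * sin (t / 2)))); last by apply: Rmult_le_compat; lra.
  apply: Req_le; transitivity (cos t * cos t + sin t * sin t - 2 * cos t + 1); first by rewrite /=; ring.
  have -> : sin t * sin t = 1 - cos t * cos t by lra. rewrite E; ring.
Qed.

Lemma cis_ex u : Cmod u = 1 -> exists t, 0 <= t < 2 * PI /\ u = cis t.
Proof.
  move=> Hu; have H2 : Re u * Re u + Im u * Im u = 1.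
    have : Cmod u ^ 2 = 1 by rewrite Hu; ring.
    rewrite /Cmod -/(Re u) -/(Im u) => <-; rewrite pow2_sqrt; first by rewrite /Re /Im; ring.
    nra.
  have [th [B [E1 E2]]] := angle_ex H2.
  have P := PI_RGT_0.
  case: (Rlt_dec th 0) => H.
  - exists (th + 2 * PI); split; first lra.
    rewrite cis_plus cis_2PI Cmult_1_r cisE E1 E2; by case: (u).
  - exists th; split; first lra. rewrite cisE E1 E2; by case: (u).
Qed.

Lemma geom_root x M : x <> RtoC 1 -> (x ^ M)%C = RtoC 1 -> Csum (fun k => x ^ k)%C M = RtoC 0.
Proof.
  move=> Hx HM.
  have E : forall K, ((x - 1) * Csum (fun k => x ^ k) K = x ^ K - 1)%C.
    elim=> [|K IH]; first by rewrite /=; ring.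
    rewrite /= Cmult_plus_distr_l IH; ring.
  apply: (@Cmult_eq0_r (x - 1)%C); last by rewrite E HM; ring.
  move=> H; apply: Hx; have -> : x = (x - 1 + 1)%C by ring. rewrite H; ring.
Qed.

(** The mean over the [M]-th roots of unity picks out the coefficients of index divisible by [M]. *)
Lemma wiener_mean (H : C -> C) B : wiener 0 H -> (forall w, Cmod w = 1 -> Cmod (H w) <= B) -> Cmod (H (RtoC 0)) <= B.
Proof.
  move=> [h [Hh E]] HB.
  have Sh := wsummable_summable (Rle_refl 0) Hh.
  rewrite E; last by rewrite Cmod_0; lra.
  rewrite powser_at_0; apply: le_epsilon => eps He.
  have [M0 HM0] := series_tail_small (fun k => Cmod_ge_0 (h k)) Sh He.
  set M := S M0; have P := PI_RGT_0.
  have MP : 0 < INR M by apply: lt_0_INR; rewrite /M; lia.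
  set om := cis (2 * PI / INR M).
  have omk k : Cmod (om ^ k) = 1 by rewrite /om -cis_nat Cmod_cis.
  have dec k : Cmod (Csum (fun m => h m * (om ^ k) ^ m)%C M) <= B + eps.
    have Hw : Cmod (om ^ k) <= 1 by rewrite omk; lra.
    have S1 := wsummable_pow (Rle_refl 0) Hh Hw.
    have S2 := CSeries_split M S1; rewrite -(E _ Hw) in S2.
    have -> : (Csum (fun m => h m * (om ^ k) ^ m) M = H (om ^ k) - CSeries (fun m => h (M + m)%nat * (om ^ k) ^ (M + m)))%C.
      rewrite S2; ring.
    apply: Rle_trans (Cmod_triang_sub _ _) _; apply: Rplus_le_compat; first exact: HB.
    apply: Rle_trans (CSeries_le (summable_incr S1 M)) _; left.
    have -> : Series (fun m => Cmod (h (M + m)%nat * (om ^ k) ^ (M + m))) = Series (fun m => Cmod (h (M + m)%nat)).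
      apply: Series_ext => m; by rewrite Cmod_mult Cmod_pow omk pow1 Rmult_1_r.
    by case: (HM0 M ltac:(rewrite /M; lia)).
  have tot : forall K, (K < M)%nat -> (Csum (fun k => Csum (fun m => h m * (om ^ k) ^ m) (S K)) M = RtoC (INR M) * h 0%nat)%C.
    elim=> [|K IH] HK.
      rewrite (Csum_ext (v := fun _ => h 0%nat)); last by move=> k _ /=; ring.
      elim: (M) => [|n In]; first by rewrite /=; ring.
      rewrite S_INR RtoC_plus /= In; ring.
    have -> : (Csum (fun k => Csum (fun m => h m * (om ^ k) ^ m) (S (S K))) M =
       Csum (fun k => Csum (fun m => h m * (om ^ k) ^ m) (S K)) M + h (S K) * Csum (fun k => (om ^ S K) ^ k) M)%C.
      rewrite -Csum_scal -Csum_plus; apply: Csum_ext => k _.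
      have -> : ((om ^ S K) ^ k = (om ^ k) ^ S K)%C by rewrite -!Cpow_mult_r; congr Cpow; lia.
      by [].
    rewrite IH; last lia. rewrite geom_root; first ring.
    - rewrite /om -cis_nat; apply: cis_neq1.
      have K1 : 0 < INR (S K) by apply: lt_0_INR; lia.
      have K2 : INR (S K) < INR M by exact: lt_INR.
      have D : 0 < 2 * PI / INR M by apply: Rdiv_lt_0_compat; lra.
      split; first exact: Rmult_lt_0_compat.
      have E2 : 2 * PI = INR M * (2 * PI / INR M) by field; lra.
      rewrite [X in _ < X]E2; exact: Rmult_lt_compat_r.
    - rewrite -Cpow_mult_r Nat.mul_comm Cpow_mult_r /om -cis_nat.
      have -> : INR M * (2 * PI / INR M) = 2 * PI by field; lra.
      by rewrite cis_2PI Cpow_1_l.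
  have T := tot M0 ltac:(rewrite /M; lia).
  have : Cmod (RtoC (INR M) * h 0%nat) <= INR M * (B + eps).
    rewrite -T -Rsum_const; apply: Rle_trans (Cmod_Csum _ _) _; apply: Rsum_le => k _; exact: dec.
  rewrite Cmod_mult Cmod_R Rabs_pos_eq; last lra. by move/(Rmult_le_reg_l _ _ _ MP).
Qed.

Lemma wiener_prod F (x : C) N : Cmod x = 1 -> wiener 0 F -> wiener 0 (fun w => Cprod (fun j => F (w * x ^ j)%C) N).
Proof.
  move=> Hx HF; elim: N => [|N IH] /=; first exact: wiener_const.
  apply: (wiener_mult (Rle_refl 0) IH); apply: (wiener_rot (Rle_refl 0) _ HF); by rewrite Cmod_pow Hx pow1.
Qed.

(** Multiplication by a root of unity [x] permutes the factors cyclically; the last one wraps around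
    to the first. *)
Lemma Cprod_cycle (F : C -> C) x N : (x ^ S N)%C = RtoC 1 -> forall w,
  Cprod (fun j => F (w * x * x ^ j)%C) (S N) = Cprod (fun j => F (w * x ^ j)%C) (S N).
Proof.
  move=> Hx w; rewrite [RHS]Cprod_S /=.
  have -> : (w * x * x ^ N = w * 1)%C by rewrite -Hx /=; ring.
  rewrite Cmult_comm; congr (_ * _)%C.
  elim: (N) => [|K IH] //=; rewrite IH; congr (_ * F _)%C; ring.
Qed.

Lemma ln_le_harmonic N : ln (INR (S N)) <= Rsum (fun j => / INR (S j)) N.
Proof.
  elim: N => [|N IH]; first by rewrite /= ln_1; lra.
  have P : 0 < INR (S N) by apply: lt_0_INR; lia.
  have Q := Rinv_0_lt_compat _ P.
  have : INR (S (S N)) <= INR (S N) * exp (/ INR (S N)).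
    have := exp_ineq1_le (/ INR (S N)); rewrite (S_INR (S N)) => H.
    have := Rmult_le_compat_l _ _ _ (Rlt_le _ _ P) H. rewrite Rmult_plus_distr_l Rinv_r; lra.
  move=> H; have P2 : 0 < INR (S (S N)) by apply: lt_0_INR; lia.
  have := ln_le _ _ P2 H; rewrite ln_mult //; last exact: exp_pos.
  rewrite ln_exp; change (Rsum (fun j => / INR (S j)) (S N)) with (Rsum (fun j => / INR (S j)) N + / INR (S N)); lra.
Qed.

Lemma exp_pow_nat x n : exp x ^ n = exp (INR n * x).
Proof.
  elim: n => [|n IH]; first by rewrite /= Rmult_0_l exp_0.
  rewrite S_INR -tech_pow_Rmult IH -exp_plus; congr exp; ring.
Qed.

Lemma pow_lt_S x y n : 0 <= x < y -> x ^ S n < y ^ S n.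
Proof.
  move=> H; elim: n => [|n IH]; first by rewrite /=; lra.
  rewrite -(tech_pow_Rmult x) -(tech_pow_Rmult y); have := pow_le x (S n) (proj1 H); nra.
Qed.

Section FlatCircle.
Variables (eta : R) (g : nat -> C).
Hypothesis eta0 : 0 < eta.
Hypothesis Hg : wsummable eta g.
Variable w0 : C.
Hypothesis Hw0 : Cmod w0 = 1.
Hypothesis Hflat : forall k, tcoef g w0 k = RtoC 0.
Let F (w : C) := CSeries (fun m => g m * w ^ m)%C.

(** The product of the [N] rotations of [F] by [N]-th roots of unity takes the same value at [w]
    and at a rotation of [w] within [2 PI / N] of [w0]; there its [j]-th factor is at distance at
    most [2 PI (j + 1) / N] from the flat point. *)
Lemma flat_circle_harmonic : exists A c : R, [/\ 0 <= A, 0 < c &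
  forall N, Cmod (F (RtoC 0)) <= A * exp (- (c * Rsum (fun j => / INR (S j)) (S N)))].
Proof.
  have P := PI_RGT_0. have L2 := ln_lt_2.
  set A := 2 * gsum eta g; set c0 := ln 2 * eta ^ 2 / 8.
  have A0 : 0 <= A by have := gsum_pos eta0 Hg; rewrite /A; lra.
  have c0p : 0 < c0 by apply: Rdiv_lt_0_compat; [apply: Rmult_lt_0_compat; [lra | exact: pow_lt] | lra].
  exists A, (c0 / (2 * PI)); split => //; first by apply: Rdiv_lt_0_compat; lra.
  move=> N'; set N := S N'; set c := c0 / (2 * PI).
  have NP : 0 < INR N by apply: lt_0_INR; rewrite /N; lia.
  set d := 2 * PI / INR N.
  have d0 : 0 < d by apply: Rdiv_lt_0_compat; lra.
  have dN : INR N * d = 2 * PI by rewrite /d; field; lra.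
  set x := cis d.
  have xN : (x ^ N)%C = RtoC 1 by rewrite /x -cis_nat dN cis_2PI.
  set H := fun w : C => Cprod (fun j => F (w * x ^ j)%C) N.
  have inv k w : H (w * x ^ k)%C = H w.
    elim: k => [|k IH]; first by rewrite Cmult_1_r.
    have -> : (w * x ^ S k = w * x ^ k * x)%C by rewrite /=; ring.
    by rewrite /H (Cprod_cycle F xN) -/(H (w * x ^ k)%C) IH.
  have PF : wiener 0 F.
    apply: (wiener_weaken (Rlt_le _ _ eta0)); by exists g.
  have PH : wiener 0 H by apply: wiener_prod => //; exact: Cmod_cis.
  have term th j : 0 <= th <= d -> (j < N)%nat -> Cmod (F (w0 * cis th * x ^ j)%C) <= A * exp (- (c * INR N * / INR (S j))).
    move=> Hth Hj.
    have JP : 0 < INR (S j) by apply: lt_0_INR; lia.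
    have JN : INR (S j) <= INR N by apply: le_INR; lia.
    have -> : (w0 * cis th * x ^ j = w0 * cis (th + INR j * d))%C by rewrite cis_plus cis_nat; rewrite -/x; ring.
    have J0 := pos_INR j.
    have t0 : 0 < INR (S j) * d by exact: Rmult_lt_0_compat.
    have tb : 0 <= th + INR j * d <= INR (S j) * d.
      rewrite S_INR; have := Rmult_le_pos _ _ J0 (Rlt_le _ _ d0); lra.
    have tN : INR (S j) * d <= 2 * PI by rewrite -dN; apply: Rmult_le_compat_r; lra.
    have -> : c * INR N * / INR (S j) = ln 2 * eta ^ 2 / (8 * (INR (S j) * d)).
      rewrite /c /c0 /d; field; lra.
    apply: (flat_exp eta0 Hg) => //; first lra.
    - rewrite Cmod_mult Hw0 Cmod_cis; lra.
    - have -> : (w0 * cis (th + INR j * d) - w0 = w0 * (cis (th + INR j * d) - 1))%C by ring.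
      rewrite Cmod_mult Hw0 Rmult_1_l; apply: Rle_trans (cis_minus1 _) _; lra.
  have arc th : 0 <= th <= d -> Cmod (H (w0 * cis th)%C) <= A ^ N * exp (- (c * INR N * Rsum (fun j => / INR (S j)) N)).
    move=> Hth; rewrite /H.
    have : forall K, (K <= N)%nat -> Cmod (Cprod (fun j => F (w0 * cis th * x ^ j)%C) K) <= A ^ K * exp (- (c * INR N * Rsum (fun j => / INR (S j)) K)).
      elim=> [|K IH] HK; first by rewrite /= Cmod_1 Rmult_0_r Ropp_0 exp_0; lra.
      have -> : Cprod (fun j => F (w0 * cis th * x ^ j)%C) (S K) = (Cprod (fun j => F (w0 * cis th * x ^ j)%C) K * F (w0 * cis th * x ^ K))%C by [].
      have -> : A ^ S K * exp (- (c * INR N * Rsum (fun j => / INR (S j)) (S K))) =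
        A ^ K * exp (- (c * INR N * Rsum (fun j => / INR (S j)) K)) * (A * exp (- (c * INR N * / INR (S K)))).
        have -> : - (c * INR N * Rsum (fun j => / INR (S j)) (S K)) = - (c * INR N * Rsum (fun j => / INR (S j)) K) + - (c * INR N * / INR (S K)).
          change (Rsum (fun j => / INR (S j)) (S K)) with (Rsum (fun j => / INR (S j)) K + / INR (S K)); ring.
        rewrite exp_plus -tech_pow_Rmult; ring.
      rewrite Cmod_mult; apply: Rmult_le_compat; try exact: Cmod_ge_0.
      - apply: IH; lia.
      - apply: term => //; lia.
    by apply.
  have circ w : Cmod w = 1 -> Cmod (H w) <= A ^ N * exp (- (c * INR N * Rsum (fun j => / INR (S j)) N)).
    move=> Hw.
    have w0n : w0 <> RtoC 0 by move=> E; move: Hw0; rewrite E Cmod_0; lra.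
    have [|th [[T1 T2] E]] := @cis_ex (w / w0)%C; first by rewrite Cmod_div // Hw Hw0; field.
    (* The number of whole steps [d] in the angle from [w0] to [w]; after undoing them the remaining
       angle lies between 0 and [d], where [arc] applies. *)
    have [k [K1 K2]] := @nfloor_ex (th / d) (Rle_mult_inv_pos _ _ T1 d0).
    have D : th = th / d * d by field; lra.
    have -> : w = (w0 * cis (th - INR k * d) * x ^ k)%C.
      rewrite -Cmult_assoc /x -cis_nat -cis_plus.
      have -> : th - INR k * d + INR k * d = th by ring. rewrite -E; field; exact: w0n.
    rewrite inv; apply: arc; move: (th / d) D K1 K2 => y D K1 K2; nra.
  have := wiener_mean PH circ.
  have -> : H (RtoC 0) = (F (RtoC 0) ^ N)%C.
    rewrite /H; elim: (N) => [|K IH] //=; rewrite IH Cmult_0_l; ring.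
  have -> : A ^ N * exp (- (c * INR N * Rsum (fun j => / INR (S j)) N)) = (A * exp (- (c * Rsum (fun j => / INR (S j)) N))) ^ N.
    rewrite Rpow_mult_distr; congr (_ * _).
    have -> : exp (- (c * Rsum (fun j => / INR (S j)) N)) ^ N = exp (INR N * - (c * Rsum (fun j => / INR (S j)) N)).
      exact: exp_pow_nat.
    congr exp; ring.
  rewrite Cmod_pow => Hp; apply: Rnot_lt_le => Hlt.
  have : (A * exp (- (c * Rsum (fun j => / INR (S j)) N))) ^ N < Cmod (F (RtoC 0)) ^ N; last lra.
  apply: pow_lt_S; split => //; apply: Rmult_le_pos => //; left; exact: exp_pos.
Qed.

(** The harmonic sums [h] are unbounded. Once [h > B = A / (c |g 0|)], the inequality
    [|g 0| (1 + c h) <= |g 0| exp (c h) <= A] fails. *)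
Lemma flat_circle : g 0%nat = RtoC 0.
Proof.
  have [A [c [A0 c0 H]]] := flat_circle_harmonic.
  have E0 : F (RtoC 0) = g 0%nat by exact: powser_at_0.
  rewrite E0 in H; apply: Cmod_eq_0; apply: Rle_antisym; last exact: Cmod_ge_0.
  apply: Rnot_lt_le => G0.
  set B := A / (c * Cmod (g 0%nat)).
  have cg : 0 < c * Cmod (g 0%nat) by exact: Rmult_lt_0_compat.
  have B0 : 0 <= B by apply: Rle_mult_inv_pos.
  have [N [N1 N2]] := nfloor_ex (exp B) (Rlt_le _ _ (exp_pos B)).
  have HN := H N; set h := Rsum (fun j => / INR (S j)) (S N) in HN.
  have hB : B < h.
    apply: Rlt_le_trans (ln_le_harmonic (S N)); rewrite -(ln_exp B); apply: ln_increasing; first exact: exp_pos.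
    rewrite !S_INR; lra.
  have E1 : Cmod (g 0%nat) * exp (c * h) <= A.
    have := Rmult_le_compat_r _ _ _ (Rlt_le _ _ (exp_pos (c * h))) HN.
    rewrite Rmult_assoc -exp_plus Rplus_opp_l exp_0; lra.
  have E2 := exp_ineq1_le (c * h).
  have E3 : A = B * (c * Cmod (g 0%nat)) by rewrite /B; field; lra.
  nra.
Qed.
End FlatCircle.

(** * Zeros in the closed disk *)

(** Homogeneity of [binomial(m, k) w^(m - k)] in [w]; it moves an interior point of the disk to the
    circle. *)
Lemma tay_scale (r : C) u k m : (r ^ k * tay (r * u) k m = r ^ m * tay u k m)%C.
Proof.
  elim: m k => [|m IH] k; first by case: k => [|k] /=; ring.
  case: k => [|k].
    have H := IH 0%nat; rewrite /= in H *.
    have -> : (1 * (r * u * tay (r * u) 0 m + 0) = r * u * (1 * tay (r * u) 0 m))%C by ring.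
    rewrite H; ring.
  have H1 := IH (S k); have H2 := IH k; rewrite /= in H1 H2 *.
  have -> : (r * r ^ k * (r * u * tay (r * u) (S k) m + tay (r * u) k m) =
     r * u * (r * r ^ k * tay (r * u) (S k) m) + r * (r ^ k * tay (r * u) k m))%C by ring.
  rewrite H1 H2; ring.
Qed.

Section Zeros.
Variables (eta : R) (g : nat -> C).
Hypothesis eta0 : 0 < eta.
Hypothesis Hg : wsummable eta g.
Hypothesis g0 : g 0%nat <> RtoC 0.
Let F (w : C) := CSeries (fun m => g m * w ^ m)%C.

(** Interior points reduce to the circle: replacing [g m] by [g m * r^m] moves [w0 = r u] to the
    point [u] of modulus 1, preserves flatness and weighted summability, and keeps the constant
    term. At the centre the Taylor coefficient of order 0 is already [g 0]. *)
Lemma not_flat w0 : Cmod w0 <= 1 -> exists k, tcoef g w0 k <> RtoC 0.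
Proof.
  move=> H0; apply: NNPP => Hn.
  have flat k : tcoef g w0 k = RtoC 0 by apply: NNPP => Hk; apply: Hn; exists k.
  apply: g0.
  case: (Ceq_dec w0 0) => [E | Hw].
    have := flat 0%nat; rewrite /tcoef (CSeries_ext (v := fun m => (g m * RtoC 0 ^ m)%C)); first by rewrite powser_at_0.
    by move=> m; rewrite tay_0 E.
  set r := Cmod w0.
  have r0 : 0 < r by exact/Cmod_gt_0.
  have rn : RtoC r <> RtoC 0 by move/RtoC_inj; lra.
  set u := (w0 / RtoC r)%C; set c := fun m => (g m * RtoC r ^ m)%C.
  have Eu : w0 = (RtoC r * u)%C by rewrite /u; field.
  have Hu : Cmod u = 1.
    rewrite /u Cmod_div // Cmod_R Rabs_pos_eq /r; [field | ]; rewrite -/r; lra.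
  have rpow m : 0 <= Cmod (RtoC r ^ m) <= 1.
    split; [exact: Cmod_ge_0 | apply: Cpow_le1; rewrite Cmod_R Rabs_pos_eq; [exact: H0 | lra]].
  have Hc : wsummable eta c.
    apply: ex_series_Rle Hg => m; have W := wt_ge1 (INR m) (Rlt_le _ _ eta0); have G := Cmod_ge_0 (g m).
    rewrite /c Cmod_mult; have := rpow m; move: (Cmod (RtoC r ^ m)) => y Hy.
    split; first by apply: Rmult_le_pos; [lra | apply: Rmult_le_pos; lra].
    apply: Rmult_le_compat_l; first lra. nra.
  have flatc k : tcoef c u k = RtoC 0.
    rewrite /tcoef (CSeries_ext (v := fun m => (RtoC r ^ k * (g m * tay w0 k m))%C)).
      rewrite CSeries_scal; last exact: (g_tay_summable eta0 Hg). rewrite -/(tcoef g w0 k) flat; ring.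
    move=> m; rewrite /c Eu.
    have -> : (g m * RtoC r ^ m * tay u k m = g m * (RtoC r ^ m * tay u k m))%C by ring.
    rewrite -tay_scale; ring.
  have := flat_circle eta0 Hc Hu flatc; rewrite /c /= Cmult_1_r //.
Qed.

(** Let [k] be the order of the first nonzero Taylor coefficient. At another zero [w] the term
    [|tcoef g w0 k| |w - w0|^k] is at most the remainder [B |w - w0|^(k + 1)], which keeps [w] away
    from [w0]. *)
Lemma zeros_isolated w0 : Cmod w0 <= 1 ->
  exists d, 0 < d /\ forall w, Cmod w <= 1 -> Cmod (w - w0) < d -> F w = RtoC 0 -> w = w0.
Proof.
  move=> H0.
  have [k [[Hk Hmin] _]] := Wf_nat.dec_inh_nat_subset_has_unique_least_element _ (fun k => classic (tcoef g w0 k <> RtoC 0)) (not_flat H0).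
  have low i : (i < k)%nat -> tcoef g w0 i = RtoC 0.
    move=> Hi; apply: NNPP => Hn; have := Hmin _ Hn; lia.
  set B := Series (fun m => bin (S k) m * Cmod (g m)).
  have B0 : 0 <= B.
    apply: Series_ge0; last exact: (g_bin_ex eta0 Hg).
    move=> m; apply: Rmult_le_pos; [exact: bin_pos | exact: Cmod_ge_0].
  have t0 : 0 < Cmod (tcoef g w0 k) by exact/Cmod_gt_0.
  exists (Cmod (tcoef g w0 k) / (B + 1)); split; first by apply: Rdiv_lt_0_compat; lra.
  move=> w H1 Hd HF; apply: NNPP => Hn.
  have d0 : 0 < Cmod (w - w0).
    apply/Cmod_gt_0 => E; apply: Hn; have -> : w = (w - w0 + w0)%C by ring. rewrite E; ring.
  have := taylor_bound eta0 Hg (S k) H0 H1.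
  rewrite -/(F w) HF.
  have -> : Csum (fun i => tcoef g w0 i * (w - w0) ^ i)%C (S k) = (tcoef g w0 k * (w - w0) ^ k)%C.
    have E : forall j, (j <= k)%nat -> Csum (fun i => tcoef g w0 i * (w - w0) ^ i)%C j = RtoC 0.
      elim=> [|j IH] Hj //=; rewrite IH ?low; try lia; ring.
    rewrite /= E; [ring | lia].
  have -> : (0 - tcoef g w0 k * (w - w0) ^ k = - (tcoef g w0 k * (w - w0) ^ k))%C by ring.
  rewrite Cmod_opp Cmod_mult Cmod_pow -tech_pow_Rmult -/B => Hb.
  have Pk : 0 < Cmod (w - w0) ^ k by exact: pow_lt.
  have : Cmod (tcoef g w0 k) <= B * Cmod (w - w0).
    apply: (Rmult_le_reg_r (Cmod (w - w0) ^ k)) => //; lra.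
  have : (B + 1) * Cmod (w - w0) < Cmod (tcoef g w0 k).
    have -> : Cmod (tcoef g w0 k) = (B + 1) * (Cmod (tcoef g w0 k) / (B + 1)) by field; lra.
    apply: Rmult_lt_compat_l; lra.
  nra.
Qed.

(** Each point of the plane gets a radius within which it is the only possible zero in the disk; for
    points outside the disk the radius is too small to reach it. A finite subcover of the square
    from -1 to 1 then lists all candidates by its centres. *)
Lemma zeros_finite : exists l : list C, forall w, Cmod w <= 1 -> F w = RtoC 0 -> In w l.
Proof.
  pose pt (t : Compactness.Tn 2 R) : C := (fst t, fst (snd t)).
  have loc t : exists d : posreal, forall w, Cmod w <= 1 -> F w = RtoC 0 ->
      Rabs (Re w - Re (pt t)) < d -> Rabs (Im w - Im (pt t)) < d -> w = pt t.
    have near (d : R) w : Rabs (Re w - Re (pt t)) < d / 2 -> Rabs (Im w - Im (pt t)) < d / 2 -> Cmod (w - pt t) < d.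
      move=> A1 A2; apply: Rle_lt_trans (Cmod_le_ReIm _) _.
      change (Rabs (Re w - Re (pt t)) + Rabs (Im w - Im (pt t)) < d); lra.
    case: (Rle_dec (Cmod (pt t)) 1) => H.
    - have [d [d0 Hd]] := zeros_isolated H.
      exists (mkposreal (d / 2) ltac:(lra)) => w H1 HF /= A1 A2; apply: Hd => //; exact: near.
    - exists (mkposreal ((Cmod (pt t) - 1) / 2) ltac:(lra)) => w H1 HF /= A1 A2; exfalso.
      have N := near _ _ A1 A2.
      have : Cmod (pt t) <= Cmod w + Cmod (w - pt t).
        have {1}-> : pt t = (w - (w - pt t))%C by ring. exact: Cmod_triang_sub.
      lra.
  pose delta t := proj1_sig (ClassicalEpsilon.constructive_indefinite_description _ (loc t)).
  have Hdelta t := proj2_sig (ClassicalEpsilon.constructive_indefinite_description _ (loc t)).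
  have [l Hl] := NNPP _ (@Compactness.compactness_list 2 (-1, (-1, tt)) (1, (1, tt)) delta).
  exists (List.map pt l) => w H1 HF.
  have A1 := re_le_Cmod w. have A2 := im_le_Cmod w.
  have B1 : -1 <= Re w <= 1 by have := proj1 (Rabs_le_between (Re w) 1) (Rle_trans _ _ _ A1 H1); lra.
  have B2 : -1 <= Im w <= 1 by have := proj1 (Rabs_le_between (Im w) 1) (Rle_trans _ _ _ A2 H1); lra.
  have [|t [It [_ Ct]]] := Hl (Re w, (Im w, tt)); first by rewrite /=; split => //; split.
  have -> : w = pt t; last exact: List.in_map.
  have H2 := Hdelta t; rewrite -/(delta t) in H2; move: (delta t) H2 Ct => d; clear It; move: t => [x [y u]] H2 /= [C1 [C2 _]].
  exact: (H2 w H1 HF C1 C2).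
Qed.
End Zeros.

(** * Eigenvalues and spectral singularities under exponential decay *)

Lemma Fp_PS eta a h p n : 0 <= eta -> plus_moment eta a h p -> wiener eta (Fp a h p n).
Proof.
  move=> He Hs; exists (fun m => kap a h p (m + 4) n); split => //.
  apply: ex_series_ext (kap_wsummable He Hs n) => k; by rewrite Nat.add_0_r.
Qed.

Lemma Fp_at_0 a h p n : Fp a h p n (RtoC 0) = RtoC 1.
Proof. exact: powser_at_0. Qed.

Section Decay.
Variables (q : R) (a b c : R -> C).
Hypothesis hq : 1 < q.
Hypothesis ha : forall t, qZ q t -> a t <> RtoC 0.
Local Notation A := (seq_a q a).
Local Notation H := (seq_h q a b).
Local Notation P := (seq_p q c).
Local Notation A' := (refl_a (seq_a q a)).
Local Notation H' := (refl (seq_h q a b)).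
Local Notation P' := (refl (seq_p q c)).
Variable eta : R.
Hypothesis eta0 : 0 < eta.
Hypothesis Mp0 : plus_moment 0 A H P.
Hypothesis Mm0 : plus_moment 0 A' H' P'.
Hypothesis Mp : plus_moment eta A H P.
Hypothesis Mm : plus_moment eta A' H' P'.

(** The factor [w^2] clears the only negative power, which comes from the reflected solution at site
    1. At [w = 0] the term with [w^4] drops out and every [Fp] is 1, so the constant term is [- x2],
    a product of nonzero factors up to sign. *)
Lemma Phi_series : exists g, wsummable eta g /\ g 0%nat <> RtoC 0 /\
  forall z, 0 <= Im z -> (wz z ^ 2 * Phi q a b c z = CSeries (fun m => g m * wz z ^ m))%C.
Proof.
  have e0 := Rlt_le _ _ eta0.
  pose x1 := (A 0%Z * (alp A' 0 * alp A 1))%C. pose x2 := (A 0%Z * (alp A' (-1) * alp A 0))%C.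
  pose G w := (x1 * (w ^ 4 * (Fp A' H' P' 0 w * Fp A H P 1 w)) - x2 * (Fp A' H' P' (-1) w * Fp A H P 0 w))%C.
  have [g [Hg Eg]] : wiener eta G.
    apply: (wiener_minus e0); apply: (wiener_scal _ e0); last by apply: (wiener_mult e0); exact: Fp_PS.
    apply: (wiener_mult e0); first exact: wiener_pow. apply: (wiener_mult e0); exact: Fp_PS.
  exists g; split => //; split.
  - have := Eg (RtoC 0) ltac:(rewrite Cmod_0; lra).
    rewrite powser_at_0 /G !Fp_at_0 => <-.
    have n1 : x2 <> RtoC 0.
      rewrite /x2; apply: Cmult_neq_0; first exact: (A_neq0 hq ha).
      apply: Cmult_neq_0.
      + exact: (alp_neq0 (a_summable e0 Mm) (rA_neq0 hq ha)).
      + exact: (alp_neq0 (a_summable e0 Mp) (A_neq0 hq ha)).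
    move=> E; apply: n1; have -> : x2 = (- (x1 * (0 ^ 4 * (1 * 1)) - x2 * (1 * 1)))%C by ring.
    rewrite E; ring.
  - move=> z Hz; rewrite -Eg; last exact: wz_le1.
    rewrite /Phi (Phi_at_Wr hq Mp0 Mm0) // /Wr /jm /jp /jost /G /x1 /x2.
    have -> : (0 + 1 = 1)%Z by []. have -> : (- 0 = 0)%Z by []. have -> : (- (1) = -1)%Z by [].
    have W := @wz_neq0 z.
    have E0 : en 0 z = RtoC 1.
      rewrite /en; have -> : (Ci * RtoC (IZR 0) * z = 0)%C by ring. exact: Cexp_0.
    have E1 : en 1 z = (wz z * wz z)%C by rewrite -[1%Z]/(0 + 1)%Z en_succ E0; ring.
    have Em : en (-1) z = (/ (wz z * wz z))%C.
      rewrite -[(-1)%Z]/(0 - 1)%Z en_pred E0; field; exact: W.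
    rewrite E0 E1 Em; field; exact: W.
Qed.

(** By periodicity infinitely many [z] lie over one [w], but [lam_of] depends on [w] alone, so a
    finite list of [w] is enough. *)
Lemma zeros_over_finite : exists l : list C, forall z, 0 <= Im z -> Phi q a b c z = RtoC 0 -> In (lam_of q z) l.
Proof.
  have [g [Hg [g0 Eg]]] := Phi_series.
  have [l Hl] := zeros_finite eta0 Hg g0.
  exists (List.map (fun w => RtoC (Rpower q (1 / 4)) * (w + / w))%C l) => z Hz HP.
  have -> : lam_of q z = (RtoC (Rpower q (1 / 4)) * (wz z + / wz z))%C.
    rewrite /lam_of -two_cos_wz RtoC_mult; ring.
  apply: (List.in_map (fun w => RtoC (Rpower q (1 / 4)) * (w + / w))%C); apply: Hl; first exact: wz_le1.
  by rewrite -Eg // HP Cmult_0_r.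
Qed.

End Decay.

(** * Multiplicities *)

(** It is applied to [mu m * h], which is not small uniformly in [m]. For [|x| > 1/2] the triangle
    inequality is enough, because [1 + |x| <= 14 |x|^2] there. *)
Lemma Cexp_2nd_global x : Cmod (Cexp x - 1 - x) <= (14 + 4 * exp (Re x)) * Cmod x ^ 2.
Proof.
  have E0 := exp_pos (Re x). have C0 := Cmod_ge_0 x.
  have S0 : 0 <= Cmod x ^ 2 by exact: pow_le.
  case: (Rle_dec (Cmod x) (1 / 2)) => H; first by have := Cexp_2nd H; nra.
  apply: Rle_trans (Cmod_triang_sub _ _) _.
  have := Cmod_triang_sub (Cexp x) 1; rewrite Cmod_Cexp Cmod_1 => T.
  move: (Cmod x) (exp (Re x)) E0 H T {C0 S0} => y e E0 H T.
  have S1 : 1 / 4 <= y ^ 2 by nra. have S2 : 1 + y <= 14 * y ^ 2 by nra. nra.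
Qed.

Lemma C_derive_quadratic (f : C -> C) (z l : C) K r : 0 < r ->
  (forall h, Cmod h < r -> Cmod (f (z + h)%C - f z - h * l)%C <= K * Cmod h ^ 2) ->
  @is_derive C_AbsRing C_NormedModule f z l.
Proof.
  move=> r0 Hf; split; first exact: (@is_linear_scal_l C_AbsRing C_NormedModule).
  move=> x Hx eps.
  have -> : x = z by symmetry; exact: (@is_filter_lim_locally_unique C_AbsRing (AbsRing_NormedModule C_AbsRing)).
  have K0 : 0 < Rmax K 0 + 1 by have := Rmax_r K 0; lra.
  have d0 : 0 < Rmin r (eps / (Rmax K 0 + 1)) by apply: Rmin_pos => //; apply: Rdiv_lt_0_compat => //; exact: cond_pos.
  exists (mkposreal _ d0) => y Hy.
  have {}Hy : Cmod (y - z) < Rmin r (eps / (Rmax K 0 + 1)) by exact: Hy.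
  have H1 := Rlt_le_trans _ _ _ Hy (Rmin_l _ _). have H2 := Rlt_le_trans _ _ _ Hy (Rmin_r _ _).
  change (Cmod (f y - f z - (y - z) * l)%C <= eps * Cmod (y - z)%C).
  have := Hf (y - z)%C H1; have -> : (z + (y - z) = y)%C by ring.
  move=> B; apply: Rle_trans B _; have D0 := Cmod_ge_0 (y - z).
  have -> : K * Cmod (y - z) ^ 2 = K * Cmod (y - z) * Cmod (y - z) by ring.
  apply: Rmult_le_compat_r => //.
  have M1 := Rmax_l K 0.
  have : (Rmax K 0 + 1) * Cmod (y - z) <= eps; last nra.
  have E : (pos eps) = (Rmax K 0 + 1) * (eps / (Rmax K 0 + 1)) by field; lra.
  rewrite {}E; apply: Rmult_le_compat_l; lra.
Qed.

(** The identity [(k + 1) binomial(m, k + 1) = (m - k) binomial(m, k)], multiplied by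
    [w0^(m - k)]. *)
Lemma tay_step w0 k m : (w0 * (RtoC (INR (S k)) * tay w0 (S k) m) = (RtoC (INR m) - RtoC (INR k)) * tay w0 k m)%C.
Proof.
  elim: m k => [|m IH] k.
    case: k => [|k]; rewrite /=; ring.
  have E1 : tay w0 (S k) (S m) = (w0 * tay w0 (S k) m + tay w0 k m)%C by [].
  rewrite E1.
  have -> : (w0 * (RtoC (INR (S k)) * (w0 * tay w0 (S k) m + tay w0 k m)) =
    w0 * (w0 * (RtoC (INR (S k)) * tay w0 (S k) m)) + RtoC (INR (S k)) * (w0 * tay w0 k m))%C by ring.
  rewrite IH; case: k {E1} => [|k].
    have -> : tay w0 0 (S m) = (w0 * tay w0 0 m + 0)%C by []. rewrite !S_INR !RtoC_plus; have -> : INR 0 = 0 by []. ring.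
  have -> : tay w0 (S k) (S m) = (w0 * tay w0 (S k) m + tay w0 k m)%C by [].
  have H := IH k; rewrite !S_INR !RtoC_plus in H *.
  have -> : ((RtoC (INR m) + 1 - (RtoC (INR k) + 1)) * (w0 * tay w0 (S k) m + tay w0 k m) =
     (RtoC (INR m) - RtoC (INR k)) * (w0 * tay w0 (S k) m) + (RtoC (INR m) - RtoC (INR k)) * tay w0 k m)%C by ring.
  rewrite -H; ring.
Qed.

(** [w^(m - 2) = exp (mu m * z)] for [w = wz z], so [Phi] is the sum of [g m * exp (mu m * z)] and
    differentiation in [z] multiplies the terms by [mu m]. For [m < 2] the exponential grows with
    [Im z], hence the bounds on horizontal strips. *)
Definition mu (m : nat) : C := (Ci * (RtoC (INR m) - 2) / 2)%C.

Lemma Cmod_mu m : Cmod (mu m) <= INR m + 1.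
Proof.
  have -> : mu m = (Ci * RtoC ((INR m - 2) / 2))%C.
    rewrite /mu /Rdiv RtoC_mult RtoC_inv; last lra. rewrite RtoC_minus /Cdiv; ring.
  rewrite Cmod_mult Cmod_Ci Rmult_1_l Cmod_R; have := pos_INR m => M0.
  apply: Rabs_le; lra.
Qed.

Lemma Re_mu m z : Re (mu m * z) = - ((INR m - 2) / 2 * Im z).
Proof.
  have -> : mu m = (Ci * RtoC ((INR m - 2) / 2))%C.
    rewrite /mu /Rdiv RtoC_mult RtoC_inv; last lra. rewrite RtoC_minus /Cdiv; ring.
  rewrite /= /Im; ring.
Qed.

Lemma Cmod_exp_mu m z M : 0 <= Im z <= M -> Cmod (Cexp (mu m * z)) <= exp M.
Proof.
  move=> H; rewrite Cmod_Cexp Re_mu; apply: exp_mono; have := pos_INR m; nra.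
Qed.

Lemma Cexp_mu m z : (wz z ^ 2 * Cexp (mu m * z) = wz z ^ m)%C.
Proof.
  rewrite /wz -!Cexp_nat -Cexp_plus; congr Cexp; rewrite /mu.
  have -> : RtoC (INR 2) = RtoC 2 by []. field; exact: C2_neq0.
Qed.

Section Multiplicity.
Variables (eta : R) (g : nat -> C).
Hypothesis eta0 : 0 < eta.
Hypothesis Hg : wsummable eta g.
Hypothesis g0 : g 0%nat <> RtoC 0.

Lemma g_moment N : ex_series (fun m => (INR m + 1) ^ N * Cmod (g m)).
Proof.
  apply: ex_series_Rle (ex_series_plusR (ex_series_scalR (2 ^ N) (g_pow_ex eta0 Hg N)) (wsummable_summable (Rlt_le _ _ eta0) Hg)) => m.
  have M0 := pos_INR m; have G := Cmod_ge_0 (g m).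
  split; first by apply: Rmult_le_pos => //; apply: pow_le; lra.
  have : (INR m + 1) ^ N <= 2 ^ N * INR m ^ N + 1; last nra.
  case: m M0 {G} => [|m] M0.
    have P2 : 0 <= 2 ^ N * INR 0 ^ N by apply: Rmult_le_pos; apply: pow_le; [lra | exact: M0].
    have -> : INR 0 + 1 = 1 by rewrite /=; ring. rewrite pow1; lra.
  rewrite -Rpow_mult_distr.
  have : (INR (S m) + 1) ^ N <= (2 * INR (S m)) ^ N; last lra.
  apply: pow_incr; rewrite S_INR; have := pos_INR m; lra.
Qed.

Definition Dser (k : nat) (z : C) : C := CSeries (fun m => g m * mu m ^ k * Cexp (mu m * z))%C.

Lemma mu_pow_le m k : Cmod (mu m ^ k) <= (INR m + 1) ^ k.
Proof. rewrite Cmod_pow; apply: pow_incr; split; [exact: Cmod_ge_0 | exact: Cmod_mu]. Qed.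

Lemma Dterm_le m k z M : 0 <= Im z <= M ->
  Cmod (g m * mu m ^ k * Cexp (mu m * z)) <= (INR m + 1) ^ k * Cmod (g m) * exp M.
Proof.
  move=> H; rewrite !Cmod_mult (Rmult_comm (Cmod (g m))).
  apply: Rmult_le_compat; [| exact: Cmod_ge_0 | | exact: Cmod_exp_mu].
    apply: Rmult_le_pos; exact: Cmod_ge_0.
  apply: Rmult_le_compat_r; [exact: Cmod_ge_0 | exact: mu_pow_le].
Qed.

Lemma g_moment_scal N x : ex_series (fun m => (INR m + 1) ^ N * Cmod (g m) * x).
Proof. apply: ex_series_ext (ex_series_scalR x (g_moment N)) => m; rewrite /=; ring. Qed.

Lemma Dser_summable k z : 0 <= Im z -> summable (fun m => g m * mu m ^ k * Cexp (mu m * z))%C.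
Proof.
  move=> Hz; apply: summable_le (g_moment_scal k (exp (Im z))) => m; apply: Dterm_le; lra.
Qed.

Lemma Dser_continuous k : continuous_closed_uhp (Dser k).
Proof.
  move=> z Hz; apply/filterlim_Cmod.
  have I := @Ctends_id z (fun w => 0 <= Im w).
  apply: (CSeries_dominated (g_moment_scal k (exp (Im z + 1)))).
  - apply: filter_imp (filter_and _ _ (I 1 Rlt_0_1) (within_uhp z (fun w Hw => Hw))) => w [Hw Hi] m.
    apply: Dterm_le; split => //.
    have := im_le_Cmod (w - z); have := Rle_abs (Im (w - z)).
    have -> : Im (w - z) = Im w - Im z by []. lra.
  - move=> m; apply: Dterm_le; lra.
  - move=> m; apply: Ctends_scal; apply: Ctends_Cexp; exact: Ctends_scal.
Qed.

Lemma Dser_derive k z : 0 < Im z -> @is_derive C_AbsRing C_NormedModule (Dser k) z (Dser (S k) z).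
Proof.
  (* The radius [Rmin 1 (Im z)] keeps [z + h] in the strip up to height [M]. The 18 is 14 + 4 from
     [Cexp_2nd_global], the exponentials at [z] and at [z + h] being at most [exp M]. *)
  move=> Hz; set M := Im z + 1; set x := 18 * exp M.
  set K := Series (fun m => (INR m + 1) ^ (k + 2) * Cmod (g m) * x).
  apply: (@C_derive_quadratic _ _ _ K (Rmin 1 (Im z))); first by apply: Rmin_pos; lra.
  move=> h Hh.
  have H1 := Rlt_le_trans _ _ _ Hh (Rmin_l _ _). have H2 := Rlt_le_trans _ _ _ Hh (Rmin_r _ _).
  have Ih := Rle_trans _ _ _ (Rle_abs _) (im_le_Cmod h).
  have Ih' : - Im h <= Cmod h by have := im_le_Cmod h; have := Rle_abs (- Im h); rewrite Rabs_Ropp; lra.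
  have Izh : 0 <= Im (z + h) <= M by rewrite Im_plus /M; lra.
  have Iz : 0 <= Im z <= M by rewrite /M; lra.
  have Q m : (g m * mu m ^ k * Cexp (mu m * (z + h)) - g m * mu m ^ k * Cexp (mu m * z) - h * (g m * mu m ^ S k * Cexp (mu m * z)) =
     g m * mu m ^ k * (Cexp (mu m * z) * (Cexp (mu m * h) - 1 - mu m * h)))%C.
    rewrite Cmult_plus_distr_l Cexp_plus Cpow_S; ring.
  have S1 := Dser_summable k (proj1 Izh). have S2 := Dser_summable k (proj1 Iz). have S3 := Dser_summable (S k) (proj1 Iz).
  have S4 := summable_minus (summable_minus S1 S2) (summable_scal S3 h).
  rewrite /Dser -(CSeries_scal S3) -(CSeries_minus S1 S2) -(CSeries_minus (summable_minus S1 S2) (summable_scal S3 h)).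
  apply: Rle_trans (CSeries_le S4) _; rewrite /K -Series_scal_r; apply: Series_le; last first.
    have := ex_series_scalR (Cmod h ^ 2) (g_moment_scal (k + 2) x); apply: ex_series_ext => m; rewrite /=; ring.
  move=> m; split; first exact: Cmod_ge_0.
  rewrite Q Cmod_mult.
  have B1 : Cmod (g m * mu m ^ k) <= (INR m + 1) ^ k * Cmod (g m).
    rewrite Cmod_mult Rmult_comm; apply: Rmult_le_compat_r; [exact: Cmod_ge_0 | exact: mu_pow_le].
  have B2 : Cmod (Cexp (mu m * z) * (Cexp (mu m * h) - 1 - mu m * h)) <= x * ((INR m + 1) ^ 2 * Cmod h ^ 2).
    rewrite Cmod_mult; have C1 := Cexp_2nd_global (mu m * h)%C.
    have E1 := Cmod_exp_mu m Iz. have E2 := Cmod_exp_mu m Izh.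
    rewrite Cmult_plus_distr_l Cexp_plus Cmod_mult (Cmod_Cexp (mu m * h)%C) in E2.
    have Pz := Cmod_ge_0 (Cexp (mu m * z)).
    have D2 : Cmod (mu m * h)%C ^ 2 <= (INR m + 1) ^ 2 * Cmod h ^ 2.
      rewrite -Rpow_mult_distr; apply: pow_incr; split; first exact: Cmod_ge_0.
      rewrite Cmod_mult; apply: Rmult_le_compat_r; [exact: Cmod_ge_0 | exact: Cmod_mu].
    have P2 : 0 <= Cmod (mu m * h)%C ^ 2 by apply: pow_le; exact: Cmod_ge_0.
    have Px : 0 < exp M := exp_pos M.
    apply: (Rle_trans _ (x * Cmod (mu m * h)%C ^ 2)); last by apply: Rmult_le_compat_l => //; rewrite /x; lra.
    apply: Rle_trans (Rmult_le_compat_l _ _ _ Pz C1) _; rewrite -Rmult_assoc; apply: Rmult_le_compat_r => //.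
    rewrite /x; lra.
  apply: Rle_trans (Rmult_le_compat _ _ _ _ (Cmod_ge_0 _) (Cmod_ge_0 _) B1 B2) _.
  rewrite pow_add; apply: Req_le; ring.
Qed.

(** If all derivatives in [z] vanish, so do all Taylor coefficients in [w]: by [tay_step], order
    [k + 1] is a combination of order [k] with and without one more factor [mu m], so the induction
    on [k] carries every power [mu m ^ j]. This contradicts [not_flat]. *)
Lemma Dser_nonzero z : 0 <= Im z -> exists k, Dser k z <> RtoC 0.
Proof.
  move=> Hz; apply: NNPP => Hn.
  have D0 k : Dser k z = RtoC 0 by apply: NNPP => Hk; apply: Hn; exists k.
  have H1 := wz_le1 Hz; set w := wz z in H1. have w0 : w <> RtoC 0 := @wz_neq0 z.
  have sm k j : summable (fun m => g m * mu m ^ j * tay w k m)%C.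
    apply: summable_le (g_moment (j + k)) => m; rewrite !Cmod_mult pow_add.
    have M0 := pos_INR m.
    have B1 := mu_pow_le m j.
    have B2 : Cmod (tay w k m) <= (INR m + 1) ^ k.
      apply: Rle_trans (tay_le_bin k m H1) _; apply: Rle_trans (bin_le_pow k m) _; apply: pow_incr; lra.
    have := Rmult_le_compat _ _ _ _ (Cmod_ge_0 _) (Cmod_ge_0 _) B1 B2 => B3.
    have := Rmult_le_compat_l _ _ _ (Cmod_ge_0 (g m)) B3; lra.
  have flat k : forall j, CSeries (fun m => g m * mu m ^ j * tay w k m)%C = RtoC 0.
    elim: k => [|k IH] j.
      rewrite (CSeries_ext (v := fun m => (w ^ 2 * (g m * mu m ^ j * Cexp (mu m * z)))%C)).
        by rewrite CSeries_scal ?[CSeries _](D0 j) ?Cmult_0_r //; exact: Dser_summable.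
      move=> m; rewrite tay_0 -Cexp_mu -/w; ring.
    have kn : (w * RtoC (INR (S k)))%C <> RtoC 0.
      apply: Cmult_neq_0 => //; apply: RtoC_neq0; have := lt_0_INR (S k) ltac:(lia); lra.
    apply: (Cmult_eq0_r kn).
    rewrite -CSeries_scal // (CSeries_ext (v := fun m => (RtoC 2 / Ci * (g m * mu m ^ S j * tay w k m) + (RtoC 2 - RtoC (INR k)) * (g m * mu m ^ j * tay w k m))%C)); last first.
      move=> m.
      have -> : (w * RtoC (INR (S k)) * (g m * mu m ^ j * tay w (S k) m) = g m * mu m ^ j * (w * (RtoC (INR (S k)) * tay w (S k) m)))%C by ring.
      rewrite tay_step Cpow_S.
      have -> : RtoC (INR m) = (RtoC 2 / Ci * mu m + RtoC 2)%C.
        rewrite /mu; field; exact: Ci_nz.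
      ring.
    rewrite CSeries_plus; try exact: summable_scal.
    rewrite !CSeries_scal // !IH; ring.
  have [k Hk] := not_flat eta0 Hg g0 H1.
  apply: Hk; rewrite -(flat k 0%nat); apply: CSeries_ext => m; rewrite /=; ring.
Qed.

Lemma Dser_order F z0 : (forall z, 0 <= Im z -> wz z ^ 2 * F z = CSeries (fun m => g m * wz z ^ m))%C ->
  0 <= Im z0 -> F z0 = RtoC 0 -> exists m, (1 <= m)%nat /\ zero_of_order F z0 m.
Proof.
  move=> HF H0 E0.
  have D0 z : 0 <= Im z -> Dser 0 z = F z.
    move=> Hz; have W : (wz z ^ 2)%C <> RtoC 0 by apply: Cpow_nz; exact: wz_neq0.
    have : (wz z ^ 2 * (Dser 0 z - F z) = 0)%C.
      have -> : (wz z ^ 2 * (Dser 0 z - F z) = wz z ^ 2 * Dser 0 z - wz z ^ 2 * F z)%C by ring.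
      rewrite HF // /Dser -CSeries_scal; last exact: Dser_summable.
      rewrite (CSeries_ext (v := fun m => (g m * wz z ^ m)%C)); first by ring.
      move=> m; rewrite -(Cexp_mu m z) /=; ring.
    move/(Cmult_eq0_r W) => E; have -> : Dser 0 z = (Dser 0 z - F z + F z)%C by ring. rewrite E; ring.
  have [m [[Hm Hmin] _]] := Wf_nat.dec_inh_nat_subset_has_unique_least_element _ (fun k => classic (Dser k z0 <> RtoC 0)) (Dser_nonzero H0).
  exists m; split.
    case: m Hm {Hmin} => [|m] Hm; last lia. by case: Hm; rewrite D0.
  exists Dser; split; first exact: D0.
  split; first by move=> k z; exact: Dser_derive.
  split; first exact: Dser_continuous.
  split => // k Hk; apply: NNPP => Hn; have := Hmin _ Hn; lia.
Qed.
End Multiplicity.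

Theorem theorem5 (q : R) (a b c : R -> C)
    (hq : 1 < q) (ha : forall t, qZ q t -> a t <> RtoC 0) :
  (* (i) *)
  (forall (lam : C) (u : R -> C),
     (in_l2q q u /\ solves_A q a b c lam u) <->
     (in_l2Z (qseq q (hat_u u)) /\
      solves_B (seq_a q a) (seq_b q a b) (seq_p q c) (hat_lam q lam)
               (qseq q (hat_u u)))) /\
  (* (ii) *)
  (forall lam : C,
     eigenvalue_A q a b c lam <->
     eigenvalue_B (seq_a q a) (seq_b q a b) (seq_p q c) (hat_lam q lam)) /\
  (first_moment q a b c ->
     (* (iii) *)
     (represents_jost_plus q a b c (alpha_plus q a) (A_plus q a b c) /\
      represents_jost_minus q a b c (alpha_minus q a) (A_minus q a b c) /\
      coef_formulas_plus (seq_a q a) (seq_h q a b) (seq_p q c)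
        (alpha_plus_seq (seq_a q a))
        (K_plus (seq_a q a) (seq_h q a b) (seq_p q c)) /\
      coef_formulas_minus (seq_a q a) (seq_h q a b) (seq_p q c)
        (alpha_minus_seq (seq_a q a))
        (K_minus (seq_a q a) (seq_h q a b) (seq_p q c)) /\
      (forall (alpha : R -> C) (A : R -> R -> C),
         represents_jost_plus q a b c alpha A ->
         forall t, qZ q t ->
           alpha t = alpha_plus q a t /\
           forall r, qN q r -> A t r = A_plus q a b c t r) /\
      (forall (alpha : R -> C) (A : R -> R -> C),
         represents_jost_minus q a b c alpha A ->
         forall t, qZ q t ->
           alpha t = alpha_minus q a t /\
           forall r, qNinv q r -> A t r = A_minus q a b c t r)) /\
     (* the formulas extend continuously to real z; Q and Phi are well defined *)
     ((forall t, qZ q t ->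
         (forall z, 0 <= Im z ->
            qintegrable q (qN q) (jost_integrand_plus q (A_plus q a b c) t z) /\
            qintegrable q (qNinv q) (jost_integrand_minus q (A_minus q a b c) t z)) /\
         continuous_closed_uhp (J_plus q a b c t) /\
         continuous_closed_uhp (J_minus q a b c t)) /\
      (forall z, 0 <= Im z ->
         (forall t, qZ q t ->
            wronskian q a (fun s => J_minus q a b c s z)
                          (fun s => J_plus q a b c s z) t = Q_fun q a b c z) /\
         (forall n, Phi_at q a b c n z = Phi q a b c z))) /\
     (* (iv) *)
     ((forall lam : C,
         sigma_d q a b c lam <->
         exists z, P_plus z /\ Q_fun q a b c z = RtoC 0 /\ lam = lam_of q z) /\
      (forall lam : C,
         sigma_ss q a b c lam <->
         exists z, P_zero z /\ Q_fun q a b c z = RtoC 0 /\ lam = lam_of q z)) /\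
     (* (v) *)
     (forall lam : C,
        sigma_c q a b c lam <->
        Im lam = 0 /\
        - (2 * Rpower q (1 / 4)) <= Re lam <= 2 * Rpower q (1 / 4))) /\
  (* (vi) *)
  (forall eps delta : R,
     0 < eps -> 1 / 2 <= delta <= 1 -> exp_decay q a b c eps delta ->
     (exists l : list C, forall lam : C,
        sigma_d q a b c lam \/ sigma_ss q a b c lam -> In lam l) /\
     (forall lam : C,
        sigma_d q a b c lam \/ sigma_ss q a b c lam ->
        finite_multiplicity q a b c lam)).
Proof.
  have e0 := Rle_refl 0.
  split; first exact: part_i.
  split; first exact: part_ii.
  split.
  - move=> /(first_moment_plus hq) [Mp Mm].
    have An0 := A_neq0 hq ha. have An0' := rA_neq0 hq ha.
    split; [| split; [| split]].
    + split; first exact: (jost_plus_represents hq ha e0 Mp).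
      split; first exact: (jost_minus_represents hq ha e0 Mm).
      split; first exact: (coef_formulas_plus_K e0 Mp An0).
      split; first exact: (coef_formulas_refl (coef_formulas_plus_K e0 Mm An0')).
      split => alpha B HB t Ht; first exact: (plus_unique hq ha Mp HB Ht).
      exact: (minus_unique hq ha Mm HB Ht).
    + split=> [t Ht | z Hz].
      * split; last by split; [exact: J_plus_continuous | exact: J_minus_continuous].
        move: Ht => [n ->] z Hz; split.
          exact: (qint_plus_conv hq (summable_plus_K hq e0 Mp n Hz)).
        exact: (qint_minus_conv hq (summable_minus_K hq e0 Mm n Hz)).
      * split=> [t [n ->] | n]; last exact: (Phi_const hq ha Mp Mm).
        by rewrite (wronskian_Phi hq ha Mp Mm) // (Q_fun_Phi hq ha Mp Mm).
    + split; [exact: (sigma_d_iff hq ha Mp Mm) | exact: (sigma_ss_iff hq ha Mp Mm)].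
    + exact: (sigma_c_iff hq ha Mp Mm).
  - move=> eps delta He [Hd _] Hdec.
    (* Exponential decay also yields the unweighted moments, under which the spectra have been
       described; the weighted ones at [eps / 4] give the series for [Phi]. *)
    have [Mp0 Mm0] := exp_decay_moments hq He Hd Hdec (ltac:(lra) : 0 <= 0 <= eps / 4).
    have [Mp Mm] := exp_decay_moments hq He Hd Hdec (ltac:(lra) : 0 <= eps / 4 <= eps / 4).
    have eta0 : 0 < eps / 4 by lra.
    have ex lam : sigma_d q a b c lam \/ sigma_ss q a b c lam -> exists z, zero_over q a b c lam z.
      case=> [/(sigma_d_iff hq ha Mp0 Mm0) | /(sigma_ss_iff hq ha Mp0 Mm0)] [z [Hz [HQ E]]]; exists z.
      - have Iz : 0 <= Im z by case: Hz => _; lra.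
        split; [by left | split => //]; exact/(Q_fun_zero hq ha Mp0 Mm0 Iz).
      - have Iz : 0 <= Im z by case: Hz => ->; lra.
        split; [by right | split => //]; exact/(Q_fun_zero hq ha Mp0 Mm0 Iz).
    have up lam z : zero_over q a b c lam z -> 0 <= Im z.
      by case=> [[[_ H] | [H _]] _]; lra.
    split.
    + have [l Hl] := zeros_over_finite hq ha eta0 Mp0 Mm0 Mp Mm.
      exists l => lam /ex [z Hz]; have Iz := up _ _ Hz; case: Hz => _ [-> HP]; exact: Hl.
    + move=> lam Hlam; split; first exact: ex.
      move=> z Hz; have Iz := up _ _ Hz; case: Hz => _ [_ HP].
      have [g [Hg [g0 Eg]]] := Phi_series hq ha eta0 Mp0 Mm0 Mp Mm.
      exact: (Dser_order eta0 Hg g0 Eg Iz HP).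
Qed.
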